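(* The manifold $F_3$ of complete flags in $\mathbb{C}^3$, with its canonical $T^2$-action, has a structure of a $(6,2)$-manifold, and $F_3/T^2\cong S^1*\mathbb{C}P^1\cong S^4$ (homeomorphisms, $*$ denoting the join).
   Context: $F_3$ is the manifold of flags $L=(L_1\subset L_2)$ of complex subspaces of $\mathbb{C}^3$ with $\dim L_i=i$. The coordinatewise $T^3$-action on $\mathbb{C}^3$ induces an action on $F_3$ in which the diagonal circle acts trivially, giving an effective action of $T^2=T^3/\mathrm{diag}$. The moment map is $\mu(L)=\mu_1(L_1)+\mu_2(L_2)\in\mathbb{R}^3$, where $\mu_i(L_i)=\frac{\sum_{|J|=i}|P^J(L_i)|^2\delta_J}{\sum_{|J|=i}|P^J(L_i)|^2}$, with $P^J$ the Plücker coordinates and $\delta_J\in\mathbb{R}^3$ the indicator vector of $J\subset\{1,2,3\}$; its image is the 2-dimensional permutahedron (a hexagon), whose affine hull is identified with $\mathbb{R}^2$. ''Has a structure of a $(2n,k)$-manifold'' means: the remaining data below can be chosen so that all the listed conditions hold. Conventions. $T^k=(S^1)^k$; $\mathring{P}$ is the relative interior of a convex polytope $P$ (a point is its own relative interior); for a subset $Y$ of a topological space, $\bar\partial Y=\overline{Y}\setminus Y$; $[1,m]=\{1,\dots,m\}$. A $(2n,k)$-manifold ($1\le k\le n$) is a triple $(M^{2n},\theta,\mu)$: $M^{2n}$ is a smooth closed oriented $2n$-manifold; $\theta$ is a smooth effective action of $T^k$ on $M^{2n}$ all of whose stabilizers are connected; $\mu:M^{2n}\to\mathbb{R}^k$ (the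 almost moment map) is a smooth $T^k$-invariant map whose image is a $k$-dimensional convex polytope $P^k$ and which is open as a map onto $P^k$; and Axioms 1-6 hold. Axiom 1. There is a smooth atlas $\{(M_i,\varphi_i)\}$ of $M^{2n}$ with $M_i$ open, $T^k$-invariant and dense, $\varphi_i:M_i\to\mathbb{R}^{2n}$ coordinate homeomorphisms, each $M_i$ containing exactly one $T^k$-fixed point $x_i$, with $\varphi_i(x_i)=0$ and $x_i\ne x_j$ for $i\neq j$. (The atlas is finite, indexed by $[1,m]$, $m$ being the number of fixed points.) Put $Y_i=M^{2n}\setminus M_i$, and for $\sigma\subseteq[1,m]$ put $W_\sigma=\bigcap_{i\in\sigma}M_i\cap\bigcap_{i\notin\sigma}Y_i$. If $W_\sigma\ne\emptyset$, it is called a stratum and $\sigma$ is called admissible; $\mathfrak{S}$ is the set of admissible sets. The strata are $T^k$-invariant and partition $M^{2n}$. The main stratum is $W=W_{[1,m]}$. Axiom 2. $\mu$ gives a bijection between the fixed points and the vertices of $P^k$. Put $v_i=\mu(x_i)$; for $\sigma\in\mathfrak{S}$ the admissible polytope is $P_\sigma=\mathrm{conv}\{v_i:i\in\sigma\}$. Axiom 3. The stabilizer is constant on each stratum. Let $T^\sigma$ be the quotient of $T^k$ by the stabilizer of points of $W_\sigma$; it acts freely on $W_\sigma$ and $W_\sigma/T^\sigma=W_\sigma/T^k$. Axiom 4. Let $\widehat\mu:M^{2n}/T^k\to P^k$ be induced by $\mu$. For $\sigma\in\mathfrak{S}$: (a) $\mu(W_\sigma)=\mathring{P_\sigma}$;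 (b) the restriction $\widehat\mu_\sigma:W_\sigma/T^\sigma\to\mathring{P_\sigma}$ is a fiber bundle; (c) $\dim P_\sigma=\dim T^\sigma$. This bundle is trivial (contractible base); its fiber $F_\sigma$ is the space of parameters of $W_\sigma$, and $F$ is that of the main stratum. A trivialization $h_\sigma:W_\sigma/T^\sigma\to\mathring{P_\sigma}\times F_\sigma$ over $\mathring{P_\sigma}$ is fixed as part of the structure; $\xi_\sigma:W_\sigma/T^\sigma\to F_\sigma$ is its second component. For $c\in F_\sigma$ the leaf $W_\sigma[\xi_\sigma,c]\subset W_\sigma$ is the preimage of $\xi_\sigma^{-1}(c)$ under $W_\sigma\to W_\sigma/T^\sigma$. Axiom 5. For every leaf $W_\sigma[\xi_\sigma,c_\sigma]$: (a) it is a smooth submanifold of $M^{2n}$ and $\mu$ restricts to a smooth fiber bundle $W_\sigma[\xi_\sigma,c_\sigma]\to\mathring{P_\sigma}$; (b) $\bar\partial W_\sigma[\xi_\sigma,c_\sigma]$ is the union of leaves $W_{\bar\sigma}[\xi_{\bar\sigma},c_{\bar\sigma}]$, for exactly one $c_{\bar\sigma}\in F_{\bar\sigma}$ for each $\bar\sigma$, where $P_{\bar\sigma}$ runs through some admissible faces of $P_\sigma$; (c) the map $\eta_{\sigma,\bar\sigma}:F_\sigma\to F_{\bar\sigma}$, $c_\sigma\mapsto c_{\bar\sigma}$, given by (b) is continuous. Complexes. $C(M^{2n},P^k)=\bigsqcup_{\sigma\in\mathfrak{S}}P'_\sigma$ is a formal disjoint union of copies $P'_\sigma$ of $\mathring{P_\sigma}$;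 $\widehat\pi:C(M^{2n},P^k)\to P^k$ is the canonical map, identifying each $P'_\sigma$ with $\mathring{P_\sigma}$. The map $f:M^{2n}\to C(M^{2n},P^k)$ sends $y\in W_\sigma$ to the unique $x\in P'_\sigma$ with $\widehat\pi(x)=\mu(y)$. $CQ(M^{2n},P^k)$ is $C(M^{2n},P^k)$ with the quotient topology of $f$. The space $\mathfrak{E}(M^{2n},P^k)=\{(x,y)\in C(M^{2n},P^k)\times M^{2n}: x\in P'_\sigma,\ y\in W_\sigma\text{ for some }\sigma\in\mathfrak{S},\ \widehat\pi(x)=\mu(y)\}$ has the topology induced from $CQ(M^{2n},P^k)\times M^{2n}$; $T^k$ acts on it through the second factor. Points of $\mathfrak{E}(M^{2n},P^k)/T^k$ are written as pairs $(x,c)$, $x\in P'_\sigma$, $c\in F_\sigma$, via $h_\sigma$. Axiom 6. There are a topological space $\mathcal{F}$ and, for each $\sigma\in\mathfrak{S}$, a topological space $\tilde F_\sigma$ and a continuous inclusion $I_\sigma:\tilde F_\sigma\to\mathcal{F}$ (write $\tilde F,I$ for $\sigma=[1,m]$ and $\tilde F_i,I_i$ for $\sigma=\{i\}$) such that: (a) $\tilde F=F$ and $\mathcal{F}$ is a compactification of $I(F)$; (b) $I_\sigma(\tilde F_\sigma)\subset I_{\bar\sigma}(\tilde F_{\bar\sigma})$ whenever $P_{\bar\sigma}$ is an admissible face of $P_\sigma$, and $\mathcal{F}=\bigcup_{i=1}^m I_i(\tilde F_i)$; (c) there are continuous projections $p_\sigma:\tilde F_\sigma\to F_\sigma$ with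 $p_{\bar\sigma}\circ\tilde\eta_{\sigma,\bar\sigma}=\eta_{\sigma,\bar\sigma}\circ p_\sigma$, where $\tilde\eta_{\sigma,\bar\sigma}:\tilde F_\sigma\to\tilde F_{\bar\sigma}$ is the inclusion given by (b); (d) the map $H:\mathcal{E}=\bigcup_\sigma P'_\sigma\times\tilde F_\sigma\to\mathfrak{E}(M^{2n},P^k)/T^k$, $H(x,\tilde c)=(x,p_\sigma(\tilde c))$, is continuous, where $\mathcal{E}$ has the topology induced by the embedding $\mathcal{E}\to CQ(M^{2n},P^k)\times\mathcal{F}$, $(x,\tilde c)\mapsto(x,I_\sigma(\tilde c))$. *)

(* Defs.v *)
From HB Require Import structures.
From mathcomp Require Import all_boot all_order all_algebra all_fingroup all_field.
From mathcomp Require Import all_classical all_reals all_analysis.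
From mathcomp Require Import generic_quotient complex.

Set Implicit Arguments.
Unset Strict Implicit.
Unset Printing Implicit Defensive.

Import Order.TTheory GRing.Theory Num.Theory.
Import numFieldNormedType.Exports.

Local Open Scope classical_set_scope.
Local Open Scope quotient_scope.
Local Open Scope ring_scope.

Definition homeomorphism (X Y : topologicalType) (f : X -> Y) : Prop :=
  continuous f /\ exists g : Y -> X, [/\ cancel f g, cancel g f & continuous g].

Definition homeomorphic (X Y : topologicalType) : Prop :=
  exists f : X -> Y, homeomorphism f.

(* [Y] with the finest topology making [f] continuous: for surjective [f],
   the quotient topology. *)
Definition final_topology (X : topologicalType) (Y : choiceType) (f : X -> Y)
  : Type := Y.

Section FinalTopology.
Variables (X : topologicalType) (Y : choiceType) (f : X -> Y).

HB.instance Definition _ := Choice.on (final_topology f).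

Definition final_open (A : set (final_topology f)) : Prop := open (f @^-1` A).

Fact final_openT : final_open setT.
Proof. by rewrite /final_open preimage_setT; exact: openT. Qed.

Fact final_openI (A B : set (final_topology f)) :
  final_open A -> final_open B -> final_open (A `&` B).
Proof. exact: openI. Qed.

Fact final_open_bigU (I : Type) (A : I -> set (final_topology f)) :
  (forall i, final_open (A i)) -> final_open (\bigcup_i A i).
Proof. by move=> oA; apply: bigcup_open => i _; exact: oA. Qed.

HB.instance Definition _ := @isOpenTopological.Build (final_topology f)
  final_open final_openT final_openI final_open_bigU.

End FinalTopology.

(* Quotient of [X] by the relation [e x = e y], which is [e x y] as soon as
   [e] is an equivalence relation; every [e] used below is one. *)
Section Quotient.
Variables (X : topologicalType) (e : X -> X -> Prop).

Definition same_class : rel X := fun x y => `[< e x = e y >].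

Fact same_class_refl : reflexive same_class.
Proof. by move=> x; exact/asboolP. Qed.

Fact same_class_sym : symmetric same_class.
Proof. by move=> x y; apply/asboolP/asboolP. Qed.

Fact same_class_trans : transitive same_class.
Proof. by move=> y x z /asboolP xy /asboolP yz; apply/asboolP; rewrite xy. Qed.

Definition same_class_equiv :=
  EquivRel same_class same_class_refl same_class_sym same_class_trans.

Definition quot : topologicalType :=
  quotient_topology {eq_quot same_class_equiv}.

Definition qclass (x : X) : quot := (\pi_({eq_quot same_class_equiv}) x)%qT.

End Quotient.

Definition unit_interval (R : realType) : topologicalType :=
  [set t : R | 0 <= t <= 1].

(* The join is X x Y x [0, 1] with the Y-factor collapsed at 0 and the X-factor
   collapsed at 1. *)
Definition join_rel (R : realType) (X Y : topologicalType)
    (a b : X * Y * unit_interval R) : Prop :=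
  [/\ a.2 = b.2,
      set_val a.2 <> 1 -> a.1.1 = b.1.1 &
      set_val a.2 <> 0 -> a.1.2 = b.1.2].

Definition join (R : realType) (X Y : topologicalType) : topologicalType :=
  quot (@join_rel R X Y).

(* [R[i]], packaged so that its norm topology is inferred. *)
Definition Cplx (R : realType) : numClosedFieldType := R[i].

Definition cRe (R : realType) (z : Cplx R) : R := complex.Re (z : R[i]).
Definition cIm (R : realType) (z : Cplx R) : R := complex.Im (z : R[i]).
Definition mkC (R : realType) (a b : R) : Cplx R := Complex a b.

Definition circle (R : realType) : topologicalType := [set z : Cplx R | `|z| = 1].

Definition sphere (R : realType) (n : nat) : topologicalType :=
  [set x : 'rV[R]_n.+1 | \sum_j (x 0 j) ^+ 2 = 1].

Definition nonzero_vectors (R : realType) (n : nat) : topologicalType :=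
  [set v : 'rV[Cplx R]_n.+1 | v <> 0].

Definition proportional (R : realType) (n : nat) (v w : nonzero_vectors R n)
  : Prop :=
  exists a : Cplx R, a <> 0 /\ set_val w = a *: set_val v.

Definition CP (R : realType) (n : nat) : topologicalType :=
  quot (@proportional R n).

(* [f] is of class C^k on the open set [U]. *)
Fixpoint class_C (R : realType) (n m k : nat) (U : set 'rV[R]_n)
    (f : 'rV[R]_n -> 'rV[R]_m) : Prop :=
  match k with
  | 0 => forall x, U x -> {for x, continuous f}
  | k'.+1 => (forall x, U x -> differentiable f x) /\
             forall v, class_C k' U (fun x => 'D_v f x)
  end.

Definition class_Coo (R : realType) (n m : nat) (U : set 'rV[R]_n)
    (f : 'rV[R]_n -> 'rV[R]_m) : Prop :=
  forall k, class_C k U f.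

(* A partial homeomorphism from [chart_dom] to [chart_cod], an open subset of
   R^d; the values of [chart_map] and [chart_inv] elsewhere are irrelevant. *)
Record chart (R : realType) (d : nat) (M : Type) := Chart {
  chart_dom : set M;
  chart_map : M -> 'rV[R]_d;
  chart_inv : 'rV[R]_d -> M
}.

Definition chart_cod (R : realType) (d : nat) (M : Type) (c : chart R d M) :=
  chart_map c @` chart_dom c.

Definition is_chart (R : realType) (d : nat) (M : topologicalType)
    (c : chart R d M) : Prop :=
  [/\ open (chart_dom c) /\ open (chart_cod c),
      {in chart_dom c, cancel (chart_map c) (chart_inv c)},
      forall x, chart_dom c x -> {for x, continuous (chart_map c)} &
      forall v, chart_cod c v -> {for v, continuous (chart_inv c)}].

Definition transition (R : realType) (d : nat) (M : Type) (c c' : chart R d M) :=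
  chart_map c' \o chart_inv c.

Definition compatible (R : realType) (d : nat) (M : Type) (c c' : chart R d M)
  : Prop :=
  let U := chart_dom c `&` chart_dom c' in
  class_Coo (chart_map c @` U) (transition c c') /\
  class_Coo (chart_map c' @` U) (transition c' c).

Record charted_space (R : realType) := ChartedSpace {
  cs_space :> topologicalType;
  cs_dim : nat;
  cs_atlas : set (chart R cs_dim cs_space)
}.

Definition is_atlas (R : realType) (d : nat) (M : topologicalType)
    (A : set (chart R d M)) : Prop :=
  [/\ forall c, A c -> is_chart c,
      \bigcup_(c in A) chart_dom c = setT &
      forall c c', A c -> A c' -> compatible c c'].

Definition smooth_manifold (R : realType) (M : charted_space R) : Prop :=
  [/\ hausdorff_space M, @second_countable M & is_atlas (cs_atlas (c := M))].

(* The charts of the maximal atlas. *)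
Definition smooth_chart (R : realType) (M : charted_space R)
    (c : chart R (cs_dim M) M) : Prop :=
  is_chart c /\ forall c', cs_atlas c' -> compatible c c'.

Definition orientable (R : realType) (M : charted_space R) : Prop :=
  exists O : set (chart R (cs_dim M) M),
    [/\ is_atlas O,
        O `<=` smooth_chart (M := M) &
        forall c c' x, O c -> O c' -> chart_dom c x -> chart_dom c' x ->
          0 < \det ('J (transition c c') (chart_map c x))].

Definition smooth_on_open (R : realType) (M N : charted_space R) (U : set M)
    (f : M -> N) : Prop :=
  (forall x, U x -> {for x, continuous f}) /\
  forall (c : chart R (cs_dim M) M) (c' : chart R (cs_dim N) N),
    cs_atlas c -> cs_atlas c' ->
    class_Coo (chart_map c @` (U `&` chart_dom c `&` f @^-1` chart_dom c'))
              (chart_map c' \o f \o chart_inv c).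

(* Smoothness on an arbitrary subset: local extendability to smooth maps on
   open sets.  On a submanifold this is smoothness for its induced structure. *)
Definition smooth_on (R : realType) (M N : charted_space R) (A : set M)
    (f : M -> N) : Prop :=
  forall x, A x -> exists (U : set M) (g : M -> N),
    [/\ open U, U x, {in U `&` A, f =1 g} & smooth_on_open U g].

Definition smooth_submanifold (R : realType) (M : charted_space R) (S : set M)
  : Prop :=
  exists2 e, (e <= cs_dim M)%N & forall x, S x ->
    exists c : chart R (cs_dim M) M,
      [/\ smooth_chart c, chart_dom c x &
          forall y, chart_dom c y ->
            S y <-> forall j : 'I_(cs_dim M), (e <= j)%N -> chart_map c y 0 j = 0].

Definition euclidean (R : realType) (d : nat) : charted_space R :=
  ChartedSpace (cs_space := 'rV[R]_d) [set Chart setT id id].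

Definition complex_space (R : realType) (d : nat) : charted_space R :=
  ChartedSpace (cs_space := 'rV[Cplx R]_d)
    [set Chart setT
      (fun z => row_mx (map_mx (@cRe R) z) (map_mx (@cIm R) z))
      (fun v : 'rV[R]_(d + d) => \row_j mkC (lsubmx v 0 j) (rsubmx v 0 j))].

Definition prod_chart (R : realType) (d d' : nat) (M M' : Type)
    (c : chart R d M) (c' : chart R d' M') : chart R (d + d') (M * M') :=
  Chart (chart_dom c `*` chart_dom c')
        (fun x => row_mx (chart_map c x.1) (chart_map c' x.2))
        (fun v => (chart_inv c (lsubmx v), chart_inv c' (rsubmx v))).

Definition prod_space (R : realType) (M N : charted_space R) : charted_space R :=
  ChartedSpace (cs_space := (M * N)%type)
    [set prod_chart c c' | c in cs_atlas (c := M) & c' in cs_atlas (c := N)].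

(* The restriction of [p] to the submanifold [E] of [M] is a smooth fiber bundle
   over the submanifold [B] of R^k, with typical fiber [K]: over [V `&` B] the
   maps [y |-> (p y, phi y)] and [psi] are inverse diffeomorphisms. *)
Definition smooth_fiber_bundle (R : realType) (k : nat) (M : charted_space R)
    (E : set M) (B : set 'rV[R]_k) (p : M -> 'rV[R]_k) : Prop :=
  smooth_on (N := euclidean R k) E p /\ p @` E = B /\
  exists K : charted_space R, smooth_manifold K /\
  forall b, B b -> exists V : set 'rV[R]_k,
    [/\ open V, V b &
    exists (phi : M -> K) (psi : prod_space (euclidean R k) K -> M),
      let EV := E `&` p @^-1` V in
      let BK : set (prod_space (euclidean R k) K) := (V `&` B) `*` [set: K] in
      [/\ smooth_on EV phi, smooth_on BK psi,
          psi @` BK `<=` EV,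
          {in EV, forall y, psi (p y, phi y) = y} &
          {in BK, forall z, (p (psi z), phi (psi z)) = z}]].

Section Convex.
Variables (R : realType) (k : nat).
Implicit Types (A P : set 'rV[R]_k).

Definition conv_hull A : set 'rV[R]_k :=
  [set x | exists n (p : 'I_n -> 'rV[R]_k) (w : 'I_n -> R),
    [/\ forall i, A (p i), forall i, 0 <= w i, \sum_i w i = 1 &
        x = \sum_i w i *: p i]].

Definition aff_hull A : set 'rV[R]_k :=
  [set x | exists n (p : 'I_n -> 'rV[R]_k) (w : 'I_n -> R),
    [/\ forall i, A (p i), \sum_i w i = 1 & x = \sum_i w i *: p i]].

Definition relint P : set 'rV[R]_k :=
  [set x | P x /\ \forall y \near x, aff_hull P y -> P y].

Definition polytope P : Prop :=
  exists A, [/\ finite_set A, A !=set0 & P = conv_hull A].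

Definition aff_dim P (d : nat) : Prop :=
  exists (x0 : 'rV[R]_k) (B : 'M[R]_(d, k)),
    row_free B /\ aff_hull P = [set x0 + u *m B | u in [set: 'rV[R]_d]].

(* Nonempty faces, [P] itself included: the sets of maximizers of a linear
   form. *)
Definition face F P : Prop :=
  F !=set0 /\ exists u : 'cV[R]_k,
    F = [set x | P x /\ forall y, P y -> (y *m u) 0 0 <= (x *m u) 0 0].

Definition vertices P : set 'rV[R]_k := [set v | face [set v] P].

End Convex.

Section Torus.
Variables (R : realType) (k : nat).

Definition torus : set 'rV[Cplx R]_k := [set t | forall j, `|t 0 j| = 1].

Definition torus_one : 'rV[Cplx R]_k := const_mx 1.

Definition torus_mul (s t : 'rV[Cplx R]_k) : 'rV[Cplx R]_k :=
  \row_j (s 0 j * t 0 j).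

Definition torus_exp (v : 'rV[R]_k) : 'rV[Cplx R]_k :=
  \row_j mkC (cos (v 0 j)) (sin (v 0 j)).

(* [T^k / S] has dimension [d], for a closed subgroup [S] of [T^k]: the Lie
   algebra of [S] has dimension [k - d]. *)
Definition torus_quotient_dim (S : set 'rV[Cplx R]_k) (d : nat) : Prop :=
  exists e (B : 'M[R]_(e, k)),
    [/\ (d + e = k)%N, row_free B &
        [set v | forall a : R, S (torus_exp (a *: v))] =
        [set u *m B | u in [set: 'rV[R]_e]]].

Variables (M : Type) (theta : 'rV[Cplx R]_k -> M -> M).

(* Only the values of [theta] on [torus] matter. *)
Definition torus_action : Prop :=
  (forall x, theta torus_one x = x) /\
  forall s t x, torus s -> torus t ->
    theta (torus_mul s t) x = theta s (theta t x).

Definition effective : Prop :=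
  forall t, torus t -> (forall x, theta t x = x) -> t = torus_one.

Definition stab (x : M) : set 'rV[Cplx R]_k := [set t | torus t /\ theta t x = x].

Definition fixed_point (x : M) : Prop := forall t, torus t -> theta t x = x.

Definition invariant_set (A : set M) : Prop :=
  forall t x, torus t -> A x -> A (theta t x).

Definition same_orbit (x y : M) : Prop := exists2 t, torus t & theta t x = y.

End Torus.

Definition orbit_space (R : realType) (k : nat) (M : topologicalType)
    (theta : 'rV[Cplx R]_k -> M -> M) : topologicalType :=
  quot (same_orbit theta).

Definition bdry (X : topologicalType) (Y : set X) : set X := closure Y `\` Y.

Section NKManifold.
Variables (R : realType) (n k : nat) (M : charted_space R).
Variables (theta : 'rV[Cplx R]_k -> M -> M) (mu : M -> 'rV[R]_k).

Local Notation moment_polytope := (range mu).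

Record special_atlas := SpecialAtlas {
  sa_size : nat;
  sa_chart : 'I_sa_size -> chart R (cs_dim M) M;
  sa_fixed : 'I_sa_size -> M
}.

Section Strata.
Variable A : special_atlas.
Local Notation idx := {set 'I_(sa_size A)}.
Local Notation dom i := (chart_dom (sa_chart (s := A) i)).

Definition axiom1 : Prop :=
  [/\ forall i, smooth_chart (sa_chart (s := A) i),
      \bigcup_i dom i = setT,
      injective (sa_fixed (s := A)) &
      forall i,
      [/\ invariant_set theta (dom i), dense (dom i),
          chart_cod (sa_chart i) = setT,
          dom i `&` fixed_point theta = [set sa_fixed i] &
          chart_map (sa_chart i) (sa_fixed i) = 0]].

Definition stratum (s : idx) : set M :=
  (\bigcap_(i in [set i | i \in s]) dom i) `&`
  (\bigcap_(i in [set i | i \notin s]) ~` dom i).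

Definition admissible (s : idx) : Prop := stratum s !=set0.

Definition axiom2 : Prop :=
  set_bij (fixed_point theta) (vertices moment_polytope) mu.

Definition sigma_polytope (s : idx) : set 'rV[R]_k :=
  conv_hull [set mu (sa_fixed i) | i in [set i | i \in s]].

Definition axiom3 : Prop :=
  forall s x y, stratum s x -> stratum s y -> stab theta x = stab theta y.

(* The quotient of a stratum by T^k, which is also its quotient by T^sigma. *)
Definition stratum_rel (s : idx) (x y : stratum s) : Prop :=
  same_orbit theta (set_val x) (set_val y).

Definition stratum_quot (s : idx) : topologicalType := quot (@stratum_rel s).

Definition stratum_class (s : idx) (x : stratum s) : stratum_quot s :=
  qclass (@stratum_rel s) x.

(* [pd_triv] is h_sigma.  [pd_bdry s] is the set of those t such that each leaf
   of the stratum s has a leaf of the stratum t in its boundary; [pd_eta s t]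
   is meaningful only for such t, and nothing is required when s is not
   admissible. *)
Record parameter_data := ParameterData {
  pd_space : idx -> topologicalType;
  pd_triv : forall s, stratum_quot s -> relint (sigma_polytope s) * pd_space s;
  pd_bdry : idx -> set idx;
  pd_eta : forall s t, pd_space s -> pd_space t
}.

Arguments pd_triv p {s} _.
Arguments pd_eta p {s} t _.

Section Fibration.
Variable D : parameter_data.
Local Notation F := (pd_space D).
Local Notation eta := (pd_eta D).

(* The trivialization makes the induced map W_s / T^k -> relint P_s a (trivial)
   fiber bundle. *)
Definition axiom4 : Prop := forall s, admissible s ->
  [/\ mu @` stratum s = relint (sigma_polytope s),
      homeomorphism (@pd_triv D s),
      forall x : stratum s,
        set_val (pd_triv D (stratum_class x)).1 = mu (set_val x) &
      forall x, stratum s x -> exists2 d,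
        aff_dim (sigma_polytope s) d & torus_quotient_dim (stab theta x) d].

Definition leaf (s : idx) (c : F s) : set M :=
  [set y | exists x : stratum s,
     set_val x = y /\ (pd_triv D (stratum_class x)).2 = c].

(* Distinct leaves of a stratum are disjoint and nonempty, so that the leaves
   below, hence [eta], are uniquely determined by the boundary. *)
Definition axiom5 : Prop := forall s, admissible s ->
  [/\ forall c : F s, smooth_submanifold (leaf c) /\
        smooth_fiber_bundle (leaf c) (relint (sigma_polytope s)) mu,
      forall t, pd_bdry D s t ->
        admissible t /\ face (sigma_polytope t) (sigma_polytope s),
      forall c : F s, bdry (leaf c) = \bigcup_(t in pd_bdry D s) leaf (eta t c) &
      forall t, pd_bdry D s t -> continuous (@pd_eta D s t)].

(* C(M, P) is the set [cpoints] of pairs (sigma, point of the relative interior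
   of P_sigma).  It contains the image of [cmap], so that its subspace topology
   in [CQ] is the quotient topology of [cmap] onto [cpoints]. *)
Definition cmap (y : M) : idx * 'rV[R]_k := ([set i | `[< dom i y >]]%SET, mu y).

Definition CQ : topologicalType := final_topology cmap.

Definition cpoints : set CQ :=
  [set x : idx * 'rV[R]_k | admissible x.1 /\ relint (sigma_polytope x.1) x.2].

Definition EE_set : set (CQ * M) :=
  [set z | exists s x y, [/\ z = ((s, x), y), cpoints (s, x), stratum s y & x = mu y]].

Definition EE_rel (z z' : EE_set) : Prop :=
  (set_val z).1 = (set_val z').1 /\
  same_orbit theta (set_val z).2 (set_val z').2.

Definition EE_quot : topologicalType := quot EE_rel.

Definition E_set (FF : topologicalType) (Ft : idx -> topologicalType)
    (I : forall s, Ft s -> FF) : set (CQ * FF) :=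
  [set z | exists s x (c : Ft s), z = ((s, x), I s c) /\ cpoints (s, x)].

(* [F~ = F] is the condition that the projection of the main stratum is a
   homeomorphism.  [H] is the map (x, c~) |-> (x, p c~): the point (x, c) of
   [EE_quot], x in P'_s, is the class of (x, y) for any y in the stratum [s]
   whose class corresponds to (x, c) under the trivialization. *)
Definition axiom6 : Prop :=
  exists (FF : topologicalType) (Ft : idx -> topologicalType)
    (I : forall s, Ft s -> FF) (p : forall s, Ft s -> F s),
  [/\ forall s, admissible s ->
        [/\ continuous (I s), injective (I s), continuous (p s) &
            range (p s) = setT],
      [/\ homeomorphism (p [set: 'I_(sa_size A)]%SET), compact [set: FF],
          hausdorff_space FF & dense (range (I [set: 'I_(sa_size A)]%SET))],
      (forall s t, admissible s -> admissible t ->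
         face (sigma_polytope t) (sigma_polytope s) ->
         range (I s) `<=` range (I t)) /\
      \bigcup_i range (I [set i]%SET) = setT,
      forall s t (c : Ft s) (d : Ft t), admissible s -> pd_bdry D s t ->
        I t d = I s c -> p t d = eta t (p s c) &
      exists H : E_set I -> EE_quot, continuous H /\
        forall (z : E_set I) (w : EE_set) s x (c : Ft s) (y : stratum s),
          set_val z = ((s, x), I s c) -> set_val w = ((s, x), set_val y) ->
          (pd_triv D (stratum_class y)).2 = p s c ->
          H z = qclass EE_rel w].

End Fibration.
End Strata.

(* The orientation, the special atlas, the spaces of parameters, the
   trivializations and the data of [axiom6] are existentially quantified. *)
Definition nk_manifold : Prop :=
  [/\ (1 <= k <= n)%N,
      [/\ smooth_manifold M, cs_dim M = n.*2, compact [set: M] & orientable M],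
      [/\ torus_action theta,
          smooth_on (M := prod_space (complex_space R k) M) (@torus R k `*` setT)
            (fun z => theta z.1 z.2),
          effective theta &
          forall x, connected (stab theta x)],
      [/\ smooth_on (N := euclidean R k) setT mu,
          forall t x, torus t -> mu (theta t x) = mu x,
          polytope moment_polytope, aff_dim moment_polytope k &
          forall U, open U -> exists2 V, open V & mu @` U = moment_polytope `&` V] &
      exists (A : special_atlas) (D : parameter_data A),
        [/\ axiom1 A, axiom2, axiom3 A & [/\ axiom4 D, axiom5 D & axiom6 D]]].

End NKManifold.

Section Flags.
Variable R : realType.
Local Notation C := (Cplx R).
Local Notation V := 'rV[C]_3.

Definition is_flag (L : {vspace V} * {vspace V}) : bool :=
  [&& \dim L.1 == 1, \dim L.2 == 2 & (L.1 <= L.2)%VS]%N.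

Definition flag : Type := {L : {vspace V} * {vspace V} | is_flag L}.

HB.instance Definition _ := [isSub of flag for @sval _ _].
HB.instance Definition _ := [Choice of flag by <:].

(* The flag spanned by the first rows of an invertible matrix. *)
Definition row_flag (g : 'M[C]_3) : {vspace V} * {vspace V} :=
  (<[row 0%R g]>%VS, <<[:: row 0%R g; row 1%R g]>>%VS).

Fact row_flagP (g : 'M[C]_3) : g \in unitmx -> is_flag (row_flag g).
Proof.
move=> gU; have nz (u : V) : u *m g = 0 -> u = 0.
  by move=> ug; rewrite -[u](mulmxK gU) ug mul0mx.
have r_neq0 (i : 'I_3) : row i g != 0.
  apply/eqP; rewrite rowE => /nz/matrixP/(_ 0 i); rewrite !mxE eqxx /=.
  by move/eqP; rewrite eqxx oner_eq0.
have fr : free [:: row 0 g; row 1 g].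
  rewrite free_cons seq1_free r_neq0 andbT span_seq1; apply/negP => /vlineP[a].
  rewrite !rowE scalemxAl => /eqP; rewrite -subr_eq0 -mulmxBl => /eqP/nz.
  by move=> /matrixP/(_ 0 0); rewrite !mxE /= mulr0 subr0 => /eqP; rewrite oner_eq0.
rewrite /is_flag /= dim_vline r_neq0 (eqP fr) /= -span_seq1.
by apply: sub_span => x; rewrite !inE => ->.
Qed.

Definition GL3 : set 'M[C]_3 := [set g | g \in unitmx].

Definition flag_of_GL3 (g : GL3) : flag :=
  exist _ (row_flag (set_val g)) (row_flagP (set_valP g)).

(* The topology of the homogeneous space of GL_3(C). *)
HB.instance Definition _ := Topological.copy flag (final_topology flag_of_GL3).

Definition std_flag : flag :=
  exist _ (row_flag 1%:M) (row_flagP (unitmx1 C 3)).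

Definition flag_of_mx (g : 'M[C]_3) : flag := insubd std_flag (row_flag g).

(* The upper unitriangular matrix with entries (0,1), (0,2), (1,2) the complex
   numbers of coordinates (z_0, z_1), (z_2, z_3), (z_4, z_5). *)
Definition unitriangular (z : 'rV[R]_6) : 'M[C]_3 :=
  \matrix_(i, j) if (i < j)%N then
                   let l := (i + j).-1 in
                   mkC (z 0 (inord l.*2)) (z 0 (inord l.*2.+1))
                 else (i == j)%:R.

Definition flag_param (s : 'S_3) (z : 'rV[R]_6) : flag :=
  flag_of_mx (unitriangular z *m perm_mx s).

(* The translates of the big cell, with their standard coordinates. *)
Definition flag_chart (s : 'S_3) : chart R 6 flag :=
  Chart (range (flag_param s))
        (fun L => xget 0 [set z | flag_param s z = L])
        (flag_param s).

Definition flag_manifold : charted_space R :=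
  ChartedSpace (cs_space := flag) (range flag_chart).

(* The coordinatewise action of T^3 on C^3 and on F_3; [insubd] is only needed
   for [t] outside T^3. *)
Definition T3_action (t : V) (L : flag) : flag :=
  let f := linfun (mulmxr (diag_mx t)) in
  insubd L (f @: (val L).1, f @: (val L).2)%VS.

(* T^2 is identified with T^3/diag by (t_1, t_2) |-> [t_1, t_2, 1]. *)
Definition T2_action (t : 'rV[C]_2) : flag_manifold -> flag_manifold :=
  T3_action (row_mx t (const_mx 1 : 'rV[C]_1)).

(* The Plucker coordinate P^J of [U], for #|J| = dim U, with respect to the
   basis [vbasis U]; another basis changes all of them by a common factor. *)
Definition plucker (U : {vspace V}) (J : {set 'I_3}) : C :=
  \det (\matrix_(a < \dim U, b < \dim U)
          (vbasis U)`_a 0 (nth ord0 (enum J) b)).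

Definition normsq (z : C) : R := cRe z ^+ 2 + cIm z ^+ 2.

Definition delta_set (J : {set 'I_3}) : 'rV[R]_3 := \row_j (j \in J)%:R.

Definition partial_moment_map (U : {vspace V}) : 'rV[R]_3 :=
  (\sum_(J : {set 'I_3} | #|J| == \dim U) normsq (plucker U J))^-1 *:
  \sum_(J : {set 'I_3} | #|J| == \dim U) normsq (plucker U J) *: delta_set J.

Definition moment_map3 (L : flag) : 'rV[R]_3 :=
  partial_moment_map (val L).1 + partial_moment_map (val L).2.

(* The affine hull x_1 + x_2 + x_3 = 3 of the image is identified with R^2 by
   forgetting the last coordinate. *)
Definition flag_moment_map (L : flag_manifold) : 'rV[R]_2 :=
  lsubmx (moment_map3 L : 'rV[R]_(2 + 1)).

End Flags.

(* Main.v *)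
(* A flag L is encoded by two vectors p, q of C^3 with sum p_i q_i = 0, namely
   L_1 = <p> and L_2 = {v | sum v_i q_i = 0}.  With u_i = |p_i|^2/|p|^2 and
   w_i = |q_i|^2/|q|^2 the moment map is 1 + x, x = u - w, and its image is the
   hexagon {x | sum x_i = 0, sum |x_i| <= 2}.  The triple (p_i q_i) is invariant
   under the torus up to scalars; it matches a class [c] in
   CP^1 = {c <> 0 | sum c_i = 0}/C^*.  If L matches c then u_i w_i = r |c_i|^2 for
   some r >= 0, so that u_i + w_i = sqrt (x_i^2 + 4 r |c_i|^2), and these sum to 2.
   This equation has a unique root r >= 0, whence each (x, c) is realized by
   exactly one orbit.  The orbit space is therefore the hexagon times CP^1 with
   CP^1 collapsed over the boundary of the hexagon (where r = 0), that is, the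
   join of the circle and CP^1; the Hopf map identifies CP^1 with S^2 and the join
   with S^4.

   The strata are indexed by the pairs (A, B) of supports of p and q, and c is the
   parameter of a leaf; it is free on the main stratum only.  In the chart of a
   permutation, after a shear, a leaf is given by prescribing which of the three
   complex coordinates vanish.  The moduli of the others are smooth functions of x,
   by the implicit equation for r, and their phases are free: a leaf is the product
   of an open polytope and a torus. *)
From HB Require Import structures.
Require Import Defs.
From mathcomp Require Import all_boot all_order all_algebra all_fingroup all_field.
From mathcomp Require Import all_classical all_reals all_analysis.
From mathcomp Require Import generic_quotient complex.
From mathcomp Require Import ring lra.

Set Implicit Arguments.
Unset Strict Implicit.
Unset Printing Implicit Defensive.

Import Order.TTheory GRing.Theory Num.Theory.
Import numFieldNormedType.Exports.

Local Open Scope classical_set_scope.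
Local Open Scope ring_scope.

(** * Smooth functions on open subsets of R^n *)

(** Two obstacles shape the proof. First, the vectors [p], [q] of a flag and the vector of a class
    are picked by choice and do not vary continuously. Topological statements are made through
    orthogonal projectors, which ignore the choice, and the map from (x, c) to its orbit is
    continuous by compactness: the compact set of matching pairs (L, c) maps onto all (x, c). This
    one continuity replaces estimates; it yields the openness of the moment map, the inverses of the
    trivializations, the density of the main stratum, the limits of leaves and the continuity of H.
    Second, c is not a function of the flag when the supports A and B are disjoint: every c matches.
    There the space of parameters is one point, while the space lying over it in the universal CP^1
    is all of CP^1. If A and B meet, they share two or three indices, since sum p_i q_i = 0 forbids
    a single nonzero term. With two, c is one of three special points of CP^1; with three, it avoids
    these points. Hence a leaf of the main stratum never approaches a stratum with two common
    indices, and this decides which strata bound which leaves. *)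

Section RealContinuity.
Variables (R : realType) (T : topologicalType).
Implicit Types (f g : T -> R) (x : T).

Lemma cts_cst (c : R) x : {for x, continuous (fun _ : T => c)}.
Proof. exact: cst_continuous. Qed.

Lemma ctsD f g x : {for x, continuous f} -> {for x, continuous g} ->
  {for x, continuous (fun y => f y + g y)}.
Proof. exact: cvgD. Qed.

Lemma ctsM f g x : {for x, continuous f} -> {for x, continuous g} ->
  {for x, continuous (fun y => f y * g y)}.
Proof. exact: cvgM. Qed.

Lemma ctsN f x : {for x, continuous f} -> {for x, continuous (fun y => - f y)}.
Proof. exact: cvgN. Qed.

Lemma ctsB f g x : {for x, continuous f} -> {for x, continuous g} ->
  {for x, continuous (fun y => f y - g y)}.
Proof. exact: cvgB. Qed.

Lemma ctsV f x : f x != 0 -> {for x, continuous f} ->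
  {for x, continuous (fun y => (f y)^-1)}.
Proof. by move=> f0 Cf; exact: (@cvgV _ _ _ _ _ _ f0 Cf). Qed.

Lemma cts_norm f x : {for x, continuous f} -> {for x, continuous (fun y => `|f y|)}.
Proof. exact: cvg_norm. Qed.

Lemma cts_sqrt f x : {for x, continuous f} ->
  {for x, continuous (fun y => Num.sqrt (f y))}.
Proof.
by move=> Cf; apply: (@continuous_comp _ _ _ f) => //; exact: sqrt_continuous.
Qed.

Lemma cts_sum m (F : 'I_m -> T -> R) (P : pred 'I_m) x :
  (forall i, P i -> {for x, continuous (F i)}) ->
  {for x, continuous (fun y => \sum_(i | P i) F i y)}.
Proof.
by move=> Fc; apply: (@cvg_big R _ +%R 0 P add_continuous) => i Pi; exact: Fc.
Qed.

End RealContinuity.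

Section Calculus.
Variables (R : realType) (n : nat).
Implicit Types (U V : set 'rV[R]_n) (f g : 'rV[R]_n -> R) (x v : 'rV[R]_n).

(** Turns the little-o of the definition into an estimate for each [e], the form in which a
    candidate derivative is checked below. *)
Lemma differentiable_o (V W : normedModType R) (f : V -> W) (df : {linear V -> W})
    (x : V) : continuous df ->
  (forall e : R, 0 < e -> \forall h \near 0,
     `|f (h + x) - f x - df h| <= e * `|h|) ->
  differentiable f x /\ 'd f x = df :> (V -> W).
Proof.
move=> dfc fo.
have E : f \o shift x = cst (f x) + df +o_ 0 id.
  apply/eqaddoP => e e0; near=> h.
  have -> : (f \o shift x - (cst (f x) + df)) h = f (h + x) - f x - df h.
    by rewrite /= /GRing.add /= /GRing.opp /= opprD addrA.
  by near: h; exact: fo.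
have D := diff_unique dfc E; split=> //.
by apply/diff_locallyP; rewrite D; split.
Unshelve. all: by end_near. Qed.

Lemma near_eq_differentiable (V W : normedModType R) (f g : V -> W) (x : V) :
  {near x, f =1 g} -> differentiable f x -> differentiable g x.
Proof.
move=> fg df; have [//|] := @differentiable_o V W g ('d f x) x (diff_continuous df).
move=> e e0; have [_ /eqaddoP fo] := (diff_locallyP _ _).1 df.
have fgx := nbhs_singleton fg.
have fgh : \forall h \near 0, f (h + x) = g (h + x).
  by have /nbhs0P H := fg; near=> h; rewrite addrC; near: h.
near=> h; rewrite -fgx -(near fgh h) //.
have -> : f (h + x) - f x - 'd f x h = (f \o shift x - (cst (f x) + 'd f x)) h.
  by rewrite /= /GRing.add /= /GRing.opp /= opprD addrA.
by near: h; exact: fo.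
Unshelve. all: by end_near. Qed.

(** Carathéodory's criterion. The error of the linear approximation is \sum_i h_i (K_i(x + h) -
    K_i(x)), and each bracket tends to 0. Continuity of the slopes at the single point [x] suffices,
    which suits a function known only through an equation. *)
Lemma differentiable_caratheodory f x (K : 'I_n -> 'rV[R]_n -> R) :
  (forall i, {for x, continuous (K i)}) ->
  (\forall y \near x, f y - f x = \sum_i (y 0 i - x 0 i) * K i y) ->
  differentiable f x /\ forall v, 'D_v f x = \sum_i v 0 i * K i x.
Proof.
move=> Kc fK.
pose l v : R := \sum_i v 0 i * K i x.
have ll : linear l.
  move=> a u v; rewrite /l scaler_sumr -big_split; apply: eq_bigr => i _.
  by rewrite !mxE /GRing.scale /=; ring.
pose lL := GRing.isLinear.Build R 'rV[R]_n R _ l ll.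
pose L : {linear 'rV[R]_n -> R} := HB.pack l lL.
have Lc : continuous L.
  apply: (@continuous_big R _ +%R 0 xpredT add_continuous _ _
    (fun i (z : 'rV[R]_n) => z 0 i * K i x)) => i _ y.
  exact: (cvgM (@coord_continuous R 1 n 0 i y) (cvg_cst _)).
suff [df dE] : differentiable f x /\ 'd f x = L :> (_ -> _).
  by split=> // v; rewrite deriveE // dE.
apply: differentiable_o => // e e0.
have fKh : \forall h \near (0 : 'rV[R]_n),
    f (h + x) - f x = \sum_i (h 0 i) * K i (h + x).
  have /nbhs0P H := fK; near=> h.
  have -> : h + x = x + h by rewrite addrC.
  rewrite (near H h) //; apply: eq_bigr => i _; congr (_ * _).
  by rewrite mxE addrAC subrr add0r.
(* The share [e / n.+1%:R] leaves room in a sum of [n] terms and makes sense for [n = 0] too. *)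
have Kh : \forall h \near (0 : 'rV[R]_n), forall i,
    `|K i (h + x) - K i x| <= e / n.+1%:R.
  near=> h => i; move: i; near: h; apply: filter_forall => i.
  have : \forall y \near x, `|K i x - K i y| <= e / n.+1%:R.
    by move/cvgrPdist_le: (Kc i); apply; rewrite divr_gt0.
  by move/nbhs0P => H; near=> h; rewrite distrC [h + x]addrC; near: h; exact: H.
near=> h; rewrite (near fKh h) // /L /= /l -sumrB.
apply: le_trans (ler_norm_sum _ _ _) _.
apply: (@le_trans _ _ (\sum_(i < n) e / n.+1%:R * `|h|)).
  apply: ler_sum => i _; rewrite -mulrBr normrM mulrC ler_pM //.
    by move: i; near: h; exact: Kh.
  by rewrite [leRHS]/Num.Def.normr /= mx_normrE; apply: le_trans (le_bigmax _ _ (0, i)).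
rewrite sumr_const card_ord -mulrnAl ler_wpM2r // -mulr_natr -mulrA ger_pMr //.
by rewrite mulrC ler_pdivrMr // mul1r ler_nat.
Unshelve. all: by end_near. Qed.

(** The scalar form of [class_C]; [class_CP] reduces the vector-valued notion to it. *)
Fixpoint Ck (k : nat) U f : Prop :=
  match k with
  | 0 => forall x, U x -> {for x, continuous f}
  | k'.+1 => (forall x, U x -> differentiable f x) /\
             forall v, Ck k' U (fun x => 'D_v f x)
  end.

Definition Coo U f := forall k, Ck k U f.

Lemma Ck_near U k f g : open U -> (forall x, U x -> f x = g x) ->
  Ck k U f -> Ck k U g.
Proof.
move=> oU; elim: k f g => [|k IH] f g fg /=.
  move=> Cf x Ux; have fgx : {near x, f =1 g}.
    exact: (filterS fg (open_nbhs_nbhs (conj oU Ux))).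
  have := Cf x Ux; rewrite /prop_for /continuous_at (fg _ Ux) => H.
  by apply: cvg_trans H; exact: near_eq_cvg fgx.
move=> [df Df]; split=> [x Ux|v].
  apply: (near_eq_differentiable _ (df _ Ux)).
  exact: (filterS fg (open_nbhs_nbhs (conj oU Ux))).
apply: (IH _ _ _ (Df v)) => x Ux; apply: near_eq_derive.
exact: (filterS fg (open_nbhs_nbhs (conj oU Ux))).
Qed.

Lemma Ck_sub U V k f : V `<=` U -> Ck k U f -> Ck k V f.
Proof.
move=> VU; elim: k f => [|k IH] f /=; first by move=> Cf x /VU; exact: Cf.
by move=> [df Df]; split=> [x /VU|v]; [exact: df|exact: IH].
Qed.

Lemma CkS U k f : Ck k.+1 U f -> Ck k U f.
Proof.
elim: k f => [|k IH] f [df Df].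
  by move=> x /df; exact: differentiable_continuous.
by split=> // v; apply: IH.
Qed.

Lemma Ck_cst U k (c : R) : Ck k U (fun _ => c).
Proof.
elim: k c => [|k IH] c; first by move=> x _; exact: cst_continuous.
split=> [x _|v]; first exact: differentiable_cst.
rewrite (_ : (fun x => _) = fun=> (0 : R)); first exact: (IH 0).
by apply/funext => x; rewrite derive_cst.
Qed.

Lemma Ck_coord U k i : Ck k U (fun x => x 0 i).
Proof.
case: k => [|k]; first by move=> x _; exact: coord_continuous.
split=> [x _|v]; first exact: differentiable_coord.
rewrite (_ : (fun x => _) = fun=> v 0 i); first exact: Ck_cst.
apply/funext => x; pose e (j : 'I_n) (y : 'rV[R]_n) : R := (i == j)%:R.
have [|_ ->] := @differentiable_caratheodory (fun x : 'rV[R]_n => x 0 i) x e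
  (fun j => @cst_continuous _ _ _ x); last first.
- rewrite (bigD1 i) //= /e eqxx mulr1 big1 ?addr0 // => j ji.
  by rewrite eq_sym (negbTE ji) mulr0.
- near=> y; rewrite (bigD1 i) //= /e eqxx mulr1 big1 ?addr0 // => j ji.
  by rewrite eq_sym (negbTE ji) mulr0.
Unshelve. all: by end_near. Qed.

Lemma CkD U k f g : open U -> Ck k U f -> Ck k U g ->
  Ck k U (fun x => f x + g x).
Proof.
move=> oU; elim: k f g => [|k IH] f g.
  by move=> Cf Cg x Ux; apply: (@cvgD _ _ _ _ _ _ _ _ _ (Cf x Ux) (Cg x Ux)).
move=> [df Df] [dg Dg]; split=> [x Ux|v].
  by apply: differentiableD; [exact: df|exact: dg].
apply: (Ck_near oU _ (IH _ _ (Df v) (Dg v))) => x Ux.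
by rewrite -deriveD //; apply: diff_derivable; [exact: df|exact: dg].
Qed.

Lemma CkM U k f g : open U -> Ck k U f -> Ck k U g ->
  Ck k U (fun x => f x * g x).
Proof.
move=> oU; elim: k f g => [|k IH] f g.
  by move=> Cf Cg x Ux; apply: (@cvgM _ _ _ _ _ _ _ _ (Cf x Ux) (Cg x Ux)).
move=> Cf Cg; move: (Cf) (Cg) => [df Df] [dg Dg]; split=> [x Ux|v].
  by apply: differentiableM; [exact: df|exact: dg].
apply: (Ck_near oU _ (CkD oU (IH _ _ (CkS Cf) (Dg v)) (IH _ _ (CkS Cg) (Df v)))).
move=> x Ux.
by rewrite -[LHS]deriveM //; apply: diff_derivable; [exact: df|exact: dg].
Qed.

Lemma CkN U k f : open U -> Ck k U f -> Ck k U (fun x => - f x).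
Proof.
move=> oU Cf; apply: (Ck_near oU _ (CkM oU (Ck_cst U k (-1)) Cf)) => x _.
by rewrite mulN1r.
Qed.

Lemma Ck_sum U k m (F : 'I_m -> 'rV[R]_n -> R) (P : pred 'I_m) : open U ->
  (forall i, P i -> Ck k U (F i)) -> Ck k U (fun x => \sum_(i | P i) F i x).
Proof.
move=> oU CF; rewrite (_ : (fun x => _) = \sum_(i | P i) F i).
  apply: (big_ind (Ck k U)) => // [|f g Cf Cg]; first exact: Ck_cst.
  exact: CkD.
by apply/funext => x; rewrite fct_sumE.
Qed.

Lemma CkV U k f : open U -> (forall x, U x -> f x != 0) -> Ck k U f ->
  Ck k U (fun x => (f x)^-1).
Proof.
move=> oU f0; elim: k => [|k IH] Cf.
  by move=> x Ux; apply: (@cvgV _ _ _ _ _ _ (f0 x Ux) (Cf x Ux)).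
have Cv := IH (CkS Cf); move: Cf => [df Df]; split=> [x Ux|v].
  by apply: differentiableV; [exact: df|exact: f0].
apply: (Ck_near oU _ (CkN oU (CkM oU (CkM oU Cv Cv) (Df v)))) => x Ux.
rewrite deriveV ?f0 //; last by apply: diff_derivable; exact: df.
by rewrite scaleNr /GRing.scale /= -exprVn expr2.
Qed.

(** The derivative is the derivative of [f] divided by twice the same root, so the induction on the
    order closes; positivity of [f] keeps the denominator away from 0. *)
Lemma Ck_sqrt U k f : open U -> (forall x, U x -> 0 < f x) -> Ck k U f ->
  Ck k U (fun x => Num.sqrt (f x)).
Proof.
move=> oU f0; elim: k => [|k IH] Cf.
  move=> x Ux; apply: (@continuous_comp _ _ _ f); first exact: Cf.
  exact: sqrt_continuous.
have Cv := IH (CkS Cf); have Cf' := CkS Cf; move: Cf => [df Df].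
have cs x : U x -> {for x, continuous (fun x => Num.sqrt (f x))}.
  move=> Ux; apply: (@continuous_comp _ _ _ f).
    by apply: differentiable_continuous; exact: df.
  exact: sqrt_continuous.
have dsq x : U x -> differentiable (fun x => Num.sqrt (f x)) x /\
    forall v, 'D_v (fun x => Num.sqrt (f x)) x = 'D_v f x * (2 * Num.sqrt (f x))^-1.
  move=> Ux; have dE := differentiable_comp (df x Ux) _.
  have f0x := f0 x Ux.
  have H := is_derive1_sqrt f0x.
  have d1 : differentiable Num.sqrt (f x) by apply/derivable1_diffP; case: H.
  split; first exact: (differentiable_comp (df x Ux) d1).
  move=> v; rewrite deriveE; last exact: (differentiable_comp (df x Ux) d1).
  rewrite -[(fun x => _)]/(Num.sqrt \o f) diff_comp //; last exact: df.
  rewrite /= -[X in 'd Num.sqrt _ X]deriveE; last exact: (df x Ux).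
  by rewrite diff1E // derive1E (@derive_val _ _ _ _ _ _ _ H) /GRing.scale.
split=> [x Ux|v]; first by have [] := dsq x Ux.
have C2 : Ck k U (fun x => (2 * Num.sqrt (f x))^-1).
  apply: CkV => // [x Ux|].
    by rewrite mulf_neq0 // ?sqrtr_eq0 -?ltNge ?f0 // lt0r_neq0.
  exact: CkM oU (Ck_cst U k 2) Cv.
by apply: (Ck_near oU _ (CkM oU (Df v) C2)) => x Ux; rewrite (dsq x Ux).2.
Qed.

End Calculus.

Section CalculusComp.
Variables (R : realType).

Lemma continuous_row (T : topologicalType) (m : nat) (f : T -> 'rV[R]_m) (x : T) :
  (forall j, {for x, continuous (fun y => f y 0 j)}) -> {for x, continuous f}.
Proof.
move=> Cf; apply/cvgrPdist_le => e e0; near=> y.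
rewrite [leLHS]/Num.Def.normr /= mx_normrE (bigmax_le _ (ltW e0)) //= => -[i j] _.
rewrite !mxE /= ord1 {i}; move: j; near: y; apply: filter_forall => j.
by have /cvgrPdist_le := Cf j; apply.
Unshelve. all: by end_near. Qed.

Lemma class_CP (n m k : nat) (U : set 'rV[R]_n) (f : 'rV[R]_n -> 'rV[R]_m) :
  open U -> class_C k U f <-> forall j, Ck k U (fun x => f x 0 j).
Proof.
move=> oU; elim: k f => [|k IH] f /=.
  split=> [Cf j x Ux|Cf x Ux].
    by apply: (@continuous_comp _ _ _ f (fun y : 'rV_m => y 0 j));
      [exact: Cf|exact: coord_continuous].
  by apply: continuous_row => j; exact: (Cf j x Ux).
have co m' (j : 'I_m') y : differentiable (fun z : 'rV[R]_m' => z 0 j) y.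
  exact: differentiable_coord.
split=> [[df Df] j|Cf].
  split=> [x Ux|v]; first exact: (differentiable_comp (df x Ux) (co _ _ _)).
  apply: (Ck_near oU _ ((IH _).1 (Df v) j)) => x Ux.
  by rewrite derive_mx ?mxE //; apply: diff_derivable; exact: df.
have df x : U x -> differentiable f x.
  move=> Ux; have -> : f = \sum_j (fun x => f x 0 j *: delta_mx 0 j).
    apply/funext => y; rewrite [LHS]row_sum_delta.
    by elim/big_ind2: _ => // u1 u2 v1 v2 -> ->.
  apply: differentiable_sum => j; apply: differentiableZl.
  by case: (Cf j) => + _; apply.
split=> // v; apply/IH => j.
apply: (Ck_near oU _ ((Cf j).2 v)) => x Ux.
by rewrite derive_mx ?mxE //; apply: diff_derivable; exact: df.
Qed.

Lemma class_CooP (n m : nat) (U : set 'rV[R]_n) (f : 'rV[R]_n -> 'rV[R]_m) :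
  open U -> class_Coo U f <-> forall j, Coo U (fun x => f x 0 j).
Proof.
move=> oU; split=> [Cf j k|Cf k]; first exact: (class_CP _ _ oU).1.
by apply/class_CP => // j; exact: Cf.
Qed.

Lemma Ck_comp (n m k : nat) (U : set 'rV[R]_n) (V : set 'rV[R]_m)
    (f : 'rV[R]_m -> R) (g : 'rV[R]_n -> 'rV[R]_m) :
  open U -> open V -> (forall x, U x -> V (g x)) ->
  Ck k V f -> (forall j, Ck k U (fun x => g x 0 j)) -> Ck k U (f \o g).
Proof.
move=> oU oV gV; elim: k f => [|k IH] f Cf Cg.
  have Cg' := (class_CP 0 g oU).2 Cg.
  by move=> x Ux; apply: (@continuous_comp _ _ _ g); [exact: Cg'|exact/Cf/gV].
have [dg Dg] := (class_CP k.+1 g oU).2 Cg; have [df Df] := Cf.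
split=> [x Ux|v]; first exact: differentiable_comp (dg x Ux) (df _ (gV x Ux)).
(* The chain rule in coordinates: expanding the derivative of [g] in the standard basis leaves
   partial derivatives of [f] in fixed directions, composed with [g], and the induction hypothesis
   applies to these. *)
pose F x : R := \sum_(j < m) ('D_v g x) 0 j * ('D_(delta_mx 0 j) f \o g) x.
apply: (@Ck_near _ _ U k F) => // [x Ux|].
  rewrite deriveE; last exact: differentiable_comp (dg x Ux) (df _ (gV x Ux)).
  rewrite diff_comp /=; [|exact: dg|exact/df/gV].
  rewrite -[X in 'd f (g x) X]deriveE; last exact: (dg x Ux).
  rewrite [X in 'd f (g x) X]row_sum_delta linear_sum; apply: eq_bigr => j _.
  by rewrite linearZ /= -(deriveE _ (df _ (gV x Ux))).
apply: Ck_sum => // j _; apply: CkM => //.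
  exact: (class_CP _ _ oU).1 (Dg v) j.
by apply: IH => [|i]; [exact: Df|exact: CkS].
Qed.

End CalculusComp.

Section Smooth.
Variables (R : realType) (n : nat).
Implicit Types (U : set 'rV[R]_n) (f g : 'rV[R]_n -> R).

Lemma Coo_near U f g : open U -> (forall x, U x -> f x = g x) -> Coo U f -> Coo U g.
Proof. by move=> oU fg Cf k; apply: Ck_near fg (Cf k). Qed.

Lemma Coo_sub U V f : V `<=` U -> Coo U f -> Coo V f.
Proof. by move=> VU Cf k; apply: Ck_sub VU (Cf k). Qed.

Lemma Coo_cst U (c : R) : Coo U (fun _ => c).
Proof. by move=> k; exact: Ck_cst. Qed.

Lemma Coo_coord U i : Coo U (fun x => x 0 i).
Proof. by move=> k; exact: Ck_coord. Qed.

Lemma CooD U f g : open U -> Coo U f -> Coo U g -> Coo U (fun x => f x + g x).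
Proof. by move=> oU Cf Cg k; exact: CkD. Qed.

Lemma CooM U f g : open U -> Coo U f -> Coo U g -> Coo U (fun x => f x * g x).
Proof. by move=> oU Cf Cg k; exact: CkM. Qed.

Lemma CooN U f : open U -> Coo U f -> Coo U (fun x => - f x).
Proof. by move=> oU Cf k; exact: CkN. Qed.

Lemma CooB U f g : open U -> Coo U f -> Coo U g -> Coo U (fun x => f x - g x).
Proof. by move=> oU Cf Cg; apply: CooD => //; exact: CooN. Qed.

Lemma Coo_sum U m (F : 'I_m -> 'rV[R]_n -> R) (P : pred 'I_m) : open U ->
  (forall i, P i -> Coo U (F i)) -> Coo U (fun x => \sum_(i | P i) F i x).
Proof. by move=> oU CF k; apply: Ck_sum => // i /CF; exact. Qed.

Lemma CooV U f : open U -> (forall x, U x -> f x != 0) -> Coo U f ->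
  Coo U (fun x => (f x)^-1).
Proof. by move=> oU f0 Cf k; exact: CkV. Qed.

Lemma Coo_sqrt U f : open U -> (forall x, U x -> 0 < f x) -> Coo U f ->
  Coo U (fun x => Num.sqrt (f x)).
Proof. by move=> oU f0 Cf k; exact: Ck_sqrt. Qed.

Lemma Coo_continuous U f x : Coo U f -> U x -> {for x, continuous f}.
Proof. by move=> /(_ 0%N); exact. Qed.

(* The difference quotients of [sqrt] turn the defining equation of [r] into
   [r y - r x = \sum_j (y_j - x_j) * (N x j y / Q x y)], with [N], [Q] as in the
   proof; this gives the gradient of [r] as a smooth function of [x] and [r x]. *)
Lemma Coo_implicit_sqrt U m (l : 'I_m -> 'rV[R]_n -> R) (L : 'rV[R]_n -> R)
    (d : 'I_m -> R) (r : 'rV[R]_n -> R) : open U ->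
  (forall i, exists w : 'cV[R]_n, forall x, l i x = (x *m w) 0 0) ->
  (exists (a : R) (w : 'cV[R]_n), forall x, L x = a + (x *m w) 0 0) ->
  (forall i, 0 < d i) -> (0 < m)%N ->
  (forall x, U x -> 0 < r x) ->
  (forall x, U x -> {for x, continuous r}) ->
  (forall x, U x -> \sum_i Num.sqrt (l i x ^+ 2 + 4 * r x * d i) = L x) ->
  Coo U r.
Proof.
move=> oU /choice[w lE] [a [wL LE]] d0 m0 r0 rc rE.
pose s i x := Num.sqrt (l i x ^+ 2 + 4 * r x * d i).
have sq0 i x : U x -> 0 < l i x ^+ 2 + 4 * r x * d i.
  by move=> Ux; rewrite ltr_wpDl ?sqr_ge0 // !mulr_gt0 ?r0.
have s0 i x : U x -> 0 < s i x by move=> Ux; rewrite sqrtr_gt0 sq0.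
have lC i : Coo U (l i).
  rewrite (_ : l i = fun x => \sum_j x 0 j * w i j 0); last first.
    by apply/funext => x; rewrite lE mxE.
  by apply: Coo_sum => // j _; apply: CooM => //; [exact: Coo_coord|exact: Coo_cst].
pose N x j y := wL j 0 - \sum_i (l i y + l i x) * w i j 0 / (s i y + s i x).
pose Q x y := \sum_i 4 * d i / (s i y + s i x).
(* Since [m] is positive at least one term is present, and the constants [d i] and the roots are
   positive. *)
have Q0 x y : U x -> U y -> 0 < Q x y.
  move=> Ux Uy; rewrite /Q; case: m m0 l d w lE d0 rE s sq0 s0 lC N Q => // m' _.
  move=> l d w lE d0 rE s sq0 s0 lC N Q; rewrite big_ord_recl ltr_pwDl //.
    by rewrite divr_gt0 ?mulr_gt0 // addr_gt0 ?s0.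
  by apply: sumr_ge0 => i _; rewrite divr_ge0 ?mulr_ge0 ?(ltW (d0 _)) // addr_ge0 ?ltW ?s0.
have rdiff x y : U x -> U y -> r y - r x = \sum_j (y 0 j - x 0 j) * (N x j y / Q x y).
  move=> Ux Uy; have Qn := lt0r_neq0 (Q0 _ _ Ux Uy); apply: (mulIf Qn).
  have E1 i : s i y - s i x = (l i y - l i x) * ((l i y + l i x) / (s i y + s i x))
      + (r y - r x) * (4 * d i / (s i y + s i x)).
    have sn : s i y + s i x != 0 by rewrite lt0r_neq0 // addr_gt0 ?s0.
    have E0 : (s i y - s i x) * (s i y + s i x) =
        (l i y - l i x) * (l i y + l i x) + (r y - r x) * (4 * d i).
      by rewrite -subr_sqr /s !sqr_sqrtr ?ltW ?sq0 //; ring.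
    by apply: (mulIf sn); rewrite E0; field.
  have E2 : L y - L x = \sum_i (s i y - s i x) by rewrite sumrB /s !rE.
  have E3 : L y - L x = \sum_j (y 0 j - x 0 j) * wL j 0.
    rewrite !LE !mxE opprD addrACA subrr add0r -sumrB.
    by apply: eq_bigr => j _; rewrite mulrBl.
  have E4 i : l i y - l i x = \sum_j (y 0 j - x 0 j) * w i j 0.
    by rewrite !lE !mxE -sumrB; apply: eq_bigr => j _; rewrite mulrBl.
  have E5 : \sum_i (l i y - l i x) * ((l i y + l i x) / (s i y + s i x)) =
      \sum_j (y 0 j - x 0 j) * \sum_i (l i y + l i x) * w i j 0 / (s i y + s i x).
    under [RHS]eq_bigr do rewrite mulr_sumr.
    rewrite exchange_big /=; apply: eq_bigr => i _.
    by rewrite E4 mulr_suml; apply: eq_bigr => j _; ring.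
  have E6 : (r y - r x) * Q x y = \sum_j (y 0 j - x 0 j) * N x j y.
    rewrite /N; under [RHS]eq_bigr do rewrite mulrBr.
    rewrite sumrB -E3 -E5 E2 mulr_sumr -sumrB; apply: eq_bigr => i _.
    by rewrite E1 addrAC subrr add0r.
  rewrite E6 mulr_suml; apply: eq_bigr => j _.
  by rewrite -!mulrA mulVf // mulr1.
have sc i x : U x -> {for x, continuous (s i)}.
  move=> Ux; apply/cts_sqrt/ctsD.
    exact: (Coo_continuous (CooM oU (lC i) (lC i)) Ux).
  by apply: ctsM; [apply: ctsM; [exact: cts_cst|exact: rc]|exact: cts_cst].
have rdf x : U x -> differentiable r x /\
    forall v, 'D_v r x = \sum_j v 0 j * (N x j x / Q x x).
  move=> Ux; apply: (@differentiable_caratheodory _ _ _ _ (fun j y => N x j y / Q x y)).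
    have scs i : {for x, continuous (fun y => (s i y + s i x)^-1)}.
      apply: ctsV; first by rewrite lt0r_neq0 // addr_gt0 ?s0.
      by apply: ctsD; [exact: sc|exact: cts_cst].
    move=> j; apply: ctsM.
      apply: ctsB; first exact: cts_cst.
      apply: cts_sum => i _; apply: ctsM; last exact: scs.
      apply: ctsM; last exact: cts_cst.
      by apply: ctsD; [exact: (Coo_continuous (lC i) Ux)|exact: cts_cst].
    apply: ctsV; first by rewrite lt0r_neq0 ?Q0.
    by apply: cts_sum => i _; apply: ctsM; [exact: cts_cst|exact: scs].
  by near=> y; apply: rdiff => //; near: y; exact: open_nbhs_nbhs.
(* Bootstrap: the gradient is a smooth expression in [x] and [r x], so each order of smoothness of
   [r] gives the next one. *)
elim=> [|k IH]; first exact: rc.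
split=> [x Ux|v]; first by have [] := rdf x Ux.
apply: (@Ck_near _ _ U k (fun x => \sum_j v 0 j * (N x j x / Q x x))) => //.
  by move=> x Ux; rewrite (rdf x Ux).2.
have sC i : Ck k U (s i).
  apply: Ck_sqrt => //; first exact: sq0.
  apply: CkD => //; first by apply: CkM => //; exact: lC.
  by apply: CkM => //; [apply: CkM => //|]; exact: Ck_cst.
have sV i : Ck k U (fun x => (s i x + s i x)^-1).
  apply: CkV => //; last exact: CkD.
  by move=> x Ux; rewrite lt0r_neq0 // addr_gt0 ?s0.
apply: Ck_sum => // j _; apply: CkM => //; first exact: Ck_cst.
apply: CkM => //.
  apply: CkD => //; first exact: Ck_cst.
  apply: CkN => //; apply: Ck_sum => // i _.
  apply: CkM => //; apply: CkM => //; last exact: Ck_cst.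
  by apply: CkD => //; exact: lC.
apply: CkV => //; first by move=> x Ux; rewrite lt0r_neq0 ?Q0.
by apply: Ck_sum => // i _; apply: CkM => //; exact: Ck_cst.
Unshelve. all: by end_near. Qed.

End Smooth.

Lemma Coo_comp (R : realType) (n m : nat) (U : set 'rV[R]_n) (V : set 'rV[R]_m)
    (f : 'rV[R]_m -> R) (g : 'rV[R]_n -> 'rV[R]_m) :
  open U -> open V -> (forall x, U x -> V (g x)) ->
  Coo V f -> class_Coo U g -> Coo U (f \o g).
Proof.
move=> oU oV gV Cf /(class_CooP _ oU) Cg k.
by apply: (Ck_comp oU oV gV (Cf k)) => j; exact: Cg.
Qed.

(** * Real and imaginary parts, and smooth complex-valued functions *)

Section ComplexParts.
Variable R : realType.
Implicit Types z w : Cplx R.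

Lemma cReD z w : cRe (z + w) = cRe z + cRe w. Proof. by case: z w => [? ?] [? ?]. Qed.
Lemma cImD z w : cIm (z + w) = cIm z + cIm w. Proof. by case: z w => [? ?] [? ?]. Qed.
Lemma cReN z : cRe (- z) = - cRe z. Proof. by case: z. Qed.
Lemma cImN z : cIm (- z) = - cIm z. Proof. by case: z. Qed.
Lemma cReM z w : cRe (z * w) = cRe z * cRe w - cIm z * cIm w.
Proof. by case: z w => [? ?] [? ?]. Qed.
Lemma cImM z w : cIm (z * w) = cRe z * cIm w + cIm z * cRe w.
Proof. by case: z w => [? ?] [? ?]; rewrite /cIm /=. Qed.
Lemma cReV z : cRe z^-1 = cRe z / normsq z. Proof. by case: z. Qed.
Lemma cImV z : cIm z^-1 = - cIm z / normsq z.
Proof. by case: z => a b; rewrite /cIm /= mulNr. Qed.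
Lemma cRe0 : cRe (0 : Cplx R) = 0. Proof. by []. Qed.
Lemma cIm0 : cIm (0 : Cplx R) = 0. Proof. by []. Qed.
Lemma cRe1 : cRe (1 : Cplx R) = 1. Proof. by []. Qed.
Lemma cIm1 : cIm (1 : Cplx R) = 0. Proof. by []. Qed.
Lemma mkCK z : mkC (cRe z) (cIm z) = z. Proof. by case: z. Qed.
Lemma cRe_mk (a b : R) : cRe (mkC a b) = a. Proof. by []. Qed.
Lemma cIm_mk (a b : R) : cIm (mkC a b) = b. Proof. by []. Qed.
Lemma cplxP z w : cRe z = cRe w -> cIm z = cIm w -> z = w.
Proof. by rewrite -{3}(mkCK z) -{3}(mkCK w) => -> ->. Qed.

Lemma normsq_ge0 z : 0 <= normsq z.
Proof. by rewrite addr_ge0 ?sqr_ge0. Qed.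

Lemma normsq_eq0 z : (normsq z == 0) = (z == 0).
Proof.
rewrite paddr_eq0 ?sqr_ge0 // !sqrf_eq0.
apply/andP/eqP => [[/eqP zr /eqP zi]|->]; last by rewrite cRe0 cIm0 eqxx.
exact: cplxP.
Qed.

Lemma normsq_gt0 z : (0 < normsq z) = (z != 0).
Proof. by rewrite lt_def normsq_eq0 normsq_ge0 andbT. Qed.

Lemma normsqM z w : normsq (z * w) = normsq z * normsq w.
Proof. by rewrite /normsq cReM cImM; ring. Qed.

Lemma normsq0 : normsq (0 : Cplx R) = 0.
Proof. by apply/eqP; rewrite normsq_eq0. Qed.

Lemma normsq1 : normsq (1 : Cplx R) = 1.
Proof. by rewrite /normsq cRe1 cIm1; ring. Qed.

Lemma normsqN z : normsq (- z) = normsq z.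
Proof. by rewrite /normsq cReN cImN !sqrrN. Qed.

Lemma normsqV z : normsq z^-1 = (normsq z)^-1.
Proof.
have [->|z0] := eqVneq z 0; first by rewrite invr0 normsq0 invr0.
apply: (@mulfI _ (normsq z)); first by rewrite normsq_eq0.
by rewrite -normsqM divff ?divff ?normsq_eq0 // normsq1.
Qed.

Lemma normE_sq z : `|z| = mkC (Num.sqrt (normsq z)) 0.
Proof. by case: z. Qed.

Lemma norm1P z : `|z| = 1 <-> normsq z = 1.
Proof.
rewrite normE_sq; split=> [[E]|->]; last by rewrite sqrtr1.
by rewrite -[LHS]sqr_sqrtr ?normsq_ge0 // E expr1n.
Qed.

End ComplexParts.

Section ComplexSmooth.
Variables (R : realType) (n : nat) (U : set 'rV[R]_n).
Hypothesis oU : open U.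
Implicit Types f g : 'rV[R]_n -> Cplx R.

Definition CooC f := Coo U (fun x => cRe (f x)) /\ Coo U (fun x => cIm (f x)).

Lemma CooC_near f g : (forall x, U x -> f x = g x) -> CooC f -> CooC g.
Proof.
by move=> fg [Cr Ci]; split; [apply: Coo_near Cr|apply: Coo_near Ci] => // x /fg ->.
Qed.

Lemma CooC_cst (c : Cplx R) : CooC (fun=> c).
Proof. by split; exact: Coo_cst. Qed.

Lemma CooC_mk (f g : 'rV[R]_n -> R) :
  Coo U f -> Coo U g -> CooC (fun x => mkC (f x) (g x)).
Proof. by split. Qed.

Lemma CooCD f g : CooC f -> CooC g -> CooC (fun x => f x + g x).
Proof.
move=> [fr fi] [gr gi]; split.
  by under [X in Coo _ X]funext do rewrite cReD; exact: CooD.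
by under [X in Coo _ X]funext do rewrite cImD; exact: CooD.
Qed.

Lemma CooCN f : CooC f -> CooC (fun x => - f x).
Proof.
move=> [fr fi]; split.
  by under [X in Coo _ X]funext do rewrite cReN; exact: CooN.
by under [X in Coo _ X]funext do rewrite cImN; exact: CooN.
Qed.

Lemma CooCB f g : CooC f -> CooC g -> CooC (fun x => f x - g x).
Proof. by move=> Cf Cg; apply: CooCD => //; exact: CooCN. Qed.

Lemma CooCM f g : CooC f -> CooC g -> CooC (fun x => f x * g x).
Proof.
move=> [fr fi] [gr gi]; split.
  under [X in Coo _ X]funext do rewrite cReM.
  by apply: CooB => //; exact: CooM.
under [X in Coo _ X]funext do rewrite cImM.
by apply: CooD => //; exact: CooM.
Qed.

Lemma Coo_normsq f : CooC f -> Coo U (fun x => normsq (f x)).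
Proof. by move=> [fr fi]; apply: CooD => //; exact: CooM. Qed.

Lemma CooCV f : (forall x, U x -> f x != 0) -> CooC f -> CooC (fun x => (f x)^-1).
Proof.
move=> f0 Cf; have Cv : Coo U (fun x => (normsq (f x))^-1).
  apply: CooV => //; first by move=> x Ux; rewrite normsq_eq0 f0.
  exact: Coo_normsq.
case: Cf => fr fi; split.
  by under [X in Coo _ X]funext do rewrite cReV; exact: CooM.
under [X in Coo _ X]funext do rewrite cImV.
by apply: CooM => //; exact: CooN.
Qed.

End ComplexSmooth.

(** * Topological preliminaries *)

Section ComplexContinuity.
Variables (R : realType).

Lemma cts_cRe (T : topologicalType) (f : T -> Cplx R) (x : T) :
  {for x, continuous f} -> {for x, continuous (fun y => cRe (f y))}.
Proof.
move=> fc; apply/cvgrPdist_lt => e e0; near=> y.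
have : `|f x - f y| < (mkC e 0 : Cplx R).
  near: y; move/cvgrPdist_lt: fc; apply.
  by rewrite ltcE /= eqxx.
rewrite normE_sq ltcE /= eqxx /=; apply: le_lt_trans.
by rewrite -cReN -cReD -sqrtr_sqr ler_wsqrtr // lerDl sqr_ge0.
Unshelve. all: by end_near. Qed.

Lemma cts_cIm (T : topologicalType) (f : T -> Cplx R) (x : T) :
  {for x, continuous f} -> {for x, continuous (fun y => cIm (f y))}.
Proof.
move=> fc; apply/cvgrPdist_lt => e e0; near=> y.
have : `|f x - f y| < (mkC e 0 : Cplx R).
  near: y; move/cvgrPdist_lt: fc; apply.
  by rewrite ltcE /= eqxx.
rewrite normE_sq ltcE /= eqxx /=; apply: le_lt_trans.
by rewrite -cImN -cImD -sqrtr_sqr ler_wsqrtr // lerDr sqr_ge0.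
Unshelve. all: by end_near. Qed.

Lemma cts_mkC (T : topologicalType) (f g : T -> R) (x : T) :
  {for x, continuous f} -> {for x, continuous g} ->
  {for x, continuous (fun y => mkC (f y) (g y))}.
Proof.
(* A positive element of [Cplx R] has imaginary part 0, so the radius is a real [e]. If both parts
   are within [e / 2], the squared distance is below e^2 / 2. *)
move=> fc gc; apply/cvgrPdist_lt => -[e e'] /=; rewrite ltcE /= => /andP[/eqP-> e0].
have e20 : 0 < e / 2 by rewrite divr_gt0.
near=> y; rewrite normE_sq ltcE /= eqxx /=.
have fy : `|f x - f y| < e / 2 by near: y; move/cvgrPdist_lt: fc => /(_ _ e20).
have gy : `|g x - g y| < e / 2 by near: y; move/cvgrPdist_lt: gc => /(_ _ e20).
rewrite -[ltRHS](@ger0_norm _ e) ?ltW // -sqrtr_sqr ltr_sqrt ?exprn_gt0 //.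
rewrite /normsq !cReD !cImD !cReN !cImN /=.
rewrite -(real_normK (num_real (f x - f y))) -(real_normK (num_real (g x - g y))).
have sq (a : R) : 0 <= a -> a < e / 2 -> a ^+ 2 < (e / 2) ^+ 2.
  by move=> a0 ae; rewrite !expr2 ltr_pM.
have eE : e ^+ 2 = 4 * (e / 2) ^+ 2 by field.
have := sq _ (normr_ge0 _) fy; have := sq _ (normr_ge0 _) gy; have := exprn_gt0 2 e20.
rewrite eE; lra.
Unshelve. all: by end_near. Qed.

Lemma cts_complex (T : topologicalType) (f : T -> Cplx R) (x : T) :
  {for x, continuous (fun y => cRe (f y))} ->
  {for x, continuous (fun y => cIm (f y))} -> {for x, continuous f}.
Proof.
move=> fr fi; rewrite (_ : f = fun y => mkC (cRe (f y)) (cIm (f y))).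
  exact: cts_mkC.
by apply/funext => y; rewrite mkCK.
Qed.

Lemma cts_normsq (T : topologicalType) (f : T -> Cplx R) (x : T) :
  {for x, continuous f} -> {for x, continuous (fun y => normsq (f y))}.
Proof.
by move=> fc; apply: ctsD; apply: ctsM; (apply: cts_cRe || apply: cts_cIm).
Qed.

Section CplxOperations.
Variables (T : topologicalType).
Implicit Types (f g : T -> Cplx R) (x : T).

Lemma ctsCD f g x : {for x, continuous f} -> {for x, continuous g} ->
  {for x, continuous (fun y => f y + g y)}.
Proof. exact: cvgD. Qed.

Lemma ctsCM f g x : {for x, continuous f} -> {for x, continuous g} ->
  {for x, continuous (fun y => f y * g y)}.
Proof. exact: cvgM. Qed.

Lemma ctsCN f x : {for x, continuous f} -> {for x, continuous (fun y => - f y)}.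
Proof. exact: cvgN. Qed.

Lemma ctsCV f x : f x != 0 -> {for x, continuous f} ->
  {for x, continuous (fun y => (f y)^-1)}.
Proof. by move=> f0 Cf; exact: (@cvgV _ _ _ _ _ _ f0 Cf). Qed.

End CplxOperations.

End ComplexContinuity.

Lemma cts_coord (T S : topologicalType) m n (f : T -> 'M[S]_(m, n)) i j (x : T) :
  {for x, continuous f} -> {for x, continuous (fun y => f y i j)}.
Proof.
move=> fc A /= Ax; have := fc [set M | A (M i j)]; apply.
exists (fun i' j' => [set a | (i', j') = (i, j) -> A a]) => [i' j'|M /(_ i j)]; last exact.
have [[-> ->]|ne] := pselect ((i', j') = (i, j)); first by apply: filterS Ax => a Aa _.
by apply: filterS (@filterT _ (nbhs (f x i' j')) _) => a _ /ne.
Qed.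

Lemma cts_mx (T S : topologicalType) m n (f : T -> 'M[S]_(m, n)) (x : T) :
  (forall i j, {for x, continuous (fun y => f y i j)}) -> {for x, continuous f}.
Proof.
move=> fc A [P Px PA]; rewrite /fmap /= nbhs_simpl /=.
suff : \forall y \near x, forall i j, P i j (f y i j) by apply: filterS => y /PA.
near=> y => i j.
have : forall ij : 'I_m * 'I_n, P ij.1 ij.2 (f y ij.1 ij.2).
  near: y; apply: filter_forall => -[i' j'] /=.
  by apply: (fc i' j'); exact: Px.
by move=> /(_ (i, j)).
Unshelve. all: by end_near. Qed.

Section Subsets.
Variables (X : topologicalType) (A : set X).

Lemma continuous_set_val : continuous (set_val : A -> X).
Proof. exact: initial_continuous. Qed.

Lemma cts_set_type (T : topologicalType) (f : T -> A) (x : T) :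
  {for x, continuous (fun y => set_val (f y))} -> {for x, continuous f}.
Proof.
move=> fc B [_ [[W oW <-] /= Wfx]] /filterS; apply.
by apply: fc; exact: open_nbhs_nbhs.
Qed.

Lemma compact_set_type : compact A -> compact [set: A].
Proof.
move=> cA F PF _.
have [x [Ax Fx]] := cA (fmap set_val F) _ (nearW _ (fun y : A => set_valP y)).
exists (exist _ x (mem_set Ax)); split=> //.
move=> P B FP [_ [[W oW <-] /= Wx]] WB.
have FP' : F (set_val @^-1` (set_val @` P)).
  by apply: filterS FP => z Pz /=; exists z.
have [y [[z Pz zy] Wy]] := Fx _ W FP' (open_nbhs_nbhs (conj oW Wx)).
by exists z; split=> //; apply: WB; rewrite /= zy.
Qed.

Lemma set_val_inj : injective (set_val : A -> X).
Proof. exact: val_inj. Qed.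

End Subsets.

Section QuotientSpaces.
Variables (X : topologicalType) (e : X -> X -> Prop).

Lemma qclassP (x y : X) : qclass e x = qclass e y <-> e x = e y.
Proof.
split=> [/eqquotP /asboolP//|exy]; apply/eqquotP; exact/asboolP.
Qed.

Lemma qclass_continuous : continuous (qclass e).
Proof. exact: pi_continuous. Qed.

Lemma qclass_surj (c : quot e) : exists x, qclass e x = c.
Proof. by exists (repr c); rewrite /qclass reprK. Qed.

Lemma quot_cts (Z : topologicalType) (g : quot e -> Z) :
  continuous (g \o qclass e) -> continuous g.
Proof. by move=> gc; exact/(@quotient_continuous X _ Z g). Qed.

Lemma quot_lift (Z : Type) (g : X -> Z) :
  (forall x y, e x = e y -> g x = g y) ->
  exists g' : quot e -> Z, forall x, g' (qclass e x) = g x.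
Proof.
by move=> ge; exists (g \o repr) => x /=; apply/ge/qclassP; rewrite /qclass reprK.
Qed.

Lemma open_quot (O : set (quot e)) : open O <-> open (qclass e @^-1` O).
Proof. by []. Qed.

Lemma compact_quot : compact [set: X] -> compact [set: quot e].
Proof.
move=> cX; rewrite (_ : setT = qclass e @` setT).
  by apply: continuous_compact => //; apply: continuous_subspaceT qclass_continuous.
by apply/seteqP; split=> // c _; have [x <-] := qclass_surj c; exists x.
Qed.

End QuotientSpaces.

(** [quot] identifies points whose predicates [e x] and [e y] coincide; for an equivalence relation
    this is the relation itself. *)
Lemma equiv_class_eq (X : Type) (e : X -> X -> Prop) (x y : X) :
  (forall x, e x x) -> (forall x y, e x y -> e y x) ->
  (forall x y z, e x y -> e y z -> e x z) -> e x = e y <-> e x y.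
Proof.
move=> er es et; split=> [E|exy]; first by rewrite E.
by apply/funext => z; apply/propext; split; apply: et => //; exact: es.
Qed.

Lemma injective_hausdorff (X Y : topologicalType) (f : X -> Y) :
  continuous f -> injective f -> hausdorff_space Y -> hausdorff_space X.
Proof.
move=> fc fi hY x y xy; apply/fi/hY => A B Afx Bfy.
have [z [Az Bz]] := xy _ _ (fc x _ Afx) (fc y _ Bfy).
by exists (f z).
Qed.

Lemma hausdorff_prod (X Y : topologicalType) :
  hausdorff_space X -> hausdorff_space Y -> hausdorff_space (X * Y)%type.
Proof.
move=> hX hY [x y] [x' y'] c; congr (_, _).
  apply: hX => A B Ax Bx'.
  have N1 : nbhs (x, y) (A `*` setT) by exists (A, setT) => //; split=> //; exact: filterT.
  have N2 : nbhs (x', y') (B `*` setT) by exists (B, setT) => //; split=> //; exact: filterT.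
  by have [[a b] [/= [Aa _] [Ba _]]] := c _ _ N1 N2; exists a.
apply: hY => A B Ay By'.
have N1 : nbhs (x, y) (setT `*` A) by exists (setT, A) => //; split=> //; exact: filterT.
have N2 : nbhs (x', y') (setT `*` B) by exists (setT, B) => //; split=> //; exact: filterT.
by have [[a b] [/= [_ Aa] [_ Ba]]] := c _ _ N1 N2; exists b.
Qed.

Lemma hausdorff_rV (R : realType) n : hausdorff_space 'rV[R]_n.
Proof. exact: norm_hausdorff. Qed.

Lemma compact_homeomorphism (X Y : topologicalType) (f : X -> Y) :
  compact [set: X] -> hausdorff_space Y -> continuous f -> injective f ->
  (forall y, exists x, f x = y) -> homeomorphism f.
Proof.
move=> cX hY fc fi /choice[g fg]; split=> //; exists g; split=> //.
  by move=> x; apply: fi; rewrite fg.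
apply/continuous_closedP => C cC.
rewrite (_ : g @^-1` C = f @` C).
  apply: compact_closed => //; apply: continuous_compact.
    exact: continuous_subspaceT.
  exact: subclosed_compact cC cX _.
apply/seteqP; split=> [y Cy|_ [x Cx <-]]; first by exists (g y).
by rewrite /preimage /= (fi _ _ (fg (f x))).
Qed.

Section CompactEmbedding.
Variables (R : realType) (X : topologicalType) (N : nat) (E : X -> 'rV[R]_N).
Hypotheses (cX : compact [set: X]) (Ec : continuous E) (Ei : injective E).

Lemma embed_hausdorff : hausdorff_space X.
Proof. exact: (injective_hausdorff Ec Ei (@hausdorff_rV R N)). Qed.

(** The image of the complement of [U] is compact, hence closed in R^N, and its complement serves as
    [V]. So the topology of [X] is the one induced by [E]. *)
Lemma embed_open (U : set X) (x : X) : open U -> U x ->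
  exists V, [/\ open V, V (E x) & E @^-1` V `<=` U].
Proof.
move=> oU Ux; have cU : compact (E @` ~` U).
  apply: continuous_compact; first exact: continuous_subspaceT.
  by apply: (subclosed_compact (open_closedC oU) cX).
exists (~` (E @` ~` U)); split.
- exact: (closed_openC (compact_closed (@hausdorff_rV R N) cU)).
- by move=> [y nUy /Ei yx]; apply: nUy; rewrite yx.
- by move=> y /= nEy; apply: contrapT => nUy; apply: nEy; exists y.
Qed.

Lemma embed_cts (Z : topologicalType) (f : Z -> X) (z : Z) :
  {for z, continuous (fun y => E (f y))} -> {for z, continuous f}.
Proof.
move=> fc A; rewrite nbhsE => -[U [oU Ufz] UA].
have [V [oV Vfz VU]] := embed_open oU Ufz.
have : nbhs z [set y | V (E (f y))] by apply: fc; exact: open_nbhs_nbhs.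
by apply: filterS => y Vy; apply: UA; exact: VU.
Qed.

(** The topology pulled back along [E] is pseudometric and compact, hence second countable; by
    [embed_open] its countable basis is also one for [X]. *)
Lemma embed_second_countable (x0 : X) : @second_countable X.
Proof.
pose T := initial_topology E.
pose pT : pseudoPMetricType R := HB.pack T (isPointed.Build T x0).
have cT : compact [set: pT].
  rewrite (_ : [set: pT] = (id : X -> pT) @` [set: X]).
    apply: continuous_compact => //; apply: continuous_subspaceT.
    exact: continuous_comp_initial Ec.
  by apply/seteqP; split=> // x _; exists x.
have [B cB [oB nB]] := @compact_second_countable R pT cT.
exists B => //; split=> [U /oB [V oV <-]|x A].
  by apply: open_comp => // y _; exact: Ec.
rewrite nbhsE => -[U [oU Ux] UA].
have [V [oV Vx VU]] := embed_open oU Ux.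
have : nbhs (x : pT) (E @^-1` V).
  by apply: open_nbhs_nbhs; split=> //; exists V.
move=> /nB [W [BW Wx WV]]; exists W => //.
by move=> y /WV /VU /UA.
Qed.

End CompactEmbedding.

(** The preimage of a closed set under [G] is the [phi]-image of a closed, hence compact, set of
    [Z]. A map defined by choice becomes continuous as soon as its witnesses form a compact
    space. *)
Lemma compact_graph_continuous (Z Y X : topologicalType) (phi : Z -> Y)
    (pr : Z -> X) (G : Y -> X) :
  compact [set: Z] -> hausdorff_space Y -> continuous phi -> continuous pr ->
  (forall y, exists z, phi z = y) -> (forall z, G (phi z) = pr z) -> continuous G.
Proof.
move=> cZ hY phic prc phis GE; apply/continuous_closedP => C cC.
rewrite (_ : G @^-1` C = phi @` (pr @^-1` C)).
  apply: compact_closed => //; apply: continuous_compact.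
    exact: continuous_subspaceT.
  by apply: subclosed_compact cZ _ => //; move/continuous_closedP: prc; exact.
apply/seteqP; split=> [y Cy|_ [z Cz <-]].
  by have [z zy] := phis y; exists z; rewrite // /preimage /= -GE zy.
by rewrite /preimage /= GE.
Qed.

(** * Plucker vectors of a flag *)

Lemma ord3_ind (P : 'I_3 -> Prop) : P 0 -> P 1 -> P 2 -> forall i, P i.
Proof.
move=> P0 P1 P2 [[|[|[|//]]] lt].
- by rewrite (_ : Ordinal lt = 0) //; exact/val_inj.
- by rewrite (_ : Ordinal lt = 1) //; exact/val_inj.
- by rewrite (_ : Ordinal lt = 2) //; exact/val_inj.
Qed.

Lemma ord3_cases (i j k l : 'I_3) : i != j -> k != i -> k != j ->
  [|| l == i, l == j | l == k].
Proof.
by elim/ord3_ind: i; elim/ord3_ind: j; elim/ord3_ind: k; elim/ord3_ind: l.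
Qed.

Lemma sum_ord3 (M : nmodType) (F : 'I_3 -> M) : \sum_i F i = F 0 + F 1 + F 2.
Proof.
rewrite !big_ord_recl big_ord0 addr0 addrA.
by congr (F _ + F _ + F _); apply/val_inj.
Qed.

Lemma sum_perm3 (M : nmodType) (s : 'S_3) (F : 'I_3 -> M) :
  \sum_i F i = F (s 0) + F (s 1) + F (s 2).
Proof. by rewrite (reindex_inj (@perm_inj _ s)) sum_ord3. Qed.

Lemma perm3_ind (s : 'S_3) (P : 'I_3 -> Prop) :
  P (s 0) -> P (s 1) -> P (s 2) -> forall i, P i.
Proof.
move=> P0 P1 P2 i; rewrite -(permKV s i).
by elim/ord3_ind: ((s^-1)%g i).
Qed.

Section CrossProduct.
Variable F : fieldType.
Local Notation V := 'rV[F]_3.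
Implicit Types u v p q r : V.

Definition dotp u v : F := \sum_i u 0 i * v 0 i.

Definition crossp u v : V := \row_i
  [:: u 0 1 * v 0 2 - u 0 2 * v 0 1; u 0 2 * v 0 0 - u 0 0 * v 0 2;
      u 0 0 * v 0 1 - u 0 1 * v 0 0]`_i.

Lemma crossp0 u v : crossp u v 0 0 = u 0 1 * v 0 2 - u 0 2 * v 0 1.
Proof. by rewrite mxE. Qed.
Lemma crossp1 u v : crossp u v 0 1 = u 0 2 * v 0 0 - u 0 0 * v 0 2.
Proof. by rewrite mxE. Qed.
Lemma crossp2 u v : crossp u v 0 2 = u 0 0 * v 0 1 - u 0 1 * v 0 0.
Proof. by rewrite mxE. Qed.
Definition crosspE := (crossp0, crossp1, crossp2).

Lemma row3P u v : u 0 0 = v 0 0 -> u 0 1 = v 0 1 -> u 0 2 = v 0 2 -> u = v.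
Proof. by move=> *; apply/rowP => i; elim/ord3_ind: i. Qed.

Lemma row_neq0P u : reflect (exists i, u 0 i != 0) (u != 0).
Proof.
apply: (iffP idP) => [u0 | [] i]; last by apply: contraNneq => ->; rewrite mxE.
apply: contrapT => nu; case/eqP: u0; apply/rowP => i; rewrite mxE.
by apply/eqP; apply: contrapT => /negP ui; apply: nu; exists i.
Qed.

Lemma dotpC u v : dotp u v = dotp v u.
Proof. by apply: eq_bigr => i _; rewrite mulrC. Qed.

Lemma dotpDl u v w : dotp (u + v) w = dotp u w + dotp v w.
Proof. by rewrite -big_split; apply: eq_bigr => i _; rewrite !mxE mulrDl. Qed.

Lemma dotpZl (a : F) u v : dotp (a *: u) v = a * dotp u v.
Proof. by rewrite /dotp mulr_sumr; apply: eq_bigr => i _; rewrite !mxE mulrA. Qed.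

Lemma dotpZr (a : F) u v : dotp u (a *: v) = a * dotp u v.
Proof. by rewrite dotpC dotpZl dotpC. Qed.

Lemma dotp_crossl u v : dotp u (crossp u v) = 0.
Proof. by rewrite /dotp sum_ord3 !crosspE; ring. Qed.

Lemma dotp_crossr u v : dotp v (crossp u v) = 0.
Proof. by rewrite /dotp sum_ord3 !crosspE; ring. Qed.

Lemma crossp_self u : crossp u u = 0.
Proof. by apply: row3P; rewrite !crosspE mxE; ring. Qed.

Lemma crosspZr (a : F) u v : crossp u (a *: v) = a *: crossp u v.
Proof. by apply: row3P; rewrite [in RHS]mxE !crosspE !mxE; ring. Qed.

Lemma crossp_triple u v w : crossp u (crossp v w) = dotp u w *: v - dotp u v *: w.
Proof.
by apply: row3P; rewrite [in RHS]mxE !crosspE !mxE /dotp !sum_ord3 /=; ring.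
Qed.

Lemma span2P u v w :
  reflect (exists a b, w = a *: u + b *: v) (w \in <<[:: u; v]>>%VS).
Proof.
rewrite span_cons span_seq1; apply: (iffP memv_addP).
  by move=> [x /vlineP[a ->] [y /vlineP[b ->] ->]]; exists a, b.
move=> [a [b ->]]; exists (a *: u); first by rewrite memvZ ?memv_line.
by exists (b *: v) => //; rewrite memvZ ?memv_line.
Qed.

(** If all 2 x 2 minors vanish, [r] is a multiple of [p], with the factor read off at a nonzero
    coordinate of [p]. *)
Lemma cross_neq0 p r : p != 0 -> r \notin <[p]>%VS -> crossp p r != 0.
Proof.
move=> /row_neq0P[i pi] rp; apply: contraNneq rp => c0; apply/vlineP.
exists (r 0 i / p 0 i).
have : [/\ crossp p r 0 0 = 0, crossp p r 0 1 = 0 & crossp p r 0 2 = 0].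
  by rewrite c0 !mxE.
rewrite !crosspE => -[e0 e1 e2].
have sw (a b : F) : a - b = 0 -> a = b by move/eqP; rewrite subr_eq0 => /eqP.
move: e0 e1 e2 => /sw e0 /sw e1 /sw e2.
apply/rowP => j; rewrite mxE; apply: (mulfI pi); rewrite mulrA (mulrC (p 0 i) (_ / _)) divfK //.
by clear pi; elim/ord3_ind: i; elim/ord3_ind: j;
  first [by rewrite mulrC | by rewrite (e0, e1, e2) mulrC
    | by rewrite -e0 mulrC | by rewrite -e1 mulrC | by rewrite -e2 mulrC].
Qed.

(** For the converse inclusion, let coordinate [k] of the cross product be nonzero. Cramer's rule in
    the two other coordinates gives the coefficients [a] and [b], and the coordinate [k] then agrees
    because both vectors are orthogonal to the cross product. *)
Lemma mem_span_cross p r v : crossp p r != 0 ->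
  (v \in <<[:: p; r]>>%VS) = (dotp v (crossp p r) == 0).
Proof.
move=> /row_neq0P q0; set q := crossp p r.
apply/span2P/eqP => [[a [b ->]]|vq].
  by rewrite dotpDl !dotpZl dotp_crossl dotp_crossr !mulr0 addr0.
have key : crossp v q = dotp v r *: p - dotp v p *: r by exact: crossp_triple.
have pq : dotp p q = 0 by exact: dotp_crossl.
have rq : dotp r q = 0 by exact: dotp_crossr.
case: q0 => k; rewrite -/q => qk.
suff Cr i j : p 0 i * r 0 j - p 0 j * r 0 i = q 0 k -> i != j -> k != i -> k != j ->
    exists a b, v = a *: p + b *: r.
  elim/ord3_ind: k qk Cr => qk Cr.
  - by apply: (Cr 1 2) => //; rewrite /q crosspE; ring.
  - by apply: (Cr 2 0) => //; rewrite /q crosspE; ring.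
  - by apply: (Cr 0 1) => //; rewrite /q crosspE; ring.
move=> qE ij ki kj.
set a := (v 0 i * r 0 j - v 0 j * r 0 i) / q 0 k.
set b := (p 0 i * v 0 j - p 0 j * v 0 i) / q 0 k.
exists a, b; set w := a *: p + b *: r.
have wi : w 0 i = v 0 i by rewrite !mxE; apply: (mulIf qk); rewrite /a /b -qE; field; rewrite qE.
have wj : w 0 j = v 0 j by rewrite !mxE; apply: (mulIf qk); rewrite /a /b -qE; field; rewrite qE.
have wq : dotp (v - w) q = 0.
  by rewrite -scaleN1r dotpDl dotpZl vq dotpDl !dotpZl pq rq !mulr0 addr0 mulr0 addr0.
have wk : v 0 k = w 0 k.
  apply: (mulIf qk); apply/eqP; rewrite -subr_eq0 -mulrBl -wq /dotp.
  rewrite (bigD1 k) //= big1 ?addr0 ?mxE ?[(- w) _ _]mxE // => l lk.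
  have /or3P[/eqP|/eqP|/idPn] := ord3_cases l ij ki kj; last by rewrite lk.
    by move=> ->; rewrite [(v - w) _ _]mxE [(- w) _ _]mxE wi subrr mul0r.
  by move=> ->; rewrite [(v - w) _ _]mxE [(- w) _ _]mxE wj subrr mul0r.
apply/rowP => l; have /or3P[] := ord3_cases l ij ki kj; by move=> /eqP ->.
Qed.

(** Tested on the vectors q_i e_j - q_j e_i, which are orthogonal to [q]. *)
Lemma ortho_prop q q' : q != 0 -> q' != 0 ->
  (forall v, dotp v q = 0 -> dotp v q' = 0) -> exists2 a, a != 0 & q' = a *: q.
Proof.
move=> /row_neq0P[i qi] q'0 H.
have E j : q 0 i * q' 0 j = q 0 j * q' 0 i.
  have D (x : V) : dotp (q 0 i *: delta_mx 0 j - q 0 j *: delta_mx 0 i) x =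
      q 0 i * x 0 j - q 0 j * x 0 i.
    have Dd l : dotp (delta_mx 0 l) x = x 0 l.
      rewrite /dotp (bigD1 l) //= big1 ?addr0 ?mxE ?eqxx ?mul1r // => m ml.
      by rewrite mxE (negbTE ml) andbF mul0r.
    by rewrite -scaleNr dotpDl !dotpZl !Dd mulNr.
  by apply/eqP; rewrite -subr_eq0 -D; apply/eqP/H; rewrite D mulrC subrr.
have q'E : q' = (q' 0 i / q 0 i) *: q.
  by apply/rowP => j; rewrite mxE; apply: (mulfI qi); rewrite E; field.
exists (q' 0 i / q 0 i) => //.
by apply: contraNneq q'0 => c0; rewrite q'E c0 scale0r.
Qed.

End CrossProduct.

Section PluckerPairs.
Variable R : realType.
Local Notation C := (Cplx R).
Local Notation V := 'rV[C]_3.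
Implicit Types (L : flag R) (p q : V).

(* [p] spans the line of the flag and [q] is the equation of its plane. *)
Definition plucker_pair L p q : Prop :=
  [/\ p != 0, q != 0, (val L).1 = <[p]>%VS &
      forall v : V, (v \in (val L).2) = (dotp v q == 0)].

Lemma pair_dot L p q : plucker_pair L p q -> dotp p q = 0.
Proof.
case=> p0 q0 L1 L2; apply/eqP; rewrite -L2.
by case/and3P: (valP L) => _ _ /subvP; apply; rewrite L1 memv_line.
Qed.

Lemma pair_inj L L' p q : plucker_pair L p q -> plucker_pair L' p q -> L = L'.
Proof.
case=> p0 q0 L1 L2 [_ _ L1' L2']; apply: val_inj.
rewrite [LHS]surjective_pairing [RHS]surjective_pairing L1 L1'; congr (_, _).
by apply/vspaceP => v; rewrite L2 L2'.
Qed.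

Lemma pair_scale L p q (a b : C) : a != 0 -> b != 0 ->
  plucker_pair L p q -> plucker_pair L (a *: p) (b *: q).
Proof.
move=> a0 b0 [p0 q0 L1 L2]; split; rewrite ?scaler_eq0 ?negb_or ?a0 ?b0 //.
  rewrite L1; apply/vspaceP => v; apply/vlineP/vlineP => -[k ->].
    by exists (k / a); rewrite scalerA divfK.
  by exists (k * a); rewrite scalerA.
by move=> v; rewrite L2 dotpZr mulf_eq0 (negbTE b0).
Qed.

Lemma pair_uniq L p q p' q' : plucker_pair L p q -> plucker_pair L p' q' ->
  exists a b, [/\ a != 0, b != 0, p' = a *: p & q' = b *: q].
Proof.
case=> p0 q0 L1 L2 [p'0 q'0 L1' L2'].
have [a pE] : exists a, p' = a *: p by apply/vlineP; rewrite -L1 L1' memv_line.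
have [v /eqP|b b0 qE] := @ortho_prop _ q q' q0 q'0.
  by rewrite -L2 L2' => /eqP.
exists a, b; split=> //.
by apply: contraNneq p'0 => a0; rewrite pE a0 scale0r.
Qed.

Lemma row_flag_pair (g : 'M[C]_3) (gU : g \in unitmx) L : val L = row_flag g ->
  plucker_pair L (row 0 g) (crossp (row 0 g) (row 1 g)).
Proof.
move=> LE; have /and3P[d1 d2 _] := row_flagP gU.
have r0 : row 0 g != 0 by move: d1; rewrite /= dim_vline eqb1.
have c0 : crossp (row 0 g) (row 1 g) != 0.
  apply: cross_neq0 => //; apply/negP => r1.
  suff /dimvS : ((row_flag g).2 <= (row_flag g).1)%VS by rewrite (eqP d1) (eqP d2).
  rewrite /= span_cons span_seq1 subv_add subvv /=; apply/subvP => v /vlineP[k ->]; exact: memvZ.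
by split; rewrite ?LE //= => v; rewrite mem_span_cross.
Qed.

Lemma flag_of_GL3_pair (g : @GL3 R) : plucker_pair (flag_of_GL3 g)
  (row 0 (set_val g)) (crossp (row 0 (set_val g)) (row 1 (set_val g))).
Proof. exact: (@row_flag_pair (set_val g) (set_valP g) (flag_of_GL3 g) erefl). Qed.

Definition conjv (v : V) : V := \row_i (mkC (cRe (v 0 i)) (- cIm (v 0 i))).

Lemma mul_conj (z : C) : z * mkC (cRe z) (- cIm z) = mkC (normsq z) 0.
Proof. by apply: cplxP; rewrite ?cReM ?cImM /= /normsq; ring. Qed.

Lemma sum_normsq_gt0 p : p != 0 -> 0 < \sum_i normsq (p 0 i).
Proof.
move=> /row_neq0P[i pi]; rewrite (bigD1 i) //= ltr_pwDl ?normsq_gt0 //.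
by apply: sumr_ge0 => j _; exact: normsq_ge0.
Qed.

Lemma dotp_conj p : dotp p (conjv p) = mkC (\sum_i normsq (p 0 i)) 0.
Proof.
rewrite /dotp; under eq_bigr do rewrite mxE mul_conj.
by rewrite !sum_ord3; apply: cplxP; rewrite ?cReD ?cImD //= !addr0.
Qed.

(** The plane is spanned by [p] and [r], the cross product of [q] with the conjugate of [p]: by the
    triple product formula and [dotp p q = 0], the cross product of [p] and [r] is |p|^2 [q]. The
    conjugate makes this factor nonzero. *)
Lemma pair_ex p q : p != 0 -> q != 0 -> dotp p q = 0 -> exists L, plucker_pair L p q.
Proof.
move=> p0 q0 pq; pose r := crossp q (conjv p); pose n := dotp p (conjv p).
have n0 : n != 0.
  rewrite /n dotp_conj; apply/eqP => -[E].
  by have := sum_normsq_gt0 p0; rewrite E ltxx.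
have crE : crossp p r = n *: q by rewrite crossp_triple pq scale0r subr0.
have c0 : crossp p r != 0 by rewrite crE scaler_eq0 negb_or n0.
have rp : r \notin <[p]>%VS.
  apply: contra c0 => /vlineP[k ->].
  by rewrite crosspZr crossp_self scaler0.
have fl : is_flag (<[p]>%VS, <<[:: p; r]>>%VS).
  have fr : free [:: r; p] by rewrite free_cons span_seq1 rp seq1_free.
  have fr' : free [:: p; r] by rewrite (perm_free (_ : perm_eq _ [:: r; p])) // perm_sym (perm_catC [:: r] [:: p]).
  rewrite /is_flag /= dim_vline p0 (eqP fr') /= -span_seq1.
  by apply: sub_span => x; rewrite !inE => ->.
exists (exist (fun x => is_true (is_flag x)) _ fl : flag R); split=> //= v.
by rewrite mem_span_cross // crE dotpZr mulf_eq0 (negbTE n0).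
Qed.

Lemma flag_pair L : exists p q, plucker_pair L p q.
Proof.
case: L => -[L1 L2] fl; case/and3P: (fl) => /= /eqP d1 /eqP d2 L12.
have [p p0 L1E] : exists2 p, p != 0 & L1 = <[p]>%VS.
  have v0 : vpick L1 != 0 by rewrite vpick0 -dimv_eq0 d1.
  exists (vpick L1) => //; apply/esym/eqP.
  by rewrite eqEdim d1 dim_vline v0 andbT -memvE memv_pick.
have [r rL2 rp] : exists2 r, r \in L2 & r \notin <[p]>%VS.
  apply: contrapT => H; suff /dimvS : (L2 <= L1)%VS by rewrite d1 d2.
  rewrite L1E; apply/subvP => v vL2.
  by apply/negPn/negP => vp; apply: H; exists v.
exists p, (crossp p r); have c0 := cross_neq0 p0 rp.
split=> // v; rewrite -mem_span_cross //= (_ : <<_>>%VS = L2) //.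
have fr : free [:: r; p] by rewrite free_cons span_seq1 rp seq1_free.
have fr' : free [:: p; r] by rewrite (perm_free (_ : perm_eq _ [:: r; p])) // perm_sym (perm_catC [:: r] [:: p]).
apply/eqP; rewrite eqEdim d2 (eqP fr') leqnn andbT.
apply/span_subvP => x; rewrite !inE => /orP[] /eqP -> //.
by move/subvP: L12; apply; rewrite L1E memv_line.
Qed.

(** The equation of the plane transforms by the inverse of [t], so each product p_i q_i is
    invariant. *)
Lemma T3_action_pair (t : V) L p q : (forall j, t 0 j != 0) -> plucker_pair L p q ->
  plucker_pair (T3_action t L) (\row_j (p 0 j * t 0 j)) (\row_j (q 0 j / t 0 j)).
Proof.
move=> t0 [p0 q0 L1 L2]; rewrite /T3_action; set f := linfun _.
have fE v : f v = \row_j (v 0 j * t 0 j).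
  by rewrite lfunE /=; apply/rowP => j; rewrite mul_mx_diag !mxE.
have fi : lker f == 0%VS.
  apply/eqP/vspaceP => v; rewrite memv_ker memv0 fE.
  apply/eqP/eqP => [/rowP H|->]; apply/rowP => j; rewrite !mxE ?mul0r //.
  by have := H j; rewrite !mxE => /eqP; rewrite mulf_eq0 (negbTE (t0 j)) orbF => /eqP.
have fl : is_flag (f @: (val L).1, f @: (val L).2)%VS.
  case/and3P: (valP L) => d1 d2 L12; rewrite /is_flag /=.
  have fd U : \dim (f @: U) = \dim U.
    by apply: limg_dim_eq; rewrite (eqP fi) capv0.
  by rewrite !fd d1 d2 limgS.
have nz (v : V) (w : V) : (forall j, w 0 j != 0) -> v != 0 ->
    \row_j (v 0 j * w 0 j) != 0.
  move=> w0 /row_neq0P[j vj]; apply/row_neq0P; exists j.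
  by rewrite mxE mulf_neq0.
have q'0 : \row_j (q 0 j / t 0 j) != 0.
  have := nz q (\row_j (t 0 j)^-1) _ q0; rewrite (_ : \row_j _ = \row_j (q 0 j / t 0 j)).
    by apply=> j; rewrite mxE invr_eq0.
  by apply/rowP => j; rewrite !mxE.
have LE := insubdK L fl; split; [exact: nz|exact: q'0|by rewrite LE /= L1 limg_line fE|].
move=> v; rewrite LE /=; apply/memv_imgP/eqP => [[u + ->]|vq].
  rewrite L2 fE => /eqP; rewrite /dotp => {2}<-; apply: eq_bigr => j _.
  by rewrite !mxE; field.
exists (\row_j (v 0 j / t 0 j)); last first.
  by rewrite fE; apply/rowP => j; rewrite !mxE divfK.
rewrite L2 -vq /dotp; apply/eqP; apply: eq_bigr => j _.
by rewrite !mxE; field.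
Qed.

End PluckerPairs.

(** * The moment map *)

Lemma det_mx22 (K : comNzRingType) (A : 'M[K]_2) :
  \det A = A 0 0 * A 1 1 - A 0 1 * A 1 0.
Proof.
rewrite (expand_det_row _ 0) !big_ord_recl big_ord0 addr0 /cofactor !det_mx11 !mxE /=.
rewrite expr0 expr1 mul1r mulN1r mulrN.
by congr (_ * A _ _ - A _ _ * A _ _); apply/val_inj.
Qed.

Section MomentMap.
Variable R : realType.
Local Notation C := (Cplx R).
Local Notation V := 'rV[C]_3.
Implicit Types (L : flag R) (p q : V).

Definition weight p (j : 'I_3) : R := normsq (p 0 j) / \sum_i normsq (p 0 i).

Lemma weight_ge0 p j : 0 <= weight p j.
Proof.
by rewrite divr_ge0 ?normsq_ge0 // sumr_ge0 // => i _; exact: normsq_ge0.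
Qed.

Lemma weight_eq0 p j : p != 0 -> (weight p j == 0) = (p 0 j == 0).
Proof.
move=> /sum_normsq_gt0 s0.
by rewrite mulf_eq0 normsq_eq0 invr_eq0 (gt_eqF s0) orbF.
Qed.

Lemma weight_gt0 p j : p != 0 -> (0 < weight p j) = (p 0 j != 0).
Proof. by move=> p0; rewrite lt_def weight_ge0 andbT weight_eq0. Qed.

Lemma sum_weight p : p != 0 -> \sum_j weight p j = 1.
Proof. by move=> /sum_normsq_gt0 s0; rewrite -mulr_suml divff ?gt_eqF. Qed.

Lemma weight_scaled p (n : 'I_3 -> R) (b : R) j : b != 0 ->
  (forall i, n i = b * normsq (p 0 i)) -> n j / (\sum_i n i) = weight p j.
Proof.
move=> b0 nE; rewrite nE; under eq_bigr do rewrite nE.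
by rewrite -mulr_sumr -mulf_div divff ?mul1r.
Qed.

(** [plucker] with the basis and the dimension made variables. In [plucker U J] the size of the
    matrix depends on [\dim U] and cannot be rewritten in place. *)
Definition minor (X : seq V) (d : nat) (J : {set 'I_3}) : C :=
  \det (\matrix_(a < d, b < d) X`_a 0 (nth ord0 (enum J) b)).

Lemma pluckerE (U : {vspace V}) J X d : tval (vbasis U) = X -> \dim U = d ->
  plucker U J = minor X d J.
Proof. by move=> <- <-. Qed.

Lemma enum_I3 : enum 'I_3 = [:: 0; 1; 2].
Proof. by apply: (inj_map val_inj); rewrite val_enum_ord. Qed.

Lemma enum_I3C :
  [/\ enum (~: [set 0 : 'I_3]%SET) = [:: 1; 2], enum (~: [set 1 : 'I_3]%SET) = [:: 0; 2] &
      enum (~: [set 2 : 'I_3]%SET) = [:: 0; 1]].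
Proof.
by split; rewrite /enum_mem -enumT enum_I3 /= !inE.
Qed.

Lemma plucker_line p (i : 'I_3) : p != 0 ->
  exists2 b, b != 0 & forall i, plucker <[p]>%VS [set i]%SET = b * p 0 i.
Proof.
move=> p0; have d1 : \dim <[p]>%VS = 1%N by rewrite dim_vline p0.
have bas := vbasisP <[p]>%VS.
have [b bE] : exists b, (vbasis <[p]>)`_0 = b *: p.
  by apply/vlineP; rewrite vbasis_mem // mem_nth // size_tuple d1.
exists b.
  have : (vbasis <[p]>)`_0 != 0.
    by apply: (basis_not0 bas); apply: mem_nth; rewrite size_tuple d1.
  by apply: contraNneq => b0; rewrite bE b0 scale0r.
by move=> j; rewrite (pluckerE _ erefl d1) /minor det_mx11 mxE enum_set1 /= bE mxE.
Qed.

(** The minor that omits column [i] is, up to sign, coordinate [i] of the cross product of the two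
    basis vectors, and that product is a multiple of [q]. *)
Lemma plucker_plane (U : {vspace V}) q : \dim U = 2%N -> q != 0 ->
  (forall v, (v \in U) = (dotp v q == 0)) ->
  exists2 b, b != 0 &
    forall i, normsq (plucker U (~: [set i]%SET)) = b * normsq (q 0 i).
Proof.
move=> d2 q0 Uq; have sz : size (vbasis U) = 2%N by rewrite size_tuple d2.
move: sz (span_basis (vbasisP U)) (basis_free (vbasisP U)).
move E : (tval (vbasis U)) => X; case: X E => [|x0 [|x1 [|]]] // E _ sp fr.
have {}fr : free [:: x1; x0].
  by rewrite (perm_free (_ : perm_eq _ [:: x0; x1])) // (perm_catC [:: x1] [:: x0]).
have x10 : x1 \notin <[x0]>%VS by move: fr; rewrite free_cons span_seq1 => /andP[].
have x00 : x0 != 0.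
  by move: fr; rewrite free_cons => /andP[_]; rewrite free_cons => /andP[]; rewrite span_nil memv0.
have c0 := cross_neq0 x00 x10.
have [b b0 bE] : exists2 b, b != 0 & crossp x0 x1 = b *: q.
  by apply: ortho_prop => // v vq; apply/eqP; rewrite -mem_span_cross // sp Uq vq.
exists (normsq b); first by rewrite normsq_eq0.
move=> i; rewrite -normsqM (_ : b * q 0 i = (b *: q) 0 i); last by rewrite mxE.
rewrite (pluckerE _ E d2) /minor det_mx22 -bE !mxE.
have [e0 e1 e2] := enum_I3C.
elim/ord3_ind: i; rewrite ?(e0, e1, e2) //=.
(* Only the middle index remains: the minor on columns 0 and 2 is the opposite of the coordinate of
   the cross product. *)
by rewrite -normsqN opprB.
Qed.

Lemma sum_card1 (M : nmodType) (F : {set 'I_3} -> M) :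
  \sum_(J : {set 'I_3} | #|J| == 1%N) F J = \sum_i F [set i]%SET.
Proof.
transitivity (\sum_(J in [set [set i]%SET | i in 'I_3]%SET) F J).
  apply: eq_bigl => J; apply/cards1P/imsetP => [[i ->] | [i _ ->]]; by exists i.
by rewrite big_imset //= => i j _ _; exact: finset.set1_inj.
Qed.

Lemma sum_card2 (M : nmodType) (F : {set 'I_3} -> M) :
  \sum_(J : {set 'I_3} | #|J| == 2%N) F J = \sum_i F (~: [set i]%SET).
Proof.
transitivity (\sum_(J in [set (~: [set i])%SET | i in 'I_3]%SET) F J).
  apply: eq_bigl => J; apply/idP/imsetP => [J2|[i _ ->]].
    have /cards1P[i iE] : #|~: J| == 1%N.
      by rewrite -(eqn_add2l #|J|) cardsC card_ord (eqP J2).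
    by exists i => //; rewrite -iE finset.setCK.
  by rewrite -(eqn_add2l #|[set i]%SET|) cardsC card_ord cards1.
by rewrite big_imset //= => i j _ _ /finset.setC_inj; exact: finset.set1_inj.
Qed.

(** For the plane, the sets J of size 2 are complements of single indices and carry the weights of
    [q]. Hence its moment map is 1 minus these weights. *)
Lemma moment_map3E L p q j : plucker_pair L p q ->
  moment_map3 L 0 j = 1 + (weight p j - weight q j).
Proof.
case=> p0 q0 L1 L2; have /and3P[/eqP d1 /eqP d2 _] := valP L.
rewrite /moment_map3 mxE addrCA; congr (_ + _).
  have [b b0 bE] := plucker_line j p0.
  rewrite /partial_moment_map mxE summxE d1 !sum_card1 L1 mulrC.
  rewrite (bigD1 j) //= big1 ?addr0; last first.
    by move=> i ij; rewrite !mxE inE eq_sym (negbTE ij) mulr0.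
  rewrite !mxE inE eqxx mulr1.
  apply: (@weight_scaled _ (fun i => normsq (plucker <[p]>%VS [set i]%SET)) (normsq b)).
    by rewrite normsq_eq0.
  by move=> i; rewrite bE normsqM.
have [b b0 bE] := plucker_plane d2 q0 L2.
rewrite /partial_moment_map mxE summxE d2 !sum_card2.
set n := fun i => normsq (plucker (val L).2 (~: [set i]%SET)).
have nE : n j / (\sum_i n i) = weight q j by apply: weight_scaled bE.
rewrite -nE; have sn : \sum_i n i != 0.
  under eq_bigr do rewrite /n bE.
  by rewrite -mulr_sumr mulf_neq0 // gt_eqF ?sum_normsq_gt0.
have -> : \sum_i (n i *: delta_set R (~: [set i])%SET) 0 j = \sum_i n i - n j.
  rewrite [in RHS](bigD1 j) //= addrAC subrr add0r (bigD1 j) //= !mxE !inE eqxx mulr0 add0r.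
  by apply: eq_bigr => i ij; rewrite !mxE !inE eq_sym ij mulr1.
by field.
Qed.

Definition moment_x L (j : 'I_3) : R := moment_map3 L 0 j - 1.

Lemma moment_xE L p q j : plucker_pair L p q ->
  moment_x L j = weight p j - weight q j.
Proof. by move=> pL; rewrite /moment_x (moment_map3E _ pL) addrC addKr. Qed.

Lemma sum_moment_x L : \sum_j moment_x L j = 0.
Proof.
have [p [q pL]] := flag_pair L; have [p0 q0 _ _] := pL.
under eq_bigr do rewrite (moment_xE _ pL).
by rewrite sumrB !sum_weight // subrr.
Qed.

(* The identification of the plane x_1 + x_2 + x_3 = 0 with R^2. *)
Definition plane_x (y : 'rV[R]_2) (j : 'I_3) : R :=
  [:: y 0 0 - 1; y 0 1 - 1; 2 - y 0 0 - y 0 1]`_j.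

Lemma plane_x0 y : plane_x y 0 = y 0 0 - 1. Proof. by []. Qed.
Lemma plane_x1 y : plane_x y 1 = y 0 1 - 1. Proof. by []. Qed.
Lemma plane_x2 y : plane_x y 2 = 2 - y 0 0 - y 0 1. Proof. by []. Qed.
Definition plane_xE := (plane_x0, plane_x1, plane_x2).

Lemma sum_plane_x y : \sum_j plane_x y j = 0.
Proof. by rewrite sum_ord3 !plane_xE; ring. Qed.

Definition plane_y (x : 'I_3 -> R) : 'rV[R]_2 := \row_(j < 2) (1 + x (lshift 1 j)).

Lemma plane_yK y : plane_y (plane_x y) = y.
Proof.
apply/rowP => j; rewrite mxE addrC.
case: j => -[|[|//]] i; rewrite /plane_x /= subrK; congr (y _ _); exact/val_inj.
Qed.

Lemma plane_xK x j : \sum_i x i = 0 -> plane_x (plane_y x) j = x j.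
Proof.
rewrite sum_ord3 => x0.
have l0 : lshift 1 (0 : 'I_2) = (0 : 'I_3) by exact/val_inj.
have l1 : lshift 1 (1 : 'I_2) = (1 : 'I_3) by exact/val_inj.
elim/ord3_ind: j; rewrite plane_xE !mxE ?l0 ?l1.
- by rewrite addrC addKr.
- by rewrite addrC addKr.
- by apply/eqP; rewrite -subr_eq0 -oppr_eq0 -x0; apply/eqP; ring.
Qed.

Lemma flag_moment_mapE L : flag_moment_map L = plane_y (moment_x L).
Proof. by apply/rowP => j; rewrite [LHS]mxE [RHS]mxE /moment_x addrC subrK. Qed.

Lemma plane_x_moment L j : plane_x (flag_moment_map L) j = moment_x L j.
Proof. by rewrite flag_moment_mapE plane_xK // sum_moment_x. Qed.

End MomentMap.

(** * Affine coordinates on the translates of the big cell *)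

Section Coordinates.
Variable R : realType.
Local Notation C := (Cplx R).
Local Notation V := 'rV[C]_3.
Implicit Types (L : flag R) (z : 'rV[R]_6) (s : 'S_3).

Definition ccoord z (l : 'I_3) : C :=
  mkC (z 0 (inord l.*2)) (z 0 (inord l.*2.+1)).

Definition rcoord (c : 'I_3 -> C) : 'rV[R]_6 :=
  \row_(j < 6) if odd j then cIm (c (inord j./2)) else cRe (c (inord j./2)).

Lemma rcoordK c l : ccoord (rcoord c) l = c l.
Proof.
have H (b : bool) : (b + l.*2 < 6)%N.
  by rewrite ltnS; case: l => -[|[|[|//]]] ?; case: b.
rewrite /ccoord !mxE (inordK (H false)) (inordK (H true)) odd_double /= odd_double /=.
rewrite uphalf_double doubleK mkCK; congr (c _).
by apply/val_inj; rewrite /= inordK.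
Qed.

Lemma ccoordK z : rcoord (ccoord z) = z.
Proof.
apply/rowP => j; rewrite mxE /ccoord.
have jh : (j./2 < 3)%N by rewrite ltn_half_double.
rewrite (inordK jh); case: ifP => jo /=.
  have -> : (j./2).*2.+1 = j by rewrite -[RHS]odd_double_half jo.
  by rewrite inord_val.
have -> : (j./2).*2 = j by rewrite -[RHS]odd_double_half jo.
by rewrite inord_val.
Qed.

Lemma ccoord_inj z z' : ccoord z =1 ccoord z' -> z = z'.
Proof. by move=> H; rewrite -[z]ccoordK -[z']ccoordK; congr rcoord; exact/funext. Qed.

(** Before permutation, the first two rows of the unitriangular matrix are (1, a, b) and (0, 1, d).
    Their cross product is (a d - b, -d, 1), which is [qvec], normalized to 1 at the last index. *)
Definition pvec s z : V :=
  \row_j [:: 1; ccoord z 0; ccoord z 1]`_((s^-1)%g j).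
Definition qvec s z : V :=
  \row_j [:: ccoord z 0 * ccoord z 2 - ccoord z 1; - ccoord z 2; 1]`_((s^-1)%g j).

Lemma pvec0 s z : pvec s z 0 (s 0) = 1. Proof. by rewrite mxE permK. Qed.
Lemma pvec1 s z : pvec s z 0 (s 1) = ccoord z 0. Proof. by rewrite mxE permK. Qed.
Lemma pvec2 s z : pvec s z 0 (s 2) = ccoord z 1. Proof. by rewrite mxE permK. Qed.
Lemma qvec0 s z : qvec s z 0 (s 0) = ccoord z 0 * ccoord z 2 - ccoord z 1.
Proof. by rewrite mxE permK. Qed.
Lemma qvec1 s z : qvec s z 0 (s 1) = - ccoord z 2. Proof. by rewrite mxE permK. Qed.
Lemma qvec2 s z : qvec s z 0 (s 2) = 1. Proof. by rewrite mxE permK. Qed.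
Definition pqvecE := (pvec0, pvec1, pvec2, qvec0, qvec1, qvec2).

Lemma pvec_neq0 s z : pvec s z != 0.
Proof. by apply/row_neq0P; exists (s 0); rewrite pvec0 oner_eq0. Qed.

Lemma qvec_neq0 s z : qvec s z != 0.
Proof. by apply/row_neq0P; exists (s 2); rewrite qvec2 oner_eq0. Qed.

Lemma unitriangularE z : unitriangular z = \matrix_(i, j)
  [:: [:: 1; ccoord z 0; ccoord z 1]`_j; [:: 0; 1; ccoord z 2]`_j; [:: 0; 0; 1]`_j]`_i.
Proof.
apply/matrixP => i j; rewrite !mxE.
by elim/ord3_ind: i; elim/ord3_ind: j.
Qed.

Lemma flag_param_unit s z : unitriangular z *m perm_mx s \in unitmx.
Proof.
rewrite unitmx_mul unitmx_perm andbT unitmxE -det_tr det_trig.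
  rewrite unitrE; apply/eqP; rewrite big1 ?divr1 ?invr1 ?mulr1 // => i _.
  by rewrite !mxE ltnn eqxx.
apply/is_trig_mxP => i j ij; rewrite !mxE ltnNge (ltnW ij) /=.
by rewrite eq_sym -val_eqE /= (ltn_eqF ij).
Qed.

Lemma flag_param_pair s z : plucker_pair (flag_param s z) (pvec s z) (qvec s z).
Proof.
set g := unitriangular z *m perm_mx s.
have gU : g \in unitmx by exact: flag_param_unit.
have LE : val (flag_param s z) = row_flag g.
  by rewrite /flag_param /flag_of_mx insubdK //; exact: row_flagP.
have gE i j : g i (s j) = unitriangular z i j.
  rewrite /g mxE (bigD1 j) //= !mxE eqxx mulr1 big1 ?addr0 // => k kj.
  by rewrite !mxE (inj_eq perm_inj) (negbTE kj) mulr0.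
have r0E : row 0 g = pvec s z.
  apply/rowP => j; rewrite mxE.
  by move: j; apply: (@perm3_ind s); rewrite gE ?pqvecE unitriangularE mxE.
clearbody g; split; rewrite ?pvec_neq0 ?qvec_neq0 ?LE /= ?r0E // => v.
apply/span2P/eqP => [[a [b ->]]|].
  rewrite /dotp (sum_perm3 s) !mxE !permK ?gE !unitriangularE !mxE /=; ring.
rewrite /dotp (sum_perm3 s) ?pqvecE => E.
exists (v 0 (s 0)), (v 0 (s 1) - ccoord z 0 * v 0 (s 0)).
apply/rowP => j; rewrite !mxE; move: j.
apply: (@perm3_ind s); rewrite gE ?permK unitriangularE !mxE /=; [ring|ring|].
by apply/eqP; rewrite -subr_eq0 -E; apply/eqP; ring.
Qed.

Lemma flag_param_inj s : injective (@flag_param R s).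
Proof.
move=> z z' E; have := flag_param_pair s z'; rewrite -E => pz'.
have [a [b [a0 b0 pE qE]]] := pair_uniq (flag_param_pair s z) pz'.
have pj j : pvec s z' 0 j = a * pvec s z 0 j by rewrite pE mxE.
have qj j : qvec s z' 0 j = b * qvec s z 0 j by rewrite qE mxE.
have a1 : a = 1 by move: (pj (s 0)); rewrite !pqvecE mulr1.
have b1 : b = 1 by move: (qj (s 2)); rewrite !pqvecE mulr1.
apply: ccoord_inj; apply: ord3_ind.
- by move: (pj (s 1)); rewrite a1 !pqvecE mul1r.
- by move: (pj (s 2)); rewrite a1 !pqvecE mul1r.
- by move: (qj (s 1)); rewrite b1 !pqvecE mul1r => /oppr_inj.
Qed.

Definition pair_coord s (p q : V) : 'rV[R]_6 := rcoord (fun l : 'I_3 =>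
  [:: p 0 (s 1) / p 0 (s 0); p 0 (s 2) / p 0 (s 0); - (q 0 (s 1) / q 0 (s 2))]`_l).

Lemma flag_param_coord s L p q : plucker_pair L p q ->
  p 0 (s 0) != 0 -> q 0 (s 2) != 0 -> flag_param s (pair_coord s p q) = L.
Proof.
move=> pL p0 q0; have pq := pair_dot pL.
apply: (@pair_inj _ _ _ _ _ (flag_param_pair s _)).
have := @pair_scale _ L p q (p 0 (s 0))^-1 (q 0 (s 2))^-1 (invr_neq0 p0) (invr_neq0 q0) pL.
congr plucker_pair; apply/rowP; apply: (@perm3_ind s); rewrite ?pqvecE !mxE ?rcoordK /=.
- by rewrite mulVf.
- by rewrite mulrC.
- by rewrite mulrC.
(* The one entry that does not hold by construction; it is forced by [dotp p q = 0]. *)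
- apply: (mulfI q0); rewrite mulrA divff // mul1r; apply: (mulfI p0).
  move: pq; rewrite /dotp (sum_perm3 s) => pq.
  apply/eqP; rewrite -subr_eq0 -pq; apply/eqP; field.
  by rewrite p0 q0.
- by rewrite opprK mulrC.
- by rewrite mulVf.
Qed.

Lemma flag_chart_dom s L p q : plucker_pair L p q ->
  chart_dom (flag_chart R s) L <-> p 0 (s 0) != 0 /\ q 0 (s 2) != 0.
Proof.
move=> pL; split=> [[z _ zL]|[p0 q0]]; last first.
  by exists (pair_coord s p q) => //; exact: flag_param_coord.
have := flag_param_pair s z; rewrite zL => pz.
have [a [b [a0 b0 -> ->]]] := pair_uniq pz pL.
by rewrite [X in X != 0 /\ _]mxE [X in _ /\ X != 0]mxE !pqvecE !mulr1.
Qed.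

Lemma flag_chart_param s z : chart_map (flag_chart R s) (flag_param s z) = z.
Proof.
apply: (@flag_param_inj s).
exact: (xgetPex 0 (ex_intro [set y | flag_param s y = flag_param s z] z erefl)).
Qed.

Lemma flag_chart_coord s L p q : plucker_pair L p q ->
  chart_dom (flag_chart R s) L -> chart_map (flag_chart R s) L = pair_coord s p q.
Proof.
move=> pL /(flag_chart_dom s pL)[p0 q0].
by rewrite -{1}(flag_param_coord pL p0 q0) flag_chart_param.
Qed.

End Coordinates.

(** * Topology and atlas of the flag manifold *)

Lemma perm3_ex (i k j : 'I_3) : i != k -> i != j -> k != j ->
  exists s : 'S_3, [/\ s 0 = i, s 1 = k & s 2 = j].
Proof.
move=> ik ij kj; pose f (l : 'I_3) : 'I_3 := [:: i; k; j]`_l.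
have fi : injective f.
  by move=> a b; elim/ord3_ind: a; elim/ord3_ind: b; rewrite /f //= => E;
    move: ik ij kj; rewrite E eqxx.
by exists (perm fi); rewrite !permE.
Qed.

Lemma cts_const (T S : topologicalType) (c : S) (x : T) :
  {for x, continuous (fun _ => c)}.
Proof. exact: cst_continuous. Qed.

Lemma cts_nth3 (T : topologicalType) (F : numFieldType) (a b c : T -> F) (x : T)
    (k : 'I_3) :
  {for x, continuous a} -> {for x, continuous b} -> {for x, continuous c} ->
  {for x, continuous (fun y => [:: a y; b y; c y]`_k)}.
Proof. by elim/ord3_ind: k. Qed.

Section FlagTopology.
Variable R : realType.
Local Notation C := (Cplx R).
Local Notation V := 'rV[C]_3.
Local Notation M := (flag_manifold R).
Implicit Types (L : M) (p q : V) (z : 'rV[R]_6) (s : 'S_3).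

Definition flag_p L : V := sval (cid (flag_pair L)).
Definition flag_q L : V := sval (cid (svalP (cid (flag_pair L)))).

Lemma flag_pqP L : plucker_pair L (flag_p L) (flag_q L).
Proof. exact: svalP (cid (svalP (cid (flag_pair L)))). Qed.

Definition cj (z : C) : C := mkC (cRe z) (- cIm z).

Lemma cjM (a b : C) : cj (a * b) = cj a * cj b.
Proof. by apply: cplxP; rewrite ?cReM ?cImM /= ?cReM ?cImM; ring. Qed.

(* The entries of the orthogonal projector onto the line of [p]. *)
Definition proj_entry p (i j : 'I_3) : C :=
  p 0 i * cj (p 0 j) * (mkC (\sum_l normsq (p 0 l)) 0)^-1.

Lemma proj_entryZ p (a : C) i j : a != 0 -> proj_entry (a *: p) i j = proj_entry p i j.
Proof.
move=> a0; rewrite /proj_entry !mxE cjM.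
have -> : mkC (\sum_l normsq ((a *: p) 0 l)) 0 = a * cj a * mkC (\sum_l normsq (p 0 l)) 0.
  under eq_bigr do rewrite mxE normsqM.
  rewrite -mulr_sumr mul_conj; apply: cplxP; rewrite ?cReM ?cImM /=; ring.
have aj : cj a != 0.
  apply/eqP => /(congr1 (fun z : C => a * z)); rewrite mul_conj mulr0 => -[] /eqP.
  by rewrite normsq_eq0 (negbTE a0).
rewrite invfM; move: (mkC (\sum_l _) 0)^-1 => w; field.
by rewrite a0 aj.
Qed.

Lemma proj_entry_diag p i : cRe (proj_entry p i i) = weight p i.
Proof.
rewrite /proj_entry mul_conj cReM cRe_mk cIm_mk mul0r subr0 cReV cRe_mk.
rewrite /weight /normsq cRe_mk cIm_mk expr0n /= addr0 -/(normsq _).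
set t := \sum_(l < 3) _; have [->|t0] := eqVneq t 0; first by rewrite !(invr0, mulr0, mul0r).
by field.
Qed.

(** Quotients of coordinates, and with them the chart coordinates, are quotients of projector
    entries; those are continuous in the flag although the chosen vectors are not. *)
Lemma proj_entry_ratio p i j : p 0 i != 0 ->
  p 0 j / p 0 i = proj_entry p j i / proj_entry p i i.
Proof.
move=> pi; have pn : p != 0 by apply/row_neq0P; exists i.
have aj : cj (p 0 i) != 0.
  apply/eqP => /(congr1 (fun z : C => p 0 i * z)); rewrite mul_conj mulr0 => -[] /eqP.
  by rewrite normsq_eq0 (negbTE pi).
have n0 : mkC (\sum_l normsq (p 0 l)) 0 != 0 :> C.
  by apply/eqP => -[] /eqP; rewrite gt_eqF // sum_normsq_gt0.
by rewrite /proj_entry; field; rewrite n0 aj pi.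
Qed.

Lemma proj_entry_inj p p' : p != 0 -> p' != 0 ->
  (forall i j, proj_entry p i j = proj_entry p' i j) -> exists2 a, a != 0 & p' = a *: p.
Proof.
move=> p0 p'0 H; have [i pi] := row_neq0P _ p0.
have p'i : p' 0 i != 0.
  by rewrite -weight_gt0 // -proj_entry_diag -H proj_entry_diag weight_gt0.
exists (p' 0 i / p 0 i); first by rewrite mulf_neq0 ?invr_eq0.
apply/rowP => j; rewrite mxE mulrAC -mulrA proj_entry_ratio // !H.
by rewrite -proj_entry_ratio // mulrC divfK.
Qed.

Definition emb_idx := (bool * bool * 'I_3 * 'I_3)%type.

Definition pair_emb p q (k : emb_idx) : R :=
  let: (b, c, i, j) := k in
  let e := if b then proj_entry p i j else proj_entry q i j in
  if c then cRe e else cIm e.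

(** The real and imaginary parts of the projectors onto the lines of [p] and of [q]. They do not
    depend on the choice of these vectors and embed the flags into a Euclidean space. *)
Definition flag_emb L : 'rV[R]_#|{: emb_idx}| :=
  \row_k pair_emb (flag_p L) (flag_q L) (enum_val k).

Lemma pair_emb_eq L p q k : plucker_pair L p q ->
  pair_emb (flag_p L) (flag_q L) k = pair_emb p q k.
Proof.
move=> pL; have [a [b [a0 b0 -> ->]]] := pair_uniq (flag_pqP L) pL.
by case: k => [[[c d] i] j]; rewrite /pair_emb !proj_entryZ.
Qed.

Lemma flag_emb_inj : injective flag_emb.
Proof.
move=> L L' E.
have H k : pair_emb (flag_p L) (flag_q L) k = pair_emb (flag_p L') (flag_q L') k.
  have /rowP /(_ (enum_rank k)) := E.
  by rewrite !mxE enum_rankK.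
have [p0 q0 _ _] := flag_pqP L; have [p'0 q'0 _ _] := flag_pqP L'.
have [|a a0 pE] := @proj_entry_inj (flag_p L) (flag_p L') p0 p'0.
  by move=> i j; apply: cplxP; [exact: (H (true, true, i, j))|exact: (H (true, false, i, j))].
have [|b b0 qE] := @proj_entry_inj (flag_q L) (flag_q L') q0 q'0.
  by move=> i j; apply: cplxP; [exact: (H (false, true, i, j))|exact: (H (false, false, i, j))].
apply: pair_inj (pair_scale a0 b0 (flag_pqP L)) _.
by rewrite -pE -qE; exact: flag_pqP.
Qed.

Lemma cts_proj_entry (T : topologicalType) (p : T -> V) x i j : p x != 0 ->
  (forall l, {for x, continuous (fun y => p y 0 l)}) ->
  {for x, continuous (fun y => proj_entry (p y) i j)}.
Proof.
move=> p0 pc; apply: ctsCM; last first.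
  apply: ctsCV.
    by apply/eqP => -[] /eqP; rewrite gt_eqF // sum_normsq_gt0.
  apply: cts_mkC; last exact: cts_cst.
  by apply: cts_sum => l _; exact: cts_normsq.
apply: ctsCM => //; apply: cts_mkC; first exact: cts_cRe.
by apply: ctsN; exact: cts_cIm.
Qed.

Lemma cts_pair_emb (T : topologicalType) (p q : T -> V) x k : p x != 0 -> q x != 0 ->
  (forall l, {for x, continuous (fun y => p y 0 l)}) ->
  (forall l, {for x, continuous (fun y => q y 0 l)}) ->
  {for x, continuous (fun y => pair_emb (p y) (q y) k)}.
Proof.
move=> p0 q0 pc qc; case: k => [[[b c] i] j]; rewrite /pair_emb.
by case: b; case: c; (apply: cts_cRe || apply: cts_cIm); exact: cts_proj_entry.
Qed.

Lemma flag_of_GL3_continuous : continuous (@flag_of_GL3 R : _ -> M).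
Proof. by apply/continuousP. Qed.

Lemma flag_emb_continuous : continuous flag_emb.
Proof.
apply/continuousP => A oA.
suff : continuous (flag_emb \o (@flag_of_GL3 R)) by move/continuousP; apply.
move=> g; apply: continuous_row => k.
pose p (g : @GL3 R) := row 0 (set_val g).
pose q (g : @GL3 R) := crossp (row 0 (set_val g)) (row 1 (set_val g)).
rewrite (_ : (fun _ => _) = fun g => pair_emb (p g) (q g) (enum_val k)); last first.
  by apply/funext => h; rewrite mxE; apply: pair_emb_eq; exact: flag_of_GL3_pair.
have [p0 q0 _ _] := flag_of_GL3_pair g.
have gc i j : {for g, continuous (fun h : @GL3 R => set_val h i j)}.
  by apply: cts_coord; exact: continuous_set_val.
have rc i j : {for g, continuous (fun h : @GL3 R => row i (set_val h) 0 j)}.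
  by under [X in {for _, continuous X}]funext do rewrite mxE; exact: gc.
apply: cts_pair_emb => // l; first exact: rc.
rewrite /q; elim/ord3_ind: l; under [X in {for _, continuous X}]funext do rewrite crosspE;
  exact: (ctsCD (ctsCM (rc _ _) (rc _ _)) (ctsCN (ctsCM (rc _ _) (rc _ _)))).
Qed.

Lemma cts_ccoord z l : {for z, continuous (fun y : 'rV[R]_6 => ccoord y l)}.
Proof. by apply: cts_mkC; exact: coord_continuous. Qed.

Lemma flag_param_continuous s : continuous (flag_param s : _ -> M).
Proof.
pose g z : @GL3 R := exist _ (unitriangular z *m perm_mx s) (mem_set (flag_param_unit s z)).
rewrite (_ : flag_param s = (@flag_of_GL3 R) \o g).
  move=> z; apply: continuous_comp; last exact: flag_of_GL3_continuous.
  apply: cts_set_type; apply: cts_mx => i j.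
  rewrite (_ : (fun _ => _) = fun y => unitriangular y i ((s^-1)%g j)).
    under [X in {for _, continuous X}]funext do rewrite unitriangularE mxE.
    set k := (s^-1)%g j; pose one (_ : 'rV[R]_6) : C := 1; pose zero (_ : 'rV[R]_6) : C := 0.
    have c1 : {for z, continuous one} by exact: cts_const.
    have c0 : {for z, continuous zero} by exact: cts_const.
    have h0 := @cts_nth3 _ C _ _ _ z k c1 (@cts_ccoord z 0) (@cts_ccoord z 1).
    have h1 := @cts_nth3 _ C _ _ _ z k c0 c1 (@cts_ccoord z 2).
    exact: (@cts_nth3 _ C _ _ _ z i h0 h1 (@cts_nth3 _ C _ _ _ z k c0 c0 c1)).
  apply/funext => y; rewrite /g set_valE /= mxE (bigD1 ((s^-1)%g j)) //= !mxE permKV eqxx.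
  rewrite mulr1 big1 ?addr0 // => k kj; rewrite [X in _ * X]mxE [X in _ * X]mxE.
  by rewrite -(inj_eq (@perm_inj _ (s^-1)%g)) permK (negbTE kj) mulr0.
apply/funext => z; apply: val_inj => /=.
by rewrite /flag_param /flag_of_mx insubdK ?set_valE //; exact: row_flagP (flag_param_unit s z).
Qed.

Definition unit_box : set 'rV[R]_6 := [set z | forall i, `[(-1), 1]%classic (z 0 i)].

(** Let [i] maximize |p_i|, and among the two other indices let [j] be the one with the larger
    |q_j|. Then q_j is nonzero: otherwise [q] would be supported at [i] and p_i q_i = 0 would make
    it vanish. In the chart with [s 0 = i] and [s 2 = j] all quotients have modulus at most 1.
    Compactness follows. *)
Lemma box_chart L : exists2 s, chart_dom (flag_chart R s) L & (flag_param s @` unit_box) L.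
Proof.
have [p [q pL]] := flag_pair L; have [p0 q0 _ _] := pL.
have pq := pair_dot pL.
pose i := [arg max_(i > (0 : 'I_3)) normsq (p 0 i)]%O.
have pmax l : normsq (p 0 l) <= normsq (p 0 i).
  by rewrite /i; case: arg_maxP => // m _ /(_ l isT).
have pi : p 0 i != 0.
  have [l pl] := row_neq0P _ p0.
  by rewrite -normsq_gt0 (lt_le_trans _ (pmax l)) // normsq_gt0.
have [k [j [ik ij kj qm]]] : exists k j, [/\ i != k, i != j, k != j &
    normsq (q 0 k) <= normsq (q 0 j)].
  have [k [j [ik ij kj]]] : exists k j, [/\ i != k, i != j & k != j].
    by elim/ord3_ind: (i); [exists 1, 2|exists 0, 2|exists 0, 1].
  by have [H|/ltW H] := leP (normsq (q 0 k)) (normsq (q 0 j));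
    [exists k, j|exists j, k; rewrite eq_sym in kj].
have [s [s0 s1 s2]] := perm3_ex ik ij kj.
have qj : q 0 j != 0.
  apply/eqP => qj; move: qm; rewrite qj normsq0 => qk.
  have {}qk : q 0 k = 0 by apply/eqP; rewrite -normsq_eq0 eq_le qk normsq_ge0.
  have qi : q 0 i = 0.
    move: pq; rewrite /dotp (sum_perm3 s) s0 s1 s2 qj qk !mulr0 !addr0 => /eqP.
    by rewrite mulf_eq0 (negbTE pi) => /eqP.
  case/eqP: q0; apply/rowP => l; rewrite mxE; move: l.
  by apply: (@perm3_ind s); rewrite ?s0 ?s1 ?s2.
have dL : p 0 (s 0) != 0 /\ q 0 (s 2) != 0 by rewrite s0 s2.
exists s; first exact/(flag_chart_dom s pL).
exists (pair_coord s p q); last by apply: flag_param_coord pL _ _; case: dL.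
have rat (a b : C) : normsq b != 0 -> normsq a <= normsq b -> normsq (a / b) <= 1.
  by move=> b0 ab; rewrite normsqM normsqV ler_pdivrMr ?mul1r // lt_def b0 normsq_ge0.
have part (c : C) : normsq c <= 1 -> -1 <= cRe c <= 1 /\ -1 <= cIm c <= 1.
  by rewrite /normsq => H; split; apply/andP; split; nra.
move=> l; rewrite /= in_itv /= /pair_coord mxE.
suff H m : normsq ([:: p 0 (s 1) / p 0 (s 0); p 0 (s 2) / p 0 (s 0);
    - (q 0 (s 1) / q 0 (s 2))]`_m) <= 1 \/ (2 < m)%N.
  have [Hm|] := H (inord l./2 : 'I_3); last by rewrite ltnNge -ltnS ltn_ord.
  by case: ifP => _; case: (part _ Hm).
case: m => [|[|[|m]]] /=; [left|left|left|by right].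
- by apply: rat; rewrite ?normsq_eq0 s0 // s1; exact: pmax.
- by apply: rat; rewrite ?normsq_eq0 s0 // s2; exact: pmax.
- by rewrite normsqN; apply: rat; rewrite ?normsq_eq0 s2 // s1.
Qed.

Lemma compact_flag : compact [set: M].
Proof.
have cb : compact unit_box.
  exact: (@rV_compact R 6 (fun=> `[(-1), 1]%classic) (fun=> @segment_compact R (-1) 1)).
rewrite (_ : setT = \big[setU/set0]_(s <- enum 'S_3) (flag_param s @` unit_box)).
  apply: bigsetU_compact => s _; apply: continuous_compact => //.
  exact/continuous_subspaceT/flag_param_continuous.
rewrite -bigcup_seq; apply/seteqP; split=> // L _.
by have [s _ Ls] := box_chart L; exists s => //=; rewrite mem_enum.
Qed.

Lemma hausdorff_flag : hausdorff_space M.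
Proof. exact: embed_hausdorff flag_emb_continuous flag_emb_inj. Qed.

Lemma second_countable_flag : @second_countable M.
Proof.
exact: embed_second_countable compact_flag flag_emb_continuous flag_emb_inj (std_flag R).
Qed.

(** Continuity into the flags can be tested on any local pair of vectors that varies continuously;
    the chosen [flag_p] and [flag_q] need not. *)
Lemma cts_flag (T : topologicalType) (f : T -> M) (p q : T -> V) x :
  (\forall y \near x, plucker_pair (f y) (p y) (q y)) ->
  (forall l, {for x, continuous (fun y => p y 0 l)}) ->
  (forall l, {for x, continuous (fun y => q y 0 l)}) ->
  {for x, continuous f}.
Proof.
move=> pf pc qc; apply: (embed_cts compact_flag flag_emb_continuous flag_emb_inj).
apply: continuous_row => k; have [p0 q0 _ _] := nbhs_singleton pf.
have pfE : \forall y \near x, pair_emb (p y) (q y) (enum_val k) = flag_emb (f y) 0 k.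
  by near=> y; rewrite mxE; apply/esym/pair_emb_eq; near: y.
have H := @cts_pair_emb _ p q x (enum_val k) p0 q0 pc qc.
rewrite /prop_for /continuous_at -(nbhs_singleton pfE).
by apply: cvg_trans H; exact: near_eq_cvg pfE.
Unshelve. all: by end_near. Qed.

Lemma pair_emb_continuous k : continuous (fun L => pair_emb (flag_p L) (flag_q L) k).
Proof.
rewrite (_ : (fun _ => _) = fun L => flag_emb L 0 (enum_rank k)).
  by move=> L; apply: cts_coord; exact: flag_emb_continuous.
by apply/funext => L; rewrite mxE enum_rankK.
Qed.

Lemma proj_p_continuous i j : continuous (fun L => proj_entry (flag_p L) i j).
Proof.
move=> L; apply: cts_complex.
  exact: (@pair_emb_continuous (true, true, i, j) L).
exact: (@pair_emb_continuous (true, false, i, j) L).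
Qed.

Lemma proj_q_continuous i j : continuous (fun L => proj_entry (flag_q L) i j).
Proof.
move=> L; apply: cts_complex.
  exact: (@pair_emb_continuous (false, true, i, j) L).
exact: (@pair_emb_continuous (false, false, i, j) L).
Qed.

Lemma weight_p_continuous i : continuous (fun L => weight (flag_p L) i).
Proof.
under [X in continuous X]funext do rewrite -proj_entry_diag.
by move=> L; exact: (cts_cRe (@proj_p_continuous i i L)).
Qed.

Lemma weight_q_continuous i : continuous (fun L => weight (flag_q L) i).
Proof.
under [X in continuous X]funext do rewrite -proj_entry_diag.
by move=> L; exact: (cts_cRe (@proj_q_continuous i i L)).
Qed.

Lemma open_flag_p i : open [set L : M | flag_p L 0 i != 0].
Proof.
rewrite (_ : mkset _ = (fun L => weight (flag_p L) i) @^-1` [set x | 0 < x]).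
  by apply: open_comp => [L _|]; [exact: weight_p_continuous|exact: open_gt].
apply/seteqP; split=> L /=; have [p0 _ _ _] := flag_pqP L; by rewrite weight_gt0.
Qed.

Lemma open_flag_q i : open [set L : M | flag_q L 0 i != 0].
Proof.
rewrite (_ : mkset _ = (fun L => weight (flag_q L) i) @^-1` [set x | 0 < x]).
  by apply: open_comp => [L _|]; [exact: weight_q_continuous|exact: open_gt].
apply/seteqP; split=> L /=; have [_ q0 _ _] := flag_pqP L; by rewrite weight_gt0.
Qed.

Lemma flag_domE s : chart_dom (flag_chart R s) =
  [set L : M | flag_p L 0 (s 0) != 0] `&` [set L : M | flag_q L 0 (s 2) != 0].
Proof.
by apply/seteqP; split=> L /(flag_chart_dom s (flag_pqP L)).
Qed.

Lemma flag_chart_cod s : chart_cod (flag_chart R s : chart R 6 M) = setT.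
Proof.
apply/seteqP; split=> // z _; exists (flag_param s z); last exact: flag_chart_param.
by exists z.
Qed.

Lemma flag_is_chart s : is_chart (flag_chart R s : chart R 6 M).
Proof.
have oD : open (chart_dom (flag_chart R s : chart R 6 M)).
  by rewrite flag_domE; apply: openI; [exact: open_flag_p|exact: open_flag_q].
split.
- by split => //; rewrite flag_chart_cod; exact: openT.
- by move=> L; rewrite inE => -[z _ <-]; rewrite flag_chart_param.
- move=> L DL.
  pose c L (l : 'I_3) : C :=
    [:: proj_entry (flag_p L) (s 1) (s 0) / proj_entry (flag_p L) (s 0) (s 0);
        proj_entry (flag_p L) (s 2) (s 0) / proj_entry (flag_p L) (s 0) (s 0);
        - (proj_entry (flag_q L) (s 1) (s 2) / proj_entry (flag_q L) (s 2) (s 2))]`_l.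
  have cE : \forall L' \near L, rcoord (c L') = chart_map (flag_chart R s) L'.
    have nD : nbhs L (chart_dom (flag_chart R s : chart R 6 M)).
      exact: open_nbhs_nbhs.
    apply: filterS nD => L' DL'; rewrite (flag_chart_coord (flag_pqP L')) //.
    have [p0 q0] := (flag_chart_dom s (flag_pqP L')).1 DL'.
    congr rcoord; apply/funext => l; rewrite /c; apply/esym.
    by elim/ord3_ind: l; rewrite /= proj_entry_ratio.
  have H : {for L, continuous (fun L => rcoord (c L))}.
    have [p0 q0] := (flag_chart_dom s (flag_pqP L)).1 DL.
    have [pn qn _ _] := flag_pqP L.
    have nz p i : p != 0 -> p 0 i != 0 -> proj_entry p i i != 0.
      move=> pn' pi'; apply/eqP => E; have := weight_gt0 i pn'.
      by rewrite -proj_entry_diag E pi' cRe0 ltxx.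
    have cc l : {for L, continuous (fun L => c L l)}.
      have cp i j : {for L, continuous (fun L => proj_entry (flag_p L) i j)} by exact: proj_p_continuous.
      have cq i j : {for L, continuous (fun L => proj_entry (flag_q L) i j)} by exact: proj_q_continuous.
      have np := nz _ _ pn p0; have nq := nz _ _ qn q0.
      elim/ord3_ind: l.
      - by apply: ctsCM; [exact: cp|apply: ctsCV; [exact: np|exact: cp]].
      - by apply: ctsCM; [exact: cp|apply: ctsCV; [exact: np|exact: cp]].
      - by apply: ctsCN; apply: ctsCM; [exact: cq|apply: ctsCV; [exact: nq|exact: cq]].
    apply: continuous_row => j; under [X in {for _, continuous X}]funext do rewrite mxE.
    by case: (odd j); [exact: (cts_cIm (cc _))|exact: (cts_cRe (cc _))].
  rewrite /prop_for /continuous_at -(nbhs_singleton cE).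
  by apply: cvg_trans H; exact: near_eq_cvg cE.
- by move=> z _; exact: flag_param_continuous.
Qed.

Lemma CooC_pvec s i (U : set 'rV[R]_6) : open U -> CooC U (fun z => pvec s z 0 i).
Proof.
move=> oU; have Cc l : CooC U (fun z => ccoord z l).
  by apply: CooC_mk; exact: Coo_coord.
move: i; apply: (@perm3_ind s); under [X in CooC _ X]funext do rewrite pqvecE.
- exact: CooC_cst.
- exact: Cc.
- exact: Cc.
Qed.

Lemma CooC_qvec s i (U : set 'rV[R]_6) : open U -> CooC U (fun z => qvec s z 0 i).
Proof.
move=> oU; have Cc l : CooC U (fun z => ccoord z l).
  by apply: CooC_mk; exact: Coo_coord.
move: i; apply: (@perm3_ind s); under [X in CooC _ X]funext do rewrite pqvecE.
- by apply: CooCB => //; apply: CooCM.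
- exact: CooCN.
- exact: CooC_cst.
Qed.

Lemma Coo_rcoord n (U : set 'rV[R]_n) (c : 'rV[R]_n -> 'I_3 -> C) : open U ->
  (forall l, CooC U (fun x => c x l)) -> class_Coo U (fun x => rcoord (c x)).
Proof.
move=> oU Cc; apply/class_CooP => // j.
under [X in Coo _ X]funext do rewrite mxE.
by have [Cr Ci] := Cc (inord j./2); case: (odd j).
Qed.

Lemma class_Coo_near n m (U : set 'rV[R]_n) (f g : 'rV[R]_n -> 'rV[R]_m) : open U ->
  (forall x, U x -> f x = g x) -> class_Coo U f -> class_Coo U g.
Proof.
move=> oU fg /(class_CooP _ oU) Cf; apply/class_CooP => // j.
by apply: Coo_near (Cf j) => // x /fg ->.
Qed.

(** Chart coordinates are quotients of entries of [p] and [q]. This serves the transition maps, the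
    torus action and the parametrizations of leaves alike. *)
Lemma smooth_into_flag n (U : set 'rV[R]_n) (f : 'rV[R]_n -> M) (p q : 'rV[R]_n -> V) s :
  open U -> (forall x, U x -> plucker_pair (f x) (p x) (q x)) ->
  (forall i, CooC U (fun x => p x 0 i)) -> (forall i, CooC U (fun x => q x 0 i)) ->
  (forall x, U x -> chart_dom (flag_chart R s) (f x)) ->
  class_Coo U (chart_map (flag_chart R s) \o f).
Proof.
move=> oU pf Cp Cq fD.
apply: (@class_Coo_near _ _ _ (fun x => pair_coord s (p x) (q x))) => //.
  by move=> x Ux; apply/esym; exact: flag_chart_coord (pf x Ux) (fD x Ux).
have nz x : U x -> p x 0 (s 0) != 0 /\ q x 0 (s 2) != 0.
  by move=> Ux; apply/(flag_chart_dom s (pf x Ux)); exact: fD.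
apply: Coo_rcoord => // l; elim/ord3_ind: l => /=; [| |apply: CooCN => //];
  by apply: CooCM => //; apply: CooCV => // x /nz[].
Qed.

Lemma open_chart_image (d : nat) (X : topologicalType) (c : chart R d X) (U : set X) :
  is_chart c -> open U -> open (chart_map c @` (U `&` chart_dom c)).
Proof.
move=> [[oD oC] cK mc ic] oU.
rewrite (_ : _ @` _ = chart_cod c `&` (chart_inv c @^-1` (U `&` chart_dom c))); last first.
  apply/seteqP; split=> [_ [x [Ux Dx] <-]|v [[x Dx <-]]].
    by split; [exists x|rewrite /preimage /= cK ?inE].
  by rewrite /preimage /= cK ?inE // => ?; exists x.
rewrite openE => v [Cv Uv]; apply: filterI; first exact: open_nbhs_nbhs.
by apply: (ic v Cv); apply: open_nbhs_nbhs; split => //; exact: openI.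
Qed.

Lemma flag_compatible s s' :
  compatible (flag_chart R s : chart R 6 M) (flag_chart R s').
Proof.
suff H s1 s2 : class_Coo (chart_map (flag_chart R s1) @`
    (chart_dom (flag_chart R s1) `&` chart_dom (flag_chart R s2 : chart R 6 M)))
    (transition (flag_chart R s1) (flag_chart R s2)).
  by split; [exact: H|rewrite setIC; exact: H].
have [oD _ _ _] := flag_is_chart s2.
have oU : open (chart_map (flag_chart R s1) @`
    (chart_dom (flag_chart R s1) `&` chart_dom (flag_chart R s2 : chart R 6 M))).
  by rewrite setIC; apply: (open_chart_image (flag_is_chart s1)); case: oD.
apply: (@smooth_into_flag _ _ (flag_param s1) (pvec s1) (qvec s1)) => //.
- by move=> z _; exact: flag_param_pair.
- by move=> i; exact: CooC_pvec.
- by move=> i; exact: CooC_qvec.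
- by move=> _ [L [[z _ <-] D2] <-]; rewrite flag_chart_param.
Qed.

Lemma flag_is_atlas : is_atlas (cs_atlas (c := M)).
Proof.
split=> [_ [s _ <-]||_ _ [s _ <-] [s' _ <-]].
- exact: flag_is_chart.
- apply/seteqP; split=> // L _; have [s DL _] := box_chart L.
  by exists (flag_chart R s) => //; exists s.
- exact: flag_compatible.
Qed.

Lemma flag_smooth_manifold : smooth_manifold M.
Proof.
split; [exact: hausdorff_flag|exact: second_countable_flag|exact: flag_is_atlas].
Qed.

End FlagTopology.

(** * Orientability *)

Section BlockDeterminant.
Variable R : realType.
Local Notation C := (Cplx R).

Lemma block_conj (K : comNzRingType) n (A B : 'M[K]_n) (a : K) : a * a = -1 ->
  block_mx 1%:M a%:M 0 1%:M *m block_mx A B (- B) A *m block_mx 1%:M (- a)%:M 0 1%:M =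
  block_mx (A - a *: B) 0 (- B) (A + a *: B).
Proof.
move=> aa; rewrite !mulmx_block !mul1mx !mul0mx !mulmx1 !mulmx0 !mul_scalar_mx !mul_mx_scalar.
rewrite !addr0 !add0r; congr block_mx.
- by rewrite scalerN.
- rewrite scalerDr !scalerN !scaleNr scalerA aa scaleN1r !opprK.
  by rewrite addrC -!addrA [a *: A + _]addrC; apply/matrixP => k l; rewrite !mxE; ring.
- by rewrite scalerN scaleNr opprK addrC.
Qed.

(** Over the complex numbers [block_conj] conjugates the matrix to a block triangular one with
    diagonal blocks A - iB and A + iB, conjugates of each other. The determinant is therefore |det(A
    + iB)|^2. *)
Lemma det_complex_block n (A B : 'M[R]_n) : 0 <= \det (block_mx A B (- B) A).
Proof.
pose c : {rmorphism R -> C} := real_complex R.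
pose i : C := mkC 0 1.
have ii : i * i = -1 by apply: cplxP; rewrite ?cReM ?cImM ?cReN ?cImN /=; ring.
pose cA := map_mx c A; pose cB := map_mx c B.
pose U (a : C) := block_mx (1%:M : 'M[C]_n) (a%:M) 0 1%:M.
have dU a : \det (U a) = 1 by rewrite det_ublock !det1 mulr1.
have E : U i *m block_mx cA cB (- cB) cA *m U (- i) =
    block_mx (cA - i *: cB) 0 (- cB) (cA + i *: cB).
  exact: block_conj.
pose N := cA + i *: cB.
have Nc : cA - i *: cB = map_mx (@conjc R) N.
  apply/matrixP => k l; rewrite !mxE; apply: cplxP;
    rewrite ?cReD ?cImD ?cReN ?cImN ?cReM ?cImM /=; rewrite ?cReD ?cImD ?cReM ?cImM /=; ring.
have dE : c (\det (block_mx A B (- B) A)) = conjc (\det N) * \det N.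
  rewrite -det_map_mx map_block_mx map_mxN -/cA -/cB.
  have := congr1 determinant E; rewrite !det_mulmx !dU mul1r mulr1 => ->.
  by rewrite det_lblock Nc -/N det_map_mx.
have := congr1 (@cRe R) dE; rewrite -[cRe (c _)]/(\det (block_mx A B (- B) A)) => ->.
case: (\det N) => a b; rewrite cReM /=.
by rewrite /cRe /cIm /= mulNr opprK addr_ge0 // -expr2 sqr_ge0.
Qed.

End BlockDeterminant.

Section Holomorphic.
Variable R : realType.
Local Notation C := (Cplx R).
Implicit Types (U : set 'rV[R]_6) (z v : 'rV[R]_6) (f g : 'rV[R]_6 -> C).

Definition imul v : 'rV[R]_6 := rcoord (fun l => mkC 0 1 * ccoord v l).

Definition derC v f z : C := mkC ('D_v (fun y => cRe (f y)) z) ('D_v (fun y => cIm (f y)) z).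

(* Smooth functions satisfying the Cauchy-Riemann equations. *)
Definition holo U f := CooC U f /\
  forall z v, U z -> derC (imul v) f z = mkC 0 1 * derC v f z.

Lemma CooC_derivable U f z v : CooC U f -> U z ->
  derivable (fun y => cRe (f y)) z v /\ derivable (fun y => cIm (f y)) z v.
Proof.
by move=> [Cr Ci] Uz; split; apply: diff_derivable;
  [case: (Cr 1%N)|case: (Ci 1%N)] => + _; apply.
Qed.

Lemma derC_near f g v z : {near z, f =1 g} -> derC v f z = derC v g z.
Proof.
move=> fg; congr mkC; apply: near_eq_derive; near=> y;
  by rewrite (near fg y).
Unshelve. all: by end_near. Qed.

Lemma derC_cst c v z : derC v (fun=> c) z = 0.
Proof. by rewrite /derC !derive_cst. Qed.

Lemma derCD U f g v z : CooC U f -> CooC U g -> U z ->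
  derC v (fun y => f y + g y) z = derC v f z + derC v g z.
Proof.
move=> Cf Cg Uz; have [fr fi] := CooC_derivable v Cf Uz.
have [gr gi] := CooC_derivable v Cg Uz.
have Er : (fun y => cRe (f y + g y)) = (fun y => cRe (f y)) + (fun y => cRe (g y)).
  by apply/funext => y; rewrite cReD.
have Ei : (fun y => cIm (f y + g y)) = (fun y => cIm (f y)) + (fun y => cIm (g y)).
  by apply/funext => y; rewrite cImD.
by rewrite /derC Er Ei (deriveD fr gr) (deriveD fi gi).
Qed.

Lemma derCM U f g v z : CooC U f -> CooC U g -> U z ->
  derC v (fun y => f y * g y) z = f z * derC v g z + g z * derC v f z.
Proof.
move=> Cf Cg Uz; have [fr fi] := CooC_derivable v Cf Uz.
have [gr gi] := CooC_derivable v Cg Uz.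
pose fR y := cRe (f y); pose fI y := cIm (f y); pose gR y := cRe (g y); pose gI y := cIm (g y).
have Er : (fun y => cRe (f y * g y)) = fR * gR - fI * gI.
  by apply/funext => y; rewrite cReM.
have Ei : (fun y => cIm (f y * g y)) = fR * gI + fI * gR.
  by apply/funext => y; rewrite cImM.
rewrite -/fR in fr; rewrite -/fI in fi; rewrite -/gR in gr; rewrite -/gI in gi.
rewrite /derC Er Ei (deriveB (derivableM fr gr) (derivableM fi gi)).
rewrite (deriveD (derivableM fr gi) (derivableM fi gr)).
rewrite (deriveM fr gr) (deriveM fi gi) (deriveM fr gi) (deriveM fi gr).
rewrite -/fR -/fI -/gR -/gI /fR /fI /gR /gI; move: ('D_v _ z) ('D_v _ z) => d1 d2.
move: ('D_v _ z) ('D_v _ z) => d3 d4.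
by apply: cplxP; rewrite ?cReD ?cImD ?cReM ?cImM /= /GRing.scale /=; ring.
Qed.

Lemma holo_near U f g : open U -> (forall z, U z -> f z = g z) -> holo U f -> holo U g.
Proof.
move=> oU fg [Cf hf]; split; first exact: CooC_near fg Cf.
move=> z v Uz; have fgz : {near z, g =1 f}.
  by near=> y; apply/esym/fg; near: y; exact: open_nbhs_nbhs.
by rewrite !(derC_near _ fgz) hf.
Unshelve. all: by end_near. Qed.

Lemma holo_cst U c : holo U (fun=> c).
Proof. by split; [exact: CooC_cst|move=> z v _; rewrite !derC_cst mulr0]. Qed.

Lemma derive_coord n (v z : 'rV[R]_n) j : 'D_v (fun y : 'rV[R]_n => y 0 j) z = v 0 j.
Proof.
have := @derive_mx R 'rV[R]_n 1 n id z v (@derivable_id _ _ z v).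
by rewrite derive_id => /rowP /(_ j); rewrite mxE.
Qed.

Lemma holo_coord U l : holo U (fun z => ccoord z l).
Proof.
split; first by split; exact: Coo_coord.
have E z v : derC v (fun z => ccoord z l) z = ccoord v l.
  by rewrite /derC /ccoord !derive_coord.
by move=> z v Uz; rewrite !E rcoordK.
Qed.

Lemma holoD U f g : open U -> holo U f -> holo U g -> holo U (fun z => f z + g z).
Proof.
move=> oU [Cf hf] [Cg hg]; split; first exact: CooCD.
by move=> z v Uz; rewrite !(derCD _ Cf Cg Uz) hf // hg // mulrDr.
Qed.

Lemma holoM U f g : open U -> holo U f -> holo U g -> holo U (fun z => f z * g z).
Proof.
move=> oU [Cf hf] [Cg hg]; split; first exact: CooCM.
by move=> z v Uz; rewrite !(derCM _ Cf Cg Uz) hf // hg //; ring.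
Qed.

Lemma holoN U f : open U -> holo U f -> holo U (fun z => - f z).
Proof.
move=> oU hf; apply: (holo_near oU _ (holoM oU (holo_cst U (-1)) hf)) => z _.
by rewrite mulN1r.
Qed.

Lemma holoV U f : open U -> (forall z, U z -> f z != 0) -> holo U f ->
  holo U (fun z => (f z)^-1).
Proof.
move=> oU f0 [Cf hf]; have CV := CooCV oU f0 Cf; split=> // z v Uz.
have E w : derC w (fun y => (f y)^-1) z = - (derC w f z / f z / f z).
  (* The derivative of the inverse comes from differentiating the constant product of [f] and its
     inverse. *)
  have : derC w (fun y => f y * (f y)^-1) z = 0.
    rewrite -(derC_cst 1 w z); apply: derC_near; near=> y.
    by rewrite divff // f0 //; near: y; exact: open_nbhs_nbhs.
  rewrite (derCM _ Cf CV Uz) => /eqP; rewrite addr_eq0 => /eqP H.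
  apply: (mulfI (f0 z Uz)); rewrite H; field; exact: f0.
by rewrite !E hf //; field; exact: f0.
Unshelve. all: by end_near. Qed.

End Holomorphic.

Lemma jacobian_unit (R : realType) n (f g : 'rV[R]_n -> 'rV[R]_n) x :
  differentiable f x -> differentiable g (f x) -> {near x, g \o f =1 id} ->
  'J f x \in unitmx.
Proof.
move=> df dg gf; rewrite -row_free_unit; apply: inj_row_free => v.
rewrite -deriveEjacobian //.
rewrite deriveE // => dv0.
have dgf := differentiable_comp df dg.
have E : 'D_v (g \o f) x = v.
  rewrite (near_eq_derive v gf).
  by rewrite derive_id.
rewrite -E (deriveE v dgf) (diff_comp df dg).
exact: etrans (congr1 ('d g (f x)) dv0) (linear0 _).
Qed.

Section FlagOrientation.
Variable R : realType.
Local Notation C := (Cplx R).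
Local Notation M := (flag_manifold R).
Implicit Types (s : 'S_3) (z v : 'rV[R]_6).

Lemma even_lt6 (l : 'I_3) : (l.*2 < 6)%N.
Proof. by rewrite -[6%N]/(3.*2) ltn_double. Qed.

Lemma odd_lt6 (l : 'I_3) : (l.*2.+1 < 6)%N.
Proof. by rewrite -[6%N]/(3.*2) ltn_Sdouble. Qed.

(** Coordinates of ['rV_6] interleave real and imaginary parts; this reordering lists the three real
    parts first. *)
Definition re_im (k : 'I_(3 + 3)) : 'I_6 :=
  match fintype.split k with
  | inl l => Ordinal (even_lt6 l) | inr l => Ordinal (odd_lt6 l)
  end.

Lemma re_im_inj : injective re_im.
Proof.
move=> a b; rewrite /re_im -{2}(splitK a) -{2}(splitK b).
case: (fintype.split a) => l; case: (fintype.split b) => m /(congr1 (@nat_of_ord 6)) /= E.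
- by have -> : l = m by exact/val_inj/double_inj/E.
- by have := congr1 odd E; rewrite /= !odd_double.
- by have := congr1 odd E; rewrite /= !odd_double.
- by have -> : l = m by move: E => [] /double_inj E; exact/val_inj.
Qed.

(** The same reordering of rows and columns leaves the determinant unchanged. Commuting with
    multiplication by i then gives the blocks of [det_complex_block]. *)
Lemma det_commute_i (J : 'M[R]_6) :
  (forall v, imul v *m J = imul (v *m J)) -> 0 <= \det J.
Proof.
move=> JI; pose s : 'S_6 := perm re_im_inj.
have sl (l : 'I_3) : s (lshift 3 l) = Ordinal (even_lt6 l).
  by rewrite permE /re_im (unsplitK (inl l)).
have sr (l : 'I_3) : s (rshift 3 l) = Ordinal (odd_lt6 l).
  by rewrite permE /re_im (unsplitK (inr l)).
pose J' : 'M[R]_(3 + 3) := row_perm s (col_perm s J).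
have -> : \det J = \det J'.
  rewrite /J' row_permE col_permE !det_mulmx !det_perm odd_permV mulrC -mulrA.
  by rewrite -signr_addb addbb expr0 mulr1.
have ev (l : 'I_3) : inord l.*2 = s (lshift 3 l) by rewrite sl; apply/val_inj; rewrite /= inordK ?even_lt6.
have od (l : 'I_3) : inord l.*2.+1 = s (rshift 3 l) by rewrite sr; apply/val_inj; rewrite /= inordK ?odd_lt6.
have e_i (l : 'I_3) : imul (delta_mx 0 (s (lshift 3 l))) = delta_mx 0 (s (rshift 3 l)).
  apply: ccoord_inj => m; rewrite rcoordK /ccoord !ev !od !mxE !(inj_eq perm_inj) -!val_eqE.
  by elim/ord3_ind: l; elim/ord3_ind: m; apply: cplxP; rewrite ?cReM ?cImM /=; ring.
have Jr (l m : 'I_3) : ccoord (row (s (rshift 3 l)) J) m =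
    mkC 0 1 * ccoord (row (s (lshift 3 l)) J) m.
  by rewrite !rowE -e_i JI rcoordK.
have JE : J' = block_mx (ulsubmx J') (ursubmx J') (- ursubmx J') (ulsubmx J').
  rewrite -{1}(submxK J'); congr block_mx; apply/matrixP => l m; rewrite !mxE.
    have /(congr1 (@cRe R)) := Jr l m; rewrite cReM /= /ccoord !ev !od !mxE /=.
    by move=> ->; rewrite mul0r mul1r sub0r.
  have /(congr1 (@cIm R)) := Jr l m; rewrite cImM /= /ccoord !ev !od !mxE /=.
  by move=> ->; rewrite mul0r mul1r add0r.
rewrite JE; exact: det_complex_block.
Qed.

Lemma holo_jacobian (U : set 'rV[R]_6) (f : 'rV[R]_6 -> 'rV[R]_6)
    (c : 'rV[R]_6 -> 'I_3 -> C) z : open U -> U z -> differentiable f z ->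
  (forall y, U y -> f y = rcoord (c y)) -> (forall l, holo U (fun y => c y l)) ->
  0 <= \det ('J f z).
Proof.
move=> oU Uz df fE hc.
have dE w : 'D_w f z = rcoord (fun l => derC w (fun y => c y l) z).
  rewrite derive_mx; last exact: diff_derivable.
  apply/rowP => j; rewrite !mxE.
  have E : {near z, (fun t => f t 0 j) =1
      (fun y => if odd j then cIm (c y (inord j./2)) else cRe (c y (inord j./2)))}.
    have : nbhs z U by exact: open_nbhs_nbhs.
    by apply: filterS => y /fE ->; rewrite mxE.
  by rewrite (near_eq_derive _ E); case: (odd j).
apply: det_commute_i => v.
rewrite -(deriveEjacobian (imul v) df) -(deriveEjacobian v df) !dE.
rewrite /imul; congr rcoord; apply/funext => l; rewrite rcoordK.
by have [_ ->] := hc l.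
Qed.

Lemma unit_det_gt0 n (A : 'M[R]_n) : A \in unitmx -> 0 <= \det A -> 0 < \det A.
Proof. by rewrite unitmxE unitfE lt_def => -> ->. Qed.

Definition flag_trans s s' (z : 'rV[R]_6) : 'rV[R]_6 :=
  chart_map (flag_chart R s') (flag_param s z).

Definition flag_overlap s s' : set 'rV[R]_6 :=
  [set z | pvec s z 0 (s' 0) != 0 /\ qvec s z 0 (s' 2) != 0].

Lemma flag_overlapP s s' z :
  flag_overlap s s' z <-> chart_dom (flag_chart R s') (flag_param s z).
Proof. by apply: iff_sym; exact: flag_chart_dom (flag_param_pair s z). Qed.

Lemma flag_transE s s' z : flag_overlap s s' z ->
  flag_trans s s' z = pair_coord s' (pvec s z) (qvec s z).
Proof. by move/flag_overlapP; exact: flag_chart_coord (flag_param_pair s z). Qed.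

Lemma flag_param_trans s s' z : flag_overlap s s' z ->
  flag_param s' (flag_trans s s' z) = flag_param s z.
Proof.
move=> oz; rewrite (flag_transE oz); case: oz => p0 q2.
exact: (flag_param_coord (flag_param_pair s z) p0 q2).
Qed.

Lemma flag_transK s s' z : flag_overlap s s' z ->
  flag_overlap s' s (flag_trans s s' z) /\ flag_trans s' s (flag_trans s s' z) = z.
Proof.
move=> oz; split; first by apply/flag_overlapP; rewrite flag_param_trans //; exists z.
by rewrite {1}/flag_trans flag_param_trans // flag_chart_param.
Qed.

Lemma open_flag_overlap s s' : open (flag_overlap s s').
Proof.
rewrite (_ : flag_overlap s s' =
    (flag_param s : _ -> M) @^-1` chart_dom (flag_chart R s' : chart R 6 M)).
  apply: open_comp; first by move=> z _; exact: flag_param_continuous.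
  by have [[]] := flag_is_chart R s'.
by apply/seteqP; split=> z /flag_overlapP.
Qed.

Lemma flag_trans_smooth s s' : class_Coo (flag_overlap s s') (flag_trans s s').
Proof.
have oU := @open_flag_overlap s s'.
apply: (@smooth_into_flag R 6 _ (flag_param s) (pvec s) (qvec s) s' oU).
- by move=> z _; exact: flag_param_pair.
- by move=> i; exact: CooC_pvec.
- by move=> i; exact: CooC_qvec.
- by move=> z /flag_overlapP.
Qed.

(** The Cauchy-Riemann equations make the determinant nonnegative, and the opposite transition,
    being an inverse, makes it nonzero. *)
Lemma flag_trans_jacobian s s' z : flag_overlap s s' z ->
  0 < \det ('J (flag_trans s s') z).
Proof.
move=> oz; have oU := @open_flag_overlap s s'.
have [dT _] := @flag_trans_smooth s s' 1; have [dT' _] := @flag_trans_smooth s' s 1.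
have [oz' _] := flag_transK oz.
have gf : {near z, flag_trans s' s \o flag_trans s s' =1 id}.
  have : nbhs z (flag_overlap s s') by exact: open_nbhs_nbhs.
  by apply: filterS => y oy; have [_] := flag_transK oy.
have J1 := jacobian_unit (dT z oz) (dT' _ oz') gf.
pose cc (z : 'rV[R]_6) (l : 'I_3) : C := [:: pvec s z 0 (s' 1) / pvec s z 0 (s' 0);
  pvec s z 0 (s' 2) / pvec s z 0 (s' 0); - (qvec s z 0 (s' 1) / qvec s z 0 (s' 2))]`_l.
have tE y : flag_overlap s s' y -> flag_trans s s' y = rcoord (cc y) by exact: flag_transE.
have hp i : holo (flag_overlap s s') (fun z => pvec s z 0 i).
  move: i; apply: (@perm3_ind s); under [X in holo _ X]funext do rewrite pqvecE.
  - exact: holo_cst.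
  - exact: holo_coord.
  - exact: holo_coord.
have hq i : holo (flag_overlap s s') (fun z => qvec s z 0 i).
  move: i; apply: (@perm3_ind s); under [X in holo _ X]funext do rewrite pqvecE.
  - apply: holoD => //; first by apply: holoM => //; exact: holo_coord.
    by apply: holoN => //; exact: holo_coord.
  - by apply: holoN => //; exact: holo_coord.
  - exact: holo_cst.
have hc l : holo (flag_overlap s s') (fun z => cc z l).
  elim/ord3_ind: l; [| |apply: holoN => //]; apply: holoM => //;
    by apply: holoV => // y [].
have J2 := holo_jacobian oU oz (dT z oz) tE hc.
exact: unit_det_gt0 J1 J2.
Qed.

Lemma flag_orientable : orientable M.
Proof.
exists (cs_atlas (c := M)); split; first exact: flag_is_atlas.
  move=> _ [s _ <-]; split; first exact: flag_is_chart.
  by move=> _ [s' _ <-]; exact: flag_compatible.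
move=> _ _ L [s _ <-] [s' _ <-] [z _ <-] D'.
rewrite flag_chart_param; apply: flag_trans_jacobian.
exact/flag_overlapP.
Qed.

End FlagOrientation.

(** * Orbits of the torus *)

Section Radial.
Variable R : realType.
Implicit Types (x d : 'I_3 -> R) (r : R).

Definition radial_sum x d r : R := \sum_i Num.sqrt (x i ^+ 2 + 4 * r * d i).

Lemma radial_sum_lt x d r r' : (forall i, 0 <= d i) -> (exists i, 0 < d i) ->
  0 <= r -> r < r' -> radial_sum x d r < radial_sum x d r'.
Proof.
move=> d0 [k dk] r0 rr'; rewrite /radial_sum (bigD1 k) //= [ltRHS](bigD1 k) //=.
have r'0 : 0 <= r' by exact: le_trans (ltW rr').
apply: ltr_leD.
  rewrite ltr_sqrt; last by rewrite ltr_wpDl ?sqr_ge0 // !mulr_gt0 // (le_lt_trans r0).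
  by rewrite ltrD2l ltr_pM2r // ltr_pM2l.
apply: ler_sum => i _; rewrite ler_wsqrtr // lerD2l ler_wpM2r // ler_wpM2l //.
exact: ltW.
Qed.

Lemma radial_sum_inj x d r r' : (forall i, 0 <= d i) -> (exists i, 0 < d i) ->
  0 <= r -> 0 <= r' -> radial_sum x d r = radial_sum x d r' -> r = r'.
Proof.
move=> d0 dk r0 r'0 E; have [lt|gt|//] := ltgtP r r'.
  by have := radial_sum_lt x d0 dk r0 lt; rewrite E ltxx.
by have := radial_sum_lt x d0 dk r'0 gt; rewrite E ltxx.
Qed.

Lemma radial_sum0 x d : radial_sum x d 0 = \sum_i `|x i|.
Proof. by apply: eq_bigr => i _; rewrite mulr0 mul0r addr0 sqrtr_sqr. Qed.

(** Intermediate values between 0, where the sum is \sum_i |x_i|, and the inverse of [d k], where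
    the term [k] alone is at least the root of 4. *)
Lemma radial_ex x d : (forall i, 0 <= d i) -> (exists i, 0 < d i) ->
  \sum_i `|x i| <= 2 -> exists2 r, 0 <= r & radial_sum x d r = 2.
Proof.
move=> d0 [k dk] x2.
have fc : {within `[0, (d k)^-1], continuous (radial_sum x d)}.
  apply: continuous_subspaceT => r; apply: cts_sum => i _; apply: cts_sqrt.
  apply: ctsD; first exact: cts_cst.
  apply: ctsM; last exact: cts_cst.
  by apply: ctsM; [exact: cts_cst|exact: cvg_id].
have k0 : 0 <= (d k)^-1 by rewrite invr_ge0 d0.
have big2 : 2 <= radial_sum x d (d k)^-1.
  rewrite /radial_sum (bigD1 k) //=; apply: ler_wpDr.
    by apply: sumr_ge0 => i _; exact: sqrtr_ge0.
  rewrite -(mulrA 4) mulVf ?gt_eqF // mulr1 -{1}[2](ger0_norm) // -sqrtr_sqr ler_wsqrtr //.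
  by rewrite -natrX ler_wpDl ?sqr_ge0.
have [|r + rE] := @IVT R (radial_sum x d) 0 (d k)^-1 2 k0 fc.
  by rewrite radial_sum0 ge_min le_max x2 big2 orbT.
by rewrite in_itv /= => /andP[r0 _]; exists r.
Qed.

End Radial.

Section Orbits.
Variable R : realType.
Local Notation C := (Cplx R).
Local Notation V := 'rV[C]_3.
Local Notation M := (flag_manifold R).
Implicit Types (L : M) (p q c : V) (t : 'rV[C]_2).

(* The triple [p_i q_i], of sum 0, is proportional to [c]. *)
Definition matches p q c : Prop :=
  forall i j, p 0 i * q 0 i * c 0 j = p 0 j * q 0 j * c 0 i.

Lemma matches_lambda p q c : c != 0 -> matches p q c ->
  exists l, forall i, p 0 i * q 0 i = l * c 0 i.
Proof.
move=> /row_neq0P[k ck] m; exists (p 0 k * q 0 k / c 0 k) => i.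
by apply: (mulIf ck); rewrite m; field.
Qed.

Lemma matchesZ p q c (a b : C) : matches p q c -> matches (a *: p) (b *: q) c.
Proof.
move=> m i j; rewrite !mxE.
have := m i j; set x := c 0 i; set y := c 0 j => E.
transitivity (a * b * (p 0 i * q 0 i * y)); first by ring.
by rewrite E; ring.
Qed.

Lemma matchesZr p q c (a : C) : matches p q c -> matches p q (a *: c).
Proof.
move=> m i j; rewrite ![(a *: c) _ _]mxE mulrCA m; ring.
Qed.

Definition flag_matches L c : Prop := matches (flag_p L) (flag_q L) c.

Lemma flag_matchesP L p q c : plucker_pair L p q -> flag_matches L c <-> matches p q c.
Proof.
move=> pL; split=> m.
  by have [a [b [_ _ -> ->]]] := pair_uniq (flag_pqP L) pL; exact: matchesZ.
by have [a [b [_ _ pE qE]]] := pair_uniq pL (flag_pqP L); rewrite /flag_matches pE qE; exact: matchesZ.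
Qed.

Lemma flag_matchesZ L c (a : C) : a != 0 -> flag_matches L (a *: c) <-> flag_matches L c.
Proof.
move=> a0; split=> [|m]; last exact: matchesZr.
by move=> /(matchesZr a^-1); rewrite scalerA mulVf // scale1r.
Qed.

Lemma flag_matches_ex L : exists c, [/\ c != 0, \sum_i c 0 i = 0 & flag_matches L c].
Proof.
have pq := pair_dot (flag_pqP L).
have [|] := eqVneq (\row_i (flag_p L 0 i * flag_q L 0 i)) 0.
  (* All products vanish, so every class matches and (1, -1, 0) is an arbitrary choice. *)
  move=> /rowP z; exists (delta_mx 0 0 - delta_mx 0 1); split.
  - apply/row_neq0P; exists 0; by rewrite !mxE /= subr0 oner_eq0.
  - by rewrite sum_ord3 !mxE /=; ring.
  - by move=> i j; have := z i; have := z j; rewrite !mxE => -> ->; rewrite !mul0r.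
move=> pq0; exists (\row_i (flag_p L 0 i * flag_q L 0 i)); split => //.
  by rewrite -[RHS]pq /dotp; apply: eq_bigr => k _; rewrite mxE.
by move=> i j; rewrite !mxE mulrC.
Qed.

Definition height c (i : 'I_3) : R := normsq (c 0 i).

Lemma height_ge0 c i : 0 <= height c i. Proof. exact: normsq_ge0. Qed.
Lemma height_gt0 c : c != 0 -> exists i, 0 < height c i.
Proof. by move=> /row_neq0P[i ci]; exists i; rewrite /height normsq_gt0. Qed.

(* The weights of a flag are determined by its moment and by a single number
   [r >= 0], the root of [radial_sum x d r = 2]. *)
Lemma weights_radial L p q c : plucker_pair L p q -> c != 0 -> matches p q c ->
  exists r, [/\ 0 <= r, radial_sum (moment_x L) (height c) r = 2,
    (forall i, weight p i * weight q i = r * height c i) &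
    (forall i, weight p i + weight q i = Num.sqrt (moment_x L i ^+ 2 + 4 * r * height c i))].
Proof.
move=> pL c0 m; have [l lE] := matches_lambda c0 m; have [p0 q0 _ _] := pL.
have P0 := sum_normsq_gt0 p0; have Q0 := sum_normsq_gt0 q0.
set P := \sum_i normsq (p 0 i) in P0; set Q := \sum_i normsq (q 0 i) in Q0.
pose r := normsq l / (P * Q).
have uw i : weight p i * weight q i = r * height c i.
  rewrite /weight -/P -/Q /r /height mulf_div -normsqM lE normsqM.
  by rewrite mulrAC.
(* (u + w)^2 = (u - w)^2 + 4 u w. *)
have sE i : weight p i + weight q i = Num.sqrt (moment_x L i ^+ 2 + 4 * r * height c i).
  rewrite (moment_xE i pL) -mulrA -uw -[LHS]ger0_norm ?addr_ge0 ?weight_ge0 //.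
  by rewrite -sqrtr_sqr; congr Num.sqrt; ring.
exists r; split=> //; first by rewrite divr_ge0 ?normsq_ge0 // mulr_ge0 // ltW.
rewrite /radial_sum; under eq_bigr do rewrite -sE.
by rewrite big_split /= !sum_weight.
Qed.

Lemma moment_x_bound L : \sum_i `|moment_x L i| <= 2.
Proof.
have pL := flag_pqP L; have [p0 q0 _ _] := pL.
apply: (@le_trans _ _ (\sum_i (weight (flag_p L) i + weight (flag_q L) i))).
  apply: ler_sum => i _; rewrite (moment_xE i pL) (le_trans (ler_normB _ _)) //.
  by rewrite !ger0_norm ?weight_ge0.
by rewrite big_split /= !sum_weight.
Qed.

(** The root r gives the sums s_i of the weights, and the x_i are their differences; this determines
    the weights. Taking [p] real and putting the phase of c_i into q_i makes the products equal to
    sqrt(r) c_i, whose sum vanishes together with that of [c]. *)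
Lemma flag_radial_ex (x : 'I_3 -> R) c : \sum_i x i = 0 -> \sum_i `|x i| <= 2 ->
  c != 0 -> \sum_i c 0 i = 0 ->
  exists L, (forall i, moment_x L i = x i) /\ flag_matches L c.
Proof.
move=> x0 x2 c0 cs.
have [r r0 rE] := radial_ex (height_ge0 c) (height_gt0 c0) x2.
pose s i := Num.sqrt (x i ^+ 2 + 4 * r * height c i).
pose u i := (s i + x i) / 2; pose w i := (s i - x i) / 2.
have sx i : `|x i| <= s i.
  rewrite -sqrtr_sqr ler_wsqrtr // lerDl !mulr_ge0 ?height_ge0 //.
have u0 i : 0 <= u i by have := sx i; rewrite ler_norml /u => /andP[]; lra.
have w0 i : 0 <= w i by have := sx i; rewrite ler_norml /w => /andP[]; lra.
have uw i : u i * w i = r * height c i.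
  have s2 : s i ^+ 2 = x i ^+ 2 + 4 * r * height c i.
    by rewrite sqr_sqrtr // addr_ge0 ?sqr_ge0 // !mulr_ge0 ?height_ge0.
  have -> : u i * w i = (s i ^+ 2 - x i ^+ 2) / 4 by rewrite /u /w; field.
  by rewrite s2; field.
have us : \sum_i u i = 1.
  rewrite -mulr_suml big_split /= x0 addr0 -[\sum_i s i]/(radial_sum x (height c) r) rE.
  by rewrite divff.
have ws : \sum_i w i = 1.
  rewrite -mulr_suml sumrB x0 subr0 -[\sum_i s i]/(radial_sum x (height c) r) rE.
  by rewrite divff.
pose n i : C := mkC (Num.sqrt (height c i)) 0.
pose p : V := \row_i mkC (Num.sqrt (u i)) 0.
(* Where c_i = 0 there is no phase to use, and 1 stands in for it. *)
pose q : V := \row_i (mkC (Num.sqrt (w i)) 0 * (if c 0 i == 0 then 1 else c 0 i / n i)).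
have nn i : normsq (n i) = height c i.
  by rewrite /normsq /= expr0n addr0 sqr_sqrtr ?height_ge0.
have mkM (a b : R) : mkC a 0 * mkC b 0 = mkC (a * b) 0.
  by apply: cplxP; rewrite ?cReM ?cImM /=; ring.
have pn i : normsq (p 0 i) = u i.
  by rewrite mxE /normsq /= expr0n addr0 sqr_sqrtr.
have qn i : normsq (q 0 i) = w i.
  rewrite mxE normsqM {1}/normsq /= expr0n addr0 sqr_sqrtr //.
  case: eqP => [_|/eqP ci]; first by rewrite normsq1 mulr1.
  by rewrite normsqM normsqV nn /height divff ?mulr1 // normsq_eq0.
have pqE i : p 0 i * q 0 i = mkC (Num.sqrt r) 0 * c 0 i.
  rewrite !mxE mulrA mkM -sqrtrM // uw sqrtrM // -mkM -/(n i).
  case: eqP => [ci|/eqP ci].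
    by rewrite ci mulr0 /n /height ci normsq0 sqrtr0 mulr0 mul0r.
  have ni : n i != 0 by rewrite -normsq_eq0 nn /height normsq_eq0.
  by rewrite -mulrA [n i * _]mulrC divfK.
have p0 : p != 0.
  apply/eqP => p0; move: us; under eq_bigr do rewrite -pn p0 mxE normsq0.
  by rewrite sumr_const mul0rn => /eqP; rewrite eq_sym oner_eq0.
have q0 : q != 0.
  apply/eqP => q0; move: ws; under eq_bigr do rewrite -qn q0 mxE normsq0.
  by rewrite sumr_const mul0rn => /eqP; rewrite eq_sym oner_eq0.
have pq : dotp p q = 0.
  by rewrite /dotp; under eq_bigr do rewrite pqE; rewrite -mulr_sumr cs mulr0.
have [L pL] := pair_ex p0 q0 pq; exists L; split.
  move=> i; rewrite (moment_xE i pL) /weight; under eq_bigr do rewrite pn.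
  under [X in _ - _ / X]eq_bigr do rewrite qn.
  by rewrite us ws pn qn /u /w !divr1; field.
apply/(flag_matchesP c pL) => i j; rewrite !pqE; ring.
Qed.

Definition ext_torus t : V := \row_j [:: t 0 0; t 0 1; 1]`_j.

Lemma ext_torusE t : ext_torus t = row_mx t (const_mx 1 : 'rV[C]_1).
Proof.
apply/rowP => j; rewrite mxE; elim/ord3_ind: j => /=.
- rewrite (_ : (0 : 'I_3) = lshift 1 (0 : 'I_2)); last exact/val_inj.
  by rewrite (row_mxEl t (const_mx 1 : 'rV[C]_1)).
- rewrite (_ : (1 : 'I_3) = lshift 1 (1 : 'I_2)); last exact/val_inj.
  by rewrite (row_mxEl t (const_mx 1 : 'rV[C]_1)).
- rewrite (_ : (2 : 'I_3) = rshift 2 (0 : 'I_1)); last exact/val_inj.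
  by rewrite (row_mxEr t (const_mx 1 : 'rV[C]_1)) mxE.
Qed.

Lemma ext_torus_neq0 t : (forall j, t 0 j != 0) -> forall j, ext_torus t 0 j != 0.
Proof. by move=> t0 j; rewrite mxE; elim/ord3_ind: j => //=; exact: oner_neq0. Qed.

Lemma T2_action_pair t L p q : (forall j, t 0 j != 0) -> plucker_pair L p q ->
  plucker_pair (T2_action t L) (\row_j (p 0 j * ext_torus t 0 j))
    (\row_j (q 0 j / ext_torus t 0 j)).
Proof.
move=> t0 pL; rewrite /T2_action -ext_torusE; apply: T3_action_pair => //.
exact: ext_torus_neq0.
Qed.

Lemma torus_neq0 t : torus t -> forall j, t 0 j != 0.
Proof. by move=> tT j; rewrite -normr_gt0 tT. Qed.

Lemma torus_normsq k (t : 'rV[C]_k) : torus t <-> forall j, normsq (t 0 j) = 1.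
Proof. by split=> H j; apply/norm1P; exact: H. Qed.

Lemma normsq_ext_torus t : torus t -> forall j, normsq (ext_torus t 0 j) = 1.
Proof.
move=> /torus_normsq tT j; rewrite mxE; elim/ord3_ind: j => //=; exact: normsq1.
Qed.

(** Here [t] lies in T^3. Dividing it by its last coordinate gives an element of T^2 and only
    rescales the two vectors. *)
Lemma same_orbitP L L' p q p' q' (t : V) : plucker_pair L p q -> plucker_pair L' p' q' ->
  (forall j, normsq (t 0 j) = 1) -> (forall j, p' 0 j = p 0 j * t 0 j) ->
  (forall j, q' 0 j * t 0 j = q 0 j) -> same_orbit (@T2_action R) L L'.
Proof.
move=> pL pL' tn pE qE.
have t0 j : t 0 j != 0 by rewrite -normsq_gt0 tn.
pose u : 'rV[C]_2 := \row_(j < 2) (t 0 (lshift 1 j) / t 0 2).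
have l0 : lshift 1 (0 : 'I_2) = (0 : 'I_3) by exact/val_inj.
have l1 : lshift 1 (1 : 'I_2) = (1 : 'I_3) by exact/val_inj.
have uE j : ext_torus u 0 j = t 0 j / t 0 2.
  by rewrite mxE; elim/ord3_ind: j => /=; rewrite ?mxE ?l0 ?l1 ?divff.
have uT : torus u.
  by apply/torus_normsq => j; rewrite mxE normsqM normsqV !tn invr1 mulr1.
exists u => //; have pu := T2_action_pair (torus_neq0 uT) pL.
apply: (pair_inj pu).
have := pair_scale (invr_neq0 (t0 2)) (t0 2) pL'.
congr plucker_pair; apply/rowP => j; rewrite [LHS]mxE [RHS]mxE uE ?pE.
  by rewrite mulrC mulrA.
by rewrite -qE; field; rewrite !t0.
Qed.

Lemma pair_unit L : exists p q, [/\ plucker_pair L p q, \sum_i normsq (p 0 i) = 1 &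
  \sum_i normsq (q 0 i) = 1].
Proof.
have pL := flag_pqP L; have [p0 q0 _ _] := pL.
pose n p : C := mkC (Num.sqrt (\sum_i normsq (p 0 i)))^-1 0.
have nn p : p != 0 -> normsq (n p) = (\sum_i normsq (p 0 i))^-1.
  move=> /sum_normsq_gt0 s0; rewrite /normsq /= expr0n addr0 exprVn sqr_sqrtr //.
  exact: ltW.
have n0 p : p != 0 -> n p != 0.
  by move=> p1; rewrite -normsq_gt0 nn // invr_gt0 sum_normsq_gt0.
have s1 p : p != 0 -> \sum_i normsq ((n p *: p) 0 i) = 1.
  move=> p1; under eq_bigr do rewrite mxE normsqM nn //.
  by rewrite -mulr_sumr mulVf // gt_eqF // sum_normsq_gt0.
exists (n (flag_p L) *: flag_p L), (n (flag_q L) *: flag_q L); split; rewrite ?s1 //.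
by apply: pair_scale => //; exact: n0.
Qed.

(** The root r is unique, so the two flags have equal weights, and unit vectors for them have
    coordinates of equal moduli. What remains is to absorb the phases into a torus element. *)
Lemma flag_radial_uniq L L' c : c != 0 -> flag_matches L c -> flag_matches L' c ->
  (forall i, moment_x L i = moment_x L' i) -> same_orbit (@T2_action R) L L'.
Proof.
move=> c0 mL mL' xE.
have [p [q [pL p1 q1]]] := pair_unit L; have [p' [q' [pL' p'1 q'1]]] := pair_unit L'.
have m := (flag_matchesP c pL).1 mL; have m' := (flag_matchesP c pL').1 mL'.
have [l lE] := matches_lambda c0 m; have [l' l'E] := matches_lambda c0 m'.
have [r [r0 rS uw sE]] := weights_radial pL c0 m.
have [r' [r'0 rS' uw' sE']] := weights_radial pL' c0 m'.
have rr' : r = r'.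
  apply: (@radial_sum_inj _ (moment_x L) _ _ _ (height_ge0 c) (height_gt0 c0) r0 r'0).
  rewrite rS -rS'; apply: eq_bigr => i _; by rewrite xE.
have wE (v : V) i : \sum_i normsq (v 0 i) = 1 -> weight v i = normsq (v 0 i).
  by move=> v1; rewrite /weight v1 divr1.
have pn i : normsq (p 0 i) = normsq (p' 0 i).
  have := sE i; have := sE' i; have := xE i; rewrite rr' xE => _ <-.
  have := moment_xE i pL; have := moment_xE i pL'; rewrite xE => ->.
  by rewrite !wE //; lra.
have qn i : normsq (q 0 i) = normsq (q' 0 i).
  have := sE i; have := sE' i; have := xE i; rewrite rr' xE => _ <-.
  have := moment_xE i pL; have := moment_xE i pL'; rewrite xE => ->.
  by rewrite !wE //; lra.
have [k ck] := height_gt0 c0.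
have ln : normsq l = normsq l'.
  have H : normsq l * normsq (c 0 k) = normsq l' * normsq (c 0 k).
    by rewrite -!normsqM -lE -l'E !normsqM pn qn.
  exact: (mulIf (lt0r_neq0 ck)) H.
(* After rotating [q'] the two triples of products agree. *)
have [e [e1 eE]] : exists e : C, normsq e = 1 /\ e * l' = l.
  have [l0|l0] := eqVneq l' 0.
    exists 1; split; first exact: normsq1.
    by rewrite l0 mulr0; apply/esym/eqP; rewrite -normsq_eq0 ln l0 normsq0.
  exists (l / l'); split; last by rewrite divfK.
  by rewrite normsqM normsqV ln divff // normsq_eq0.
have e0 : e != 0 by rewrite -normsq_gt0 e1.
pose q2 := e *: q'.
have pL2 : plucker_pair L' p' q2.
  by have := pair_scale (oner_neq0 _) e0 pL'; rewrite scale1r.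
have q2n i : normsq (q2 0 i) = normsq (q 0 i).
  by rewrite mxE normsqM e1 mul1r qn.
have pq i : p' 0 i * q2 0 i = p 0 i * q 0 i.
  by rewrite mxE mulrCA l'E lE mulrA eE.
(* Where neither coordinate vanishes, both quotients are the same number because the products agree.
   Where both vanish any phase would do. *)
pose t : V := \row_i (if p 0 i != 0 then p' 0 i / p 0 i
                      else if q 0 i != 0 then q 0 i / q2 0 i else 1).
have nz (a b : C) : normsq a = normsq b -> a != 0 -> b != 0.
  by move=> ab; rewrite -normsq_gt0 ab normsq_gt0.
have n1 (a b : C) : normsq a = normsq b -> a != 0 -> normsq (b / a) = 1.
  by move=> ab a0; rewrite normsqM normsqV ab divff // -ab normsq_eq0.
apply: (same_orbitP pL pL2 (t := t)) => j; rewrite [t 0 j]mxE.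
- case: ifP => [pj|_]; first exact: n1.
  case: ifP => [qj|_]; last exact: normsq1.
  by apply: n1; rewrite ?q2n //; apply: nz qj; rewrite q2n.
- case: ifP => [pj|/negbFE/eqP pj]; first by rewrite mulrC divfK.
  by rewrite pj mul0r; apply/eqP; rewrite -normsq_eq0 -pn pj normsq0.
- case: ifP => [pj|_]; first by rewrite mulrA [_ * p' _ _]mulrC pq mulrAC divff // mul1r.
  case: ifP => [qj|/negbFE/eqP qj].
    by rewrite mulrC divfK //; apply: nz qj; rewrite q2n.
  by rewrite mulr1 qj; apply/eqP; rewrite -normsq_eq0 q2n qj normsq0.
Qed.

Lemma moment_x_action t L i : torus t -> moment_x (T2_action t L) i = moment_x L i.
Proof.
move=> tT; have pL := flag_pqP L.
rewrite (moment_xE i (T2_action_pair (torus_neq0 tT) pL)) (moment_xE i pL).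
have tn := normsq_ext_torus tT.
congr (_ - _); rewrite /weight mxE normsqM ?normsqV tn ?invr1 mulr1; congr (_ / _);
  by apply: eq_bigr => j _; rewrite mxE normsqM ?normsqV tn ?invr1 mulr1.
Qed.

Lemma flag_matches_action t L c : torus t ->
  flag_matches (T2_action t L) c <-> flag_matches L c.
Proof.
move=> tT; have pL := flag_pqP L; have t0 := torus_neq0 tT.
rewrite (flag_matchesP c (T2_action_pair t0 pL)) (flag_matchesP c pL).
have e0 := ext_torus_neq0 t0.
have E i : (\row_j (flag_p L 0 j * ext_torus t 0 j)) 0 i *
    (\row_j (flag_q L 0 j / ext_torus t 0 j)) 0 i = flag_p L 0 i * flag_q L 0 i.
  by rewrite [X in X * _]mxE [X in _ * X]mxE; field; exact: e0.
by split=> m i j; have := m i j; rewrite !E.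
Qed.

Lemma torus_mulP (s t : 'rV[C]_2) : torus s -> torus t -> torus (torus_mul s t).
Proof.
move=> /torus_normsq sT /torus_normsq tT; apply/torus_normsq => j.
by rewrite mxE normsqM sT tT mulr1.
Qed.

Lemma T2_torus_action : torus_action (@T2_action R).
Proof.
have ext1 j : ext_torus (torus_one R 2) 0 j = 1.
  by rewrite mxE; elim/ord3_ind: j; rewrite /= ?mxE.
have extM (s t : 'rV[C]_2) j : ext_torus (torus_mul s t) 0 j = ext_torus s 0 j * ext_torus t 0 j.
  by rewrite !mxE; elim/ord3_ind: j; rewrite /= ?mxE ?mulr1.
split=> [L|s t L sT tT]; have pL := flag_pqP L.
  have o0 j : torus_one R 2 0 j != 0 by rewrite mxE oner_eq0.
  apply: (pair_inj (T2_action_pair o0 pL)).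
  move: pL; congr plucker_pair; apply/rowP => j;
    by rewrite [RHS]mxE ext1 ?divr1 ?mulr1.
have s0 := torus_neq0 sT; have t0 := torus_neq0 tT.
apply: (pair_inj (T2_action_pair (torus_neq0 (torus_mulP sT tT)) pL)).
have := T2_action_pair s0 (T2_action_pair t0 pL).
congr plucker_pair; apply/rowP => j; rewrite [LHS]mxE [X in X * _]mxE [RHS]mxE extM.
  by rewrite mulrAC mulrA.
by rewrite invfM mulrA mulrAC.
Qed.

Definition torus_inv k (t : 'rV[C]_k) : 'rV[C]_k := \row_j (t 0 j)^-1.

Lemma torus_invP k (t : 'rV[C]_k) : torus t -> torus (torus_inv t).
Proof.
move=> /torus_normsq tT; apply/torus_normsq => j.
by rewrite mxE normsqV tT invr1.
Qed.

Lemma T2_actionK (t : 'rV[C]_2) : torus t ->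
  cancel (T2_action t) (T2_action (torus_inv t) : M -> M).
Proof.
move=> tT L; have [a1 aM] := T2_torus_action.
have E : torus_mul (torus_inv t) t = torus_one R 2.
  by apply/rowP => j; rewrite !mxE mulVf // torus_neq0.
by rewrite -aM ?E ?a1 //; exact: torus_invP.
Qed.

Lemma same_orbit_refl L : same_orbit (@T2_action R) L L.
Proof.
have [a1 _] := T2_torus_action; exists (torus_one R 2) => //.
by apply/torus_normsq => j; rewrite mxE normsq1.
Qed.

Lemma same_orbit_sym L L' :
  same_orbit (@T2_action R) L L' -> same_orbit (@T2_action R) L' L.
Proof.
by move=> [t tT <-]; exists (torus_inv t); [exact: torus_invP|exact: T2_actionK].
Qed.

Lemma same_orbit_trans L L' L'' : same_orbit (@T2_action R) L L' ->
  same_orbit (@T2_action R) L' L'' -> same_orbit (@T2_action R) L L''.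
Proof.
move=> [t tT <-] [s sT <-]; have [_ aM] := T2_torus_action.
by exists (torus_mul s t); [exact: torus_mulP|exact: aM].
Qed.

Lemma orbit_eqP L L' : qclass (same_orbit (@T2_action R)) L =
  qclass (same_orbit (@T2_action R)) L' <-> same_orbit (@T2_action R) L L'.
Proof.
rewrite qclassP; apply: equiv_class_eq.
- exact: same_orbit_refl.
- exact: same_orbit_sym.
- exact: same_orbit_trans.
Qed.

End Orbits.

(** * The orbit space *)

Section ContinuityAtAPoint.
Variables (T S U : topologicalType).

Lemma cts_comp (f : T -> S) (g : S -> U) (x : T) :
  {for x, continuous f} -> {for f x, continuous g} ->
  {for x, continuous (fun y => g (f y))}.
Proof. exact: continuous_comp. Qed.

Lemma cts_fst (f : T -> S * U) (x : T) :
  {for x, continuous f} -> {for x, continuous (fun y => (f y).1)}.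
Proof. by move=> fc; apply: continuous_comp fc _; exact: cvg_fst. Qed.

Lemma cts_snd (f : T -> S * U) (x : T) :
  {for x, continuous f} -> {for x, continuous (fun y => (f y).2)}.
Proof. by move=> fc; apply: continuous_comp fc _; exact: cvg_snd. Qed.

Lemma cts_pair (f : T -> S) (g : T -> U) (x : T) :
  {for x, continuous f} -> {for x, continuous g} ->
  {for x, continuous (fun y => (f y, g y))}.
Proof. exact: cvg_pair. Qed.

Lemma cts_id (x : T) : {for x, continuous (fun y => y)}.
Proof. exact: cvg_id. Qed.

End ContinuityAtAPoint.

Lemma cjV (R : realType) (z : Cplx R) : cj z^-1 = (cj z)^-1.
Proof.
have E : normsq (cj z) = normsq z by rewrite /normsq /= sqrrN.
apply: cplxP; first by rewrite [RHS]cReV E -[LHS]/(cRe z^-1) cReV.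
by rewrite [RHS]cImV E -[LHS]/(- cIm z^-1) cImV -[cIm (cj z)]/(- cIm z) !mulNr.
Qed.

(** * The projective line as triples of sum 0 up to scalars *)

Section ProjectiveLine.
Variable R : realType.
Local Notation C := (Cplx R).
Local Notation CP1 := (CP R 1).
Implicit Types (k : CP1).

(* [v] in C^2 is turned into a triple of sum 0. *)
Definition triple (v : 'rV[C]_2) : 'rV[C]_3 :=
  \row_j [:: v 0 0; v 0 1; - v 0 0 - v 0 1]`_j.

Lemma triple0 v : triple v 0 0 = v 0 0. Proof. by rewrite mxE. Qed.
Lemma triple1 v : triple v 0 1 = v 0 1. Proof. by rewrite mxE. Qed.
Lemma triple2 v : triple v 0 2 = - v 0 0 - v 0 1. Proof. by rewrite mxE. Qed.
Definition tripleE := (triple0, triple1, triple2).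

Lemma sum_triple v : \sum_i triple v 0 i = 0.
Proof. by rewrite sum_ord3 !tripleE; ring. Qed.

Lemma row2P (u v : 'rV[C]_2) : u 0 0 = v 0 0 -> u 0 1 = v 0 1 -> u = v.
Proof.
move=> e0 e1; apply/rowP => -[[|[|//]] lt].
  by rewrite (_ : Ordinal lt = 0) //; exact/val_inj.
by rewrite (_ : Ordinal lt = 1) //; exact/val_inj.
Qed.

Lemma triple_inj : injective triple.
Proof.
move=> u v /rowP E; apply: row2P.
  by have := E 0; rewrite !tripleE.
by have := E 1; rewrite !tripleE.
Qed.

Lemma tripleZ (a : C) v : triple (a *: v) = a *: triple v.
Proof. by apply: row3P; rewrite [RHS]mxE !tripleE !mxE; ring. Qed.

Lemma triple_neq0 v : v <> 0 -> triple v != 0.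
Proof.
move=> v0; apply/eqP => E; apply: v0; apply: triple_inj; rewrite E.
by rewrite -[in RHS](scale0r 0) tripleZ scale0r.
Qed.

Lemma proportional_equiv (v w : nonzero_vectors R 1) :
  qclass (@proportional R 1) v = qclass (@proportional R 1) w <-> proportional v w.
Proof.
rewrite qclassP; apply: equiv_class_eq.
- by move=> x; exists 1; split; [exact/eqP/oner_neq0|rewrite scale1r].
- move=> x y [a [/eqP a0 yE]]; exists a^-1; split; first exact/eqP/invr_neq0.
  by rewrite yE scalerA mulVf // scale1r.
- move=> x y z [a [/eqP a0 yE]] [b [/eqP b0 zE]]; exists (b * a); split.
    by apply/eqP; rewrite mulf_neq0.
  by rewrite zE yE scalerA.
Qed.

Definition CPvec k : 'rV[C]_3 := triple (set_val (sval (cid (qclass_surj k)))).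

Lemma CPvec_neq0 k : CPvec k != 0.
Proof. by apply: triple_neq0; exact: set_valP (sval (cid (qclass_surj k))). Qed.

Lemma sum_CPvec k : \sum_i CPvec k 0 i = 0.
Proof. exact: sum_triple. Qed.

Lemma CPvec_class v : exists2 a, a != 0 &
  CPvec (qclass (@proportional R 1) v) = a *: triple (set_val v).
Proof.
have /proportional_equiv[a [/eqP a0 E]] :=
  svalP (cid (qclass_surj (qclass (@proportional R 1) v))).
exists a^-1; first exact: invr_neq0.
by rewrite /CPvec E tripleZ scalerA mulVf // scale1r.
Qed.

Lemma CPvec_inj k k' (a : C) : a != 0 -> CPvec k' = a *: CPvec k -> k' = k.
Proof.
move=> a0; rewrite /CPvec -tripleZ => /triple_inj E.
rewrite -(svalP (cid (qclass_surj k))) -(svalP (cid (qclass_surj k'))); apply/esym.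
by apply/proportional_equiv; exists a; split; [exact/eqP|].
Qed.

Lemma CPvec_surj (c : 'rV[C]_3) : c != 0 -> \sum_i c 0 i = 0 ->
  exists k, exists2 a, a != 0 & CPvec k = a *: c.
Proof.
move=> c0; rewrite sum_ord3 => cs.
pose v : 'rV[C]_2 := \row_(j < 2) c 0 (lshift 1 j).
have l0 : lshift 1 (0 : 'I_2) = (0 : 'I_3) by exact/val_inj.
have l1 : lshift 1 (1 : 'I_2) = (1 : 'I_3) by exact/val_inj.
have tv : triple v = c.
  apply: row3P; rewrite !tripleE !mxE ?l0 ?l1 //.
  by apply/eqP; rewrite -subr_eq0 -oppr_eq0 -cs; apply/eqP; ring.
have v0 : v <> 0.
  move=> v0; move: c0; rewrite -tv v0 -[X in triple X](scale0r 0) tripleZ scale0r.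
  by rewrite eqxx.
have [a a0 E] := CPvec_class (exist _ v (mem_set v0) : nonzero_vectors R 1).
by exists (qclass (@proportional R 1) (exist _ v (mem_set v0))), a; rewrite // E set_valE /= tv.
Qed.

(** Unlike the representative [CPvec], picked by choice, the entries of the projector are continuous
    in the class; together they separate classes. *)
Definition CP_entry k i j : C := proj_entry (CPvec k) i j.

Lemma CP_entry_class v i j :
  CP_entry (qclass (@proportional R 1) v) i j = proj_entry (triple (set_val v)) i j.
Proof. by rewrite /CP_entry; have [a a0 ->] := CPvec_class v; exact: proj_entryZ. Qed.

Lemma CP_entry_continuous i j : continuous (fun k => CP_entry k i j).
Proof.
apply: quot_cts => v.
have vc m : {for v, continuous (fun w : nonzero_vectors R 1 => set_val w 0 m)}.
  by apply: cts_coord; exact: continuous_set_val.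
rewrite (_ : _ \o _ = fun w => proj_entry (triple (set_val w)) i j); last first.
  by apply/funext => w; exact: CP_entry_class.
apply: (@cts_proj_entry R _ (fun w : nonzero_vectors R 1 => triple (set_val w))).
  by apply: triple_neq0; exact: (set_valP v).
move=> l; elim/ord3_ind: l; under [X in {for _, continuous X}]funext do rewrite tripleE.
- exact: vc.
- exact: vc.
- exact: (ctsCD (ctsCN (vc 0)) (ctsCN (vc 1))).
Qed.

Lemma CP_entry_inj k k' : (forall i j, CP_entry k i j = CP_entry k' i j) -> k = k'.
Proof.
move=> H; have [a a0 E] := proj_entry_inj (CPvec_neq0 k) (CPvec_neq0 k') H.
by rewrite (CPvec_inj a0 E).
Qed.

Lemma hausdorff_CP1 : hausdorff_space CP1.
Proof.
pose f k : 'rV[R]_#|{: bool * 'I_3 * 'I_3}| := \row_m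
  let: (b, i, j) := enum_val m in
  if b then cRe (CP_entry k i j) else cIm (CP_entry k i j).
apply: (@injective_hausdorff _ _ f); last exact: hausdorff_rV.
  move=> k; apply: continuous_row => m; under [X in {for _, continuous X}]funext do rewrite mxE.
  case: (enum_val m) => -[b i] j.
  by case: b; [exact: (cts_cRe (@CP_entry_continuous i j k))|exact: (cts_cIm (@CP_entry_continuous i j k))].
move=> k k' /rowP E; apply: CP_entry_inj => i j; apply: cplxP.
  by have := E (enum_rank (true, i, j)); rewrite !mxE enum_rankK.
by have := E (enum_rank (false, i, j)); rewrite !mxE enum_rankK.
Qed.

(** Two boxes cover: dividing by the coordinate of larger modulus brings the other one into the unit
    disc. *)
Lemma compact_CP1 : compact [set: CP1].
Proof.
pose vec (b : bool) (y : 'rV[R]_2) : 'rV[C]_2 :=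
  \row_(j < 2) if (j == 0) == b then 1 else mkC (y 0 0) (y 0 1).
have vec_neq0 b y : vec b y <> 0.
  move=> /rowP /(_ (if b then 0 else 1)); rewrite !mxE.
  by case: b => /= /eqP; rewrite oner_eq0.
pose cl b y : CP1 := qclass (@proportional R 1) (exist _ (vec b y) (mem_set (vec_neq0 b y))).
pose box : set 'rV[R]_2 := [set y | forall i, `[(-1), 1]%classic (y 0 i)].
have cbox : compact box.
  exact: (@rV_compact R 2 (fun=> `[(-1), 1]%classic) (fun=> @segment_compact R (-1) 1)).
have clc b : continuous (cl b).
  move=> y; apply: (@cts_comp _ _ _ (fun y => exist _ (vec b y) (mem_set (vec_neq0 b y)) :
    nonzero_vectors R 1) (qclass (@proportional R 1))); last exact: qclass_continuous.
  apply: cts_set_type; apply: cts_mx => i j.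
  under [X in {for _, continuous X}]funext do rewrite set_valE /= mxE.
  case: (_ == b); first exact: cts_const.
  by apply: cts_mkC; exact: coord_continuous.
have -> : [set: CP1] = cl true @` box `|` cl false @` box.
  apply/seteqP; split=> // k _; have [v <-] := qclass_surj k.
  have [a b /eqP v0] : [/\ True, True & set_val v != 0] by split=> //; exact/eqP/(set_valP v).
  set x := set_val v 0 0; set y := set_val v 0 1.
  have in_box (w z : C) : z != 0 -> normsq w <= normsq z ->
      box (\row_(j < 2) if j == 0 then cRe (w / z) else cIm (w / z)).
    move=> z0 wz; have : normsq (w / z) <= 1.
      by rewrite normsqM normsqV ler_pdivrMr ?mul1r // normsq_gt0.
    move=> n1 j; rewrite /= mxE in_itv /=.
    by move: n1; rewrite /normsq => n1; case: ifP => _; apply/andP; split; nra.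
  have both : x = 0 -> y = 0 -> False by move=> ex ey; apply: v0; apply: row2P; rewrite ?ex ?ey mxE.
  have r2 (F : 'I_2 -> R) : (\row_j F j) 0 0 = F 0 /\ (\row_j F j) 0 1 = F 1 by rewrite !mxE.
  have [xy|yx] := leP (normsq y) (normsq x).
    have x0 : x != 0.
      apply/eqP => x0; move: xy; rewrite x0 normsq0 => y0; apply: (both x0).
      by apply/eqP; rewrite -normsq_eq0 eq_le y0 normsq_ge0.
    left; exists (\row_(j < 2) if j == 0 then cRe (y / x) else cIm (y / x)); first exact: in_box.
    apply/proportional_equiv; exists x; split; first exact/eqP.
    apply: row2P; rewrite set_valE /= !mxE /= ?mulr1 //.
    by rewrite mkCK mulrC divfK.
  have y0 : y != 0 by rewrite -normsq_gt0 (le_lt_trans (normsq_ge0 x)).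
  right; exists (\row_(j < 2) if j == 0 then cRe (x / y) else cIm (x / y)).
    by apply: in_box => //; exact: ltW.
  apply/proportional_equiv; exists y; split; first exact/eqP.
  apply: row2P; rewrite set_valE /= !mxE /= ?mulr1 //.
  by rewrite mkCK mulrC divfK.
by apply: compactU; apply: continuous_compact => //; exact: continuous_subspaceT.
Qed.

End ProjectiveLine.

Section OrbitSpace.
Variable R : realType.
Local Notation C := (Cplx R).
Local Notation V := 'rV[C]_3.
Local Notation M := (flag_manifold R).
Local Notation CP1 := (CP R 1).
Local Notation orbits := (orbit_space (@T2_action R)).
Implicit Types (L : M) (k : CP1) (t : 'rV[C]_2).

Definition orb L : orbits := qclass (same_orbit (@T2_action R)) L.

Lemma orb_continuous : continuous orb.
Proof. exact: qclass_continuous. Qed.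

(** The chart around a flag supplies vectors that are continuous nearby, in place of the chosen
    ones. *)
Lemma near_pair L : exists p q : M -> V, [/\ \forall L' \near L, plucker_pair L' (p L') (q L'),
  forall l, {for L, continuous (fun L' => p L' 0 l)} &
  forall l, {for L, continuous (fun L' => q L' 0 l)}].
Proof.
have [s DL _] := box_chart L; have [[oD _] cK mc _] := flag_is_chart R s.
exists (fun L' => pvec s (chart_map (flag_chart R s) L')).
exists (fun L' => qvec s (chart_map (flag_chart R s) L')); split.
- have : nbhs L (chart_dom (flag_chart R s : chart R 6 M)) by exact: open_nbhs_nbhs.
  apply: filterS => L' DL'; have := flag_param_pair s (chart_map (flag_chart R s) L').
  by rewrite -[flag_param s _]/(chart_inv (flag_chart R s) _) cK ?inE.
- move=> l; have H := (Coo_continuous (proj1 (@CooC_pvec R s l setT openT)) I).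
  have H' := (Coo_continuous (proj2 (@CooC_pvec R s l setT openT)) I).
  apply: (@continuous_comp _ _ _ (chart_map (flag_chart R s)) (fun z => pvec s z 0 l)).
    exact: mc.
  exact: cts_complex (H _) (H' _).
- move=> l; have H := (Coo_continuous (proj1 (@CooC_qvec R s l setT openT)) I).
  have H' := (Coo_continuous (proj2 (@CooC_qvec R s l setT openT)) I).
  apply: (@continuous_comp _ _ _ (chart_map (flag_chart R s)) (fun z => qvec s z 0 l)).
    exact: mc.
  exact: cts_complex (H _) (H' _).
Qed.

Lemma T2_action_cts (t : 'rV[C]_2) L : (forall j, t 0 j != 0) ->
  {for (t, L), continuous (fun z : 'rV[C]_2 * M => T2_action z.1 z.2)}.
Proof.
move=> t0; have [p [q [pL pc qc]]] := near_pair L.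
have c1 : {for (t, L), continuous (fun z : 'rV[C]_2 * M => z.1)} by exact: cvg_fst.
have c2 : {for (t, L), continuous (fun z : 'rV[C]_2 * M => z.2)} by exact: cvg_snd.
have tc j : {for (t, L), continuous (fun z : 'rV[C]_2 * M => z.1 0 j)} by exact: cts_coord.
have ec j : {for (t, L), continuous (fun z : 'rV[C]_2 * M => ext_torus z.1 0 j)}.
  under [X in {for _, continuous X}]funext do rewrite mxE.
  by elim/ord3_ind: j; [exact: tc|exact: tc|exact: cts_const].
have pc' l : {for (t, L), continuous (fun z : 'rV[C]_2 * M => p z.2 0 l)}.
  exact: (@continuous_comp _ _ _ snd (fun L' => p L' 0 l) (t, L) c2 (pc l)).
have qc' l : {for (t, L), continuous (fun z : 'rV[C]_2 * M => q z.2 0 l)}.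
  exact: (@continuous_comp _ _ _ snd (fun L' => q L' 0 l) (t, L) c2 (qc l)).
apply: (@cts_flag R _ _ (fun z : 'rV[C]_2 * M => \row_j (p z.2 0 j * ext_torus z.1 0 j))
  (fun z => \row_j (q z.2 0 j / ext_torus z.1 0 j))).
- have N1 : \forall z \near (t, L), plucker_pair z.2 (p z.2) (q z.2) by exact: (c2 _ pL).
  have nz j : \forall z \near (t, L), (z : 'rV[C]_2 * M).1 0 j != 0.
    have oz : open [set z : C | z != 0].
      rewrite (_ : mkset _ = ~` [set 0]); last first.
        by apply/seteqP; split=> z /=; [move/eqP|move/eqP].
      apply/closed_openC/accessible_closed_set1/hausdorff_accessible.
      exact: norm_hausdorff.
    exact: (tc j _ (open_nbhs_nbhs (conj oz (t0 j)))).
  near=> z; apply: T2_action_pair; last by near: z.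
  by near: z; apply: filter_forall.
- move=> l; under [X in {for _, continuous X}]funext do rewrite mxE.
  exact: ctsCM.
- move=> l; under [X in {for _, continuous X}]funext do rewrite mxE.
  exact: (ctsCM (qc' l) (ctsCV (ext_torus_neq0 t0 l) (ec l))).
Unshelve. all: by end_near. Qed.

Lemma T2_action_continuous t : (forall j, t 0 j != 0) -> continuous (T2_action t : M -> M).
Proof.
move=> t0 L; apply: (@cts_comp _ _ _ (fun L' : M => (t, L'))
  (fun z : 'rV[C]_2 * M => T2_action z.1 z.2)); last exact: T2_action_cts.
by apply: cts_pair; [exact: cts_const|exact: cts_id].
Qed.

Lemma orb_open (U : set M) : open U -> open (orb @` U).
Proof.
move=> oU; apply/open_quot.
rewrite (_ : _ @^-1` _ = \bigcup_(t in @torus R 2) (T2_action t @^-1` U)).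
  apply: bigcup_open => t tT; apply: open_comp => // L _.
  by apply: T2_action_continuous; exact: torus_neq0.
apply/seteqP; split=> [L [L' UL' /orbit_eqP/same_orbit_sym[t tT tL]]|L [t tT UL]].
  by exists t; rewrite // /preimage /= tL.
exists (T2_action t L) => //; apply/orbit_eqP/same_orbit_sym.
by exists t.
Qed.

Definition inv_idx := ('I_3 + 'I_3 + (bool * 'I_3 * 'I_3))%type.

(** Torus invariants that separate orbits. The entry (i, j) of the first projector is multiplied by
    t_i times the conjugate of t_j, that of the second by the inverse, so the entrywise product of
    the two is invariant. *)
Definition flag_inv L (m : inv_idx) : R :=
  match m with
  | inl (inl i) => weight (flag_p L) i
  | inl (inr i) => weight (flag_q L) i
  | inr (b, i, j) =>
      let e := proj_entry (flag_p L) i j * proj_entry (flag_q L) i j in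
      if b then cRe e else cIm e
  end.

Lemma flag_inv_continuous m : continuous (fun L => flag_inv L m).
Proof.
case: m => [[i|i]|[[b i] j]] L.
- exact: weight_p_continuous.
- exact: weight_q_continuous.
- have H := ctsCM (@proj_p_continuous R i j L) (@proj_q_continuous R i j L).
  by case: b; [exact: (cts_cRe H)|exact: (cts_cIm H)].
Qed.

Lemma flag_inv_orbit L L' m : same_orbit (@T2_action R) L L' -> flag_inv L m = flag_inv L' m.
Proof.
move=> [t tT <-]; have pL := flag_pqP L.
have pL' := T2_action_pair (torus_neq0 tT) pL.
have [a [b [a0 b0 pE qE]]] := pair_uniq pL' (flag_pqP (T2_action t L)).
have tn := normsq_ext_torus tT; have e0 := ext_torus_neq0 (torus_neq0 tT).
have jj i : ext_torus t 0 i * cj (ext_torus t 0 i) = 1 by rewrite mul_conj tn.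
have np (v : V) : \sum_l normsq ((\row_j (v 0 j * ext_torus t 0 j)) 0 l) = \sum_l normsq (v 0 l).
  by apply: eq_bigr => l _; rewrite [X in normsq X]mxE normsqM tn mulr1.
have nq (v : V) : \sum_l normsq ((\row_j (v 0 j / ext_torus t 0 j)) 0 l) = \sum_l normsq (v 0 l).
  by apply: eq_bigr => l _; rewrite [X in normsq X]mxE normsqM normsqV tn invr1 mulr1.
have Pp i j : proj_entry (flag_p (T2_action t L)) i j =
    ext_torus t 0 i * cj (ext_torus t 0 j) * proj_entry (flag_p L) i j.
  rewrite pE proj_entryZ // /proj_entry np [X in X * cj _]mxE [X in cj X]mxE cjM; ring.
have Pq i j : proj_entry (flag_q (T2_action t L)) i j =
    (ext_torus t 0 i * cj (ext_torus t 0 j))^-1 * proj_entry (flag_q L) i j.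
  rewrite qE proj_entryZ // /proj_entry nq [X in X * cj _]mxE [X in cj X]mxE cjM cjV invfM; ring.
have tt i j : ext_torus t 0 i * cj (ext_torus t 0 j) != 0.
  by rewrite mulf_neq0 // -(inj_eq (mulfI (e0 j))) jj mulr0 oner_neq0.
case: m => [[i|i]|[[c i] j]] /=.
- by rewrite -!proj_entry_diag Pp jj mul1r.
- by rewrite -!proj_entry_diag Pq jj invr1 mul1r.
- have -> : proj_entry (flag_p (T2_action t L)) i j * proj_entry (flag_q (T2_action t L)) i j =
      proj_entry (flag_p L) i j * proj_entry (flag_q L) i j.
    rewrite Pp Pq; move: (tt i j); set x := _ * cj _ => x0; field; exact: x0.
  by [].
Qed.

(** The weights give equal moments. If some p_k q_k is nonzero, column [k] of the entrywise product
    of the projectors is proportional to (p_i q_i), so one class matches both flags; otherwise all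
    products vanish for both and every class does. Then [flag_radial_uniq] applies. *)
Lemma flag_inv_inj L L' : (forall m, flag_inv L m = flag_inv L' m) ->
  same_orbit (@T2_action R) L L'.
Proof.
move=> H; have pL := flag_pqP L; have pL' := flag_pqP L'.
have [p0 q0 _ _] := pL; have [p'0 q'0 _ _] := pL'.
have xE i : moment_x L i = moment_x L' i.
  rewrite (moment_xE i pL) (moment_xE i pL').
  by rewrite [weight _ _](H (inl (inl i))) [X in _ - X = _](H (inl (inr i))).
have mE i j : proj_entry (flag_p L) i j * proj_entry (flag_q L) i j =
    proj_entry (flag_p L') i j * proj_entry (flag_q L') i j.
  by apply: cplxP; [exact: (H (inr (true, i, j)))|exact: (H (inr (false, i, j)))].
have z (i : 'I_3) : flag_p L 0 i * flag_q L 0 i = 0 <-> flag_p L' 0 i * flag_q L' 0 i = 0.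
  have W : weight (flag_p L) i * weight (flag_q L) i =
      weight (flag_p L') i * weight (flag_q L') i.
    by rewrite [weight (flag_p L) i](H (inl (inl i))) [weight (flag_q L) i](H (inl (inr i))).
  have Z (v w : V) : v != 0 -> w != 0 ->
      (v 0 i * w 0 i == 0) = (weight v i * weight w i == 0).
    by move=> v0 w0; rewrite mulf_eq0 [RHS]mulf_eq0 !weight_eq0.
  have e : (flag_p L 0 i * flag_q L 0 i == 0) = (flag_p L' 0 i * flag_q L' 0 i == 0).
    by rewrite !Z // W.
  by split=> /eqP E; apply/eqP; rewrite ?e // -e.
have [[k kn]|all0] := pselect (exists k : 'I_3, flag_p L 0 k * flag_q L 0 k <> 0); last first.
  have a0 (k : 'I_3) : flag_p L 0 k * flag_q L 0 k = 0.
    by apply: contrapT => kn; apply: all0; exists k.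
  have [c [c0 _ mc]] := flag_matches_ex L.
  apply: flag_radial_uniq c0 mc _ xE => i j.
  by rewrite !(z _).1 ?mul0r.
have kn' : flag_p L' 0 k * flag_q L' 0 k <> 0 by move/z.
pose c : V := \row_i (flag_p L 0 i * flag_q L 0 i).
have c0 : c != 0 by apply/row_neq0P; exists k; rewrite mxE; exact/eqP.
(* The factor common to column [k]: entry (i, k) of the product of projectors is p_i q_i times
   [a]. *)
pose a := cj (flag_p L 0 k) * cj (flag_q L 0 k) * (mkC (\sum_l normsq (flag_p L 0 l)) 0)^-1 *
  (mkC (\sum_l normsq (flag_q L 0 l)) 0)^-1.
pose b := cj (flag_p L' 0 k) * cj (flag_q L' 0 k) * (mkC (\sum_l normsq (flag_p L' 0 l)) 0)^-1 *
  (mkC (\sum_l normsq (flag_q L' 0 l)) 0)^-1.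
have ab i : flag_p L 0 i * flag_q L 0 i * a = flag_p L' 0 i * flag_q L' 0 i * b.
  have := mE i k; rewrite /proj_entry /a /b => E.
  transitivity (flag_p L 0 i * cj (flag_p L 0 k) * (mkC (\sum_l normsq (flag_p L 0 l)) 0)^-1 *
     (flag_q L 0 i * cj (flag_q L 0 k) * (mkC (\sum_l normsq (flag_q L 0 l)) 0)^-1)); first by ring.
  by rewrite E; ring.
have a_neq0 : a != 0.
  have cn (y : C) : y != 0 -> cj y != 0.
    by move=> y0; apply/eqP => -[/eqP yr /eqP]; rewrite oppr_eq0 => /eqP yi;
      case/eqP: y0; apply: cplxP => //; exact/eqP.
  have sn (v : V) : v != 0 -> (mkC (\sum_l normsq (v 0 l)) 0)^-1 != 0 :> C.
    by move=> v0; rewrite invr_neq0 //; apply/eqP => -[] /eqP; rewrite gt_eqF // sum_normsq_gt0.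
  have /eqP := kn; rewrite mulf_eq0 negb_or => /andP[pk qk].
  by rewrite !mulf_neq0 ?cn ?sn.
have mL : flag_matches L c by move=> i j; rewrite !mxE mulrC.
apply: flag_radial_uniq c0 mL _ xE => i j; rewrite !mxE.
apply: (mulIf a_neq0); rewrite -[LHS]mulrA -[RHS]mulrA !ab; ring.
Qed.

Lemma hausdorff_orbits : hausdorff_space orbits.
Proof.
pose f L : 'rV[R]_#|{: inv_idx}| := \row_m flag_inv L (enum_val m).
have fc : continuous f.
  move=> L; apply: continuous_row => m; under [X in {for _, continuous X}]funext do rewrite mxE.
  exact: flag_inv_continuous.
have fo L L' : same_orbit (@T2_action R) L = same_orbit (@T2_action R) L' -> f L = f L'.
  move/qclassP/orbit_eqP => LL'; apply/rowP => m; rewrite !mxE; exact: flag_inv_orbit.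
have [g gE] := quot_lift fo.
apply: (@injective_hausdorff _ _ g); last exact: hausdorff_rV.
  apply: quot_cts; rewrite (_ : g \o _ = f) //.
  by apply/funext => L; exact: gE.
move=> o o'; have [L <-] := qclass_surj o; have [L' <-] := qclass_surj o'.
rewrite !gE => /rowP E; apply/orbit_eqP/flag_inv_inj => m.
by have := E (enum_rank m); rewrite !mxE enum_rankK.
Qed.

Definition CP_matches L k : Prop := flag_matches L (CPvec k).

Lemma CP_matches_ex L : exists k, CP_matches L k.
Proof.
have [c [c0 cs m]] := flag_matches_ex L.
have [k [a a0 kE]] := CPvec_surj c0 cs.
by exists k; rewrite /CP_matches kE; apply/flag_matchesZ.
Qed.

(** The matching equations, multiplied by suitable conjugate factors, are equations between
    projector entries and so closed. Unless all products p_i q_i vanish, some choice of [l] and [n]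
    makes the factor nonzero and gives the original equations back. *)
Lemma CP_matches_closed : closed [set z : M * CP1 | CP_matches z.1 z.2].
Proof.
pose m L i j := proj_entry (flag_p L) i j * proj_entry (flag_q L) i j.
pose F i j l n (z : M * CP1) : C :=
  m z.1 i l * CP_entry z.2 j n - m z.1 j l * CP_entry z.2 i n.
have Fc i j l n : continuous (F i j l n).
  move=> z.
  have c1 : {for z, continuous (fun z : M * CP1 => z.1)} by exact: cvg_fst.
  have c2 : {for z, continuous (fun z : M * CP1 => z.2)} by exact: cvg_snd.
  have mc i' l' : {for z, continuous (fun z : M * CP1 => m z.1 i' l')}.
    apply: (@continuous_comp _ _ _ fst (fun L => m L i' l') z c1).
    exact: (ctsCM (@proj_p_continuous R i' l' z.1) (@proj_q_continuous R i' l' z.1)).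
  have ec i' l' : {for z, continuous (fun z : M * CP1 => CP_entry z.2 i' l')}.
    exact: (@continuous_comp _ _ _ snd (fun k => CP_entry k i' l') z c2 (@CP_entry_continuous R i' l' z.2)).
  exact: (ctsCD (ctsCM (mc _ _) (ec _ _)) (ctsCN (ctsCM (mc _ _) (ec _ _)))).
have cl0 : closed [set 0 : C].
  by apply: accessible_closed_set1; apply: hausdorff_accessible; exact: norm_hausdorff.
rewrite (_ : mkset _ = \bigcap_(x in [set: 'I_3 * 'I_3 * 'I_3 * 'I_3])
    F x.1.1.1 x.1.1.2 x.1.2 x.2 @^-1` [set 0]).
  by apply: closed_bigI => x _; apply: closed_comp => // z _; exact: Fc.
have key L i l : m L i l = flag_p L 0 i * flag_q L 0 i *
    (cj (flag_p L 0 l) * cj (flag_q L 0 l) * ((mkC (\sum_l normsq (flag_p L 0 l)) 0)^-1 *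
     (mkC (\sum_l normsq (flag_q L 0 l)) 0)^-1)).
  by rewrite /m /proj_entry; ring.
apply/seteqP; split=> [[L k] mLk [[[i j] l] n] _|[L k] H].
  rewrite /preimage /= /F /CP_entry /proj_entry /= !key.
  have E := mLk i j.
  set A := cj (flag_p L 0 l) * _ * _; set B := cj (CPvec k 0 n); set N := _^-1.
  transitivity ((flag_p L 0 i * flag_q L 0 i * CPvec k 0 j - flag_p L 0 j * flag_q L 0 j * CPvec k 0 i)
    * A * B * N); first by ring.
  by rewrite E subrr !mul0r.
have [p0 q0 _ _] := flag_pqP L.
have cn (y : C) : y != 0 -> cj y != 0.
  by move=> y0; apply/eqP => -[/eqP yr /eqP]; rewrite oppr_eq0 => /eqP yi;
    case/eqP: y0; apply: cplxP => //; exact/eqP.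
have sn (v : V) : v != 0 -> (mkC (\sum_l normsq (v 0 l)) 0)^-1 != 0 :> C.
  by move=> v0; rewrite invr_neq0 //; apply/eqP => -[] /eqP; rewrite gt_eqF // sum_normsq_gt0.
have [[l ln]|all0] := pselect (exists l : 'I_3, flag_p L 0 l * flag_q L 0 l <> 0); last first.
  have a0 i : flag_p L 0 i * flag_q L 0 i = 0.
    by apply: contrapT => kn; apply: all0; exists i.
  by move=> i j; rewrite !a0 !mul0r.
have /eqP := ln; rewrite mulf_eq0 negb_or => /andP[pl ql].
have [n kn] := row_neq0P _ (CPvec_neq0 k).
move=> i j; have /= := H (i, j, l, n) I; rewrite /F /CP_entry /proj_entry /= !key.
set A := cj (flag_p L 0 l) * _ * _.
have A0 : A != 0 by rewrite !mulf_neq0 ?cn ?sn.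
set B := cj (CPvec k 0 n); have B0 : B != 0 by exact: cn.
set N := (mkC _ 0)^-1; have N0 : N != 0 by exact/sn/CPvec_neq0.
move=> E; apply/eqP; rewrite -subr_eq0; apply/eqP.
apply: (mulIf A0); apply: (mulIf B0); apply: (mulIf N0); rewrite !mul0r -[RHS]E; ring.
Qed.

Definition hexagon : set 'rV[R]_2 := [set y | \sum_i `|plane_x y i| <= 2].

Lemma flag_moment_hexagon L : hexagon (flag_moment_map L).
Proof.
rewrite /hexagon /=; under eq_bigr do rewrite plane_x_moment.
exact: moment_x_bound.
Qed.

Lemma orbit_of_ex (y : 'rV[R]_2) k : hexagon y ->
  exists L, flag_moment_map L = y /\ CP_matches L k.
Proof.
move=> hy; have [L [Lx Lm]] := flag_radial_ex (sum_plane_x y) hy (CPvec_neq0 k) (sum_CPvec k).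
exists L; split=> //; rewrite flag_moment_mapE -[RHS]plane_yK; congr plane_y.
exact/funext.
Qed.

Lemma orbit_of_uniq L L' k : flag_moment_map L = flag_moment_map L' ->
  CP_matches L k -> CP_matches L' k -> orb L = orb L'.
Proof.
move=> E m m'; apply/orbit_eqP; apply: flag_radial_uniq (CPvec_neq0 k) m m' _ => i.
by rewrite -!plane_x_moment E.
Qed.

Definition orbit_of (z : hexagon * CP1) : orbits :=
  orb (sval (cid (orbit_of_ex z.2 (set_valP z.1)))).

Lemma orbit_ofE (z : hexagon * CP1) L : flag_moment_map L = set_val z.1 ->
  CP_matches L z.2 -> orbit_of z = orb L.
Proof.
move=> LE Lm; have [E m] := svalP (cid (orbit_of_ex z.2 (set_valP z.1))).
by apply: orbit_of_uniq m Lm; rewrite LE.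
Qed.

Lemma orbit_ofP (z : hexagon * CP1) : exists L, [/\ orbit_of z = orb L,
  flag_moment_map L = set_val z.1 & CP_matches L z.2].
Proof.
have [E m] := svalP (cid (orbit_of_ex z.2 (set_valP z.1))).
by exists (sval (cid (orbit_of_ex z.2 (set_valP z.1)))).
Qed.

Lemma flag_moment_continuous : continuous (@flag_moment_map R : M -> _).
Proof.
move=> L; apply: continuous_row => j.
rewrite (_ : (fun _ => _) = fun L' => 1 +
    (weight (flag_p L') (lshift 1 j) - weight (flag_q L') (lshift 1 j))).
  apply: ctsD; first exact: cts_cst.
  by apply: ctsB; [exact: weight_p_continuous|exact: weight_q_continuous].
by apply/funext => L'; rewrite flag_moment_mapE mxE (moment_xE _ (flag_pqP L')).
Qed.

(** The compact set [Z] of matching pairs of a flag and a class maps onto the hexagon times CP^1,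
    and through this map [orbit_of] becomes the projection to orbits. *)
Lemma orbit_of_continuous : continuous orbit_of.
Proof.
pose Z : set (M * CP1) := [set z | CP_matches z.1 z.2].
pose phi (z : Z) : hexagon * CP1 :=
  (exist _ (flag_moment_map (set_val z).1) (mem_set (flag_moment_hexagon (set_val z).1)),
   (set_val z).2).
have vc (z : Z) : {for z, continuous (set_val : Z -> _)} by exact: continuous_set_val.
have c1 (z : Z) : {for z, continuous (fun z : Z => (set_val z).1)}.
  exact: (cts_fst (vc z)).
have c2 (z : Z) : {for z, continuous (fun z : Z => (set_val z).2)}.
  exact: (cts_snd (vc z)).
apply: (@compact_graph_continuous _ _ _ phi (fun z => orb (set_val z).1)).
- apply: compact_set_type; apply: (subclosed_compact CP_matches_closed
    (compact_setX (@compact_flag R) (@compact_CP1 R))) => -[]; by [].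
- apply: hausdorff_prod; last exact: hausdorff_CP1.
  apply: (injective_hausdorff (@continuous_set_val _ hexagon)); last exact: hausdorff_rV.
  exact: set_val_inj.
- move=> z; suff f1 : {for z, continuous (fun z : Z => (phi z).1)}.
    exact: (cts_pair f1 (c2 z)).
  apply: cts_set_type.
  exact: (cts_comp (c1 z) (@flag_moment_continuous (set_val z).1)).
- move=> z; exact: (cts_comp (c1 z) (@orb_continuous (set_val z).1)).
- move=> [y k]; have [L [LE Lm]] := orbit_of_ex k (set_valP y).
  exists (exist _ (L, k) (mem_set Lm)); congr (_, _); apply: set_val_inj.
  by rewrite !set_valE.
- by move=> z; apply: orbit_ofE; rewrite ?set_valE //; exact: (set_valP z).
Qed.

(** Fix a class [k] that matches a flag of [U]. As the moment moves slightly in the hexagon, the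
    orbit with class [k] moves continuously and keeps meeting [U]. *)
Lemma flag_moment_open (U : set M) : open U ->
  exists2 W, open W & @flag_moment_map R @` U = range (@flag_moment_map R : M -> _) `&` W.
Proof.
move=> oU.
exists (\bigcup_(W in [set W : set 'rV[R]_2 | open W /\ W `&` hexagon `<=` @flag_moment_map R @` U]) W).
  by apply: bigcup_open => W [].
apply/seteqP; split=> [_ [L UL <-]|y [[L _ <-] [W [oW WU] WL]]]; last first.
  by apply: WU; split=> //; exact: flag_moment_hexagon.
split; first by exists L.
have [k mk] := CP_matches_ex L.
pose y0 : hexagon := exist _ (flag_moment_map L) (mem_set (flag_moment_hexagon L)).
have oE : orbit_of (y0, k) = orb L by apply: orbit_ofE; rewrite ?set_valE.
have N : nbhs (y0, k) (orbit_of @^-1` (orb @` U)).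
  apply: orbit_of_continuous; apply: open_nbhs_nbhs; split; first exact: orb_open.
  by rewrite oE; exists L.
case: N => -[A B] /= [NA NB] AB.
case: NA => A' [[W oW WA'] /= A'y] A'A.
exists W; last by move: A'y; rewrite -WA' /preimage /= set_valE.
split=> // y [Wy hy]; pose y1 : hexagon := exist _ y (mem_set hy).
have : (orb @` U) (orbit_of (y1, k)).
  apply: AB; split=> /=; last exact: nbhs_singleton.
  by apply: A'A; rewrite -WA' /preimage /= set_valE.
have [L1 [-> L1E _]] := orbit_ofP (y1, k).
move=> [L2 UL2 /orbit_eqP[t tT L12]]; exists L2 => //.
rewrite -[RHS](_ : flag_moment_map L1 = y); last by rewrite L1E set_valE.
rewrite -L12 !flag_moment_mapE; congr plane_y; apply/funext => i.
by rewrite moment_x_action.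
Qed.

End OrbitSpace.

(** * The join of the circle and the projective line *)

Lemma homeomorphic_sym (X Y : topologicalType) : homeomorphic X Y -> homeomorphic Y X.
Proof. by move=> [f [fc [g [fK gK gc]]]]; exists g; split=> //; exists f. Qed.

Lemma matches_row_uniq (R : realType) (p q c c' : 'rV[Cplx R]_3) :
  (exists i, p 0 i * q 0 i != 0) -> c != 0 -> c' != 0 ->
  matches p q c -> matches p q c' -> exists2 a, a != 0 & c' = a *: c.
Proof.
move=> [i pqi] c0 c'0 m m'.
have [l lE] := matches_lambda c0 m; have [l' l'E] := matches_lambda c'0 m'.
have l0 : l != 0 by apply: contraNneq pqi => l0; rewrite lE l0 mul0r.
have l'0 : l' != 0 by apply: contraNneq pqi => l'0; rewrite l'E l'0 mul0r.
exists (l / l'); first by rewrite mulf_neq0 // invr_neq0.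
by apply/rowP => j; rewrite mxE; apply: (mulfI l'0); rewrite -l'E lE mulrA mulrCA divff // mulr1.
Qed.

Section Join.
Variable R : realType.
Local Notation C := (Cplx R).
Local Notation M := (flag_manifold R).
Local Notation CP1 := (CP R 1).
Local Notation S1 := (circle R).
Local Notation I := (unit_interval R).
Local Notation J := (join R S1 CP1).
Implicit Types (z : S1) (k : CP1) (t : I).

(** Termwise |u - w| <= u + w for nonnegative weights, with equality exactly when u w = 0, and the
    right-hand sides add up to 2. *)
Lemma moment_boundary (L : M) : \sum_i `|moment_x L i| = 2 <->
  forall i, flag_p L 0 i * flag_q L 0 i = 0.
Proof.
have pL := flag_pqP L; have [p0 q0 _ _] := pL.
have S2 : \sum_i (weight (flag_p L) i + weight (flag_q L) i) = 2.
  by rewrite big_split /= !sum_weight.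
have pq0 i : (flag_p L 0 i * flag_q L 0 i == 0) = (weight (flag_p L) i * weight (flag_q L) i == 0).
  by rewrite mulf_eq0 [RHS]mulf_eq0 !weight_eq0.
have nle i : `|moment_x L i| <= weight (flag_p L) i + weight (flag_q L) i.
  by rewrite (moment_xE i pL) (le_trans (ler_normB _ _)) // !ger0_norm ?weight_ge0.
have nE i : (`|moment_x L i| == weight (flag_p L) i + weight (flag_q L) i) =
    (weight (flag_p L) i * weight (flag_q L) i == 0).
  rewrite (moment_xE i pL); have u0 := weight_ge0 (flag_p L) i.
  have w0 := weight_ge0 (flag_q L) i.
  set u := weight _ i in u0 *; set w := weight _ i in w0 *.
  rewrite -(eqrXn2 (n := 2)) ?addr_ge0 // real_normK ?num_real // -subr_eq0.
  have -> : (u - w) ^+ 2 - (u + w) ^+ 2 = - (4 * (u * w)) by ring.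
  by rewrite oppr_eq0 mulf_eq0 pnatr_eq0.
split=> [S i|pq].
  apply/eqP; rewrite pq0 -nE eq_le nle /= leNgt; apply/negP => lt.
  have : \sum_i `|moment_x L i| < \sum_i (weight (flag_p L) i + weight (flag_q L) i).
    rewrite (bigD1 i) //= [ltRHS](bigD1 i) //=; apply: ltr_leD => //.
    by apply: ler_sum => j _; exact: nle.
  by rewrite S S2 ltxx.
by rewrite -S2; apply: eq_bigr => i _; apply/eqP; rewrite nE -pq0 pq.
Qed.

Lemma orbit_of_boundary (y : @hexagon R) k k' : \sum_i `|plane_x (set_val y) i| = 2 ->
  orbit_of (y, k) = orbit_of (y, k').
Proof.
move=> y2; have [L [-> LE _]] := orbit_ofP (y, k); apply/esym/orbit_ofE => //=.
have /moment_boundary z : \sum_i `|moment_x L i| = 2.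
  by rewrite -y2 -[set_val y]LE; apply: eq_bigr => i _; rewrite plane_x_moment.
by move=> i j; rewrite !z !mul0r.
Qed.

Lemma orbit_of_inj (z z' : @hexagon R * CP1) : orbit_of z = orbit_of z' ->
  z.1 = z'.1 /\ (\sum_i `|plane_x (set_val z.1) i| < 2 -> z.2 = z'.2).
Proof.
have [L [-> LE m]] := orbit_ofP z; have [L' [-> LE' m']] := orbit_ofP z'.
move=> /orbit_eqP[t tT tL].
have E : z.1 = z'.1.
  apply: set_val_inj; rewrite -LE -LE' -tL !flag_moment_mapE; congr plane_y.
  by apply/funext => i; rewrite moment_x_action.
split=> // lt2.
have m2 : CP_matches L z'.2 by apply/(flag_matches_action _ _ tT); rewrite tL.
have [i pqi] : exists i, flag_p L 0 i * flag_q L 0 i != 0.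
  apply: contrapT => H; move: lt2; rewrite -LE.
  suff S : \sum_i `|moment_x L i| = 2.
    by under eq_bigr do rewrite plane_x_moment; rewrite S ltxx.
  apply/moment_boundary => i; apply/eqP/negPn/negP => pqi; apply: H; by exists i.
have [a a0 aE] := matches_row_uniq (ex_intro _ i pqi) (CPvec_neq0 z'.2) (CPvec_neq0 z.2) m2 m.
exact: CPvec_inj a0 aE.
Qed.

Definition circle_pt (w : C) (e : normsq w = 1) : S1 :=
  exist _ w (mem_set ((norm1P w).2 e)).

Definition interval_pt (t : R) (e : 0 <= t <= 1) : I := exist _ t (mem_set e).

Definition circle_x z (j : 'I_3) : R :=
  [:: cRe (set_val z); cIm (set_val z); - cRe (set_val z) - cIm (set_val z)]`_j.

Definition circle_norm z : R := \sum_j `|circle_x z j|.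

Lemma circle_normsq z : normsq (set_val z) = 1.
Proof. by apply/norm1P; exact: set_valP z. Qed.

Lemma circle_x01 z : circle_x z 0 ^+ 2 + circle_x z 1 ^+ 2 = 1.
Proof. exact: circle_normsq. Qed.

Lemma circle_norm_gt0 z : 0 < circle_norm z.
Proof.
rewrite lt_def sumr_ge0 ?andbT //; apply/eqP => /eqP; rewrite psumr_eq0 // => /allP H.
have x0 j : circle_x z j = 0.
  by have := H j (mem_index_enum j) => /= /eqP/normr0_eq0.
have := circle_normsq z; rewrite /normsq -[cRe _]/(circle_x z 0) -[cIm _]/(circle_x z 1).
by rewrite !x0 expr0n /= addr0 => /eqP; rewrite eq_sym oner_eq0.
Qed.

(** Scaled so that the point has l^1 norm [2 * (1 - t)]. At [t = 0] it runs over the boundary of the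
    hexagon, where classes are identified, and at [t = 1] it is the centre, as in the collapses of
    the join. *)
Definition disc_radius z t : R := 2 * (1 - set_val t) / circle_norm z.

Definition disc_point z t : 'rV[R]_2 := plane_y (fun j => disc_radius z t * circle_x z j).

Lemma interval_bound t : 0 <= set_val t <= 1.
Proof. exact: set_valP t. Qed.

Lemma disc_plane_x z t j : plane_x (disc_point z t) j = disc_radius z t * circle_x z j.
Proof.
by rewrite plane_xK // -mulr_sumr sum_ord3 /circle_x /=; ring.
Qed.

Lemma disc_sum z t : \sum_i `|plane_x (disc_point z t) i| = 2 * (1 - set_val t).
Proof.
have /andP[t0 t1] := interval_bound t; have n0 := circle_norm_gt0 z.
under eq_bigr do rewrite disc_plane_x normrM.
rewrite -mulr_sumr -/(circle_norm z) ger0_norm /disc_radius ?divfK ?gt_eqF //.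
by rewrite divr_ge0 ?(ltW n0) // mulr_ge0 // subr_ge0.
Qed.

Lemma disc_hexagon z t : hexagon (disc_point z t).
Proof.
rewrite /hexagon /= disc_sum; have /andP[t0 t1] := interval_bound t; lra.
Qed.

Definition join_orbit (a : S1 * CP1 * I) : orbit_space (@T2_action R) :=
  orbit_of (exist _ (disc_point a.1.1 a.2) (mem_set (disc_hexagon a.1.1 a.2)), a.1.2).

Lemma cts_circle_x j : continuous (fun z => circle_x z j).
Proof.
move=> z; have vc : {for z, continuous (set_val : S1 -> C)} by exact: continuous_set_val.
have c0 := cts_cRe vc; have c1 := cts_cIm vc.
elim/ord3_ind: j; [exact: c0|exact: c1|exact: (ctsB (ctsN c0) c1)].
Qed.

Lemma cts_circle_norm : continuous circle_norm.
Proof. by move=> z; apply: cts_sum => j _; apply: cts_norm; exact: cts_circle_x. Qed.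

Lemma join_orbit_continuous : continuous join_orbit.
Proof.
move=> a; have ac := @cts_id _ a; have a1 := cts_fst ac; have a2 := cts_snd ac.
have az := cts_fst a1; have ak := cts_snd a1.
suff f1 : {for a, continuous (fun a : S1 * CP1 * I =>
    exist _ (disc_point a.1.1 a.2) (mem_set (disc_hexagon a.1.1 a.2))   : @hexagon R)}.
  exact: (cts_comp (cts_pair f1 ak) (@orbit_of_continuous R _)).
apply: cts_set_type; apply: continuous_row => j.
have rc := ctsM (ctsM (@cts_cst R _ 2 a) (ctsB (@cts_cst R _ 1 a) (cts_comp a2 (@continuous_set_val _ _ _))))
  (@ctsV R _ (fun a : S1 * CP1 * I => circle_norm a.1.1) a (lt0r_neq0 (circle_norm_gt0 _))
    (cts_comp az (@cts_circle_norm _))).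
have H i := ctsD (@cts_cst R _ 1 a) (ctsM rc (cts_comp az (@cts_circle_x i _))).
move: (H (widen_ord (isT : (2 <= 3)%N) j)); congr (continuous_at a _).
by apply/funext => y; rewrite set_valE /= mxE.
Qed.

Lemma join_relP (X Y : topologicalType) (a b : X * Y * I) :
  qclass (@join_rel R X Y) a = qclass (@join_rel R X Y) b <-> join_rel a b.
Proof.
rewrite qclassP; apply: equiv_class_eq => [x|x y [e f g]|x y w [e f g] [e' f' g']].
- by split.
- by split=> [|h|h]; rewrite // ?f ?g // e.
- split=> [|h|h]; first by rewrite e.
    by rewrite f // f' // -e.
  by rewrite g // g' // -e.
Qed.

Lemma join_orbit_rel a b : join_rel a b -> join_orbit a = join_orbit b.
Proof.
case: a b => [[z k] t] [[z' k'] t'] [/= <- ez ek].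
have [t1|t1] := eqVneq (set_val t) 1.
  have t0 : set_val t <> 0 by rewrite t1; exact/eqP/oner_neq0.
  rewrite /join_orbit /= (ek t0); congr orbit_of; congr (_, _); apply: set_val_inj.
  rewrite !set_valE /=; congr plane_y; apply/funext => j.
  by rewrite /disc_radius t1 subrr mulr0 !mul0r.
have [t0|t0] := eqVneq (set_val t) 0; last by rewrite (ez (elimN eqP t1)) (ek (elimN eqP t0)).
rewrite (ez (elimN eqP t1)); apply: orbit_of_boundary.
by rewrite set_valE /= disc_sum t0 subr0 mulr1.
Qed.

Lemma join_orbit_inj a b : join_orbit a = join_orbit b -> join_rel a b.
Proof.
case: a b => [[z k] t] [[z' k'] t'] /orbit_of_inj [/= /(congr1 set_val)].
rewrite !set_valE /= => E; rewrite disc_sum => kE.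
have xE j : disc_radius z t * circle_x z j = disc_radius z' t' * circle_x z' j.
  by rewrite -!disc_plane_x E.
have tE : t = t'.
  apply: set_val_inj; have := disc_sum z t; rewrite E disc_sum; lra.
have /andP[t0 t1] := interval_bound t.
subst t'; split=> //= tn.
  have r0 w : 0 < disc_radius w t.
    rewrite divr_gt0 ?circle_norm_gt0 // mulr_gt0 // subr_gt0 lt_def t1 andbT.
    by rewrite eq_sym; exact/eqP.
  have sq w : (disc_radius w t * circle_x w 0) ^+ 2 + (disc_radius w t * circle_x w 1) ^+ 2 =
      disc_radius w t ^+ 2.
    by rewrite !exprMn -mulrDr circle_x01 mulr1.
  have rr : disc_radius z t = disc_radius z' t.
    apply/eqP; rewrite -(eqrXn2 (n := 2)) ?(ltW (r0 _)) // -sq !xE sq //.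
  apply: (@set_val_inj _ [set z : C | `|z| = 1]); apply: cplxP.
    by apply: (mulfI (lt0r_neq0 (r0 z))); rewrite {2}rr; exact: (xE 0).
  by apply: (mulfI (lt0r_neq0 (r0 z))); rewrite {2}rr; exact: (xE 1).
apply: kE; have : 0 < set_val t by rewrite lt_def t0 andbT; exact/eqP.
lra.
Qed.

Lemma circle_ex (a b : R) : exists z : S1, exists2 n, 0 <= n &
  a = n * cRe (set_val z) /\ b = n * cIm (set_val z).
Proof.
have [ab|ab] := eqVneq (a ^+ 2 + b ^+ 2) 0.
  exists (circle_pt (normsq1 R)), 0 => //.
  by move/eqP: ab; rewrite paddr_eq0 ?sqr_ge0 // !sqrf_eq0 => /andP[/eqP -> /eqP ->]; rewrite !mul0r.
pose n := Num.sqrt (a ^+ 2 + b ^+ 2).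
have n2 : n ^+ 2 = a ^+ 2 + b ^+ 2 by rewrite sqr_sqrtr // addr_ge0 ?sqr_ge0.
have n0 : n != 0 by rewrite -sqrf_eq0 n2.
have w1 : normsq (mkC (a / n) (b / n) : C) = 1.
  by rewrite /normsq /= !expr_div_n -mulrDl -n2 divff // sqrf_eq0.
exists (circle_pt w1), n; first exact: sqrtr_ge0.
by rewrite set_valE /= mulrC divfK // mulrC divfK.
Qed.

Lemma join_orbit_surj o : exists a, join_orbit a = o.
Proof.
have [L <-] := qclass_surj o; rewrite -/(orb L).
have [k mk] := CP_matches_ex L.
have [z [n n0 [e0 e1]]] := circle_ex (moment_x L 0) (moment_x L 1).
have xE j : moment_x L j = n * circle_x z j.
  have s0 := sum_moment_x L; rewrite sum_ord3 e0 e1 in s0.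
  elim/ord3_ind: j; rewrite /circle_x //=.
  by apply/eqP; rewrite -subr_eq0 -[X in _ == X]s0; apply/eqP; ring.
have sE : \sum_i `|moment_x L i| = n * circle_norm z.
  by rewrite /circle_norm mulr_sumr; apply: eq_bigr => i _; rewrite xE normrM ger0_norm.
have m2 := moment_x_bound L; have N0 := circle_norm_gt0 z.
have tI : 0 <= 1 - n * circle_norm z / 2 <= 1.
  rewrite sE in m2; have := mulr_ge0 n0 (ltW N0).
  by move=> H; apply/andP; split; lra.
exists ((z, k), interval_pt tI); apply: orbit_ofE => //=.
rewrite set_valE /= flag_moment_mapE; congr plane_y; apply/funext => j.
rewrite xE /disc_radius set_valE /=; congr (_ * _); field; exact: lt0r_neq0.
Qed.

Lemma compact_circle : compact [set: S1].
Proof.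
apply: compact_set_type.
pose f (y : 'rV[R]_2) : C := mkC (y 0 0) (y 0 1).
pose box : set 'rV[R]_2 := [set y | forall i, `[(-1), 1]%classic (y 0 i)].
have cbox : compact box.
  exact: (@rV_compact R 2 (fun=> `[(-1), 1]%classic) (fun=> @segment_compact R (-1) 1)).
have fc : continuous f by move=> y; apply: cts_mkC; exact: coord_continuous.
have cf : compact (f @` box).
  by apply: continuous_compact => //; exact: continuous_subspaceT.
apply: (subclosed_compact _ cf).
  rewrite (_ : mkset _ = (@normsq R) @^-1` [set 1]); last first.
    by apply/seteqP; split=> w /norm1P.
  apply: closed_comp => [w _|]; last exact: closed_eq.
  exact: (cts_normsq (@cts_id _ w)).
move=> w /norm1P w1; exists (\row_(j < 2) if j == 0 then cRe w else cIm w).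
  by move=> j; rewrite /= mxE in_itv /=; move: w1; rewrite /normsq => w1;
    case: ifP => _; apply/andP; split; nra.
by rewrite /f !mxE /= mkCK.
Qed.

Lemma compact_interval : compact [set: I].
Proof.
apply: compact_set_type; rewrite (_ : mkset _ = `[0, 1]%classic).
  exact: segment_compact.
by apply/seteqP; split=> t; rewrite /= in_itv.
Qed.

Lemma compact_join : compact [set: J].
Proof.
apply: compact_quot; have := compact_setX (compact_setX compact_circle (@compact_CP1 R)) compact_interval.
by rewrite !setXTT.
Qed.

(** Both homeomorphisms of the theorem come from here: the join is compact, so a continuous
    surjection with the right fibres onto a Hausdorff space is enough. *)
Lemma join_lift (Z : topologicalType) (f : S1 * CP1 * I -> Z) :
  hausdorff_space Z -> continuous f -> (forall a b, f a = f b <-> join_rel a b) ->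
  (forall y, exists a, f a = y) -> homeomorphic J Z.
Proof.
move=> hZ fc fr fs.
have [g gE] := @quot_lift _ (@join_rel R S1 CP1) _ f
  (fun a b e => (fr a b).2 ((join_relP a b).1 ((qclassP _ _ _).2 e))).
exists g; apply: compact_homeomorphism => //.
- exact: compact_join.
- by apply: quot_cts; rewrite (_ : g \o _ = f) //; apply/funext => a; exact: gE.
- move=> x y; have [a <-] := qclass_surj x; have [b <-] := qclass_surj y.
  by rewrite !gE => /fr/join_relP.
- by move=> y; have [a <-] := fs y; exists (qclass (@join_rel R S1 CP1) a).
Qed.

Lemma orbits_join : homeomorphic (orbit_space (@T2_action R)) J.
Proof.
apply: homeomorphic_sym; apply: join_lift join_orbit_continuous _ join_orbit_surj.
  exact: hausdorff_orbits.
by move=> a b; split; [exact: join_orbit_inj|exact: join_orbit_rel].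
Qed.

(** * The Hopf map and the four-sphere *)

Definition hopf k (j : 'I_3) : R :=
  let n := cRe (CP_entry k 0 0) + cRe (CP_entry k 1 1) in
  [:: 2 * cRe (CP_entry k 0 1) / n; 2 * cIm (CP_entry k 0 1) / n;
      (cRe (CP_entry k 0 0) - cRe (CP_entry k 1 1)) / n]`_j.

(** The classical formula in the homogeneous coordinates c_0, c_1. In [hopf] it is written with
    projector entries, which are continuous in the class and whose common factor cancels in the
    quotients. *)
Definition hopf_vec (c : 'rV[C]_3) (j : 'I_3) : R :=
  let n := normsq (c 0 0) + normsq (c 0 1) in
  [:: 2 * cRe (c 0 0 * cj (c 0 1)) / n; 2 * cIm (c 0 0 * cj (c 0 1)) / n;
      (normsq (c 0 0) - normsq (c 0 1)) / n]`_j.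

Lemma CPvec01 k : 0 < normsq (CPvec k 0 0) + normsq (CPvec k 0 1).
Proof.
rewrite lt_def addr_ge0 ?normsq_ge0 // andbT paddr_eq0 ?normsq_ge0 // !normsq_eq0.
apply/negP => /andP[/eqP c0 /eqP c1]; case/eqP: (CPvec_neq0 k).
have := sum_CPvec k; rewrite sum_ord3 c0 c1 !add0r => c2.
by apply: row3P; rewrite ?c0 ?c1 ?c2 mxE.
Qed.

Lemma hopfE k : hopf k =1 hopf_vec (CPvec k).
Proof.
have S0 := sum_normsq_gt0 (CPvec_neq0 k); set S := \sum_i _ in S0.
have W i : cRe (CP_entry k i i) = normsq (CPvec k 0 i) / S by exact: proj_entry_diag.
have E (a : C) : cRe (a * (mkC S 0)^-1) = cRe a / S /\ cIm (a * (mkC S 0)^-1) = cIm a / S.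
  have Sn := lt0r_neq0 S0.
  by rewrite cReM cImM cReV cImV /normsq /=; split; field.
have n0 := CPvec01 k; have Sn := lt0r_neq0 S0.
have := lt0r_neq0 n0; set a := normsq _; set b := normsq _ => ab.
apply: ord3_ind; rewrite /hopf /hopf_vec /= !W -/a -/b;
  rewrite ?[cRe (CP_entry k 0 1)](E _).1 ?[cIm (CP_entry k 0 1)](E _).2; field;
  by rewrite ab Sn.
Qed.

Lemma hopf_sphere k : \sum_j hopf k j ^+ 2 = 1.
Proof.
rewrite sum_ord3 !hopfE /hopf_vec /=; have := lt0r_neq0 (CPvec01 k).
have : cRe (CPvec k 0 0 * cj (CPvec k 0 1)) ^+ 2 + cIm (CPvec k 0 0 * cj (CPvec k 0 1)) ^+ 2 =
    normsq (CPvec k 0 0) * normsq (CPvec k 0 1).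
  by rewrite -/(normsq _) normsqM /normsq /cj /= sqrrN.
move: (cRe (_ * _)) (cIm (_ * _)) (normsq _) (normsq _) => x y b a E n0.
have -> : (2 * x / (a + b)) ^+ 2 + (2 * y / (a + b)) ^+ 2 + ((a - b) / (a + b)) ^+ 2 =
    (4 * (x ^+ 2 + y ^+ 2) + (a - b) ^+ 2) / (a + b) ^+ 2 by field.
by rewrite E; field.
Qed.

Lemma hopf_continuous j : continuous (fun k => hopf k j).
Proof.
move=> k; have ec i l := @CP_entry_continuous R i l k.
have r i l := cts_cRe (ec i l); have im i l := cts_cIm (ec i l).
have S0 := sum_normsq_gt0 (CPvec_neq0 k).
have n0 : cRe (CP_entry k 0 0) + cRe (CP_entry k 1 1) != 0.
  rewrite /CP_entry !proj_entry_diag /weight -mulrDl mulf_neq0 ?invr_eq0 ?gt_eqF //.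
  exact: CPvec01.
have nV := @ctsV R _ (fun k => cRe (CP_entry k 0 0) + cRe (CP_entry k 1 1)) k n0 (ctsD (r 0 0) (r 1 1)).
elim/ord3_ind: j.
- exact: (ctsM (ctsM (@cts_cst R _ 2 k) (r _ _)) nV).
- exact: (ctsM (ctsM (@cts_cst R _ 2 k) (im _ _)) nV).
- exact: (ctsM (ctsB (r _ _) (r _ _)) nV).
Qed.

(** The last coordinate gives |c_0|^2 / n, with n = |c_0|^2 + |c_1|^2, and the others give c_0 times
    the conjugate of c_1, over n. Together they determine c_1 / c_0, unless c_0 = 0, a single
    class. *)
Lemma hopf_inj k k' : (forall j, hopf k j = hopf k' j) -> k = k'.
Proof.
move=> H; set c := CPvec k; set c' := CPvec k'.
have n0 := CPvec01 k; have n'0 := CPvec01 k'; rewrite -/c in n0; rewrite -/c' in n'0.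
have h0 : normsq (c 0 0) / (normsq (c 0 0) + normsq (c 0 1)) =
    normsq (c' 0 0) / (normsq (c' 0 0) + normsq (c' 0 1)).
  have := H 2; rewrite !hopfE /hopf_vec /= -/c -/c'.
  move: (normsq (c 0 0)) (normsq (c 0 1)) (normsq (c' 0 0)) (normsq (c' 0 1)) n0 n'0 => a b a' b' n0 n'0 E.
  have F x y : 0 < x + y -> x / (x + y) = ((x - y) / (x + y) + 1) / 2 :> R.
    by move=> xy; field; exact: lt0r_neq0.
  by rewrite F // E -F.
have h1 : mkC (cRe (c 0 0 * cj (c 0 1)) / (normsq (c 0 0) + normsq (c 0 1)))
    (cIm (c 0 0 * cj (c 0 1)) / (normsq (c 0 0) + normsq (c 0 1))) =
  mkC (cRe (c' 0 0 * cj (c' 0 1)) / (normsq (c' 0 0) + normsq (c' 0 1)))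
    (cIm (c' 0 0 * cj (c' 0 1)) / (normsq (c' 0 0) + normsq (c' 0 1))).
  have := H 0; have := H 1; rewrite !hopfE /hopf_vec /= -/c -/c' -!mulrA.
  by have two : (2 : R) != 0 by []; move=> /(mulfI two) -> /(mulfI two) ->.
have s := sum_CPvec k; have s' := sum_CPvec k'; rewrite sum_ord3 -/c in s; rewrite sum_ord3 -/c' in s'.
have c2 : c 0 2 = - (c 0 0 + c 0 1) by apply/eqP; rewrite -subr_eq0 opprK addrC s.
have c2' : c' 0 2 = - (c' 0 0 + c' 0 1) by apply/eqP; rewrite -subr_eq0 opprK addrC s'.
suff [a a0 [e0 e1]] : exists2 a, a != 0 & c' 0 0 = a * c 0 0 /\ c' 0 1 = a * c 0 1.
  apply/esym; apply: (CPvec_inj a0); apply: row3P; rewrite [RHS]mxE -/c -/c' //.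
  by rewrite c2' e0 e1 c2; ring.
have iff0 : (c 0 0 == 0) = (c' 0 0 == 0).
  rewrite -!normsq_eq0; move/eqP: h0 => /eqP h0.
  by apply/eqP/eqP => E; move: h0; rewrite E mul0r => /esym/eqP; rewrite ?(eq_sym 0) mulf_eq0 invr_eq0
    ?(gt_eqF n0) ?(gt_eqF n'0) orbF => /eqP.
have [c00|c00] := eqVneq (c 0 0) 0.
  have c'00 : c' 0 0 = 0 by apply/eqP; rewrite -iff0 c00.
  have c1 : c 0 1 != 0 by rewrite -normsq_gt0; move: n0; rewrite c00 normsq0 add0r.
  have c'1 : c' 0 1 != 0 by rewrite -normsq_gt0; move: n'0; rewrite c'00 normsq0 add0r.
  exists (c' 0 1 / c 0 1); first by rewrite mulf_neq0 // invr_neq0.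
  by rewrite c00 c'00 mulr0 divfK.
have c'00 : c' 0 0 != 0 by rewrite -iff0.
exists (c' 0 0 / c 0 0); first by rewrite mulf_neq0 // invr_neq0.
split; first by rewrite divfK.
have scal (n : R) (w : C) : mkC (cRe w / n) (cIm w / n) = w * mkC n^-1 0.
  by apply: cplxP; rewrite ?cReM ?cImM /=; ring.
move: h1; rewrite !scal => h1.
have cjj (x : C) : cj (cj x) = x by apply: cplxP; rewrite /= ?opprK.
have cjr (x : R) : cj (mkC x 0) = mkC x 0 by apply: cplxP; rewrite /= ?oppr0.
have := congr1 (@cj R) h1; rewrite !cjM !cjj !cjr => h2.
have n2 (v : 'rV[C]_3) : mkC (normsq (v 0 0) / (normsq (v 0 0) + normsq (v 0 1))) 0 =
    v 0 0 * cj (v 0 0) * mkC (normsq (v 0 0) + normsq (v 0 1))^-1 0.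
  by rewrite mul_conj; apply: cplxP; rewrite ?cReM ?cImM /=; ring.
have h3 : c 0 0 * cj (c 0 0) * mkC (normsq (c 0 0) + normsq (c 0 1))^-1 0 =
    c' 0 0 * cj (c' 0 0) * mkC (normsq (c' 0 0) + normsq (c' 0 1))^-1 0 by rewrite -!n2 h0.
set N' := mkC _ 0 in h2 h3; set N := mkC _ 0 in h2 h3.
have X0 : cj (c' 0 0) * N != 0.
  rewrite mulf_neq0 //; last by rewrite -normsq_eq0 /normsq /= expr0n addr0 sqrf_eq0 invr_eq0 gt_eqF.
  by rewrite -normsq_eq0 /normsq /= sqrrN -/(normsq _) normsq_eq0.
apply: (mulIf X0); apply: (mulIf c00); rewrite mulrAC mulrC.
transitivity (c 0 0 * (cj (c' 0 0) * c' 0 1 * N)); first by ring.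
rewrite -h2; transitivity (c 0 0 * cj (c 0 0) * N' * c 0 1); first by ring.
by rewrite h3; field.
Qed.

(** Normalize by |c_0|^2 + |c_1|^2 = 1 and c_0 > 0: then |c_0|^2 = (1 + h_2) / 2, and c_1 is forced.
    The point with h_2 = -1 has c_0 = 0 and comes from (0, 1). *)
Lemma hopf_surj (h : 'I_3 -> R) : \sum_j h j ^+ 2 = 1 -> exists k, forall j, hopf k j = h j.
Proof.
rewrite sum_ord3 => h1.
suff [c0 [c1 [n0 e0 e1 e2]]] : exists c0 c1 : C, [/\ normsq c0 + normsq c1 = 1,
    2 * cRe (c0 * cj c1) = h 0, 2 * cIm (c0 * cj c1) = h 1 & normsq c0 - normsq c1 = h 2].
  pose c : 'rV[C]_3 := \row_j [:: c0; c1; - c0 - c1]`_j.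
  have [E0 E1 E2] : [/\ c 0 0 = c0, c 0 1 = c1 & c 0 2 = - c0 - c1] by rewrite !mxE.
  have cn : c != 0.
    apply/eqP => cz; move: n0; rewrite -E0 -E1 cz !mxE normsq0 addr0 => /eqP.
    by rewrite eq_sym oner_eq0.
  have cs : \sum_i c 0 i = 0 by rewrite sum_ord3 E0 E1 E2; ring.
  have [k [a a0 kE]] := CPvec_surj cn cs; exists k => j.
  rewrite hopfE /hopf_vec kE ![(a *: c) _ _]mxE E0 E1 !normsqM.
  have na : normsq a != 0 by rewrite normsq_eq0.
  have F : a * c0 * cj (a * c1) = mkC (normsq a) 0 * (c0 * cj c1).
    by rewrite cjM -mul_conj -/(cj a); ring.
  have -> : normsq a * normsq c0 + normsq a * normsq c1 = normsq a by rewrite -mulrDr n0 mulr1.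
  have RM (n : R) (w : C) : cRe (mkC n 0 * w) = n * cRe w /\ cIm (mkC n 0 * w) = n * cIm w.
    by rewrite cReM cImM /= !mul0r subr0 addr0.
  rewrite F (RM _ _).1 (RM _ _).2.
by elim/ord3_ind: j; rewrite /= -?e0 -?e1 -?e2; field.
have [h2|h2] := eqVneq (h 2) (-1).
  have [z0 z1] : h 0 = 0 /\ h 1 = 0.
    have : h 0 ^+ 2 + h 1 ^+ 2 = 0 by move: h1; rewrite h2; lra.
    by move/eqP; rewrite paddr_eq0 ?sqr_ge0 // !sqrf_eq0 => /andP[/eqP -> /eqP ->].
  by exists 0, 1; rewrite normsq0 normsq1 mul0r cRe0 cIm0 mulr0 z0 z1 h2; split=> //; ring.
have g0 : 0 < (1 + h 2) / 2.
  rewrite divr_gt0 // lt_def; apply/andP; split.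
    by apply: contra h2 => /eqP E; apply/eqP; lra.
  by have := sqr_ge0 (h 0); have := sqr_ge0 (h 1); nra.
pose s := Num.sqrt ((1 + h 2) / 2); have s0 : s != 0 by rewrite sqrtr_eq0 -ltNge.
have s2 : s ^+ 2 = (1 + h 2) / 2 by rewrite sqr_sqrtr // ltW.
have hh : h 0 ^+ 2 + h 1 ^+ 2 = 4 * s ^+ 2 * (1 - s ^+ 2) by rewrite s2; lra.
exists (mkC s 0), (mkC (h 0 / (2 * s)) (- (h 1 / (2 * s)))).
have nb : normsq (mkC (h 0 / (2 * s)) (- (h 1 / (2 * s))) : C) = 1 - s ^+ 2.
  rewrite /normsq /= sqrrN !expr_div_n -mulrDl hh exprMn; field.
  by rewrite s0.
have na : normsq (mkC s 0 : C) = s ^+ 2 by rewrite /normsq /= expr0n addr0.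
split; rewrite ?nb ?na ?cReM ?cImM /=.
- by ring.
- by field.
- by field.
- by rewrite s2; field.
Qed.

(** The usual identification of the join of S^1 and S^2 with S^4: the square roots make the squared
    norms of the two parts equal to 1 - t and t. *)
Definition join_sphere_row (a : S1 * CP1 * I) : 'rV[R]_5 := \row_(j < 5)
  (if (j < 2)%N then Num.sqrt (1 - set_val a.2) * circle_x a.1.1 (inord j)
   else Num.sqrt (set_val a.2) * hopf a.1.2 (inord (j - 2))).

Lemma sum_ord5 (F : 'I_5 -> R) : \sum_i F i =
  F (inord 0) + F (inord 1) + F (inord 2) + F (inord 3) + F (inord 4).
Proof.
rewrite !big_ord_recl big_ord0 addr0 !addrA.
by congr (F _ + F _ + F _ + F _ + F _); apply/val_inj; rewrite /= inordK.
Qed.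

Lemma join_row01 a : join_sphere_row a 0 (inord 0) = Num.sqrt (1 - set_val a.2) * circle_x a.1.1 0 /\
  join_sphere_row a 0 (inord 1) = Num.sqrt (1 - set_val a.2) * circle_x a.1.1 1.
Proof. by rewrite !mxE !inordK //; split; congr (_ * circle_x _ _); apply/val_inj; rewrite /= inordK. Qed.

Lemma join_row234 a : [/\ join_sphere_row a 0 (inord 2) = Num.sqrt (set_val a.2) * hopf a.1.2 0,
  join_sphere_row a 0 (inord 3) = Num.sqrt (set_val a.2) * hopf a.1.2 1 &
  join_sphere_row a 0 (inord 4) = Num.sqrt (set_val a.2) * hopf a.1.2 2].
Proof. by rewrite !mxE !inordK //; split; congr (_ * hopf _ _); apply/val_inj; rewrite /= inordK. Qed.

Lemma join_sphere_sum a : \sum_j join_sphere_row a 0 j ^+ 2 = 1.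
Proof.
have /andP[t0 t1] := interval_bound a.2.
have [e0 e1] := join_row01 a; have [e2 e3 e4] := join_row234 a.
rewrite sum_ord5 e0 e1 e2 e3 e4; have := hopf_sphere a.1.2; have := circle_x01 a.1.1; rewrite sum_ord3.
move: (hopf _ 0) (hopf _ 1) (hopf _ 2) (circle_x _ 0) (circle_x _ 1) => u v w x y X H.
rewrite !exprMn !sqr_sqrtr ?subr_ge0 //.
by rewrite -mulrDr X -!addrA -!mulrDr addrA H; ring.
Qed.

Definition join_sphere a : sphere R 4 := exist _ (join_sphere_row a) (mem_set (join_sphere_sum a)).

Lemma join_sphere_continuous : continuous join_sphere.
Proof.
move=> a; have ac := @cts_id _ a; have a1 := cts_fst ac; have a2 := cts_snd ac.
have az := cts_fst a1; have ak := cts_snd a1.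
have tc := cts_comp a2 (@continuous_set_val _ _ _).
apply: cts_set_type; apply: continuous_row => j.
under [X in {for _, continuous X}]funext do rewrite set_valE /= mxE.
case: (j < 2)%N.
  exact: (ctsM (cts_sqrt (ctsB (@cts_cst _ _ 1 _) tc)) (cts_comp az (@cts_circle_x _ _))).
exact: (ctsM (cts_sqrt tc) (cts_comp ak (@hopf_continuous _ _))).
Qed.

Lemma join_sphere_rel a b : join_sphere a = join_sphere b <-> join_rel a b.
Proof.
case: a b => [[z k] t] [[z' k'] t']; have /andP[t0 t1] := interval_bound t.
split=> [/(congr1 set_val)|[/= <- ez ek]].
  rewrite !set_valE /= => E.
  have [e0 e1] := join_row01 ((z, k), t); have [e2 e3 e4] := join_row234 ((z, k), t).
  have [f0 f1] := join_row01 ((z', k'), t'); have [f2 f3 f4] := join_row234 ((z', k'), t').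
  rewrite E in e0 e1 e2 e3 e4; rewrite /= in e0 e1 e2 e3 e4 f0 f1 f2 f3 f4.
  have /andP[t'0 t'1] := interval_bound t'.
  have tE : t = t'.
    have T w m u : 0 <= set_val u -> set_val u <= 1 ->
      (Num.sqrt (1 - set_val u) * circle_x w 0) ^+ 2 +
      (Num.sqrt (1 - set_val u) * circle_x w 1) ^+ 2 = 1 - set_val (u : I) /\ m = m :> nat.
      move=> u0 u1; split=> //; rewrite !exprMn !sqr_sqrtr ?subr_ge0 //.
      by rewrite -mulrDr circle_x01 mulr1.
    apply: set_val_inj; have [A _] := T z 0%N t t0 t1; have [B _] := T z' 0%N t' t'0 t'1.
    by move: A B; rewrite -e0 -e1 -f0 -f1 => -> /addrI /oppr_inj.
  subst t'; split=> //= tn.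
    have s0 : Num.sqrt (1 - set_val t) != 0.
      rewrite sqrtr_eq0 -ltNge subr_gt0 lt_def t1 andbT eq_sym; exact/eqP.
    apply: (@set_val_inj _ [set z : C | `|z| = 1]); apply: cplxP; apply: (mulfI s0).
      by rewrite -[LHS]e0 -[RHS]f0.
    by rewrite -[LHS]e1 -[RHS]f1.
  have s0 : Num.sqrt (set_val t) != 0.
    rewrite sqrtr_eq0 -ltNge lt_def t0 andbT; exact/eqP.
  by apply: hopf_inj; apply: ord3_ind; apply: (mulfI s0);
    [rewrite -e2 -f2|rewrite -e3 -f3|rewrite -e4 -f4].
apply: set_val_inj; rewrite !set_valE /=; apply/rowP => j; rewrite !mxE /=.
case: ifP => _.
  have [->|t1'] := eqVneq (set_val t) 1; first by rewrite subrr sqrtr0 !mul0r.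
  by rewrite (ez (elimN eqP t1')).
have [->|t0'] := eqVneq (set_val t) 0; first by rewrite sqrtr0 !mul0r.
by rewrite (ek (elimN eqP t0')).
Qed.

Lemma join_sphere_surj y : exists a, join_sphere a = y.
Proof.
have y1 : \sum_j set_val y 0 j ^+ 2 = 1 by exact: set_valP y.
rewrite sum_ord5 in y1; set Y := set_val y in y1.
pose t : R := Y 0 (inord 2) ^+ 2 + Y 0 (inord 3) ^+ 2 + Y 0 (inord 4) ^+ 2.
have t0 : 0 <= t by rewrite !addr_ge0 ?sqr_ge0.
have tE : Y 0 (inord 0) ^+ 2 + Y 0 (inord 1) ^+ 2 = 1 - t by rewrite /t; lra.
have t1 : t <= 1 by rewrite -subr_ge0 -tE addr_ge0 ?sqr_ge0.
have tI : 0 <= t <= 1 by rewrite t0.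
have [z [n n0 [z0 z1]]] := circle_ex (Y 0 (inord 0)) (Y 0 (inord 1)).
have nE : n = Num.sqrt (1 - t).
  rewrite -tE z0 z1 !exprMn -mulrDr -/(normsq (set_val z)) circle_normsq.
  by rewrite mulr1 sqrtr_sqr ger0_norm.
have [k kE] : exists k, [/\ Y 0 (inord 2) = Num.sqrt t * hopf k 0,
    Y 0 (inord 3) = Num.sqrt t * hopf k 1 & Y 0 (inord 4) = Num.sqrt t * hopf k 2].
  have [tz|tn] := eqVneq t 0.
    have [k _] : exists k, CP_matches (std_flag R : M) k by exact: CP_matches_ex.
    exists k; rewrite tz sqrtr0 !mul0r.
    move/eqP: tz; rewrite /t !paddr_eq0 ?addr_ge0 ?sqr_ge0 // !sqrf_eq0.
    by move=> /andP[/andP[/eqP -> /eqP ->] /eqP ->].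
  have s0 : Num.sqrt t != 0 by rewrite sqrtr_eq0 -ltNge lt_def tn t0.
  pose h (j : 'I_3) := [:: Y 0 (inord 2); Y 0 (inord 3); Y 0 (inord 4)]`_j / Num.sqrt t.
  have [|k kE] := @hopf_surj h.
    by rewrite sum_ord3 /h /= !expr_div_n sqr_sqrtr // -!mulrDl divff.
  by exists k; rewrite !kE /h /=; split; rewrite mulrC divfK.
have [k2 k3 k4] := kE.
pose a := ((z, k), interval_pt tI); exists a; apply: set_val_inj; rewrite set_valE /=.
have [e0 e1] := join_row01 a; have [e2 e3 e4] := join_row234 a.
rewrite set_valE /= -nE in e0 e1; rewrite set_valE /= in e2 e3 e4.
apply/rowP => j; rewrite -[j]inord_val.
case: j => -[|[|[|[|[|//]]]]] ij /=.
- by rewrite e0 -/Y z0.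
- by rewrite e1 -/Y z1.
- by rewrite e2 -/Y k2.
- by rewrite e3 -/Y k3.
- by rewrite e4 -/Y k4.
Qed.

Lemma join_sphere_homeo : homeomorphic J (sphere R 4).
Proof.
apply: join_lift join_sphere_continuous join_sphere_rel join_sphere_surj.
apply: (injective_hausdorff (@continuous_set_val _ _)); last exact: hausdorff_rV.
exact: set_val_inj.
Qed.

End Join.

(** * Convex hulls of finite sets *)

Section FiniteHulls.
Variables (R : realType) (k : nat) (I : finType) (v : I -> 'rV[R]_k) (s : {set I}).

Local Notation hull := (conv_hull [set v i | i in [set i | i \in s]]).

Lemma sum_reindex (n : nat) (j : 'I_n -> I) (w : 'I_n -> R) (V : lmodType R) (u : I -> V) :
  \sum_l w l *: u (j l) = \sum_i (\sum_(l | j l == i) w l) *: u i.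
Proof.
rewrite (partition_big j xpredT) //=; apply: eq_bigr => i _.
by rewrite scaler_suml; apply: eq_bigr => l /eqP ->.
Qed.

Lemma sum_enum_set (w : I -> R) (V : lmodType R) (u : I -> V) :
  (forall i, i \notin s -> w i = 0) ->
  \sum_i w i *: u i = \sum_(l < #|s|) w (enum_val l) *: u (enum_val l).
Proof.
move=> w0; rewrite (bigID (fun i => i \in s)) /= addrC big1 ?add0r; last first.
  by move=> i /w0 ->; rewrite scale0r.
by rewrite (big_enum_val (fun i => w i *: u i)).
Qed.

Lemma sum_scale1 (J : finType) (w : J -> R) : \sum_i w i = \sum_i w i *: (1 : R^o).
Proof. by apply: eq_bigr => i _; rewrite /GRing.scale /= mulr1. Qed.

(** A convex combination may repeat points; grouping the terms by index leaves one weight per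
    index. *)
Lemma conv_hullP y : hull y <-> exists w : I -> R,
  [/\ forall i, 0 <= w i, forall i, i \notin s -> w i = 0, \sum_i w i = 1 &
      y = \sum_i w i *: v i].
Proof.
split=> [[n [p [w [pA w0 w1 ->]]]]|[w [w0 ws w1 ->]]].
  have /choice[j jE] : forall l, exists i, i \in s /\ p l = v i.
    by move=> l; have [i is_ <-] := pA l; exists i.
  exists (fun i => \sum_(l | j l == i) w l); split.
  - by move=> i; apply: sumr_ge0 => l _; exact: w0.
  - move=> i nis; rewrite big1 // => l /eqP ji; move: nis; rewrite -ji.
    by have [-> _] := jE l.
  - by rewrite -w1 (partition_big j xpredT).
  - by rewrite -sum_reindex; apply: eq_bigr => l _; have [_ ->] := jE l.
exists #|s|, (fun l => v (enum_val l)), (fun l => w (enum_val l)); split=> //.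
- by move=> l; exists (enum_val l) => //=; exact: enum_valP.
- by rewrite sum_scale1 -(@sum_enum_set w R^o (fun=> 1) ws) -sum_scale1.
- exact: sum_enum_set.
Qed.

Lemma conv_hull_vertex i : i \in s -> hull (v i).
Proof.
move=> si; exists 1%N, (fun=> v i), (fun=> 1); split=> //.
- by move=> _; exists i.
- by rewrite big_ord1.
- by rewrite big_ord1 scale1r.
Qed.

Lemma aff_hullP y : aff_hull hull y <-> exists w : I -> R,
  [/\ forall i, i \notin s -> w i = 0, \sum_i w i = 1 & y = \sum_i w i *: v i].
Proof.
split=> [[n [p [w [pA w1 ->]]]]|[w [ws w1 ->]]].
  have /choice[x xE] : forall l, exists x : I -> R,
      [/\ forall i, i \notin s -> x i = 0, \sum_i x i = 1 & p l = \sum_i x i *: v i].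
    by move=> l; have /conv_hullP[x [_ ? ? ?]] := pA l; exists x.
  exists (fun i => \sum_l w l * x l i); split.
  - by move=> i nis; rewrite big1 // => l _; have [-> // _ _] := xE l; rewrite mulr0.
  - rewrite exchange_big -w1; apply: eq_bigr => l _ /=; rewrite -mulr_sumr.
    by have [_ -> _] := xE l; rewrite mulr1.
  - under [RHS]eq_bigr do rewrite scaler_suml.
    rewrite exchange_big; apply: eq_bigr => l _ /=; have [_ _ ->] := xE l.
    by rewrite scaler_sumr; apply: eq_bigr => i _; rewrite scalerA.
exists #|s|, (fun l => v (enum_val l)), (fun l => w (enum_val l)); split=> //.
- by move=> l; apply: conv_hull_vertex; exact: enum_valP.
- by rewrite sum_scale1 -(@sum_enum_set w R^o (fun=> 1) ws) -sum_scale1.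
- exact: sum_enum_set.
Qed.

Lemma conv_hull_polytope : s != finset.set0 -> polytope hull.
Proof.
move=> /set0Pn[i si]; exists [set v i | i in [set i | i \in s]]; split=> //.
  by apply: finite_image; exact: finite_finset.
by exists (v i), i.
Qed.

(** Complementary slackness: m - <y, u> is the sum of the nonnegative terms w_i (m - <v_i, u>), so
    at a maximizer only maximizing vertices carry weight. *)
Lemma linear_conv_max (u : 'cV[R]_k) (m : R) : (forall i, i \in s -> (v i *m u) 0 0 <= m) ->
  forall y, hull y -> (y *m u) 0 0 <= m /\
  ((y *m u) 0 0 = m -> exists w : I -> R,
  [/\ forall i, 0 <= w i, forall i, w i != 0 -> i \in s /\ (v i *m u) 0 0 = m,
      \sum_i w i = 1 & y = \sum_i w i *: v i]).
Proof.
move=> um y /conv_hullP[w [w0 ws w1 yE]].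
have E : m - (y *m u) 0 0 = \sum_i w i * (m - (v i *m u) 0 0).
  under eq_bigr do rewrite mulrBr.
  rewrite sumrB -mulr_suml w1 mul1r; congr (_ - _).
  rewrite yE mulmx_suml summxE; apply: eq_bigr => i _.
  by rewrite -scalemxAl mxE.
have T i : 0 <= w i * (m - (v i *m u) 0 0).
  have [/um ui|/ws ->] := boolP (i \in s); last by rewrite mul0r.
  by rewrite mulr_ge0 // subr_ge0.
split; first by rewrite -subr_ge0 E sumr_ge0.
move=> ym; exists w; split=> // i wi.
have si : i \in s by apply: contraNT wi => /ws ->.
split=> //; have /eqP : \sum_i w i * (m - (v i *m u) 0 0) = 0 by rewrite -E ym subrr.
rewrite psumr_eq0 // => /allP/(_ i (mem_index_enum i)) /=.
by rewrite mulf_eq0 (negbTE wi) /= subr_eq0 => /eqP.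
Qed.

Lemma face_vertex F : face F hull -> exists i, i \in s /\ F (v i).
Proof.
move=> [[y Fy] [u FE]]; move: Fy; rewrite {1}FE => -[hy max].
pose m := (y *m u) 0 0.
have um i : i \in s -> (v i *m u) 0 0 <= m by move=> si; apply: max; exact: conv_hull_vertex.
have [_ /(_ erefl)[w [w0 wi w1 _]]] := linear_conv_max um hy.
have [i wni] : exists i, w i != 0.
  apply: contrapT => H; move: w1; rewrite big1 => [/eqP|i _].
    by rewrite eq_sym oner_eq0.
  by apply/eqP/negPn/negP => wi0; apply: H; exists i.
have [si um'] := wi _ wni; exists i; split=> //; rewrite FE; split.
  exact: conv_hull_vertex.
by move=> z /max; rewrite um'.
Qed.

End FiniteHulls.

Section SubHulls.
Variables (R : realType) (k : nat) (I : finType) (v : I -> 'rV[R]_k).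
Implicit Types (s t : {set I}).

Local Notation hull s := (conv_hull [set v i | i in [set i | i \in s]]).

Lemma face_sub_hull s t (u : 'cV[R]_k) m : t != finset.set0 -> t \subset s ->
  (forall i, i \in s -> (v i *m u) 0 0 <= m) ->
  (forall i, i \in s -> ((v i *m u) 0 0 = m <-> i \in t)) -> face (hull t) (hull s).
Proof.
move=> /set0Pn[i0 ti0] ts um ut; split; first by exists (v i0); exact: conv_hull_vertex.
have tm i : i \in t -> (v i *m u) 0 0 = m by move=> ti; apply/ut => //; exact: (fintype.subsetP ts).
have hm : hull s (v i0) /\ (v i0 *m u) 0 0 = m.
  by split; [apply: conv_hull_vertex; exact: (fintype.subsetP ts)|exact: tm].
exists u; apply/seteqP; split=> y.
  move=> /conv_hullP[w [w0 wt w1 yE]].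
  have hy : hull s y.
    apply/conv_hullP; exists w; split=> // i nsi; apply: wt.
    by apply: contra nsi; exact: (fintype.subsetP ts).
  split=> // z /(linear_conv_max um)[zm _]; apply: (le_trans zm).
  rewrite yE mulmx_suml summxE -[leLHS]mul1r -w1 mulr_suml.
  apply: ler_sum => i _; rewrite -scalemxAl mxE.
  by have [ti|/wt ->] := boolP (i \in t); [rewrite tm|rewrite !mul0r].
move=> [hy max]; have [ym] := linear_conv_max um hy.
case=> [|w [w0 wi w1 yE]].
  by apply: le_anti; rewrite ym /= -hm.2; apply: max; exact: hm.1.
apply/conv_hullP; exists w; split=> // i nti; apply/eqP/negPn/negP => /wi[si /ut ti].
by move: nti; rewrite ti.
Qed.

Lemma face_hullP s t : (forall i, i \in s -> hull t (v i) -> i \in t) ->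
  face (hull t) (hull s) -> exists (u : 'cV[R]_k) (m : R),
  (forall i, i \in s -> (v i *m u) 0 0 <= m) /\
  (forall i, i \in t -> hull s (v i) /\ (v i *m u) 0 0 = m) /\
  (forall i, i \in s -> (v i *m u) 0 0 = m -> i \in t).
Proof.
move=> tv [[y0 hy0] [u tE]].
have max y z : hull t y -> hull s z -> (z *m u) 0 0 <= (y *m u) 0 0.
  by rewrite tE => -[_ H] /H.
have hts y : hull t y -> hull s y by rewrite tE => -[].
exists u, ((y0 *m u) 0 0); split; last split.
- by move=> i si; apply: max => //; exact: conv_hull_vertex.
- move=> i ti; have hi := conv_hull_vertex v ti; split; first exact: hts.
  by apply: le_anti; rewrite !max //; exact: hts.
- move=> i si ui; apply: tv => //; rewrite tE; split; first exact: conv_hull_vertex.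
  by move=> z hz; rewrite ui; exact: max.
Qed.

End SubHulls.

Section AffineDimension.
Variables (R : realType) (k N : nat) (v : 'I_N -> 'rV[R]_k) (s : {set 'I_N}) (i0 : 'I_N).
Hypothesis si0 : i0 \in s.

Local Notation hull := (conv_hull [set v i | i in [set i | i \in s]]).

Definition edge_mx : 'M[R]_(N, k) := \matrix_(i < N) (if i \in s then v i - v i0 else 0).

Lemma row_base_range m n (A : 'M[R]_(m, n)) (y : 'rV[R]_n) :
  (exists u, y = u *m A) <-> [set u *m row_base A | u in [set: 'rV[R]_(\rank A)]] y.
Proof.
split=> [[u ->]|[u _ <-]].
  have /submxP[w ->] : (u *m A <= row_base A)%MS by rewrite eq_row_base submxMl.
  by exists w.
have /submxP[w wE] : (u *m row_base A <= A)%MS.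
  by rewrite (submx_trans (submxMl _ _)) // eq_row_base.
by exists w.
Qed.

Lemma hull_aff_dim : aff_dim hull (\rank edge_mx).
Proof.
exists (v i0), (row_base edge_mx); split; first exact: row_base_free.
have E (w : 'I_N -> R) : (forall i, i \notin s -> w i = 0) ->
    \sum_i w i *: (v i - v i0) = (\row_i w i) *m edge_mx.
  move=> ws; rewrite mulmx_sum_row; apply: eq_bigr => i _; rewrite mxE rowK.
  by case: ifPn => // /ws ->; rewrite !scale0r.
apply/seteqP; split=> y.
  move=> /aff_hullP[w [ws w1 yE]].
  have /row_base_range[u _ uE] : exists u, y - v i0 = u *m edge_mx.
    exists (\row_i w i); rewrite -E //; under [RHS]eq_bigr do rewrite scalerBr.
    by rewrite sumrB -scaler_suml w1 scale1r -yE.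
  by exists u => //; rewrite uE addrC subrK.
move=> [u _ <-]; have /row_base_range[x xE] : [set u *m row_base edge_mx | u in [set: 'rV[R]_(\rank edge_mx)]]
  (u *m row_base edge_mx) by exists u.
pose w i := (if i \in s then x 0 i else 0).
pose d : R := 1 - \sum_i w i.
apply/aff_hullP; exists (fun i => w i + (i == i0)%:R * d); split.
- move=> i nsi; rewrite /w (negbTE nsi) add0r.
  by case: eqP => [ii|_]; [move: nsi; rewrite ii si0|rewrite mul0r].
- rewrite big_split /= (bigD1 i0) //= [\sum_i _ * d](bigD1 i0) //= eqxx mul1r.
  rewrite [\sum_(i | i != i0) _ * d]big1 => [|i /negbTE ->]; last by rewrite mul0r.
  by rewrite addr0 -(bigD1 i0 (P := xpredT)) //= /d addrC subrK.
- under eq_bigr do rewrite scalerDl.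
  rewrite big_split /= [\sum_i (_ * d) *: _](bigD1 i0) //= eqxx mul1r.
  rewrite [\sum_(i | i != i0) _ *: v i]big1 ?addr0 => [|i /negbTE ->]; last by rewrite mul0r scale0r.
  rewrite /d scalerBl scale1r xE addrCA; congr (_ + _).
  rewrite scaler_suml -sumrB.
  have -> : x *m edge_mx = (\row_i w i) *m edge_mx.
    rewrite !mulmx_sum_row; apply: eq_bigr => i _; rewrite mxE rowK /w.
    by case: ifP => // _; rewrite !scaler0.
  rewrite -E => [|i nsi]; last by rewrite /w (negbTE nsi).
  by under [LHS]eq_bigr do rewrite scalerBr.
Qed.

(** The vectors orthogonal to all edges will turn out to be the Lie algebra of the stabilizer. With
    [rank_kernel_edge] this equates the dimensions of the polytope and of the acting torus. *)
Lemma edge_mx_kernel :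
  [set x : 'rV[R]_k | forall i, i \in s -> x *m (v i - v i0)^T = 0] =
  [set u *m row_base (kermx edge_mx^T) | u in [set: 'rV[R]_(\rank (kermx edge_mx^T))]].
Proof.
apply/seteqP; split=> x.
  move=> H; apply/row_base_range.
  have /submxP[u ->] : (x <= kermx edge_mx^T)%MS.
    apply/sub_kermxP; apply/rowP => i; rewrite [RHS]mxE.
    have [si|nsi] := boolP (i \in s).
      have := congr1 (fun y : 'M[R]_1 => y 0 0) (H i si); rewrite [RHS]mxE => <-.
      by rewrite !mxE; apply: eq_bigr => j _; rewrite !mxE si !mxE.
    by rewrite mxE big1 // => j _; rewrite !mxE (negbTE nsi) mxE mulr0.
  by exists u.
move=> /row_base_range[u ->] i si.
have := mulmx_ker edge_mx^T => /(congr1 (fun A => u *m A)); rewrite mulmx0 mulmxA.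
set y := u *m _ => yE; apply/rowP => j; rewrite ord1 [RHS]mxE.
have := congr1 (fun A : 'rV[R]_N => A 0 i) yE; rewrite [RHS]mxE => <-.
by rewrite !mxE; apply: eq_bigr => l _; rewrite !mxE si !mxE.
Qed.

Lemma rank_kernel_edge : (\rank edge_mx + \rank (kermx edge_mx^T) = k)%N.
Proof. by rewrite mxrank_ker mxrank_tr subnKC // rank_leq_col. Qed.

End AffineDimension.

(** * Admissible polytopes *)

Lemma conv_hull_convex (R : realType) (k : nat) (I : finType) (v : I -> 'rV[R]_k) (s : {set I})
    (J : finType) (u : J -> 'rV[R]_k) (w : J -> R) :
  (forall j, 0 <= w j) -> \sum_j w j = 1 ->
  (forall j, w j != 0 -> conv_hull [set v i | i in [set i | i \in s]] (u j)) ->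
  conv_hull [set v i | i in [set i | i \in s]] (\sum_j w j *: u j).
Proof.
move=> w0 w1 hu.
have /choice[x xE] : forall j, exists x : I -> R, w j != 0 ->
    [/\ forall i, 0 <= x i, forall i, i \notin s -> x i = 0, \sum_i x i = 1 &
        u j = \sum_i x i *: v i].
  move=> j; have [wj|wj] := eqVneq (w j) 0; first by exists (fun=> 0).
  by have /conv_hullP[x ?] := hu j wj; exists x.
apply/conv_hullP; exists (fun i => \sum_j w j * x j i); split.
- move=> i; apply: sumr_ge0 => j _; have [->|wj] := eqVneq (w j) 0; first by rewrite mul0r.
  by rewrite mulr_ge0 //; have [] := xE j wj.
- move=> i nis; rewrite big1 // => j _; have [->|wj] := eqVneq (w j) 0; first by rewrite mul0r.
  by have [_ -> //] := xE j wj; rewrite mulr0.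
- rewrite exchange_big -w1; apply: eq_bigr => j _ /=; rewrite -mulr_sumr.
  have [->|wj] := eqVneq (w j) 0; first by rewrite mul0r.
  by have [_ _ -> _] := xE j wj; rewrite mulr1.
- under [RHS]eq_bigr do rewrite scaler_suml.
  rewrite exchange_big; apply: eq_bigr => j _ /=.
  have [->|wj] := eqVneq (w j) 0; first by rewrite scale0r big1 // => i _; rewrite mul0r scale0r.
  have [_ _ _ ->] := xE j wj.
  by rewrite scaler_sumr; apply: eq_bigr => i _; rewrite scalerA.
Qed.

Notation Nfix := #|{: 'S_3}|.
Notation idx := {set 'I_Nfix}.

(* Locked, as comparing two values of [enum_val] by computation is intractable. *)
Definition fix_perm : 'I_Nfix -> 'S_3 := locked (fun i => enum_val i).

(** The chart of a permutation s consists of the flags with [s 0] in the support of p and [s 2] in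
    that of q. The charts around a flag are thus [idx_of A B] for its supports, and [firsts] and
    [lasts] recover A and B. *)
Definition firsts (s : idx) : {set 'I_3} := [set fix_perm i 0 | i in s]%SET.
Definition lasts (s : idx) : {set 'I_3} := [set fix_perm i 2 | i in s]%SET.
Definition idx_of (A B : {set 'I_3}) : idx :=
  [set i | (fix_perm i 0 \in A) && (fix_perm i 2 \in B)]%SET.

(* The pairs of supports of the Plucker vectors of a flag. *)
Definition good (A B : {set 'I_3}) : bool :=
  [&& A != finset.set0, B != finset.set0 & #|A :&: B| != 1%N].

Lemma fix_perm_neq i : fix_perm i 0 != fix_perm i 2.
Proof. by rewrite (inj_eq perm_inj). Qed.

Lemma third_ex (a b : 'I_3) : exists k, k != a /\ k != b.
Proof.
by elim/ord3_ind: a; elim/ord3_ind: b;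
  [exists 1|exists 2|exists 1|exists 2|exists 0|exists 0|exists 1|exists 0|exists 0].
Qed.

Lemma idx_ex (a b : 'I_3) : a != b -> exists i, fix_perm i 0 = a /\ fix_perm i 2 = b.
Proof.
move=> ab; have [k [ka kb]] := third_ex a b; rewrite eq_sym in ka.
have [t [t0 _ t2]] := perm3_ex ka ab kb.
by exists (enum_rank t); rewrite /fix_perm -lock enum_rankK.
Qed.

Lemma fix_perm_inj i j : fix_perm i 0 = fix_perm j 0 -> fix_perm i 2 = fix_perm j 2 -> i = j.
Proof.
move=> e0 e2; suff : fix_perm i = fix_perm j by rewrite /fix_perm -lock; exact: enum_val_inj.
set a := fix_perm i in e0 e2 *; set b := fix_perm j in e0 e2 *.
apply/permP; apply: ord3_ind => //.
have n0 : a 1 != a 0 by rewrite (inj_eq perm_inj).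
have n2 : a 1 != a 2 by rewrite (inj_eq perm_inj).
rewrite -[a 1](permKV b); congr (b _).
have : (b^-1)%g (a 1) != 0 /\ (b^-1)%g (a 1) != 2.
  by split; [apply: contra n0|apply: contra n2] => /eqP E; rewrite ?e0 ?e2 -E permKV.
by move: ((b^-1)%g (a 1)); apply: ord3_ind => // -[].
Qed.

Lemma goodC A B : good A B = good B A.
Proof. by rewrite /good andbCA finset.setIC. Qed.

Lemma good_two A B a : good A B -> a \in A :&: B -> exists b, [/\ b \in A, b \in B & b != a].
Proof.
move=> /and3P[_ _ AB] aAB.
have /card_gt1P[x [y [xAB yAB xy]]] : (1 < #|A :&: B|)%N.
  by rewrite ltn_neqAle eq_sym AB; apply/card_gt0P; exists a.
have [ya|ya] := eqVneq y a; last by exists y; move: yAB; rewrite !inE => /andP[-> ->].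
by exists x; move: xAB; rewrite !inE -ya xy => /andP[-> ->].
Qed.

Lemma good_other A B a : good A B -> a \in A -> exists2 b, b \in B & b != a.
Proof.
move=> gAB aA; have /and3P[_ /set0Pn[b bB] _] := gAB.
have [ba|ba] := eqVneq b a; last by exists b.
have [|c [_ cB ca]] := @good_two A B a gAB; last by exists c.
by rewrite !inE aA -ba bB.
Qed.

Lemma firsts_idx_of A B : good A B -> firsts (idx_of A B) = A.
Proof.
move=> gAB; apply/setP => a; apply/imsetP/idP => [[i +]|aA].
  by rewrite inE => /andP[iA _] ->.
have [b bB ba] := good_other gAB aA; rewrite eq_sym in ba.
by have [i [i0 i2]] := idx_ex ba; exists i; rewrite // inE i0 i2 aA.
Qed.

Lemma lasts_idx_of A B : good A B -> lasts (idx_of A B) = B.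
Proof.
move=> gAB; apply/setP => b; apply/imsetP/idP => [[i +]|bB].
  by rewrite inE => /andP[_ iB] ->.
have gBA : good B A by rewrite goodC.
have [a aA ab] := good_other gBA bB.
by have [i [i0 i2]] := idx_ex ab; exists i; rewrite // inE i0 i2 aA.
Qed.

Section Hulls.
Variable R : realType.
Local Notation C := (Cplx R).
Local Notation M := (flag_manifold R).
Local Notation mu := (@flag_moment_map R).
Implicit Types (x : 'I_3 -> R) (y : 'rV[R]_2) (A B : {set 'I_3}) (i : 'I_Nfix).

Definition flag_atlas : special_atlas M :=
  @SpecialAtlas R M Nfix (fun i => flag_chart R (fix_perm i)) (fun i => flag_param (fix_perm i) 0).

Definition vtx : 'I_Nfix -> 'rV[R]_2 := locked (fun i => mu (flag_param (fix_perm i) 0)).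

Lemma vtx_fixed i : vtx i = mu (flag_param (fix_perm i) 0).
Proof. by rewrite /vtx -lock. Qed.

Local Notation hull s := (conv_hull [set vtx i | i in [set i | i \in s]]).

Lemma ccoord0 l : ccoord (0 : 'rV[R]_6) l = 0.
Proof. by rewrite /ccoord !mxE; apply: cplxP. Qed.

Lemma fixed_pair (t : 'S_3) : plucker_pair (flag_param t (0 : 'rV[R]_6))
  (\row_j (j == t 0)%:R) (\row_j (j == t 2)%:R).
Proof.
have := flag_param_pair t (0 : 'rV[R]_6); congr plucker_pair; apply/rowP;
  by apply: (@perm3_ind t); rewrite pqvecE !mxE !(inj_eq perm_inj) ?ccoord0 ?mul0r ?subr0 ?oppr0.
Qed.

Lemma weight_delta (a j : 'I_3) : weight (\row_j (j == a)%:R : 'rV[C]_3) j = (j == a)%:R.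
Proof.
have n (b : bool) : normsq (b%:R : C) = b%:R by case: b; rewrite ?normsq1 ?normsq0.
rewrite /weight; under eq_bigr do rewrite mxE n.
rewrite mxE n (bigD1 a) //= eqxx big1 ?addr0 ?divr1 // => i /negbTE -> //.
Qed.

Lemma vtxE i j : plane_x (vtx i) j = (j == fix_perm i 0)%:R - (j == fix_perm i 2)%:R.
Proof. by rewrite vtx_fixed plane_x_moment (moment_xE j (fixed_pair _)) !weight_delta. Qed.

Lemma plane_x_comb (J : finType) (u : J -> 'rV[R]_2) (w : J -> R) k :
  \sum_j w j = 1 -> plane_x (\sum_j w j *: u j) k = \sum_j w j * plane_x (u j) k.
Proof.
move=> w1; have S l : (\sum_j w j *: u j) 0 l = \sum_j w j * u j 0 l.
  by rewrite summxE; apply: eq_bigr => j _; rewrite mxE.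
elim/ord3_ind: k; rewrite !plane_xE !S.
- under [RHS]eq_bigr do rewrite plane_x0 mulrBr mulr1.
  by rewrite sumrB w1.
- under [RHS]eq_bigr do rewrite plane_x1 mulrBr mulr1.
  by rewrite sumrB w1.
- under [RHS]eq_bigr do rewrite plane_x2 !mulrBr.
  by rewrite !sumrB -mulr_suml w1 mul1r.
Qed.

Lemma plane_x_inj y y' : plane_x y =1 plane_x y' -> y = y'.
Proof. by move=> E; rewrite -[y]plane_yK -[y']plane_yK; congr plane_y; exact/funext. Qed.

Lemma cts_plane_x j : continuous (fun y => plane_x y j).
Proof.
move=> y; have c l := @coord_continuous R 1 2 0 l y.
elim/ord3_ind: j; rewrite /plane_x /=.
- exact: (ctsB (c 0) (@cts_cst R _ 1 y)).
- exact: (ctsB (c 1) (@cts_cst R _ 1 y)).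
- exact: (ctsB (ctsB (@cts_cst R _ 2 y) (c 0)) (c 1)).
Qed.

(* The open and closed polytopes spanned by the vectors [e_a - e_b], a in A, b in B. *)
Definition open_cell A B x : Prop :=
  [/\ forall j, j \in A -> j \notin B -> 0 < x j,
      forall j, j \in B -> j \notin A -> x j < 0,
      forall j, j \notin A -> j \notin B -> x j = 0 &
      if A :&: B == finset.set0 then \sum_j `|x j| = 2 else \sum_j `|x j| < 2].

Definition closed_cell A B x : Prop :=
  [/\ forall j, j \notin B -> 0 <= x j,
      forall j, j \notin A -> x j <= 0,
      \sum_j `|x j| <= 2 &
      A :&: B = finset.set0 -> \sum_j `|x j| = 2].

Lemma open_closed_cell A B x : open_cell A B x -> closed_cell A B x.
Proof.
move=> [pA nB z S]; split.
- move=> j jB; have [jA|jA] := boolP (j \in A); first exact/ltW/pA.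
  by rewrite z.
- move=> j jA; have [jB|jB] := boolP (j \in B); first exact/ltW/nB.
  by rewrite z.
- by move: S; case: ifP => _ => [->|/ltW].
- by move=> AB; move: S; rewrite AB eqxx.
Qed.

(* The linear form that is maximal, equal to 2, exactly on the [e_a - e_b] when
   [A] and [B] are disjoint. *)
Definition side A B (j : 'I_3) : R := (j \in A)%:R - (j \in B)%:R.

Lemma side_norm A B x : \sum_j side A B j * x j <= \sum_j `|x j|.
Proof.
apply: ler_sum => j _; rewrite (le_trans (ler_norm _)) // normrM ler_piMl //.
by rewrite /side; case: (j \in A); case: (j \in B); rewrite ?subrr ?subr0 ?sub0r ?normrN ?normr1 ?normr0.
Qed.

Lemma idx_of_comb_side A B (w : 'I_Nfix -> R) : A :&: B = finset.set0 ->
  (forall i, i \notin idx_of A B -> w i = 0) -> \sum_i w i = 1 ->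
  \sum_j side A B j * plane_x (\sum_i w i *: vtx i) j = 2.
Proof.
move=> AB ws w1; under eq_bigr do rewrite plane_x_comb // mulr_sumr.
have -> : (2 : R) = \sum_i w i * 2 by rewrite -mulr_suml w1 mul1r.
rewrite exchange_big /=; apply: eq_bigr => i _.
have [|/ws ->] := boolP (i \in idx_of A B); last first.
  by rewrite mul0r big1 // => j _; rewrite mul0r mulr0.
rewrite inE => /andP[i0 i2].
have nB a : a \in A -> a \in B = false.
  by move=> aA; apply/negP => aB; move/setP/(_ a): AB; rewrite !inE aA aB.
have nA a : a \in B -> a \in A = false.
  by move=> aB; apply/negP => aA; move: (nB a aA); rewrite aB.
under eq_bigr do rewrite mulrCA vtxE mulrBr.
rewrite -mulr_sumr sumrB; congr (_ * _).
rewrite (bigD1 (fix_perm i 0)) //= big1 ?addr0; last by move=> j /negbTE ->; rewrite mulr0.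
rewrite (bigD1 (fix_perm i 2)) //= big1 ?addr0; last by move=> j /negbTE ->; rewrite mulr0.
by rewrite !eqxx !mulr1 /side i0 i2 (nB _ i0) (nA _ i2) subr0 sub0r opprK.
Qed.

Lemma idx_of_comb_off A B (w : 'I_Nfix -> R) j : j \notin A -> j \notin B ->
  (forall i, i \notin idx_of A B -> w i = 0) -> \sum_i w i = 1 ->
  plane_x (\sum_i w i *: vtx i) j = 0.
Proof.
move=> jA jB ws w1; rewrite plane_x_comb // big1 // => i _.
have [|/ws ->] := boolP (i \in idx_of A B); last by rewrite mul0r.
rewrite inE vtxE => /andP[i0 i2].
have [ji|_] := eqVneq j (fix_perm i 0); first by move: jA; rewrite ji i0.
have [ji|_] := eqVneq j (fix_perm i 2); first by move: jB; rewrite ji i2.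
by rewrite subrr mulr0.
Qed.

Lemma sum_norm_vtx i : \sum_j `|plane_x (vtx i) j| = 2.
Proof.
have n02 := fix_perm_neq i.
rewrite (bigD1 (fix_perm i 0)) //= (bigD1 (fix_perm i 2)) ?(eq_sym (fix_perm i 2)) //=.
rewrite big1 => [|j /andP[/negbTE n0 /negbTE n2]]; last by rewrite vtxE n0 n2 subrr normr0.
by rewrite !vtxE !eqxx (negbTE n02) (eq_sym (fix_perm i 2)) (negbTE n02) subr0 sub0r normrN normr1 addr0.
Qed.

Lemma hull_closed_cell A B y : hull (idx_of A B) y -> closed_cell A B (plane_x y).
Proof.
move=> /conv_hullP[w [w0 ws w1 ->]].
have S2 : \sum_j `|plane_x (\sum_i w i *: vtx i) j| <= 2.
  have -> : (2 : R) = \sum_i w i * 2 by rewrite -mulr_suml w1 mul1r.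
  apply: (@le_trans _ _ (\sum_j \sum_i w i * `|plane_x (vtx i) j|)).
    apply: ler_sum => j _; rewrite plane_x_comb // (le_trans (ler_norm_sum _ _ _)) //.
    by apply: ler_sum => i _; rewrite normrM ger0_norm.
  rewrite exchange_big /=; apply: ler_sum => i _.
  by rewrite -mulr_sumr sum_norm_vtx.
split=> //.
- move=> j jB; rewrite plane_x_comb //; apply: sumr_ge0 => i _.
  have [|/ws ->] := boolP (i \in idx_of A B); last by rewrite mul0r.
  rewrite inE => /andP[i0 i2]; rewrite mulr_ge0 // vtxE.
  have [ji|_] := eqVneq j (fix_perm i 2); first by move: jB; rewrite ji i2.
  by rewrite subr0.
- move=> j jA; rewrite plane_x_comb // -oppr_ge0 -sumrN; apply: sumr_ge0 => i _.
  have [|/ws ->] := boolP (i \in idx_of A B); last by rewrite mul0r oppr0.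
  rewrite inE => /andP[i0 i2]; rewrite -mulrN mulr_ge0 // vtxE.
  have [ji|_] := eqVneq j (fix_perm i 0); first by move: jA; rewrite ji i0.
  by rewrite sub0r opprK.
- move=> AB; apply: le_anti; rewrite S2 /=.
  by rewrite -(idx_of_comb_side AB ws w1) side_norm.
Qed.

Lemma idx_of_neq0 A B : good A B -> idx_of A B != finset.set0.
Proof.
move=> gAB; have /and3P[/set0Pn[a aA] _ _] := gAB.
have [b bB ba] := good_other gAB aA; rewrite eq_sym in ba.
by have [i [i0 i2]] := idx_ex ba; apply/set0Pn; exists i; rewrite inE i0 i2 aA.
Qed.

(** If A and B meet they share two indices a, b, and the origin is the midpoint of e_a - e_b and e_b
    - e_a. *)
Lemma center_hull A B : good A B -> A :&: B != finset.set0 ->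
  exists2 m, hull (idx_of A B) m & forall j, plane_x m j = 0.
Proof.
move=> gAB /set0Pn[a]; rewrite inE => /andP[aA aB].
have [b [bA bB ba]] : exists b, [/\ b \in A, b \in B & b != a].
  by apply: good_two gAB _; rewrite inE aA.
have [i [i0 i2]] := idx_ex ba; rewrite eq_sym in ba; have [i' [i'0 i'2]] := idx_ex ba.
have h2 : \sum_(c : bool) (2^-1 : R) = 1 by rewrite big_bool /=; field.
exists (\sum_(c : bool) 2^-1 *: (if c then vtx i else vtx i')).
  apply: (@conv_hull_convex R 2 _ vtx (idx_of A B) _ (fun c : bool => if c then vtx i else vtx i')
    (fun=> 2^-1)) => [c|//|[] _]; first by rewrite invr_ge0.
    by apply: conv_hull_vertex; rewrite inE i0 i2 bA aB.
  by apply: conv_hull_vertex; rewrite inE i'0 i'2 bB aA.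
move=> j; rewrite (plane_x_comb _ _ h2).
transitivity (2^-1 * plane_x (vtx i) j + 2^-1 * plane_x (vtx i') j); first by rewrite big_bool.
rewrite !vtxE i0 i2 i'0 i'2.
by rewrite -mulrDr addrA subrK subrr mulr0.
Qed.

(** Split x into its positive and negative parts, both of mass n <= 1. The product plan of transport
    writes x as the sum of (xp_a xm_b / n) (e_a - e_b). The remaining mass 1 - n goes to the origin,
    which lies in the hull when A and B meet; otherwise n = 1. *)
Lemma closed_cell_hull A B y : good A B -> closed_cell A B (plane_x y) -> hull (idx_of A B) y.
Proof.
move=> gAB [xA xB S2 S0]; set x := plane_x y in xA xB S2 S0.
pose xp j : R := (`|x j| + x j) / 2; pose xm j : R := (`|x j| - x j) / 2.
have xp0 j : 0 <= xp j by rewrite divr_ge0 // -lerBlDr sub0r ler_normr lexx orbT.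
have xm0 j : 0 <= xm j by rewrite divr_ge0 // subr_ge0 ler_norm.
have xE j : x j = xp j - xm j by rewrite /xp /xm; field.
have xpm j : xp j * xm j = 0.
  have -> : xp j * xm j = (`|x j| ^+ 2 - x j ^+ 2) / 4 by rewrite /xp /xm; field.
  by rewrite real_normK ?num_real // subrr mul0r.
have xs : \sum_j x j = 0 by exact: sum_plane_x.
pose n := \sum_j xp j.
have nm : \sum_j xm j = n.
  by apply/eqP; rewrite eq_sym -subr_eq0 /n -sumrB -[X in _ == X]xs; apply/eqP/eq_bigr => j _; rewrite -xE.
have nN : n + n = \sum_j `|x j|.
  by rewrite -{2}nm -big_split; apply: eq_bigr => j _; rewrite /xp /xm /=; field.
have n0 : 0 <= n by exact: sumr_ge0.
have n1 : n <= 1 by move: S2; rewrite -nN; lra.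
have pA j : xp j != 0 -> j \in A.
  apply: contraNT => /xB x0; rewrite /xp ler0_norm // addNr mul0r eqxx //.
have mB j : xm j != 0 -> j \in B.
  apply: contraNT => /xA x0; rewrite /xm ger0_norm // subrr mul0r eqxx //.
clearbody xp xm.
have [c hc c0] : exists2 c, (1 - n != 0 -> hull (idx_of A B) c) & forall j, (1 - n) * plane_x c j = 0.
  have [AB|AB] := eqVneq (A :&: B) finset.set0; last first.
    by have [m hm m0] := center_hull gAB AB; exists m => // j; rewrite m0 mulr0.
  have -> : 1 - n = 0 by move: nN; rewrite (S0 AB); lra.
  by exists 0 => [|j]; [rewrite eqxx|rewrite mul0r].
pose w (o : 'I_1 + 'I_3 * 'I_3) : R := if o is inr ab then xp ab.1 * xm ab.2 / n else 1 - n.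
pose u (o : 'I_1 + 'I_3 * 'I_3) : 'rV[R]_2 :=
  if o is inr ab then plane_y (fun j => (j == ab.1)%:R - (j == ab.2)%:R) else c.
(* When [n = 0] the quotient is 0 by convention, and so are all [xp] and [xm], hence the identity
   persists. *)
have nn (a : R) : (n = 0 -> a = 0) -> a * n / n = a.
  by move=> H; have [n00|n00] := eqVneq n 0; [rewrite n00 mulr0 mul0r H|rewrite mulfK].
have np : n = 0 -> forall j, xp j = 0.
  move=> /eqP; rewrite psumr_eq0 // => /allP H j.
  by have /eqP := H j (mem_index_enum j).
have nq : n = 0 -> forall j, xm j = 0.
  rewrite -nm => /eqP; rewrite psumr_eq0 // => /allP H j.
  by have /eqP := H j (mem_index_enum j).
have ZS (F : 'I_3 -> 'I_3 -> R) : \sum_(ab : 'I_3 * 'I_3) F ab.1 ab.2 = \sum_a \sum_b F a b.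
  by rewrite pair_bigA.
have w1 : \sum_o w o = 1.
  rewrite big_sumType big_ord1 /= (ZS (fun a b => xp a * xm b / n)).
  under eq_bigr do rewrite -mulr_suml -mulr_sumr nm.
  rewrite -mulr_suml -mulr_suml -/n nn ?subrK //.
have wu : \sum_o w o *: u o = y.
  apply: plane_x_inj => k; rewrite plane_x_comb // big_sumType big_ord1 /= c0 add0r.
  rewrite (eq_bigr (fun ab : 'I_3 * 'I_3 => xp ab.1 * xm ab.2 / n * ((k == ab.1)%:R - (k == ab.2)%:R))); last first.
    move=> [a b] _ /=; rewrite plane_xK // sumrB.
    have d1 (l : 'I_3) : \sum_j ((j == l)%:R : R) = 1.
      by rewrite (bigD1 l) //= eqxx big1 ?addr0 // => j /negbTE ->.
    by rewrite !d1 subrr.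
  rewrite (ZS (fun a b => xp a * xm b / n * ((k == a)%:R - (k == b)%:R))).
  under eq_bigr => a _ do under eq_bigr => b _ do rewrite mulrBr.
  under eq_bigr do rewrite sumrB.
  rewrite sumrB -/x xE; congr (_ - _).
    rewrite (bigD1 k) //= [X in _ + X]big1 ?addr0; last first.
      by move=> a ak; rewrite big1 // => b _; rewrite eq_sym (negbTE ak) mulr0.
    under eq_bigr do rewrite eqxx mulr1.
    by rewrite -mulr_suml -mulr_sumr nm nn // => /np ->.
  rewrite exchange_big (bigD1 k) //= [X in _ + X]big1 ?addr0; last first.
    by move=> a ak; rewrite big1 // => b _; rewrite eq_sym (negbTE ak) mulr0.
  under eq_bigr do rewrite eqxx mulr1.
  have E : \sum_(i < 3) xp i * xm k / n = xm k * n / n.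
    by rewrite -mulr_suml mulr_sumr; congr (_ / _); apply: eq_bigr => i _; exact: mulrC.
  by rewrite E nn // => /nq ->.
rewrite -wu; apply: conv_hull_convex => //.
  by case=> [_|[a b]] /=; [rewrite subr_ge0|rewrite divr_ge0 // mulr_ge0].
case=> [_|[a b] h] //.
have xa : xp a != 0 by apply: contraNneq h => E; rewrite /w /= E !mul0r.
have xb : xm b != 0 by apply: contraNneq h => E; rewrite /w /= E mulr0 mul0r.
have ab : a != b by apply: contraNneq xa => ab; apply/eqP/(mulIf xb); rewrite mul0r -ab xpm.
have [i [i0 i2]] := idx_ex ab.
have -> : u (inr (a, b)) = vtx i.
  by apply: plane_x_inj => j; rewrite -[vtx i]plane_yK; congr (plane_x (plane_y _) _);
    apply/funext => l; rewrite vtxE i0 i2.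
by apply: conv_hull_vertex; rewrite inE i0 i2 pA ?mB.
Qed.

(** A relative interior point can be pushed a little beyond itself, away from any point of the hull,
    and each strict inequality comes from a suitable such point. Conversely the strict inequalities
    are open conditions, and the equalities hold on the whole affine hull. *)
Lemma relint_cell A B y : good A B ->
  relint (hull (idx_of A B)) y <-> open_cell A B (plane_x y).
Proof.
move=> gAB; split.
  move=> [hy ny].
  have [xA xB S2 S0] := hull_closed_cell hy; set x := plane_x y in xA xB S2 S0 *.
  (* The push away from [m]. It is used with vertices for the signs of the coordinates, and with the
     origin for the bound on the l^1 norm. *)
  have ext m : hull (idx_of A B) m -> exists2 e, 0 < e &
      closed_cell A B (fun j => (1 + e) * x j - e * plane_x m j).
    move=> hm; have fc : continuous (fun e : R => (1 + e) *: y - e *: m).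
      by move=> e; apply: (@cvgB _ _ _ _ _ (fun e : R => (1 + e) *: y) (fun e : R => e *: m));
        [apply: cvgZr_tmp; apply: cvgD; [exact: cvg_cst|exact: cvg_id]|apply: cvgZr_tmp; exact: cvg_id].
    have : \forall e \near (0 : R), aff_hull (hull (idx_of A B)) ((1 + e) *: y - e *: m) ->
        hull (idx_of A B) ((1 + e) *: y - e *: m).
      have := fc 0; rewrite /continuous_at addr0 scale1r scale0r subr0 => F; exact: (F _ ny).
    move=> /nbhs_ballP[d /= d0 bd]; have d20 : 0 < d / 2 by rewrite divr_gt0.
    exists (d / 2) => //.
    have e1 : \sum_(c : bool) (if c then 1 + d / 2 else - (d / 2)) = 1 by rewrite big_bool /= addrK.
    have zE : \sum_(c : bool) (if c then 1 + d / 2 else - (d / 2)) *: (if c then y else m) =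
        (1 + d / 2) *: y - (d / 2) *: m by rewrite big_bool /= scaleNr.
    have hz : hull (idx_of A B) ((1 + d / 2) *: y - (d / 2) *: m).
      apply: bd.
        by rewrite /ball /= sub0r normrN gtr0_norm // ltr_pdivrMr // ltr_pMr // ltrDl ltr01.
      exists 2%N, (fun l : 'I_2 => if l == 0 then y else m),
        (fun l : 'I_2 => if l == 0 then 1 + d / 2 else - (d / 2)); split.
      - by move=> l; case: ifP.
      - by rewrite !big_ord_recl big_ord0 /= addr0 addrK.
      - by rewrite !big_ord_recl big_ord0 /= addr0 scaleNr.
    have := hull_closed_cell hz; rewrite -zE; congr closed_cell; apply/funext => j.
    by rewrite plane_x_comb // big_bool /= mulNr.
  split.
  - move=> j jA jB; have [b bB bj] := good_other gAB jA; rewrite eq_sym in bj.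
    have [i [i0 i2]] := idx_ex bj.
    have [|e e0 [H _ _ _]] := ext (vtx i); first by apply: conv_hull_vertex; rewrite inE i0 i2 jA.
    have := H j jB; rewrite vtxE i0 i2 eqxx (negbTE bj) subr0 mulr1 => H'.
    have e1 : 0 < 1 + e by rewrite ltr_wpDl.
    by rewrite -(pmulr_rgt0 _ e1); apply: (lt_le_trans e0); rewrite -subr_ge0.
  - move=> j jB jA; have gBA : good B A by rewrite goodC.
    have [a aA aj] := good_other gBA jB.
    have [i [i0 i2]] := idx_ex aj.
    have [|e e0 [_ H _ _]] := ext (vtx i); first by apply: conv_hull_vertex; rewrite inE i0 i2 jB aA.
    have := H j jA; rewrite vtxE i0 i2 eqxx eq_sym (negbTE aj) sub0r mulrN1 opprK => H'.
    have e1 : 0 < 1 + e by rewrite ltr_wpDl.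
    by rewrite -(pmulr_rlt0 _ e1); apply: lt_le_trans H'; rewrite ltrDl.
  - by move=> j jA jB; apply: le_anti; rewrite xA // xB.
  - have [AB|AB] := eqVneq (A :&: B) finset.set0; first exact: S0.
    have [m hm m0] := center_hull gAB AB.
    have [e e0 [_ _ H _]] := ext m hm; move: H.
    under eq_bigr do rewrite m0 mulr0 subr0 normrM.
    rewrite -mulr_sumr gtr0_norm; last by lra.
    set S := \sum_j _ => H; rewrite -(ltr_pM2l (_ : 0 < 1 + e)); last by lra.
    by apply: (le_lt_trans H); lra.
move=> ox; split; first by apply: closed_cell_hull => //; exact: open_closed_cell.
have [pA nB z S] := ox.
have np j : \forall y' \near y, (j \in A -> j \notin B -> 0 < plane_x y' j) /\
    (j \in B -> j \notin A -> plane_x y' j < 0).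
  have nb (b c : bool) (P : 'rV[R]_2 -> Prop) : (b -> c -> \forall y' \near y, P y') ->
      \forall y' \near y, b -> c -> P y'.
    case: b => H; last by apply: (filterS _ (@filterT _ (nbhs y) _)).
    case: c H => H; last by apply: (filterS _ (@filterT _ (nbhs y) _)).
    by apply: filterS (H isT isT).
  apply: filterI; apply: nb => h1 h2.
    exact: (@cts_plane_x j y _ (lt_nbhsr (pA j h1 h2))).
  exact: (@cts_plane_x j y _ (lt_nbhsl (nB j h1 h2))).
have nall : \forall y' \near y, forall j, (j \in A -> j \notin B -> 0 < plane_x y' j) /\
    (j \in B -> j \notin A -> plane_x y' j < 0).
  apply: filterS (filterI (np 0) (filterI (np 1) (np 2))) => y' [n0 [n1 n2]].
  exact: ord3_ind.
have nS : A :&: B != finset.set0 -> \forall y' \near y, \sum_j `|plane_x y' j| < 2.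
  move=> AB; rewrite (negbTE AB) in S.
  have Sc : {for y, continuous (fun y' => \sum_j `|plane_x y' j|)}.
    by apply: cts_sum => j _; apply: cts_norm; exact: cts_plane_x.
  exact: (Sc _ (lt_nbhsl S)).
have nS' : \forall y' \near y, A :&: B != finset.set0 -> \sum_j `|plane_x y' j| < 2.
  have [AB|AB] := eqVneq (A :&: B) finset.set0; first by apply: (filterS _ (@filterT _ (nbhs y) _)).
  by apply: filterS (nS AB).
apply: filterS (filterI nall nS') => y' [sg S2] /aff_hullP[w [ws w1 y'E]].
have off j : j \notin A -> j \notin B -> plane_x y' j = 0.
  by move=> jA jB; rewrite y'E; exact: idx_of_comb_off ws w1.
apply: closed_cell_hull => //; apply: open_closed_cell; split=> //.
- by move=> j jA jB; have [H _] := sg j; exact: H.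
- by move=> j jA jB; have [_ H] := sg j; exact: H.
case: eqP => [AB|/eqP AB]; last exact: S2.
rewrite -(idx_of_comb_side AB ws w1) -y'E; apply: eq_bigr => j _; rewrite /side.
have dis : ~~ ((j \in A) && (j \in B)) by move/setP/(_ j): AB; rewrite !inE => ->.
have [sp sn] := sg j; move: dis.
have [jA|jA] := boolP (j \in A); have [jB|jB] := boolP (j \in B) => //= _.
- by rewrite subr0 mul1r gtr0_norm // sp.
- by rewrite sub0r mulN1r ltr0_norm // sn.
- by rewrite off // subrr mul0r normr0.
Qed.

End Hulls.

(** * Strata *)

Section Supports.
Variable R : realType.
Local Notation C := (Cplx R).
Local Notation M := (flag_manifold R).
Local Notation mu := (@flag_moment_map R).
Local Notation theta := (@T2_action R).
Local Notation atlas := (@flag_atlas R).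
Local Notation stratum := (@stratum R M atlas).
Local Notation admissible := (@admissible R M atlas).
Implicit Types (L : M) (k : CP R 1) (A B : {set 'I_3}) (s t : idx).

Definition supp (p : 'rV[C]_3) : {set 'I_3} := [set j | p 0 j != 0]%SET.

(** If the supports shared exactly one index, \sum_i p_i q_i would consist of one nonzero term, but
    it is 0. *)
Lemma supp_good L : good (supp (flag_p L)) (supp (flag_q L)).
Proof.
have pL := flag_pqP L; have [/row_neq0P[a a0] /row_neq0P[b b0] _ _] := pL.
apply/and3P; split; first by apply/finset.set0Pn; exists a; rewrite inE.
  by apply/finset.set0Pn; exists b; rewrite inE.
apply/negP => /cards1P[i iE].
have pi j : (flag_p L 0 j != 0) && (flag_q L 0 j != 0) = (j == i).
  by move/setP/(_ j): iE; rewrite !inE.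
have := pair_dot pL; rewrite /dotp (bigD1 i) //= big1 ?addr0 => [/eqP|j ji].
  by rewrite mulf_eq0 -[_ || _]negbK negb_or pi eqxx.
have := pi j; rewrite (negbTE ji) => /negbT; rewrite negb_and !negbK => /orP[] /eqP ->.
  by rewrite mul0r.
by rewrite mulr0.
Qed.

Lemma stratumP L s : stratum s L <-> s = idx_of (supp (flag_p L)) (supp (flag_q L)).
Proof.
have D i : chart_dom (sa_chart (s := atlas) i) L <-> i \in idx_of (supp (flag_p L)) (supp (flag_q L)).
  rewrite -[chart_dom _]/(chart_dom (flag_chart R (fix_perm i))) flag_domE !inE.
  by split=> [[-> ->]|/andP[]].
split=> [[sD sN]|->].
  apply/setP => i; apply/idP/idP => [si|Di].
    by apply/D; exact: sD.
  apply/negPn/negP => nsi; apply: (sN i nsi); exact/D.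
split=> i /=; first by move=> /D.
by move=> ni /D; exact/negP.
Qed.

Lemma stratum_supp s L : stratum s L -> firsts s = supp (flag_p L) /\ lasts s = supp (flag_q L).
Proof.
by move=> /stratumP ->; rewrite firsts_idx_of ?lasts_idx_of //; exact: supp_good.
Qed.

Lemma stratum_idx_of A B L : good A B ->
  stratum (idx_of A B) L <-> supp (flag_p L) = A /\ supp (flag_q L) = B.
Proof.
move=> gAB; split=> [/stratum_supp[<- <-]|[<- <-]]; last exact/stratumP.
by rewrite firsts_idx_of ?lasts_idx_of.
Qed.

Lemma admissible_good s : admissible s ->
  good (firsts s) (lasts s) /\ s = idx_of (firsts s) (lasts s).
Proof.
move=> [L sL]; have [-> ->] := stratum_supp sL; split; first exact: supp_good.
exact/stratumP.
Qed.

(* The classes in CP^1 that match some flag with supports [A] and [B]. *)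
Definition fits A B k : Prop := A :&: B != finset.set0 ->
  forall j, (CPvec k 0 j != 0) = (j \in A :&: B).

Lemma supp_weight L j :
  (0 < weight (flag_p L) j) = (j \in supp (flag_p L)) /\
  (0 < weight (flag_q L) j) = (j \in supp (flag_q L)).
Proof.
by have [p0 q0 _ _] := flag_pqP L; rewrite !inE !weight_gt0.
Qed.

Lemma fits_supp L k : CP_matches L k -> fits (supp (flag_p L)) (supp (flag_q L)) k.
Proof.
move=> m /finset.set0Pn[] i; rewrite !inE => /andP[pi qi] j.
have [l lE] := matches_lambda (CPvec_neq0 k) m.
have l0 : l != 0.
  by apply: contraNneq (mulf_neq0 pi qi) => l0; rewrite lE l0 mul0r.
by rewrite !inE -negb_or -mulf_eq0 lE mulf_eq0 (negbTE l0).
Qed.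

Lemma open_cell_supp L : open_cell (supp (flag_p L)) (supp (flag_q L)) (moment_x L).
Proof.
have pL := flag_pqP L; have w0 := weight_ge0.
have wp j := (supp_weight L j).1; have wq j := (supp_weight L j).2.
have np j : j \notin supp (flag_p L) -> weight (flag_p L) j = 0.
  by rewrite -wp lt_def w0 andbT negbK => /eqP.
have nq j : j \notin supp (flag_q L) -> weight (flag_q L) j = 0.
  by rewrite -wq lt_def w0 andbT negbK => /eqP.
split.
- by move=> j jA /nq E; rewrite (moment_xE j pL) E subr0 wp.
- by move=> j jB /np E; rewrite (moment_xE j pL) E sub0r oppr_lt0 wq.
- by move=> j /np Ep /nq Eq; rewrite (moment_xE j pL) Ep Eq subrr.
case: ifPn => [/eqP AB|/finset.set0Pn[] i].
  apply/moment_boundary => j; apply/eqP; rewrite mulf_eq0 -[_ || _]negbK negb_or.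
  by move/setP/(_ j): AB; rewrite !inE => ->.
rewrite !inE => /andP[pi qi]; rewrite lt_neqAle moment_x_bound andbT.
apply/eqP => /moment_boundary/(_ i)/eqP; rewrite mulf_eq0.
by rewrite (negbTE pi) (negbTE qi).
Qed.

(** The class and the position of x tell which products p_j q_j vanish. When one does, the sign of
    x_j, the difference of the weights, tells which of the two factors is nonzero. *)
Lemma cell_supp A B L k : open_cell A B (moment_x L) -> CP_matches L k -> fits A B k ->
  supp (flag_p L) = A /\ supp (flag_q L) = B.
Proof.
move=> [pA nB z S] m f; have pL := flag_pqP L; have w0 := weight_ge0.
have wp j := (supp_weight L j).1; have wq j := (supp_weight L j).2.
have [l lE] := matches_lambda (CPvec_neq0 k) m.
have pq j : (j \in supp (flag_p L)) && (j \in supp (flag_q L)) = (j \in A :&: B).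
  rewrite !inE -negb_or -mulf_eq0.
  move: S; case: ifPn => [/eqP AB /moment_boundary ->|AB S].
    by rewrite eqxx; move/setP/(_ j): AB; rewrite !inE.
  have [i pqi] : exists i, flag_p L 0 i * flag_q L 0 i != 0.
    apply: contrapT => H; move: S; suff -> : \sum_j `|moment_x L j| = 2 by rewrite ltxx.
    by apply/moment_boundary => i; apply/eqP/negPn/negP => pqi; apply: H; exists i.
  have l0 : l != 0 by apply: contraNneq pqi => l0; rewrite lE l0 mul0r.
  by rewrite lE mulf_eq0 (negbTE l0) /= (f AB) !inE.
have sg j : (j \in A -> j \notin B -> weight (flag_q L) j < weight (flag_p L) j) /\
    (j \in B -> j \notin A -> weight (flag_p L) j < weight (flag_q L) j) /\
    (j \notin A -> j \notin B -> weight (flag_p L) j = weight (flag_q L) j).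
  split; [|split] => h1 h2.
  - by rewrite -subr_gt0 -(moment_xE j pL); exact: pA.
  - by rewrite -subr_lt0 -(moment_xE j pL); exact: nB.
  - by apply/eqP; rewrite -subr_eq0 -(moment_xE j pL) z.
suff H j : (j \in supp (flag_p L)) = (j \in A) /\ (j \in supp (flag_q L)) = (j \in B).
  by split; apply/setP => j; have [] := H j.
have := pq j; rewrite finset.in_setI; have [s1 [s2 s3]] := sg j; move: s1 s2 s3.
rewrite -!wp -!wq; have := weight_ge0 (flag_p L) j; have := weight_ge0 (flag_q L) j.
move: (weight _ _) (weight _ _) => u w w0' u0'.
case: (j \in A); case: (j \in B) => /= s1 s2 s3.
- by move=> /andP[-> ->].
- by rewrite (le_lt_trans w0' (s1 isT isT)).
- by rewrite (le_lt_trans u0' (s2 isT isT)) andbT.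
- by rewrite (s3 isT isT) andbb => ->.
Qed.

Lemma plane_moment L : plane_x (mu L) = moment_x L.
Proof. by apply/funext => j; exact: plane_x_moment. Qed.

Lemma stratum_cell s L : stratum s L -> open_cell (firsts s) (lasts s) (plane_x (mu L)).
Proof. by move=> /stratum_supp[-> ->]; rewrite plane_moment; exact: open_cell_supp. Qed.

Lemma stratum_fits s L k : stratum s L -> CP_matches L k -> fits (firsts s) (lasts s) k.
Proof. by move=> /stratum_supp[-> ->]; exact: fits_supp. Qed.

Lemma cell_stratum s L k : admissible s -> open_cell (firsts s) (lasts s) (plane_x (mu L)) ->
  CP_matches L k -> fits (firsts s) (lasts s) k -> stratum s L.
Proof.
rewrite plane_moment => /admissible_good[gs sE] c m f.
by rewrite sE; apply/stratum_idx_of => //; exact: cell_supp c m f.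
Qed.

Lemma fits_ex s : admissible s -> exists k, fits (firsts s) (lasts s) k.
Proof.
by move=> [L sL]; have [k m] := CP_matches_ex L; exists k; exact: stratum_fits m.
Qed.

Lemma cell_hexagon A B y : open_cell A B (plane_x y) -> @hexagon R y.
Proof. by move=> /open_closed_cell[]. Qed.

Lemma sigma_polytopeE s :
  sigma_polytope (A := atlas) mu s = conv_hull [set vtx R i | i in [set i | i \in s]].
Proof.
by congr conv_hull; apply/seteqP; split=> _ [i si <-]; exists i; rewrite ?vtx_fixed.
Qed.

Lemma relint_sigma s y : admissible s ->
  relint (sigma_polytope (A := atlas) mu s) y <-> open_cell (firsts s) (lasts s) (plane_x y).
Proof.
move=> /admissible_good[gs sE]; rewrite sigma_polytopeE {1}sE; exact: relint_cell.
Qed.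

Lemma mu_stratum s : admissible s -> mu @` stratum s = relint (sigma_polytope (A := atlas) mu s).
Proof.
move=> sA; apply/seteqP; split=> [_ [L sL <-]|y /(relint_sigma y sA) c].
  by apply/relint_sigma => //; exact: stratum_cell.
have [k f] := fits_ex sA; have [L [LE m]] := orbit_of_ex k (cell_hexagon c).
by exists L => //; apply: cell_stratum m f => //; rewrite LE.
Qed.

End Supports.

(** * Stabilizers, their connectedness and their dimension *)

Section Stabilizers.
Variable R : realType.
Local Notation C := (Cplx R).
Local Notation M := (flag_manifold R).
Local Notation theta := (@T2_action R).
Implicit Types (L : M) (A B : {set 'I_3}) (t : 'rV[C]_2) (v : 'rV[R]_2).

Definition const_on (T : Type) A (f : 'I_3 -> T) : Prop := forall a b, a \in A -> b \in A -> f a = f b.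

Lemma stabE L t : stab theta L t <-> torus t /\
  const_on (supp (flag_p L)) (ext_torus t 0) /\ const_on (supp (flag_q L)) (ext_torus t 0).
Proof.
have pL := flag_pqP L; have tn (tT : torus t) := ext_torus_neq0 (torus_neq0 tT).
split=> [[tT tL]|[tT [cA cB]]]; split=> //.
  have := T2_action_pair (torus_neq0 tT) pL; rewrite tL => tpL.
  have [a [b [a0 b0 pE qE]]] := pair_uniq pL tpL.
  suff [Ha Hb] : (forall j, j \in supp (flag_p L) -> ext_torus t 0 j = a) /\
      (forall j, j \in supp (flag_q L) -> ext_torus t 0 j = b^-1).
    by split=> i j iS jS; [rewrite !Ha|rewrite !Hb].
  split=> j; rewrite inE => j0.
    have := congr1 (fun u : 'rV[C]_3 => u 0 j) pE; rewrite !mxE mulrC => /(mulIf j0).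
    by [].
  have := congr1 (fun u : 'rV[C]_3 => u 0 j) qE; rewrite !mxE mulrC => /(mulIf j0) <-.
  by rewrite invrK.
have [p0 q0 _ _] := pL; have [/row_neq0P[a a0] /row_neq0P[b b0]] := (p0, q0).
have ta := tn tT a; have tb := tn tT b.
apply: (@pair_inj _ _ _ _ _ _ pL).
have := @pair_scale _ _ _ _ (ext_torus t 0 a)^-1 (ext_torus t 0 b) (invr_neq0 ta) tb
  (T2_action_pair (torus_neq0 tT) pL).
congr plucker_pair; apply/rowP => j; rewrite [LHS]mxE [X in _ * X]mxE.
  have [->|j0] := eqVneq (flag_p L 0 j) 0; first by rewrite mul0r mulr0.
  by rewrite (cA j a) ?inE // mulrC mulfK.
have [->|j0] := eqVneq (flag_q L 0 j) 0; first by rewrite mul0r mulr0.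
by rewrite (cB j b) ?inE // mulrC divfK.
Qed.

Definition ext_vec v (j : 'I_3) : R := [:: v 0 0; v 0 1; 0]`_j.

Lemma ext_torus_exp v j : ext_torus (torus_exp v) 0 j = mkC (cos (ext_vec v j)) (sin (ext_vec v j)).
Proof.
elim/ord3_ind: j; rewrite /ext_torus !mxE /= ?mxE //=.
by rewrite cos0 sin0; apply: cplxP.
Qed.

Lemma torus_expP k (v : 'rV[R]_k) : torus (torus_exp v).
Proof. by apply/torus_normsq => j; rewrite mxE /normsq /= cos2Dsin2. Qed.

Lemma ext_vecZ (a : R) v j : ext_vec (a *: v) j = a * ext_vec v j.
Proof. by elim/ord3_ind: j; rewrite /ext_vec /= ?mxE ?mulr0. Qed.

Lemma exp_line_inj (x y : R) : (forall a : R, mkC (cos (a * x)) (sin (a * x)) = mkC (cos (a * y)) (sin (a * y)) :> C) -> x = y.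
Proof.
move=> H; apply/eqP/negPn/negP; rewrite -subr_eq0 => xy.
(* For this [a] the angles differ by pi, so that the cosine of the difference is -1; by assumption
   it is also 1. *)
have := H (trigo.pi / (x - y)); set a := trigo.pi / _ => E.
have [c s] : cos (a * x) = cos (a * y) /\ sin (a * x) = sin (a * y).
  by split; [exact: (congr1 (@cRe R) E)|exact: (congr1 (@cIm R) E)].
have : cos (a * x - a * y) = 1 by rewrite cosB c s -!expr2 cos2Dsin2.
rewrite -mulrBr /a divfK // cospi => /eqP; rewrite -subr_eq0 -opprD oppr_eq0.
by rewrite (_ : 1 + 1 = 2%:R) ?pnatr_eq0.
Qed.

Lemma stab_exp L v : (forall a : R, stab theta L (torus_exp (a *: v))) <->
  const_on (supp (flag_p L)) (ext_vec v) /\ const_on (supp (flag_q L)) (ext_vec v).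
Proof.
split=> [H|[cA cB] a]; last first.
  apply/stabE; split; first exact: torus_expP.
  by split=> i j iS jS; rewrite !ext_torus_exp !ext_vecZ; [rewrite (cA i j)|rewrite (cB i j)].
have K (S : {set 'I_3}) : (forall a : R, const_on S (ext_torus (torus_exp (a *: v)) 0)) ->
    const_on S (ext_vec v).
  move=> HS i j iS jS; apply: exp_line_inj => a; rewrite -!ext_vecZ -!ext_torus_exp.
  exact: HS.
by split; apply: K => a; have /stabE[_ []] := H a.
Qed.

Lemma unit_arg (z : C) : normsq z = 1 -> exists x : R, z = mkC (cos x) (sin x).
Proof.
rewrite /normsq => z1.
have cz : -1 <= cRe z <= 1 by have := sqr_ge0 (cIm z) => z2; apply/andP; split; nra.
have c := acosK cz; have s := sin_acos cz.
have sE : cIm z ^+ 2 = 1 - cRe z ^+ 2 by rewrite -z1; ring.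
have sa : Num.sqrt (1 - cRe z ^+ 2) = `|cIm z| by rewrite -sE sqrtr_sqr.
have [z0|z0] := leP 0 (cIm z).
  exists (acos (cRe z)); apply: cplxP; rewrite /= ?c //.
  by rewrite s sa ger0_norm.
exists (- acos (cRe z)); apply: cplxP; rewrite /= ?cosN ?sinN ?c //.
by rewrite s sa ltr0_norm // opprK.
Qed.

(** Arguments of the coordinates of a stabilizing [t] form a vector that is constant on both
    supports. So [t] lies on a one-parameter subgroup of the stabilizer; all of these are connected
    and pass through 1. *)
Lemma stab_connected L : connected (stab theta L).
Proof.
pose V := [set v | const_on (supp (flag_p L)) (ext_vec v) /\ const_on (supp (flag_q L)) (ext_vec v)].
have -> : stab theta L = \bigcup_(v in V) [set torus_exp (a *: v) | a in [set: R]].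
  apply/seteqP; split=> [t st|_ [v /stab_exp H [a _ <-]]]; last exact: H.
  have /stabE[tT [cA cB]] := st.
  (* A single function of [z], so equal coordinates receive equal arguments. Its value 0 at 1 agrees
     with the last entry 0 of [ext_vec]. *)
  have /choice[arg argE] : forall z : C, exists x : R, (normsq z = 1 -> z = mkC (cos x) (sin x)) /\
      (z = 1 -> x = 0).
    move=> z; have [->|z1] := eqVneq z 1.
      by exists 0; split=> // _; rewrite cos0 sin0; apply: cplxP.
    have [/eqP/unit_arg[x xE]|nz] := boolP (normsq z == 1).
      by exists x; split=> // /eqP; rewrite (negbTE z1).
    by exists 0; split=> // /eqP; rewrite (negbTE nz).
  have tE v : (forall j, v 0 j = arg (t 0 j)) -> torus_exp v = t.
    move=> vE; apply/rowP => j; rewrite mxE vE; apply/esym; apply: (argE _).1.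
    by move/torus_normsq : tT; apply.
  pose v : 'rV[R]_2 := \row_j arg (t 0 j).
  have vE : ext_vec v =1 (fun j => arg (ext_torus t 0 j)).
    apply: ord3_ind; rewrite /ext_vec /ext_torus !mxE //=.
    by apply/esym; apply: (argE _).2.
  exists v; first by split=> i j iS jS; rewrite !vE; [rewrite (cA i j)|rewrite (cB i j)].
  by exists 1 => //; rewrite scale1r; apply: tE => j; rewrite mxE.
apply: bigcup_connected; first by exists (torus_exp 0) => v _; exists 0 => //; rewrite scale0r.
move=> v _; apply: connected_continuous_connected; first by apply/connected_intervalP.
apply: continuous_subspaceT => a; apply: cts_mx => i j; rewrite ord1.
under [X in {for _, continuous X}]funext do rewrite mxE mxE.
have ac : {for a, continuous (fun b : R => b * v 0 j)}.
  exact: (ctsM (@cts_id _ a) (@cts_cst R _ (v 0 j) a)).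
by apply: cts_mkC; [exact: (cts_comp ac (@continuous_cos R _))|exact: (cts_comp ac (@continuous_sin R _))].
Qed.

(** Orthogonality to the edges says that v_a - v_b is the same for all a in A and b in B with a !=
    b. For disjoint A and B, fixing one of the two indices gives constancy. If they share two
    indices, exchanging these shows that the common difference is 0. *)
Lemma const_on_edges A B v i0 : good A B -> i0 \in idx_of A B ->
  const_on A (ext_vec v) /\ const_on B (ext_vec v) <->
  forall i, i \in idx_of A B -> v *m (vtx R i - vtx R i0)^T = 0.
Proof.
move=> gAB i0s; pose e i := ext_vec v (fix_perm i 0) - ext_vec v (fix_perm i 2).
have dE i : (v *m (vtx R i - vtx R i0)^T) 0 0 = e i - e i0.
  have vE j l : (vtx R j) 0 l = 1 + plane_x (vtx R j) (lshift 1 l).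
    by rewrite -{1}[vtx R j]plane_yK mxE.
  have S j : \sum_(l < 2) v 0 l * plane_x (vtx R j) (lshift 1 l) = e j.
    transitivity (\sum_(m < 3) ext_vec v m * plane_x (vtx R j) m).
      rewrite big_ord_recl [RHS]big_ord_recr big_ord1 [\sum_(i < 2) _]big_ord_recl big_ord1 /=.
      rewrite /ext_vec /= mul0r addr0; congr (_ * plane_x _ _ + v _ _ * plane_x _ _); exact/val_inj.
    under eq_bigr do rewrite vtxE mulrBr.
    have D (a : 'I_3) : \sum_(m < 3) ext_vec v m * (m == a)%:R = ext_vec v a.
      by rewrite (bigD1 a) //= eqxx mulr1 big1 ?addr0 // => m /negbTE ->; rewrite mulr0.
    by rewrite sumrB !D.
  rewrite mxE -[e i]S -[e i0]S -sumrB; apply: eq_bigr => l _.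
  by rewrite !mxE !vE; ring.
have E : (forall i, i \in idx_of A B -> v *m (vtx R i - vtx R i0)^T = 0) <->
    (forall i, i \in idx_of A B -> e i = e i0).
  split=> H i si; first by apply/eqP; rewrite -subr_eq0 -dE H // mxE.
  by apply/rowP => j; rewrite ord1 dE H // subrr mxE.
rewrite E {E}; split=> [[cA cB] i|H].
  move: i0s; rewrite !inE => /andP[a0 b0] /andP[a b].
  by rewrite /e (cA (fix_perm i 0) (fix_perm i0 0)) // (cB (fix_perm i 2) (fix_perm i0 2)).
have ab a b : a \in A -> b \in B -> a != b -> ext_vec v a - ext_vec v b = e i0.
  move=> aA bB /idx_ex[i [ia ib]]; rewrite -ia -ib; apply: (H i).
  by rewrite inE ia ib aA.
have [AB|/finset.set0Pn[c cAB]] := eqVneq (A :&: B) finset.set0.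
  have nab a b : a \in A -> b \in B -> a != b.
    by move=> aA bB; apply/eqP => abE; move/setP/(_ a): AB; rewrite !inE aA abE bB.
  have /and3P[/finset.set0Pn[a0 a0A] /finset.set0Pn[b0 b0B] _] := gAB.
  split=> x y xS yS.
    by apply: (addIr (- ext_vec v b0)); rewrite !ab // nab.
  by apply: oppr_inj; apply: (addrI (ext_vec v a0)); rewrite !ab // nab.
have [d [dA dB dc]] := good_two gAB cAB; move: cAB; rewrite finset.in_setI => /andP[cA cB].
have e0 : e i0 = 0.
  have := ab c d cA dB; rewrite eq_sym => /(_ dc) E1; have E2 := ab d c dA cB dc.
  by move: E1 E2; move: (ext_vec v c) (ext_vec v d) (e i0) => x y u; lra.
have abE a b : a \in A -> b \in B -> ext_vec v a = ext_vec v b.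
  move=> aA bB; have [->//|/(ab a b aA bB)] := eqVneq a b.
  by rewrite e0 => /eqP; rewrite subr_eq0 => /eqP.
by split=> x y xS yS; [rewrite (abE x c) // (abE y c)|rewrite -(abE c x) // -(abE c y)].
Qed.

Lemma sigma_dim s L : @stratum R M (@flag_atlas R) s L -> exists2 d,
  aff_dim (sigma_polytope (A := @flag_atlas R) (@flag_moment_map R) s) d &
  torus_quotient_dim (stab theta L) d.
Proof.
move=> sL; have sA : @admissible R M (@flag_atlas R) s by exists L.
have [gs sE] := admissible_good sA; have [AE BE] := stratum_supp sL.
have /finset.set0Pn[i0 si0] : s != finset.set0 by rewrite sE; exact: idx_of_neq0.
rewrite sigma_polytopeE; exists (\rank (edge_mx (vtx R) s i0)); first exact: hull_aff_dim.
exists (\rank (kermx (edge_mx (vtx R) s i0)^T)), (row_base (kermx (edge_mx (vtx R) s i0)^T)).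
split; [exact: rank_kernel_edge|exact: row_base_free|].
rewrite -edge_mx_kernel; apply/seteqP; split=> v.
  move=> /stab_exp; rewrite -AE -BE; move=> /(const_on_edges v gs (i0 := i0)).
  by rewrite -sE; apply.
move=> H; apply/stab_exp; rewrite -AE -BE; apply/(const_on_edges v gs (i0 := i0)); by rewrite -sE.
Qed.

End Stabilizers.

(** The closed graph theorem for a compact target. It will make the class of a flag continuous where
    only one class matches. *)
Lemma closed_graph_continuous (X Y : topologicalType) (f : X -> Y) (G : set (X * Y)) :
  compact [set: Y] -> closed G -> (forall x, G (x, f x)) ->
  (forall x y, G (x, y) -> y = f x) -> continuous f.
Proof.
move=> cY cG Gf fG x U; rewrite nbhsE => -[] O [] oO Ofx OU.
have cK : compact (~` O) by exact: subclosed_compact (open_closedC oO) cY _.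
have /compact_near_coveringP /(_ X (nbhs x) (fun x' y => ~ G (x', y)) _) := cK.
move=> cov; suff hyp : forall y, (~` O) y -> \forall y' \near y & x' \near x, ~ G (x', y').
  apply: filterS (cov hyp) => x' H; apply: OU; apply: contrapT => nO; exact: H nO (Gf x').
move=> y nOy; have oG : open (~` G) by exact: closed_openC.
have [] : nbhs (x, y) (~` G).
  by apply: open_nbhs_nbhs; split=> // /fG yE; apply: nOy; rewrite yE.
move=> [V W] /= [Vx Wy] VW; exists (W, V) => //= -[y' x'] /= [Wy' Vx'].
exact: (VW (x', y')).
Qed.

(** * Generic classes, and flags of a stratum near its boundary *)

Section MainStratum.
Variable R : realType.
Local Notation C := (Cplx R).
Local Notation M := (flag_manifold R).
Local Notation mu := (@flag_moment_map R).
Local Notation theta := (@T2_action R).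
Local Notation atlas := (@flag_atlas R).
Local Notation stratum := (@stratum R M atlas).
Local Notation admissible := (@admissible R M atlas).
Implicit Types (L : M) (k : CP R 1) (A B : {set 'I_3}) (s t : idx) (i : 'I_Nfix).

Lemma near_dnbhs_avoid (P : R -> Prop) : (forall e e', P e -> P e' -> e = e') ->
  \forall e \near 0^', ~ P e.
Proof.
move=> uP; have [[e0 Pe0]|nP] := pselect (exists e, P e); last first.
  by apply: (filterS _ (@filterT _ _ _)) => e _ Pe; apply: nP; exists e.
have [e00|e00] := eqVneq e0 0.
  by apply: filterS (@nbhs_dnbhs_neq _ (0 : R)) => e /eqP en /uP/(_ Pe0); rewrite e00.
apply: cvg_within; apply: filterS (@nbhs0_lt _ _ `|e0| _) => [e elt /uP/(_ Pe0) ee0|].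
  by move: elt; rewrite ee0 ltxx.
by rewrite normr_gt0.
Qed.

Lemma CPvec_classK k (v : nonzero_vectors R 1) :
  triple (set_val v) = CPvec k -> qclass (@proportional R 1) v = k.
Proof.
move=> vE; have [a a0 E] := CPvec_class v; apply: (CPvec_inj a0).
by rewrite E -vE.
Qed.

(** Move [c] along the direction (1, b, -1 - b), which has no zero entry: each coordinate then
    vanishes for at most one value of the real parameter. *)
Lemma main_dense_CP : dense [set k : CP R 1 | fits finset.setT finset.setT k].
Proof.
move=> O [k Ok] oO; set c := CPvec k.
(* The value 1 or 2. [b0] and [b1] keep the entries of the direction nonzero, and the last condition
   makes it independent of [c], so the perturbed vector never vanishes. *)
have [b [b0 b1 cb]] : exists b : C, [/\ b != 0, b != -1 & c 0 1 != b * c 0 0].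
  have [E|E] := eqVneq (c 0 1) (c 0 0); last first.
    exists 1; rewrite mul1r oner_neq0; split=> //.
    by rewrite -subr_eq0 opprK (_ : 1 + 1 = 2%:R) ?pnatr_eq0.
  exists 2; rewrite pnatr_eq0; split=> //.
    by rewrite -subr_eq0 opprK (_ : 2 + 1 = 3%:R) ?pnatr_eq0 // -[3%N]/(2 + 1)%N natrD.
  rewrite E -subr_eq0 (_ : c 0 0 - 2 * c 0 0 = - c 0 0); last by ring.
  rewrite oppr_eq0; apply: contraNneq (CPvec_neq0 k) => c0; apply/eqP.
  have s := sum_CPvec k; rewrite sum_ord3 -/c E c0 !add0r in s.
  by apply: row3P; rewrite -/c ?E ?c0 ?s !mxE.
pose w (e : R) : 'rV[C]_2 := \row_j (if j == 0 then c 0 0 + mkC e 0 else c 0 1 + b * mkC e 0).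
have w0 e : w e <> 0.
  move=> we; have e0 : c 0 0 + mkC e 0 = 0 by have := congr1 (fun u : 'rV[C]_2 => u 0 0) we; rewrite !mxE.
  have e1 : c 0 1 + b * mkC e 0 = 0 by have := congr1 (fun u : 'rV[C]_2 => u 0 1) we; rewrite !mxE.
  case/eqP: cb; apply/eqP; rewrite -subr_eq0 -(subrr 0) -[X in _ == X - _]e1 -(mulr0 b) -e0.
  by apply/eqP; ring.
pose wz e : nonzero_vectors R 1 := exist _ (w e) (mem_set (w0 e)).
pose f e : CP R 1 := qclass (@proportional R 1) (wz e).
have mk0 : mkC 0 0 = 0 :> C by exact: cplxP.
have wc : continuous wz.
  move=> e; apply: cts_set_type; apply: cts_mx => i j; rewrite ord1.
  have mc : {for e, continuous (fun e : R => mkC e 0 : C)}.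
    by apply: cts_mkC; [exact: cts_id|exact: cts_const].
  have ac (a : C) : {for e, continuous (fun _ : R => a)} by exact: cts_const.
  have h0 : {for e, continuous (fun e : R => c 0 0 + mkC e 0)} by exact: (ctsCD (ac _) mc).
  have h1 : {for e, continuous (fun e : R => c 0 1 + b * mkC e 0)}.
    exact: (ctsCD (ac _) (ctsCM (ac _) mc)).
  have [j0|j0] := eqVneq j 0.
    by move: h0; congr (continuous_at e _); apply/funext => y; rewrite -[set_val (wz y)]/(w y) [RHS]mxE j0.
  move: h1; congr (continuous_at e _); apply/funext => y.
  by rewrite -[set_val (wz y)]/(w y) [RHS]mxE (negbTE j0).
have fc : continuous f by move=> e; apply: (cts_comp (wc e)); exact: qclass_continuous.
have cs : c 0 2 = - c 0 0 - c 0 1.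
  have := sum_CPvec k; rewrite sum_ord3 -/c => s.
  by apply/eqP; rewrite -subr_eq0 -[X in _ == X]s; apply/eqP; ring.
have f0 : f 0 = k.
  apply: CPvec_classK; rewrite set_valE /=.
  by apply: row3P; rewrite tripleE !mxE /= mk0 ?mulr0 !addr0.
have nO : \forall e \near 0^', O (f e).
  apply: cvg_within; have := fc 0; rewrite /continuous_at f0 => F.
  by apply: (F O); exact: open_nbhs_nbhs.
pose v : 'rV[C]_3 := \row_j [:: 1; b; - 1 - b]`_j.
have v0 j : v 0 j != 0.
  elim/ord3_ind: j; rewrite mxE //= ?oner_neq0 //.
  by rewrite -opprD oppr_eq0 addrC addr_eq0.
clearbody c.
have tE e j : triple (w e) 0 j = c 0 j + v 0 j * mkC e 0.
  elim/ord3_ind: j; rewrite tripleE !mxE /= ?cs; ring.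
have nz j : \forall e \near 0^', ~ triple (w e) 0 j = 0.
  apply: near_dnbhs_avoid => e e'; rewrite !tE => E E'.
  have : v 0 j * mkC e 0 = v 0 j * mkC e' 0 by apply: (addrI (c 0 j)); rewrite E E'.
  by move=> /(mulfI (v0 j)) /(congr1 (@cRe R)).
have FF := Proper_dnbhs_numFieldType (0 : R).
have [e [Oe [n0 [n1 n2]]]] := @filter_ex _ _ FF _
  (@filterI _ _ FF _ _ nO (@filterI _ _ FF _ _ (nz 0) (@filterI _ _ FF _ _ (nz 1) (nz 2)))).
exists (f e); split=> // _ j; have [a a0 ->] := CPvec_class (wz e).
rewrite mxE mulf_eq0 (negbTE a0) /= set_valE /= !inE.
by apply/eqP; move: j; exact: ord3_ind.
Qed.

(** One coordinate of the class is 0, so the other two are opposite and the class is unique. *)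
Lemma fits_uniq A B k k' : (exists j : 'I_3, j \notin A :&: B) -> A :&: B != finset.set0 ->
  fits A B k -> fits A B k' -> k = k'.
Proof.
move=> [i iD] D0 /(_ D0) f /(_ D0) f'.
have [l [m [il lm im]]] : exists l m : 'I_3, [/\ i != l, l != m & i != m].
  by elim/ord3_ind: i {iD}; [exists 1, 2|exists 0, 2|exists 0, 1].
have [s [s0 _ _]] := perm3_ex il im lm; rewrite -s0 in iD.
have H k'' : (forall j, (CPvec k'' 0 j != 0) = (j \in A :&: B)) ->
    CPvec k'' 0 (s 0) = 0 /\ CPvec k'' 0 (s 2) = - CPvec k'' 0 (s 1).
  move=> g; have i0 : CPvec k'' 0 (s 0) = 0 by apply/eqP/negPn; rewrite g (negbTE iD).
  split=> //; have := sum_CPvec k''; rewrite (sum_perm3 s) i0 add0r addrC => /eqP.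
  by rewrite addr_eq0 => /eqP.
have [i0 mE] := H _ f; have [i'0 m'E] := H _ f'.
have nl k'' : CPvec k'' 0 (s 0) = 0 -> CPvec k'' 0 (s 2) = - CPvec k'' 0 (s 1) ->
    CPvec k'' 0 (s 1) != 0.
  move=> e0 e1; apply: contraNneq (CPvec_neq0 k'') => e2; apply/eqP/rowP.
  by apply: (@perm3_ind s); rewrite ?e0 ?e1 ?e2 ?oppr0 mxE.
have l0 := nl _ i0 mE; have l'0 := nl _ i'0 m'E.
apply/esym; apply: (@CPvec_inj _ _ _ (CPvec k' 0 (s 1) / CPvec k 0 (s 1))).
  by rewrite mulf_neq0 ?invr_eq0.
apply/rowP; apply: (@perm3_ind s); rewrite [RHS]mxE ?i0 ?i'0 ?mulr0 //.
  by rewrite divfK.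
by rewrite mE m'E mulrN divfK.
Qed.

(** A segment from a point of the closed polytope to a point of its relative interior is interior
    except perhaps at its start. *)
Lemma closed_cell_mix s L y0 (e : R) : admissible s ->
  supp (flag_p L) \subset firsts s -> supp (flag_q L) \subset lasts s ->
  open_cell (firsts s) (lasts s) (plane_x y0) -> 0 < e <= 1 ->
  open_cell (firsts s) (lasts s) (plane_x ((1 - e) *: mu L + e *: y0)).
Proof.
move=> sA pA qB [cA cB c0 cS] /andP[e0 e1]; have [gs sE] := admissible_good sA.
have [dA dB d0 dS] := open_cell_supp L.
have e10 : 0 <= 1 - e by rewrite subr_ge0.
have E j : plane_x ((1 - e) *: mu L + e *: y0) j = (1 - e) * moment_x L j + e * plane_x y0 j.
  have h : \sum_(c : bool) (if c then 1 - e else e) = 1 by rewrite big_bool /= subrK.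
  have := plane_x_comb (fun c : bool => if c then mu L else y0) j h.
  by rewrite !big_bool /= plane_x_moment.
have nA j : j \notin firsts s -> j \notin supp (flag_p L) by apply: contra; exact: (fintype.subsetP pA).
have nB j : j \notin lasts s -> j \notin supp (flag_q L) by apply: contra; exact: (fintype.subsetP qB).
have pos j : j \notin lasts s -> 0 <= moment_x L j.
  move=> /nB jB; have [jA|jA] := boolP (j \in supp (flag_p L)); first exact/ltW/dA.
  by rewrite d0.
have neg j : j \notin firsts s -> moment_x L j <= 0.
  move=> /nA jA; have [jB|jB] := boolP (j \in supp (flag_q L)); first exact/ltW/dB.
  by rewrite d0.
split=> [j jA jB|j jB jA|j jA jB|].
- by rewrite E addrC ltr_wpDr ?mulr_ge0 ?pos // mulr_gt0 // cA.
- rewrite E addrC -oppr_gt0 opprD ltr_wpDr // -mulrN; last by rewrite mulr_gt0 // oppr_gt0 cB.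
  by rewrite mulr_ge0 // oppr_ge0 neg.
- by rewrite E (c0 j) // d0 ?nA ?nB // !mulr0 addr0.
have le2 : \sum_j `|plane_x ((1 - e) *: mu L + e *: y0) j| <=
    (1 - e) * \sum_j `|moment_x L j| + e * \sum_j `|plane_x y0 j|.
  rewrite !mulr_sumr -big_split; apply: ler_sum => j _; rewrite E (le_trans (ler_normD _ _)) //.
  by rewrite !normrM (ger0_norm e10) (gtr0_norm e0).
have m2 := moment_x_bound L.
case: ifPn => [/eqP D0|D0]; last first.
  rewrite (negbTE D0) in cS; apply: (le_lt_trans le2); nra.
have [_ _ H S2] : closed_cell (firsts s) (lasts s) (plane_x ((1 - e) *: mu L + e *: y0)).
  apply: hull_closed_cell; rewrite -sE.
  have h : \sum_(c : bool) (if c then 1 - e else e) = 1 by rewrite big_bool /= subrK.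
  have -> : (1 - e) *: mu L + e *: y0 = \sum_(c : bool) (if c then 1 - e else e) *: (if c then mu L else y0).
    by rewrite big_bool.
  apply: (conv_hull_convex _ h) => [[]|[]] //; first exact: ltW.
    rewrite sE; move=> _; apply: closed_cell_hull => //; rewrite plane_moment; split=> //.
    move=> _; have [_ _ _ H'] := open_closed_cell (open_cell_supp L); apply: H'.
    apply/setP => j; rewrite !inE; apply/negP => /andP[jp jq].
    move/setP/(_ j): D0; rewrite !inE (fintype.subsetP pA) ?inE // (fintype.subsetP qB) ?inE //.
  by rewrite sE; move=> _; apply: closed_cell_hull => //; exact: open_closed_cell.
exact: S2.
Qed.

(** Keep the class [k] and move the moment from that of [L] towards the interior of the polytope of
    [s]. By continuity of [orbit_of] the orbit still meets [U] after a short move, and its supports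
    are now those of [s]. *)
Lemma stratum_near s L k (U : set M) : admissible s ->
  supp (flag_p L) \subset firsts s -> supp (flag_q L) \subset lasts s ->
  CP_matches L k -> fits (firsts s) (lasts s) k -> open U -> U L ->
  exists L', [/\ U L', stratum s L' & CP_matches L' k].
Proof.
move=> sA pA qB m f oU UL; have [L0 sL0] := sA; set y0 := mu L0.
have c0 : open_cell (firsts s) (lasts s) (plane_x y0) := stratum_cell sL0.
have orbU : open (@orb R @` U) by exact: orb_open.
pose h0 : @hexagon R := exist _ (mu L) (mem_set (flag_moment_hexagon L)).
have kc : continuous (fun h : @hexagon R => orbit_of (h, k)).
  move=> h; apply: cts_comp (@orbit_of_continuous R _).
  exact: (cts_pair (@cts_id _ h) (@cts_const _ _ k h)).
have [W oW WE] : open ((fun h : @hexagon R => orbit_of (h, k)) @^-1` (@orb R @` U)).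
  by apply: open_comp => // h _; exact: kc.
have WL : W (mu L).
  rewrite -[mu L]/(set_val h0) -[W _]/((set_val @^-1` W) h0) WE.
  by exists L => //; apply/esym/orbit_ofE.
pose g (e : R) := (1 - e) *: mu L + e *: y0.
have gc : continuous g.
  move=> e; apply: cvgD; apply: cvgZr_tmp; last exact: cvg_id.
  by apply: cvgB; [exact: cvg_cst|exact: cvg_id].
have : \forall e \near (0 : R), W (g e).
  have g0 : g 0 = mu L by rewrite /g subr0 scale1r scale0r addr0.
  have := gc 0; rewrite /continuous_at g0 => F.
  by apply: (F W); exact: open_nbhs_nbhs.
move=> /nbhs_ballP[d /= d0 bd]; pose e := Num.min (d / 2) 1.
have e0 : 0 < e by rewrite lt_min ltr01 divr_gt0.
have ed : e < d by rewrite gt_min ltr_pdivrMr // ltr_pMr // ltrDl ltr01.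
have e1 : 0 < e <= 1 by rewrite e0 ge_min lexx orbT.
have We : W (g e) by apply: bd; rewrite /ball /= sub0r normrN gtr0_norm.
have ce := closed_cell_mix sA pA qB c0 e1.
pose h : @hexagon R := exist _ (g e) (mem_set (cell_hexagon ce)).
have : (set_val @^-1` W) h by [].
rewrite WE => -[L' UL' LE]; have [L1 [E1 mu1 m1]] := orbit_ofP (h, k).
have /orbit_eqP[t tT tE] : orb L' = orb L1 by rewrite LE E1.
have m' : CP_matches L' k by apply/(flag_matches_action L' _ tT); rewrite tE.
have muE : mu L' = mu L1.
  rewrite -tE !flag_moment_mapE; congr plane_y.
  by apply/funext => j; rewrite moment_x_action.
by exists L'; split=> //; apply: cell_stratum m' f => //; rewrite muE mu1; exact: ce.
Qed.

End MainStratum.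

(** * Fixed points, vertices and stabilizers *)

Section FixedPoints.
Variable R : realType.
Local Notation C := (Cplx R).
Local Notation M := (flag_manifold R).
Local Notation mu := (@flag_moment_map R).
Local Notation theta := (@T2_action R).
Local Notation atlas := (@flag_atlas R).
Local Notation stratum := (@stratum R M atlas).
Local Notation admissible := (@admissible R M atlas).
Local Notation sigma := (@sigma_polytope R 2 M mu atlas).
Local Notation hull s := (conv_hull [set vtx R i | i in [set i | i \in s]]).
Implicit Types (L : M) (k : CP R 1) (A B : {set 'I_3}) (s t : idx) (i : 'I_Nfix).

Lemma fix_perm_surj (p : 'S_3) : exists i, fix_perm i = p.
Proof. by exists (enum_rank p); rewrite /fix_perm -lock enum_rankK. Qed.

Lemma supp_pair L p q : plucker_pair L p q -> supp (flag_p L) = supp p /\ supp (flag_q L) = supp q.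
Proof.
move=> pL; have [a [b [a0 b0 -> ->]]] := pair_uniq (flag_pqP L) pL.
by split; apply/setP => j; rewrite !inE mxE mulf_eq0 ?(negbTE a0) ?(negbTE b0).
Qed.

Lemma supp_action L (t : 'rV[C]_2) : torus t ->
  supp (flag_p (theta t L)) = supp (flag_p L) /\ supp (flag_q (theta t L)) = supp (flag_q L).
Proof.
move=> tT; have [-> ->] := supp_pair (T2_action_pair (torus_neq0 tT) (flag_pqP L)).
have t0 := ext_torus_neq0 (torus_neq0 tT).
by split; apply/setP => j; rewrite !inE [(\row_j _) _ _]mxE mulf_eq0 ?invr_eq0 (negbTE (t0 j)) orbF.
Qed.

Lemma flag_domP i L : chart_dom (flag_chart R (fix_perm i)) L <->
  fix_perm i 0 \in supp (flag_p L) /\ fix_perm i 2 \in supp (flag_q L).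
Proof. by rewrite flag_domE !inE. Qed.

Lemma fixed_supp i : supp (flag_p (flag_param (fix_perm i) (0 : 'rV[R]_6) : M)) = [set fix_perm i 0]%SET /\
  supp (flag_q (flag_param (fix_perm i) (0 : 'rV[R]_6) : M)) = [set fix_perm i 2]%SET.
Proof.
have [-> ->] := supp_pair (fixed_pair R (fix_perm i)).
by split; apply/setP => j; rewrite !inE mxE pnatr_eq0 eqb0 negbK.
Qed.

Lemma const_on1 (T : Type) (a : 'I_3) (f : 'I_3 -> T) : const_on [set a]%SET f.
Proof. by move=> x y; rewrite !inE => /eqP -> /eqP ->. Qed.

Lemma flag_fixedP L : fixed_point theta L <-> exists i, L = flag_param (fix_perm i) 0.
Proof.
split=> [fL|[i ->] t tT]; last first.
  have /stabE[] // : torus t /\ const_on (supp (flag_p (flag_param (fix_perm i) (0 : 'rV[R]_6) : M))) (ext_torus t 0)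
      /\ const_on (supp (flag_q (flag_param (fix_perm i) (0 : 'rV[R]_6) : M))) (ext_torus t 0).
  by have [-> ->] := fixed_supp i; split=> //; split; exact: const_on1.
(* The weights 1, 2 and, implicitly, 0 are distinct, so a vector constant on a support forces that
   support to be a single index. *)
pose v : 'rV[R]_2 := \row_j (j.+1)%:R.
have vi : injective (ext_vec v).
  have e0 : ext_vec v 0 = 1 by rewrite /ext_vec mxE.
  have e1 : ext_vec v 1 = 2 by rewrite /ext_vec /= mxE.
  have e2 : ext_vec v 2 = 0 by [].
  by apply: ord3_ind; apply: ord3_ind; rewrite ?e0 ?e1 ?e2 // => E; exfalso; lra.
have /stab_exp[cA cB] : forall a : R, stab theta L (torus_exp (a *: v)).
  by move=> a; split; [exact: torus_expP|apply: fL; exact: torus_expP].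
have pL := flag_pqP L; have [/row_neq0P[a a0] /row_neq0P[b b0] _ _] := pL.
have pa j : flag_p L 0 j != 0 -> j = a by move=> j0; apply: vi; apply: cA; rewrite inE.
have qb j : flag_q L 0 j != 0 -> j = b by move=> j0; apply: vi; apply: cB; rewrite inE.
have ab : a != b.
  apply: contraTneq b0 => ab; have := pair_dot pL; rewrite /dotp (bigD1 a) //= big1 ?addr0.
    by move/eqP; rewrite mulf_eq0 (negbTE a0) ab /= => ->.
  move=> j ja; have [->|j0] := eqVneq (flag_p L 0 j) 0; first by rewrite mul0r.
  by move: ja; rewrite (pa j j0) eqxx.
have [i [i0 i2]] := idx_ex ab; exists i.
have LE : flag_param (fix_perm i) (pair_coord (fix_perm i) (flag_p L) (flag_q L)) = L.
  by apply: (flag_param_coord pL); rewrite ?i0 ?i2.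
have z j : j != a -> flag_p L 0 j = 0.
  by move=> ja; apply/eqP/negPn/negP => /pa jE; move: ja; rewrite jE eqxx.
have z' j : j != b -> flag_q L 0 j = 0.
  by move=> jb; apply/eqP/negPn/negP => /qb jE; move: jb; rewrite jE eqxx.
suff z0 : pair_coord (fix_perm i) (flag_p L) (flag_q L) = 0 by rewrite z0 in LE; exact: esym LE.
apply: ccoord_inj; apply: ord3_ind; rewrite rcoordK ccoord0 /=.
- by rewrite z ?mul0r // -i0 (inj_eq perm_inj).
- by rewrite z ?mul0r // -i0 (inj_eq perm_inj).
- by rewrite z' ?mul0r ?oppr0 // -i2 (inj_eq perm_inj).
Qed.

Lemma vtx_inj : injective (vtx R).
Proof.
move=> i j E; have H l : (l == fix_perm i 0)%:R - (l == fix_perm i 2)%:R =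
    (l == fix_perm j 0)%:R - (l == fix_perm j 2)%:R :> R by rewrite -!vtxE E.
have ni := fix_perm_neq i; have nj := fix_perm_neq j.
apply: fix_perm_inj; apply/eqP.
  have := H (fix_perm i 0); rewrite eqxx (negbTE ni) subr0.
  by case: (fix_perm i 0 == fix_perm j 0) => //; case: (fix_perm i 0 == fix_perm j 2) => /=; lra.
have := H (fix_perm i 2); rewrite eqxx eq_sym (negbTE ni) sub0r.
by case: (fix_perm i 2 == fix_perm j 2) => //; case: (fix_perm i 2 == fix_perm j 0) => /=; lra.
Qed.

Lemma main_good : good finset.setT finset.setT.
Proof.
apply/and3P; split; rewrite ?finset.setIid; try by (apply/finset.set0Pn; exists 0; rewrite inE).
by rewrite cardsT card_ord.
Qed.

Lemma idx_ofT : idx_of finset.setT finset.setT = finset.setT.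
Proof. by apply/setP => i; rewrite !inE. Qed.

Lemma range_mu : range mu = hull finset.setT.
Proof.
apply/seteqP; split=> [_ [L _ <-]|y].
  rewrite -idx_ofT; apply: closed_cell_hull main_good _; rewrite plane_moment; split.
  - by move=> j; rewrite inE.
  - by move=> j; rewrite inE.
  - exact: moment_x_bound.
  - by move/setP/(_ 0); rewrite !inE.
rewrite -idx_ofT => /hull_closed_cell[_ _ h2 _].
have [k _] := CP_matches_ex (std_flag R : M).
by have [L [LE _]] := orbit_of_ex k (h2 : @hexagon R y); exists L.
Qed.

(* The form [x |-> \sum_j g j * x_j] on the plane of sum 0, transported to R^2. *)
Definition plane_form (g : 'I_3 -> R) : 'cV[R]_2 := \col_(l < 2) (g (lshift 1 l) - g 2).

Lemma formE g (y : 'rV[R]_2) : (y *m plane_form g) 0 0 = \sum_j g j * plane_x y j + (g 0 + g 1 - 2 * g 2).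
Proof.
have l0 : lshift 1 (0 : 'I_2) = (0 : 'I_3) by exact/val_inj.
have l1 : lshift 1 (1 : 'I_2) = (1 : 'I_3) by exact/val_inj.
rewrite mxE (@big_ord_recl _ _ _ 1) big_ord1 sum_ord3 !plane_xE !mxE.
rewrite l0 (_ : lift ord0 0 = 1 :> 'I_2) ?l1; last exact/val_inj.
by rewrite (_ : ord0 = 0 :> 'I_2); [ring|exact/val_inj].
Qed.

Lemma sum_vtx (g : 'I_3 -> R) i :
  \sum_j g j * plane_x (vtx R i) j = g (fix_perm i 0) - g (fix_perm i 2).
Proof.
under eq_bigr do rewrite vtxE mulrBr.
have D (a : 'I_3) : \sum_(m < 3) g m * (m == a)%:R = g a.
  by rewrite (bigD1 a) //= eqxx mulr1 big1 ?addr0 // => m /negbTE ->; rewrite mulr0.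
by rewrite sumrB !D.
Qed.

Lemma face_form s t (g : 'I_3 -> R) m : t != finset.set0 -> t \subset s ->
  (forall i, i \in s -> g (fix_perm i 0) - g (fix_perm i 2) <= m) ->
  (forall i, i \in s -> (g (fix_perm i 0) - g (fix_perm i 2) = m <-> i \in t)) ->
  face (hull t) (hull s).
Proof.
move=> t0 ts gm gt.
apply: (@face_sub_hull _ _ _ _ _ _ (plane_form g) (m + (g 0 + g 1 - 2 * g 2))) => // i si;
  rewrite formE sum_vtx ?lerD2r; first exact: gm.
by rewrite -gt //; split=> [/addIr|->].
Qed.

Lemma side_le A B a b : A :&: B = finset.set0 -> side R A B a - side R A B b <= 2 /\
  (side R A B a - side R A B b = 2 <-> a \in A /\ b \in B).
Proof.
move=> AB; have d j : ~~ ((j \in A) && (j \in B)) by move/setP/(_ j): AB; rewrite !inE => ->.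
have := d a; have := d b; rewrite /side.
by case: (a \in A); case: (b \in A); case: (a \in B); case: (b \in B) => //= _ _;
  split; try lra; split=> [|[]] //; lra.
Qed.

Lemma face_disjoint s A B : good A B -> A :&: B = finset.set0 -> idx_of A B \subset s ->
  face (hull (idx_of A B)) (hull s).
Proof.
move=> gAB AB sub; apply: (@face_form _ _ (side R A B) 2) => //; first exact: idx_of_neq0.
  by move=> i _; have [] := side_le (fix_perm i 0) (fix_perm i 2) AB.
move=> i _; have [_ ->] := side_le (fix_perm i 0) (fix_perm i 2) AB; rewrite inE.
by split=> [[-> ->]|/andP[]].
Qed.

Lemma vertex_idx i : idx_of [set fix_perm i 0]%SET [set fix_perm i 2]%SET = [set i]%SET.
Proof.
apply/setP => j; rewrite !inE; apply/andP/eqP => [[/eqP e0 /eqP e2]|->]; last by rewrite !eqxx.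
exact: fix_perm_inj.
Qed.

Lemma hull1 i : hull [set i]%SET = [set vtx R i].
Proof.
apply/seteqP; split=> [y|_ ->]; last by apply: conv_hull_vertex; rewrite inE.
move=> /conv_hullP[w [w0 ws w1 ->]].
have wj j : j != i -> w j = 0 by move=> ji; apply: ws; rewrite inE.
move: w1; rewrite (bigD1 i) //= big1 ?addr0 => [wi|j /wj //].
by rewrite (bigD1 i) //= big1 ?addr0 => [|j /wj ->]; rewrite ?wi ?scale1r ?scale0r.
Qed.

Lemma good1 i : good [set fix_perm i 0]%SET [set fix_perm i 2]%SET.
Proof.
have I0 : [set fix_perm i 0]%SET :&: [set fix_perm i 2]%SET = finset.set0.
  apply/setP => j; rewrite !inE; apply/negP => /andP[/eqP -> /eqP].
  by move/eqP; rewrite (negbTE (fix_perm_neq i)).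
by apply/and3P; split; rewrite ?I0 ?cards0 //; apply/finset.set0Pn; eexists; rewrite inE.
Qed.

Lemma disjoint1 i : [set fix_perm i 0]%SET :&: [set fix_perm i 2]%SET = finset.set0.
Proof.
apply/setP => j; rewrite !inE; apply/negP => /andP[/eqP -> /eqP].
by move/eqP; rewrite (negbTE (fix_perm_neq i)).
Qed.

(** A fixed point has supports {a} and {b} with a != b. These are disjoint, so the form [side]
    singles out its vertex. *)
Lemma vertices_mu : vertices (range mu) = range (vtx R).
Proof.
rewrite range_mu; apply/seteqP; split=> [v /face_vertex[i [_ <-]]|_ [i _ <-]].
  by exists i.
rewrite /vertices /= -hull1 -vertex_idx; apply: face_disjoint; first exact: good1.
  exact: disjoint1.
exact: finset.subsetT.
Qed.

Lemma flag_axiom2 : axiom2 theta mu.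
Proof.
split.
- move=> L /flag_fixedP[i ->]; rewrite vertices_mu; exists i => //; exact: vtx_fixed.
- move=> L L' /set_mem /flag_fixedP[i ->] /set_mem /flag_fixedP[j ->].
  move=> E; have ij : vtx R i = vtx R j by rewrite !vtx_fixed; exact: E.
  by rewrite (vtx_inj ij).
- rewrite vertices_mu => _ [i _ <-]; exists (flag_param (fix_perm i) 0).
    by apply/flag_fixedP; exists i.
  by rewrite vtx_fixed.
Qed.

Lemma main_stratumP L : stratum finset.setT L <->
  supp (flag_p L) = finset.setT /\ supp (flag_q L) = finset.setT.
Proof. by rewrite -idx_ofT; exact: (stratum_idx_of _ main_good). Qed.

Lemma firstsT : firsts finset.setT = finset.setT /\ lasts finset.setT = finset.setT.
Proof. by rewrite -idx_ofT firsts_idx_of ?lasts_idx_of //; exact: main_good. Qed.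

Lemma main_admissible : admissible finset.setT.
Proof.
have [k0 _] := CP_matches_ex (std_flag R : M).
have [k [_ f]] := main_dense_CP (ex_intro _ k0 I) openT.
have [|L [LE m]] := @orbit_of_ex R (plane_y (fun=> 0)) k.
  rewrite /hexagon /= big1 // => j _; rewrite plane_xK ?normr0 // big1 //.
exists L; apply/main_stratumP; apply: cell_supp m f.
rewrite -plane_moment LE; split=> [j _|j _|j|]; rewrite ?inE //.
rewrite finset.setIid ifF; last by apply/eqP => /setP/(_ 0); rewrite !inE.
rewrite big1 // => j _; rewrite plane_xK ?normr0 // big1 //.
Qed.

(** In two moves: with the moment fixed, the class is moved to one without zero coordinates; then,
    with the class fixed, [stratum_near] moves the moment into the interior. *)
Lemma main_stratum_dense : dense (stratum finset.setT).
Proof.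
move=> U [L UL] oU.
have [k m] := CP_matches_ex L.
pose h0 : @hexagon R := exist _ (mu L) (mem_set (flag_moment_hexagon L)).
have orbU : open (@orb R @` U) by exact: orb_open.
pose O := [set k' | (@orb R @` U) (orbit_of (h0, k'))].
have oO : open O.
  apply: open_comp => // k' _; apply: cts_comp (@orbit_of_continuous R _).
  exact: (cts_pair (@cts_const _ _ h0 k') (@cts_id _ k')).
have [k' [[L1 UL1 L1E] f]] : O `&` [set k' | fits finset.setT finset.setT k'] !=set0.
  by apply: main_dense_CP => //; exists k; exists L => //; apply/esym/orbit_ofE.
have [L2 [L2E mu2 m2]] := orbit_ofP (h0, k').
have /orbit_eqP[t tT tE] : orb L1 = orb L2 by rewrite L1E L2E.
have m1 : CP_matches L1 k' by apply/(flag_matches_action L1 _ tT); rewrite tE.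
have [fT lT] := firstsT.
have sp : supp (flag_p L1) \subset firsts finset.setT by rewrite fT finset.subsetT.
have sq : supp (flag_q L1) \subset lasts finset.setT by rewrite lT finset.subsetT.
rewrite -{1}fT -{1}lT in f.
have [L' [UL' sL' _]] := stratum_near main_admissible sp sq m1 f oU UL1.
by exists L'.
Qed.

Lemma flag_axiom1 : axiom1 theta atlas.
Proof.
split.
- move=> i; split=> [|_ [s _ <-]]; [exact: flag_is_chart|exact: flag_compatible].
- apply/seteqP; split=> // L _; have [p DL _] := box_chart L.
  by have [i iE] := fix_perm_surj p; rewrite -iE in DL; exists i; [exact: I|exact: DL].
- by move=> i j /= E; apply: vtx_inj; rewrite !vtx_fixed E.
move=> i; split.
- move=> t L tT /flag_domP[p0 q2]; apply/flag_domP.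
  by have [-> ->] := supp_action L tT.
- move=> U U0 oU; have [L [UL /main_stratumP[sp sq]]] := main_stratum_dense U0 oU.
  by exists L; split=> //; apply/flag_domP; rewrite sp sq !inE.
- exact: flag_chart_cod.
- apply/seteqP; split=> [L [/flag_domP[p0 q2] /flag_fixedP[j LE]]|_ ->].
    move: p0 q2; rewrite LE; have [-> ->] := fixed_supp j; rewrite !inE => /eqP e0 /eqP e2.
    by rewrite (fix_perm_inj e0 e2).
  split; first by apply/flag_domP; have [-> ->] := fixed_supp i; rewrite !inE !eqxx.
  by apply/flag_fixedP; exists i.
- exact: flag_chart_param.
Qed.

Lemma flag_axiom3 : axiom3 theta atlas.
Proof.
move=> s L L' /stratum_supp[pE qE] /stratum_supp[pE' qE'].
by apply/seteqP; split=> t /stabE H; apply/stabE; move: H; rewrite -pE -qE -pE' -qE'.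
Qed.

End FixedPoints.

(** * Spaces of parameters and boundaries of leaves *)

Section LeafParameters.
Variable R : realType.
Local Notation C := (Cplx R).
Local Notation M := (flag_manifold R).
Local Notation CP1 := (CP R 1).
Local Notation mu := (@flag_moment_map R).
Local Notation theta := (@T2_action R).
Local Notation atlas := (@flag_atlas R).
Local Notation stratum := (@stratum R M atlas).
Local Notation admissible := (@admissible R M atlas).
Local Notation sigma := (@sigma_polytope R 2 M mu atlas).
Local Notation squot := (@stratum_quot R 2 M theta atlas).
Local Notation sclass := (@stratum_class R 2 M theta atlas _).
Local Notation hull s := (conv_hull [set vtx R i | i in [set i | i \in s]]).
Implicit Types (L : M) (k : CP R 1) (A B : {set 'I_3}) (s t : idx) (i : 'I_Nfix).

Definition flag_class L : CP1 := sval (cid (CP_matches_ex L)).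

Lemma flag_classP L : CP_matches L (flag_class L).
Proof. exact: svalP (cid (CP_matches_ex L)). Qed.

Definition base_class : CP1 := flag_class (std_flag R).

(* The strata with a single parameter that is not determined by the flags. *)
Definition simple s : bool :=
  `[< firsts s :&: lasts s = finset.set0 \/ ~ exists k, fits (firsts s) (lasts s) k >].

Definition par_ok s k : Prop := if simple s then k = base_class else fits (firsts s) (lasts s) k.

Definition par_space s : topologicalType := [set k | par_ok s k].

(** A retraction of CP^1 onto the allowed parameters, which makes [par_mk] total. The second
    alternative in [simple] keeps these inhabited for inadmissible [s] as well, since the data are
    indexed by all sets. *)
Definition par_norm s k : CP1 :=
  if simple s then base_class
  else if `[< fits (firsts s) (lasts s) k >] then k
  else xget base_class [set k | fits (firsts s) (lasts s) k].

Lemma par_normP s k : par_ok s (par_norm s k).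
Proof.
rewrite /par_ok /par_norm; case: (boolP (simple s)) => // ns.
have [k' fk'] : exists k', fits (firsts s) (lasts s) k'.
  by apply: contrapT => H; move/negP: ns; apply; apply/asboolP; right.
by case: asboolP => // _; exact: (@xgetI _ base_class [set k | fits (firsts s) (lasts s) k] k' fk').
Qed.

Lemma par_norm_id s k : par_ok s k -> par_norm s k = k.
Proof.
by rewrite /par_ok /par_norm; case: ifPn => [_ ->|_ f] //; case: asboolP.
Qed.

Definition par_mk s k : par_space s := exist _ (par_norm s k) (mem_set (par_normP s k)).

Lemma par_spaceP s (c : par_space s) : par_ok s (set_val c).
Proof. exact: set_valP c. Qed.

Lemma par_mkK s (c : par_space s) : par_mk s (set_val c) = c.
Proof. by apply: set_val_inj; rewrite set_valE /=; apply: par_norm_id; exact: par_spaceP. Qed.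

Lemma simple_disjoint s : admissible s -> simple s -> firsts s :&: lasts s = finset.set0.
Proof. by move=> sA /asboolP[//|nf]; case: nf; exact: fits_ex. Qed.

Lemma disjoint_simple s : firsts s :&: lasts s = finset.set0 -> simple s.
Proof. by move=> D; apply/asboolP; left. Qed.

Lemma par_fits s k : admissible s -> par_ok s k -> fits (firsts s) (lasts s) k.
Proof.
rewrite /par_ok => sA; case: ifPn => // ss _.
by rewrite /fits (simple_disjoint sA ss) eqxx.
Qed.

Lemma disjoint_matches L k : supp (flag_p L) :&: supp (flag_q L) = finset.set0 -> CP_matches L k.
Proof.
move=> D; have z (i : 'I_3) : flag_p L 0 i * flag_q L 0 i = 0.
  apply/eqP; rewrite mulf_eq0 -[_ || _]negbK negb_or.
  by move/setP/(_ i): D; rewrite !inE => ->.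
by move=> i j; rewrite !z !mul0r.
Qed.

Lemma matches_uniq L k k' : supp (flag_p L) :&: supp (flag_q L) != finset.set0 ->
  CP_matches L k -> CP_matches L k' -> k = k'.
Proof.
move=> /finset.set0Pn[] i; rewrite !inE => /andP[pi qi] m m'.
have [a a0 aE] := matches_row_uniq (ex_intro _ i (mulf_neq0 pi qi)) (CPvec_neq0 k') (CPvec_neq0 k) m' m.
exact: CPvec_inj a0 aE.
Qed.

Lemma par_matches s L : stratum s L -> CP_matches L (par_norm s (flag_class L)).
Proof.
move=> sL; have sA : admissible s by exists L.
have [ss|ns] := boolP (simple s).
  by apply: disjoint_matches; have [<- <-] := stratum_supp sL; exact: simple_disjoint.
rewrite par_norm_id; first exact: flag_classP.
by rewrite /par_ok (negbTE ns); exact: stratum_fits (flag_classP L).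
Qed.

Lemma par_uniq s L k : stratum s L -> CP_matches L k ->
  par_norm s (flag_class L) = par_norm s k.
Proof.
move=> sL m; have sA : admissible s by exists L.
have [ss|ns] := boolP (simple s); first by rewrite /par_norm ss.
congr par_norm; apply: matches_uniq m; last exact: flag_classP.
have [<- <-] := stratum_supp sL.
by apply: contraNneq ns => D; exact: disjoint_simple.
Qed.

Lemma mu_action L (u : 'rV[C]_2) : torus u -> mu (theta u L) = mu L.
Proof.
move=> uT; rewrite !flag_moment_mapE; congr plane_y.
by apply/funext => j; rewrite moment_x_action.
Qed.

Lemma mu_relint s L : stratum s L -> relint (sigma s) (mu L).
Proof.
move=> sL; have sA : admissible s by exists L.
by apply/relint_sigma => //; exact: stratum_cell.
Qed.

Definition relint_pt s (x : stratum s) : relint (sigma s) :=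
  exist _ (mu (set_val x)) (mem_set (mu_relint (set_valP x))).

Definition par_triv s (y : squot s) : relint (sigma s) * par_space s :=
  let x := sval (cid (qclass_surj y)) in (relint_pt x, par_mk s (flag_class (set_val x))).

Lemma sclassP s (x y : stratum s) :
  sclass x = sclass y <-> same_orbit theta (set_val x) (set_val y).
Proof.
rewrite /stratum_class qclassP; apply: equiv_class_eq => [z|z w|z w v]; rewrite /stratum_rel.
- exact: same_orbit_refl.
- exact: same_orbit_sym.
- exact: same_orbit_trans.
Qed.

Lemma matches_orbit L L' k : same_orbit theta L L' -> CP_matches L k -> CP_matches L' k.
Proof. by move=> [u uT <-] m; apply/(flag_matches_action L _ uT). Qed.

Lemma par_trivE s (x : stratum s) :
  par_triv (sclass x) = (relint_pt x, par_mk s (flag_class (set_val x))).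
Proof.
rewrite /par_triv; set y := sval _.
have /sclassP yx : sclass y = sclass x by exact: svalP (cid (qclass_surj (sclass x))).
congr (_, _); apply: set_val_inj; rewrite !set_valE /=.
  by have [u uT <-] := yx; rewrite mu_action.
apply: par_uniq; first exact: (set_valP y).
by apply: matches_orbit (same_orbit_sym yx) _; exact: flag_classP.
Qed.

(** On strata that are not simple only one class matches each flag. Its graph is the closed matching
    relation, and CP^1 is compact. *)
Lemma par_continuous s : continuous (fun x : stratum s => par_norm s (flag_class (set_val x))).
Proof.
have [ss|ns] := boolP (simple s).
  rewrite (_ : (fun x => _) = fun=> base_class); first by move=> x; exact: cts_const.
  by apply/funext => x; rewrite /par_norm ss.
have okc (x : stratum s) : par_ok s (flag_class (set_val x)).
  by rewrite /par_ok (negbTE ns); apply: stratum_fits (flag_classP _); exact: (set_valP x).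
rewrite (_ : (fun x => _) = fun x : stratum s => flag_class (set_val x)); last first.
  by apply/funext => x; exact: par_norm_id.
apply: (@closed_graph_continuous _ _ _ [set z : stratum s * CP1 | CP_matches (set_val z.1) z.2]).
- exact: compact_CP1.
- apply: (@closed_comp (stratum s * CP1)%type (M * CP1)%type (fun z => (set_val z.1, z.2))
    [set z | CP_matches z.1 z.2]) => [z _|]; last exact: CP_matches_closed.
  exact: (cts_pair (cts_comp (cts_fst (@cts_id _ z)) (@continuous_set_val _ _ _)) (cts_snd (@cts_id _ z))).
- by move=> x; exact: flag_classP.
- move=> x k /= m; apply/esym; apply: matches_uniq m; last exact: flag_classP.
  have [<- <-] := stratum_supp (set_valP x : stratum s _).
  by apply: contraNneq ns => D; exact: disjoint_simple.
Qed.

Lemma orbit_stratum s (z : relint (sigma s) * par_space s) : admissible s ->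
  exists x : stratum s, mu (set_val x) = set_val z.1 /\ CP_matches (set_val x) (set_val z.2).
Proof.
move=> sA; have yr : relint (sigma s) (set_val z.1) by exact: set_valP z.1.
have /(relint_sigma _ sA) yc := yr.
have [L [LE m]] := orbit_of_ex (set_val z.2) (cell_hexagon yc).
have sL : stratum s L.
  apply: cell_stratum m _ => //; first by rewrite LE.
  by apply: par_fits => //; exact: par_spaceP.
by exists (exist _ L (mem_set sL)).
Qed.

Lemma par_triv_of s (x : stratum s) (z : relint (sigma s) * par_space s) :
  mu (set_val x) = set_val z.1 -> CP_matches (set_val x) (set_val z.2) ->
  par_triv (sclass x) = z.
Proof.
move=> xy m; rewrite par_trivE [z]surjective_pairing; congr (_, _).
  by apply: set_val_inj; exact: xy.
rewrite -[RHS]par_mkK; apply: (@set_val_inj _ [set k | par_ok s k]).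
exact: (par_uniq (set_valP x) m).
Qed.

(** An open set of the quotient of the stratum comes from an open set [U] of flags. Its preimage
    under the inverse consists of the pairs whose orbit, given by [orbit_of], meets [U], hence is
    open. *)
Lemma par_triv_homeo s : admissible s -> homeomorphism (@par_triv s).
Proof.
move=> sA; split.
  apply: quot_cts => x.
  have c1 : {for x, continuous (@relint_pt s)}.
    apply: cts_set_type.
    exact: (cts_comp (@continuous_set_val _ _ x) (@flag_moment_continuous R _)).
  have c2 : {for x, continuous (fun x : stratum s => par_mk s (flag_class (set_val x)))}.
    by apply: cts_set_type; exact: (@par_continuous s x).
  have := cts_pair c1 c2; congr (continuous_at x _).
  by apply/funext => y; rewrite /comp -par_trivE.
have /choice[g gP] : forall z : relint (sigma s) * par_space s, exists x : stratum s,
    mu (set_val x) = set_val z.1 /\ CP_matches (set_val x) (set_val z.2).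
  by move=> z; exact: orbit_stratum.
exists (fun z => sclass (g z)); split.
- move=> y; have [x <-] := qclass_surj y; rewrite -/(sclass x) par_trivE.
  have [/= muE m] := gP (relint_pt x, par_mk s (flag_class (set_val x))).
  apply/sclassP/orbit_eqP.
  apply: orbit_of_uniq m _ => //.
  by rewrite set_valE /=; apply: par_matches; exact: (set_valP x).
- by move=> z; have [muE m] := gP z; exact: par_triv_of.
apply/continuousP => O /open_quot oO; have [U oU UE] := oO.
have cell_hex (z : relint (sigma s) * par_space s) : hexagon (set_val z.1).
  have yr : relint (sigma s) (set_val z.1) by exact: set_valP z.1.
  by have /(relint_sigma _ sA)/cell_hexagon := yr.
pose h (z : relint (sigma s) * par_space s) : @hexagon R * CP1 :=
  (exist _ (set_val z.1) (mem_set (cell_hex z)) : @hexagon R, set_val z.2).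
have hc : continuous h.
  move=> z.
  have c2 := cts_comp (cts_snd (@cts_id _ z)) (@continuous_set_val _ _ _).
  have c1 : {for z, continuous (fun z => exist _ (set_val z.1) (mem_set (cell_hex z)) : @hexagon R)}.
    by apply: cts_set_type; exact: (cts_comp (cts_fst (@cts_id _ z)) (@continuous_set_val _ _ _)).
  exact: (cts_pair c1 c2).
have -> : (fun z => sclass (g z)) @^-1` O = (@orbit_of R \o h) @^-1` (@orb R @` U).
  apply/seteqP; split=> z; have [muE m] := gP z.
    move=> Oz; have : (sclass @^-1` O) (g z) by [].
    rewrite -[sclass @^-1` O]UE => Ugz; exists (set_val (g z)) => //.
    by apply/esym/orbit_ofE.
  move=> [L UL LE]; have : orb L = orb (set_val (g z)) by rewrite LE; exact: orbit_ofE.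
  move=> /orbit_eqP Lo; have [u uT uE] := same_orbit_sym Lo.
  have sL : stratum s L.
    apply/stratumP; rewrite -uE; have [-> ->] := supp_action (set_val (g z)) uT.
    by apply/stratumP; exact: (set_valP (g z)).
  pose x : stratum s := exist _ L (mem_set sL).
  rewrite /preimage /=; have <- : sclass x = sclass (g z) by apply/sclassP.
  have : (set_val @^-1` U) x by [].
  by rewrite UE.
apply: open_comp; last exact: orb_open.
by move=> z _; exact: (cts_comp (hc z) (@orbit_of_continuous R _)).
Qed.

(** Supports can only shrink in a limit. The last condition concerns the main stratum: its classes
    have no zero coordinate, so they match no flag whose supports share exactly two indices, and
    only strata with disjoint supports remain. *)
Definition par_bdry s : set idx := [set t | [/\ admissible t,
  firsts t \subset firsts s, lasts t \subset lasts s, t <> s &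
  firsts t :&: lasts t != finset.set0 -> s <> finset.setT]].

Definition par_data : parameter_data theta mu atlas :=
  @ParameterData R 2 M theta mu atlas par_space par_triv par_bdry (fun s t c => par_mk t (set_val c)).

Lemma flag_axiom4 : axiom4 par_data.
Proof.
move=> s sA; split.
- exact: mu_stratum.
- exact: par_triv_homeo.
- by move=> x; rewrite -[pd_triv _ _]/(par_triv _) par_trivE.
- by move=> L sL; exact: sigma_dim sL.
Qed.

Lemma leafP s (c : par_space s) L : leaf (D := par_data) (s := s) c L <->
  stratum s L /\ CP_matches L (set_val c).
Proof.
split=> [[x [<-]]|[sL m]].
  rewrite -[pd_triv _ _]/(par_triv _) par_trivE /= => <-; split; first exact: (set_valP x).
  by rewrite set_valE /=; apply: par_matches; exact: (set_valP x).
exists (exist _ L (mem_set sL)); split=> //.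
rewrite -[pd_triv _ _]/(par_triv _) par_trivE /= -[RHS]par_mkK; apply: (@set_val_inj _ [set k | par_ok s k]).
exact: par_uniq sL m.
Qed.

Lemma main_of_full s : admissible s -> firsts s :&: lasts s = finset.setT -> s = finset.setT.
Proof.
move=> sA D; have [gs ->] := admissible_good sA; rewrite -idx_ofT.
have H j : (j \in firsts s) && (j \in lasts s) by move/setP/(_ j): D; rewrite !inE.
by congr idx_of; apply/setP => j; have /andP[] := H j; rewrite !inE.
Qed.

Lemma proper_subset_card2 (T : finType) (D D' : {set T}) : #|T| = 3%N -> (1 < #|D|)%N ->
  D \subset D' -> D' != finset.setT -> D = D'.
Proof.
move=> T3 D1 sub DT; apply/eqP; rewrite eqEcard sub /=.
have : (#|D'| < 3)%N.
  rewrite -T3 -cardsT; apply: proper_card.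
  by rewrite finset.properT.
by rewrite ltnS => /leq_trans; apply.
Qed.

Lemma admissible_card s : admissible s -> firsts s :&: lasts s != finset.set0 ->
  (1 < #|firsts s :&: lasts s|)%N.
Proof.
move=> /admissible_good[/and3P[_ _ n1] _] D0.
by rewrite ltn_neqAle eq_sym n1 card_gt0.
Qed.

(** A nonempty intersection of supports has at least two elements, and outside the main stratum at
    most two. *)
Lemma sub_diag s t : admissible s -> admissible t -> firsts t \subset firsts s ->
  lasts t \subset lasts s -> firsts t :&: lasts t != finset.set0 -> s <> finset.setT ->
  firsts t :&: lasts t = firsts s :&: lasts s.
Proof.
move=> sA tA ft lt D0 sT; apply: proper_subset_card2; rewrite ?card_ord //.
- exact: admissible_card.
- exact: finset.setISS.
- by apply/eqP => /main_of_full - /(_ sA).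
Qed.

Lemma not_full s : admissible s -> s <> finset.setT -> exists j : 'I_3, j \notin firsts s :&: lasts s.
Proof.
move=> sA sT; apply: contrapT => H; apply: sT; apply: main_of_full => //.
by apply/setP => j; rewrite [RHS]inE; apply/negPn/negP => nj; apply: H; exists j.
Qed.

Lemma fits_subset s t k : admissible s -> par_bdry s t -> fits (firsts s) (lasts s) k ->
  fits (firsts t) (lasts t) k.
Proof.
move=> sA [tA ft lt _ sT] f D0.
have E := sub_diag sA tA ft lt D0 (sT D0); rewrite E.
by apply: f; rewrite -E.
Qed.

Lemma par_ok_uniq t k k' : admissible t -> t <> finset.setT ->
  par_ok t k -> par_ok t k' -> k = k'.
Proof.
move=> tA tT; rewrite /par_ok; case: ifPn => [_ -> -> //|ns f f'].
apply: (@fits_uniq _ (firsts t) (lasts t)) f f'; first exact: not_full.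
by apply: contraNneq ns => D; exact: disjoint_simple.
Qed.

Lemma par_subsingleton t (c d : par_space t) : admissible t -> t <> finset.setT -> c = d.
Proof.
by move=> tA tT; apply: set_val_inj; apply: par_ok_uniq tT _ _ => //; exact: par_spaceP.
Qed.

Lemma par_bdry_proper s t : admissible s -> par_bdry s t -> t <> finset.setT.
Proof.
move=> sA [tA ft lt ts sT] tT; apply: ts; rewrite tT.
have [fT lT] := firstsT; apply/esym; apply: main_of_full => //.
apply/setP => j; rewrite !inE.
by rewrite (fintype.subsetP ft) ?tT ?fT ?inE // (fintype.subsetP lt) ?tT ?lT ?inE.
Qed.

Lemma bdry_matches s t L k : admissible s -> par_bdry s t -> fits (firsts s) (lasts s) k ->
  stratum t L -> CP_matches L k.
Proof.
move=> sA bt f tL; have [tA _ _ _ _] := bt.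
have [D0|D0] := eqVneq (firsts t :&: lasts t) finset.set0.
  by apply: disjoint_matches; have [<- <-] := stratum_supp tL.
rewrite (_ : k = flag_class L); first exact: flag_classP.
apply: (@fits_uniq _ (firsts t) (lasts t)) => //.
- by apply: not_full tA _; exact: par_bdry_proper bt.
- exact: fits_subset bt f.
- exact: stratum_fits (flag_classP L).
Qed.

Lemma closed_matches k : closed [set L | CP_matches L k].
Proof.
have := @CP_matches_closed R.
apply: (@closed_comp M (M * CP1)%type (fun L => (L, k))) => L _.
exact: (cts_pair (@cts_id _ L) (@cts_const _ _ k L)).
Qed.

Lemma closed_supp A B :
  closed [set L : M | supp (flag_p L) \subset A /\ supp (flag_q L) \subset B].
Proof.
rewrite (_ : mkset _ = \bigcap_(j in [set j | j \notin A]) (~` [set L : M | flag_p L 0 j != 0]) `&`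
    \bigcap_(j in [set j | j \notin B]) (~` [set L : M | flag_q L 0 j != 0])).
  by apply: closedI; apply: closed_bigI => j _; apply: open_closedC;
    [exact: open_flag_p|exact: open_flag_q].
apply/seteqP; split=> L [pA qB]; split.
- move=> j jA pj; move/negP: jA; apply; apply: (fintype.subsetP pA).
  by rewrite inE.
- move=> j jB qj; move/negP: jB; apply; apply: (fintype.subsetP qB).
  by rewrite inE.
- apply/fintype.subsetP => j; rewrite inE => pj; apply: contrapT => /negP jA; exact: (pA j jA).
- apply/fintype.subsetP => j; rewrite inE => qj; apply: contrapT => /negP jB; exact: (qB j jB).
Qed.

Lemma main_fits_stratum s t L k : s = finset.setT -> fits (firsts s) (lasts s) k ->
  stratum t L -> CP_matches L k -> firsts t :&: lasts t != finset.set0 -> t = s.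
Proof.
move=> -> + tL m; have [-> ->] := firstsT; have [ft lt] := stratum_supp tL => f D0.
have tA : admissible t by exists L.
apply: main_of_full => //; rewrite ft lt in D0 *; apply/setP => j.
rewrite -(fits_supp m D0) f ?finset.setIid ?inE //.
by apply/finset.set0Pn; exists 0; rewrite inE.
Qed.

(** Matching the class and having supports inside those of [s] are closed conditions, which bounds
    the closure from above. By [stratum_near] every flag satisfying them in a stratum of
    [par_bdry s] is a limit of the leaf. *)
Lemma leaf_bdry s (c : par_space s) : admissible s ->
  bdry (leaf (D := par_data) (s := s) c) =
  \bigcup_(t in par_bdry s) leaf (D := par_data) (s := t) (par_mk t (set_val c)).
Proof.
move=> sA; have fc : fits (firsts s) (lasts s) (set_val c).
  by apply: par_fits => //; exact: par_spaceP.
have leafE t L : par_bdry s t ->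
    leaf (D := par_data) (s := t) (par_mk t (set_val c)) L <-> stratum t L.
  move=> bt; split=> [/leafP[]//|tL]; apply/leafP; split=> //.
  have [tA _ _ _ _] := bt; rewrite set_valE /= -(par_uniq tL); first exact: par_matches.
  exact: bdry_matches bt fc tL.
apply/seteqP; split=> L.
  move=> [cL nL].
  have mL : CP_matches L (set_val c).
    have := (closure_id _).1 (@closed_matches (set_val c)) => E.
    have : closure [set L | CP_matches L (set_val c)] L.
      by apply: closure_subset cL => L' /leafP[].
    by rewrite -E.
  have [pA qB] : supp (flag_p L) \subset firsts s /\ supp (flag_q L) \subset lasts s.
    have := (closure_id _).1 (@closed_supp (firsts s) (lasts s)) => E.
    have : closure [set L : M | supp (flag_p L) \subset firsts s /\ supp (flag_q L) \subset lasts s] L.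
      by apply: closure_subset cL => L' /leafP[/stratum_supp[-> ->] _]; split.
    by rewrite -E.
  pose t := idx_of (supp (flag_p L)) (supp (flag_q L)).
  have tL : stratum t L by exact/stratumP.
  have [ft lt] := stratum_supp tL; have tA : admissible t by exists L.
  have ts : t <> s by move=> ts; apply: nL; apply/leafP; split=> //; rewrite -ts.
  have bt : par_bdry s t.
    split; rewrite ?ft ?lt // => D0 sT; apply: ts.
    by apply: main_fits_stratum sT fc tL mL _; rewrite ft lt.
  by exists t => //; exact/leafE.
move=> [t bt /(leafE _ _ bt) tL]; have [tA ft lt ts _] := bt.
have [fE lE] := stratum_supp tL.
have mL := bdry_matches sA bt fc tL.
split; last first.
  move=> /leafP[/stratumP sE _]; apply: ts; move/stratumP: tL => ->; exact: esym sE.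
move=> U; rewrite nbhsE => -[] O [] oO OL OU.
have pA : supp (flag_p L) \subset firsts s by rewrite -fE.
have qB : supp (flag_q L) \subset lasts s by rewrite -lE.
have [L' [OL' sL' mL']] := stratum_near sA pA qB mL fc oO OL.
by exists L'; split; [apply/leafP|exact: OU].
Qed.

Lemma par_bdry_face s t : admissible s -> par_bdry s t ->
  admissible t /\ face (sigma t) (sigma s).
Proof.
move=> sA bt; have [tA ft lt ts sT] := bt; split=> //; rewrite !sigma_polytopeE.
have [gt tE] := admissible_good tA; have [gs sE] := admissible_good sA.
have sub : t \subset s.
  rewrite tE sE; apply/fintype.subsetP => i; rewrite !inE => /andP[i0 i2].
  by rewrite (fintype.subsetP ft) // (fintype.subsetP lt).
have [D0|D0] := eqVneq (firsts t :&: lasts t) finset.set0.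
  by rewrite tE; apply: face_disjoint => //; rewrite -tE.
have E := sub_diag sA tA ft lt D0 (sT D0).
(* On the first support of [s] this form is 0 on that of [t] and -1 elsewhere; on the last support
   it is 0 on that of [t] and 1 elsewhere. The common intersection makes the two prescriptions
   agree. Hence g_a - g_b <= 0, with equality exactly on [t]. *)
pose g (j : 'I_3) : R := (j \in firsts t)%:R - (j \in firsts s)%:R - ((j \in lasts t)%:R - (j \in lasts s)%:R).
have tD j : j \in firsts s :&: lasts s -> (j \in firsts t) /\ (j \in lasts t).
  by rewrite -E !inE => /andP.
have fs j : j \in firsts t -> j \in firsts s by exact: (fintype.subsetP ft).
have ls j : j \in lasts t -> j \in lasts s by exact: (fintype.subsetP lt).
have gf a : a \in firsts s -> g a = (a \in firsts t)%:R - 1.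
  move=> aS; have := tD a; have := ls a; rewrite finset.in_setI /g aS andTb.
  case: (a \in lasts s) => [_ /(_ isT)[-> ->]|la _]; first by rewrite /=; ring.
  have -> : a \in lasts t = false by apply/negP => /la.
  by rewrite /=; ring.
have gl b : b \in lasts s -> g b = 1 - (b \in lasts t)%:R.
  move=> bS; have := tD b; have := fs b; rewrite finset.in_setI /g bS andbT.
  case: (b \in firsts s) => [_ /(_ isT)[-> ->]|fb _]; first by rewrite /=; ring.
  have -> : b \in firsts t = false by apply/negP => /fb.
  by rewrite /=; ring.
have gE a b : a \in firsts s -> b \in lasts s ->
    g a - g b <= 0 /\ (g a - g b = 0 <-> (a \in firsts t) /\ (b \in lasts t)).
  move=> /gf -> /gl ->; case: (a \in firsts t); case: (b \in lasts t) => /=.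
  - by split; [lra|split=> // _; ring].
  - by split; [lra|split=> [h|[]//]; suff : (0 : R) < 0; [by rewrite ltxx|lra]].
  - by split; [lra|split=> [h|[]//]; suff : (0 : R) < 0; [by rewrite ltxx|lra]].
  - by split; [lra|split=> [h|[]//]; suff : (0 : R) < 0; [by rewrite ltxx|lra]].
apply: (@face_form R s t g 0) => //; first by rewrite tE; exact: idx_of_neq0.
  by move=> i; rewrite {1}sE inE => /andP[i0 i2]; have [] := gE _ _ i0 i2.
move=> i; rewrite {1}sE {1}tE !inE => /andP[i0 i2]; have [_ ->] := gE _ _ i0 i2.
by split=> [[-> ->]|/andP[]].
Qed.

End LeafParameters.

(** * The universal space of parameters and global properties *)

Section UniversalParameters.
Variable R : realType.
Local Notation C := (Cplx R).
Local Notation M := (flag_manifold R).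
Local Notation CP1 := (CP R 1).
Local Notation mu := (@flag_moment_map R).
Local Notation theta := (@T2_action R).
Local Notation atlas := (@flag_atlas R).
Local Notation stratum := (@stratum R M atlas).
Local Notation admissible := (@admissible R M atlas).
Local Notation sigma := (@sigma_polytope R 2 M mu atlas).
Local Notation hull s := (conv_hull [set vtx R i | i in [set i | i \in s]]).
Local Notation EEset := (@EE_set R 2 M mu atlas).
Local Notation EErel := (@EE_rel R 2 M theta mu atlas).
Local Notation CQspace := (@CQ R 2 M mu atlas).
Implicit Types (L : M) (k : CP R 1) (A B : {set 'I_3}) (s t : idx) (i : 'I_Nfix).

(** The space over the stratum inside the universal CP^1. For disjoint supports it is the whole of
    CP^1, although the stratum has a single parameter; in general it consists of the classes
    occurring nearby in the sense of [fits]. *)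
Definition fits_space s : topologicalType := [set k : CP1 | fits (firsts s) (lasts s) k].
Definition fits_val s (c : fits_space s) : CP1 := set_val c.
Definition fits_par s (c : fits_space s) : par_space R s := par_mk s (set_val c).

Lemma fits_spaceP s (c : fits_space s) : fits (firsts s) (lasts s) (set_val c).
Proof. exact: set_valP c. Qed.

Lemma fits_val_inj s : injective (@fits_val s).
Proof. by move=> c d; exact: set_val_inj. Qed.

Lemma fits_par_continuous s : continuous (@fits_par s).
Proof.
move=> c; apply: cts_set_type; have [ss|ns] := boolP (simple R s).
  rewrite (_ : (fun y => _) = fun=> base_class R); first exact: cts_const.
  by apply/funext => d; rewrite set_valE /= /par_norm ss.
rewrite (_ : (fun y => _) = set_val); first exact: continuous_set_val.
apply/funext => d; rewrite set_valE /=; apply: par_norm_id.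
by rewrite /par_ok (negbTE ns); exact: fits_spaceP.
Qed.

Lemma fits_par_surj s : admissible s -> range (@fits_par s) = setT.
Proof.
move=> sA; apply/seteqP; split=> // d _.
have fd : fits (firsts s) (lasts s) (set_val d) by apply: par_fits => //; exact: par_spaceP.
by exists (exist _ (set_val d) (mem_set fd)) => //; rewrite /fits_par -[RHS]par_mkK.
Qed.

Lemma main_not_simple : ~~ simple R finset.setT.
Proof.
apply/negP => /(simple_disjoint (@main_admissible R)).
by have [-> ->] := firstsT; move/setP/(_ 0); rewrite !inE.
Qed.

Lemma fits_par_main : homeomorphism (@fits_par finset.setT).
Proof.
split; first exact: fits_par_continuous.
have fd (d : par_space R finset.setT) : fits (firsts finset.setT) (lasts finset.setT) (set_val d).
  by apply: par_fits; [exact: main_admissible|exact: par_spaceP].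
exists (fun d => exist _ (set_val d) (mem_set (fd d)) : fits_space finset.setT); split.
- move=> c; apply: fits_val_inj; transitivity (par_norm finset.setT (set_val c)); first by [].
  by apply: par_norm_id; rewrite /par_ok (negbTE main_not_simple); exact: fits_spaceP.
- by move=> d; rewrite /fits_par -[RHS]par_mkK.
- by move=> d; apply: cts_set_type; exact: continuous_set_val.
Qed.

Lemma hull_vtx t i : admissible t -> hull t (vtx R i) -> i \in t.
Proof.
move=> /admissible_good[gt tE]; rewrite {1}tE => /hull_closed_cell[xA xB _ _].
rewrite tE inE; apply/andP; split.
  apply/negPn/negP => /xB; rewrite vtxE eqxx (negbTE (fix_perm_neq i)) subr0.
  by rewrite leNgt ltr01.
apply/negPn/negP => /xA; rewrite vtxE eqxx eq_sym (negbTE (fix_perm_neq i)) sub0r.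
by rewrite oppr_ge0 leNgt ltr01.
Qed.

(** If a and b are shared by the supports of [t], the face contains e_a - e_b and its opposite, so
    the supporting form is maximal at the origin of the plane. Were [s] the main stratum, opposite
    vertices would make the form constant and [t] equal to [s]; otherwise [sub_diag] applies. *)
Lemma face_diag s t : admissible s -> admissible t -> face (sigma t) (sigma s) ->
  firsts t :&: lasts t != finset.set0 -> firsts t :&: lasts t = firsts s :&: lasts s.
Proof.
move=> sA tA; rewrite !sigma_polytopeE => fts D0.
have [u [m [um [ut us]]]] := face_hullP (fun i _ => @hull_vtx t i tA) fts.
have ts i : i \in t -> i \in s by move=> /ut[/(hull_vtx sA)].
pose h : 'I_3 -> R := ext_vec u^T.
have uE i : (vtx R i *m u) 0 0 = h 0 + h 1 + (h (fix_perm i 0) - h (fix_perm i 2)).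
  have -> : u = plane_form h.
    by apply/colP => l; rewrite mxE subr0; case: l => -[|[|//]] ll; rewrite /h /ext_vec /= mxE;
      congr (u _ _); exact/val_inj.
  have h2 : h 2 = 0 by [].
  by rewrite formE sum_vtx h2; ring.
have [gt tE] := admissible_good tA; have [gs sE] := admissible_good sA.
have /finset.set0Pn[a aD] := D0; have [b [bA bB ba]] := good_two gt aD.
move: aD; rewrite finset.in_setI => /andP[aA aB].
have [i [i0 i2]] := idx_ex ba; have ab := ba; rewrite eq_sym in ab; have [j [j0 j2]] := idx_ex ab.
have it : i \in t by rewrite tE inE i0 i2 bA aB.
have jt : j \in t by rewrite tE inE j0 j2 bB aA.
have [_ ui] := ut _ it; have [_ uj] := ut _ jt; rewrite !uE ?i0 ?i2 ?j0 ?j2 in ui uj.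
have hab : h a = h b by move: ui uj; move: (h 0) (h 1) (h a) (h b) => ha hb hc hd; clear => e1 e2; lra.
have mE : m = h 0 + h 1 by move: ui uj; move: (h 0) (h 1) (h a) (h b) => ha hb hc hd; clear => e1 e2; lra.
have ft : firsts t \subset firsts s by apply: imsetS; apply/fintype.subsetP.
have lt : lasts t \subset lasts s by apply: imsetS; apply/fintype.subsetP.
have [sT|sT] := pselect (s = finset.setT); last exact: sub_diag sA tA ft lt D0 sT.
suff -> : t = s by [].
apply/setP => l; apply/idP/idP => [|ls]; first exact: ts.
apply: us => //; rewrite uE mE; suff H x : h x = h a by rewrite !H subrr addr0.
have [->//|xa] := eqVneq x a; have ax := xa; rewrite eq_sym in ax.
have [l1 [l10 l12]] := idx_ex xa; have [l2 [l20 l22]] := idx_ex ax.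
have := um l1; have := um l2; rewrite !uE sT !inE l10 l12 l20 l22 mE => /(_ isT) h1 /(_ isT) h2.
lra.
Qed.

Lemma face_fits s t k : admissible s -> admissible t -> face (sigma t) (sigma s) ->
  fits (firsts s) (lasts s) k -> fits (firsts t) (lasts t) k.
Proof.
move=> sA tA fts f D0; have E := face_diag sA tA fts D0.
by rewrite E; apply: f; rewrite -E.
Qed.

Lemma EE_eq (w w' : EEset) : qclass EErel w = qclass EErel w' <-> EErel w w'.
Proof.
rewrite qclassP; apply: equiv_class_eq => [z|z v [e o]|z v u [e o] [e' o']].
- by split=> //; exact: same_orbit_refl.
- by split=> //; exact: same_orbit_sym.
- by split; [rewrite e|exact: same_orbit_trans o o'].
Qed.

Lemma EE_mk s x L : admissible s -> stratum s L -> mu L = x -> EEset (((s, x) : CQspace), L).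
Proof.
move=> sA sL muE; exists s, x, L; split=> //; split=> //=.
by rewrite -muE; exact: mu_relint.
Qed.

Lemma EE_mu (w : EEset) : mu (set_val w).2 = (set_val w).1.2.
Proof. by rewrite set_valE; have [s [x [y [-> _ _ ->]]]] := set_valP w. Qed.

Lemma EE_stratum (w : EEset) : stratum (set_val w).1.1 (set_val w).2.
Proof. by rewrite set_valE; have [s [x [y [-> _ ? _]]]] := set_valP w. Qed.

Lemma EE_uniq (w w' : EEset) k : (set_val w).1 = (set_val w').1 ->
  CP_matches (set_val w).2 k -> CP_matches (set_val w').2 k -> qclass EErel w = qclass EErel w'.
Proof.
move=> e m m'; apply/EE_eq; split=> //; apply/orbit_eqP.
by apply: orbit_of_uniq m m'; rewrite !EE_mu e.
Qed.

Lemma CQ_snd_continuous : continuous (fun z : CQspace => z.2 : 'rV[R]_2).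
Proof.
apply/continuousP => V oV; rewrite /open /= /final_open.
have -> : (@cmap R 2 M mu atlas) @^-1` ((fun z : CQspace => z.2 : 'rV[R]_2) @^-1` V) = mu @^-1` V by [].
by apply: open_comp => // L _; exact: flag_moment_continuous.
Qed.

Local Notation Eset := (@E_set R 2 M mu atlas CP1 fits_space fits_val).

(** The universal space is CP^1 itself, the spaces of the strata being the sets of fitting classes;
    it is compact, and generic classes are dense in it. *)
Lemma flag_axiom6 : axiom6 (par_data R).
Proof.
exists CP1, fits_space, fits_val, fits_par; split.
- move=> s sA; split.
  + exact: continuous_set_val.
  + exact: fits_val_inj.
  + exact: fits_par_continuous.
  + exact: fits_par_surj.
- split; [exact: fits_par_main|exact: compact_CP1|exact: hausdorff_CP1|].
  move=> U U0 oU; have [k [Uk fk]] := main_dense_CP U0 oU; exists k; split=> //.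
  have fk' : fits (firsts finset.setT) (lasts finset.setT) k by have [-> ->] := firstsT.
  by exists (exist _ k (mem_set fk')).
- split.
    move=> s t sA tA fts _ [c _ <-].
    have fc := face_fits sA tA fts (fits_spaceP c).
    by exists (exist _ (set_val c) (mem_set fc)).
  apply/seteqP; split=> // k _; have [i _] := idx_ex (isT : (0 : 'I_3) != 1).
  exists i => //; have fk : fits (firsts [set i]%SET) (lasts [set i]%SET) k.
    by rewrite /fits -(vertex_idx i) firsts_idx_of ?lasts_idx_of ?good1 // disjoint1 eqxx.
  by exists (exist _ k (mem_set fk)).
(* A boundary stratum is never the main one, so it has only one parameter and there is nothing to
   compare. *)
- move=> s t c d sA bt _; apply: par_subsingleton; first by have [] := bt.
  exact: par_bdry_proper bt.
have /choice[h hP] : forall z : Eset, exists w : EEset,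
    (set_val w).1 = (set_val z).1 /\ CP_matches (set_val w).2 (set_val z).2.
  move=> z; have [s [x [c [zE [sA xr]]]]] := set_valP z.
  have /(relint_sigma _ sA) xc : relint (sigma s) x := xr.
  have [L [LE m]] := orbit_of_ex (set_val c) (cell_hexagon xc).
  have sL : stratum s L.
    by apply: cell_stratum m _ => //; [rewrite LE|exact: fits_spaceP].
  have zE' : set_val z = (((s, x) : CQspace), set_val c) := zE.
  exists (exist _ (((s, x) : CQspace), L) (mem_set (EE_mk sA sL LE))).
  by rewrite zE'.
exists (fun z => qclass EErel (h z)); split; last first.
  move=> z w s x c y zE wE pE; have [h1 hm] := hP z.
  apply: (@EE_uniq _ _ (set_val z).2) => //; first by rewrite h1 zE wE.
  have sy : stratum s (set_val y) by exact: set_valP y.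
  rewrite wE zE /=; have sA : admissible s by exists (set_val y).
  have [ss|ns] := boolP (simple R s).
    by apply: disjoint_matches; have [<- <-] := stratum_supp sy; exact: simple_disjoint ss.
  have nE : par_norm s (flag_class (set_val y)) = par_norm s (set_val c).
    move: pE; rewrite -[pd_triv _ _]/(par_triv _) par_trivE /= => /(congr1 set_val) E.
    exact: E.
  have := par_matches sy; rewrite nE par_norm_id //.
  by rewrite /par_ok (negbTE ns); exact: fits_spaceP.
(* Continuity of the map at [z0], whose chosen lift is [w0]. For [z] near [z0] the orbit of the
   lift, given by [orbit_of], still meets the neighbourhood [U'] of the flag of [w0]. Exchanging the
   lift for a flag of its orbit inside [U'] brings it into [W] without changing its class. *)
apply/continuousP => O /open_quot [W oW WE].
rewrite openE => z0 Oz0.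
have [h1 hm] := hP z0; set w0 := h z0 in h1 hm.
have : (set_val @^-1` W) w0 by rewrite WE.
rewrite /preimage /= => Ww0.
have [[V U] /= [nV nU] VU] : nbhs ((set_val w0).1, (set_val w0).2) W.
  by rewrite -surjective_pairing; apply: open_nbhs_nbhs.
move: nU; rewrite nbhsE => -[] U' [] oU' U'L U'U.
have muw (w : EEset) : hexagon (set_val w).1.2 by rewrite -EE_mu; exact: flag_moment_hexagon.
pose hx (w : EEset) : @hexagon R := exist _ (set_val w).1.2 (mem_set (muw w)).
have hxE (w : EEset) k : CP_matches (set_val w).2 k -> orbit_of (hx w, k) = orb (set_val w).2.
  by move=> m; apply: orbit_ofE => //=; rewrite EE_mu.
pose O2 := (@orbit_of R) @^-1` (@orb R @` U').
have oO2 : open O2 by apply: open_comp; [move=> ? _; exact: orbit_of_continuous|exact: orb_open].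
have [[X K] /= [nX nK] XK] : nbhs (hx w0, (set_val z0).2) O2.
  apply: open_nbhs_nbhs; split=> //; rewrite /O2 /preimage /= hxE //.
  by exists (set_val w0).2.
move: nX; rewrite nbhsE => -[] X0 [] [X' oX' X'E] X0w X0X.
have X'x : nbhs (set_val z0).1.2 X'.
  apply: open_nbhs_nbhs; split=> //; rewrite -h1.
  have : (set_val @^-1` X') (hx w0) by rewrite X'E.
  by [].
have c1 := cts_fst (@continuous_set_val _ _ z0); have c2 := cts_snd (@continuous_set_val _ _ z0).
have n1 : nbhs z0 [set z : Eset | V (set_val z).1] by apply: c1; rewrite -h1.
have n2 : nbhs z0 [set z : Eset | K (set_val z).2] by apply: c2.
have n3 : nbhs z0 [set z : Eset | X' (set_val z).1.2].
  exact: (cts_comp c1 (@CQ_snd_continuous _) X'x).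
apply: filterS (filterI n1 (filterI n2 n3)) => z [Vz [Kz X'z]].
have [z1 zm] := hP z; set w := h z in z1 zm.
have : O2 (hx w, (set_val z).2).
  apply: XK; split=> //=; apply: X0X; rewrite -X'E /preimage /= set_valE /= z1.
  exact: X'z.
rewrite /O2 /preimage /= hxE // => -[L' U'L' /orbit_eqP Lo].
have sw := EE_stratum w.
have sL' : stratum (set_val w).1.1 L'.
  have [u uT uE] := same_orbit_sym Lo.
  by apply/stratumP; rewrite -uE; have [-> ->] := supp_action (set_val w).2 uT; exact/stratumP.
have muL' : mu L' = (set_val w).1.2.
  by have [u uT uE] := Lo; rewrite -EE_mu -uE mu_action.
have sA : admissible (set_val w).1.1 by exists L'.
pose w' : EEset := exist _ ((((set_val w).1.1, (set_val w).1.2) : CQspace), L') (mem_set (EE_mk sA sL' muL')).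
rewrite /preimage /=; have -> : qclass EErel w = qclass EErel w'.
  apply/EE_eq; split; last exact: same_orbit_sym.
  by rewrite [in RHS]set_valE /=; exact: surjective_pairing.
have : (set_val @^-1` W) w'.
  rewrite /preimage /=; apply: (VU ((set_val w').1, (set_val w').2)); split=> /=; last exact: U'U.
  by rewrite -surjective_pairing z1.
by rewrite WE.
Qed.

End UniversalParameters.

(** * Smoothness of the moment map and of the torus action *)

Section SmoothStructure.
Variable R : realType.
Local Notation C := (Cplx R).
Local Notation M := (flag_manifold R).
Local Notation mu := (@flag_moment_map R).
Local Notation theta := (@T2_action R).

Lemma CooC_comp (n m : nat) (U : set 'rV[R]_n) (f : 'rV[R]_m -> C) (g : 'rV[R]_n -> 'rV[R]_m) :
  open U -> CooC setT f -> class_Coo U g -> CooC U (fun x => f (g x)).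
Proof. by move=> oU [f1 f2] Cg; split; [apply: (Coo_comp oU openT) f1 Cg|apply: (Coo_comp oU openT) f2 Cg]. Qed.

Lemma open_neq0C (n : nat) (f : 'rV[R]_n -> C) : CooC setT f -> open [set x | f x != 0].
Proof.
move=> Cf; have nc : continuous (fun x => normsq (f x)).
  by move=> x; exact: (Coo_continuous (Coo_normsq openT Cf)).
rewrite (_ : mkset _ = (fun x => normsq (f x)) @^-1` [set r | 0 < r]).
  by apply: open_comp => [x _|]; [exact: nc|exact: open_gt].
by apply/seteqP; split=> x; rewrite /= normsq_gt0.
Qed.

Lemma Coo_weight (n : nat) (U : set 'rV[R]_n) (p : 'rV[R]_n -> 'rV[C]_3) j : open U ->
  (forall x, U x -> p x != 0) -> (forall i, CooC U (fun x => p x 0 i)) ->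
  Coo U (fun x => weight (p x) j).
Proof.
move=> oU p0 Cp; apply: (CooM oU); first exact: Coo_normsq.
apply: (CooV oU) => [x Ux|]; first by rewrite gt_eqF // sum_normsq_gt0 // p0.
by apply: Coo_sum => // i _; exact: Coo_normsq.
Qed.

Lemma flag_moment_smooth : smooth_on (N := euclidean R 2) setT (mu : M -> _).
Proof.
move=> L _; exists setT, mu; split; [exact: openT|exact: I|by move=> y _|].
split=> [x _|_ _ [s _ <-] ->]; first exact: flag_moment_continuous.
have -> : chart_map (flag_chart R s) @` (setT `&` chart_dom (flag_chart R s) `&` (mu @^-1` setT)) = setT.
  rewrite setTI preimage_setT setIT; exact: flag_chart_cod.
apply/class_CooP => [|j]; first exact: openT.
apply: (@Coo_near _ _ _ (fun z => 1 + (weight (pvec s z) (lshift 1 j) - weight (qvec s z) (lshift 1 j)))).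
- exact: openT.
- move=> z _; rewrite /= flag_moment_mapE [RHS]mxE; congr (_ + _); apply/esym.
  exact: (moment_xE _ (flag_param_pair s z)).
apply: CooD; [exact: openT|exact: Coo_cst|].
apply: CooB; first exact: openT.
  apply: Coo_weight; [exact: openT| |by move=> i; apply: CooC_pvec; exact: openT].
  by move=> z _; exact: pvec_neq0.
apply: Coo_weight; [exact: openT| |by move=> i; apply: CooC_qvec; exact: openT].
by move=> z _; exact: qvec_neq0.
Qed.

Definition prod_torus (v : 'rV[R]_(2 + 2 + 6)) : 'rV[C]_2 :=
  \row_j mkC (lsubmx (lsubmx v) 0 j) (rsubmx (lsubmx v) 0 j).

Lemma CooC_prod_torus j (U : set 'rV[R]_(2 + 2 + 6)) : open U -> CooC U (fun v => prod_torus v 0 j).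
Proof.
move=> oU; apply: (@CooC_near _ _ _ _ (fun v => mkC (v 0 (lshift 6 (lshift 2 j))) (v 0 (lshift 6 (rshift 2 j))))).
- exact: oU.
- by move=> v _; rewrite !mxE.
by apply: CooC_mk; exact: Coo_coord.
Qed.

Lemma CooC_ext_torus j (U : set 'rV[R]_(2 + 2 + 6)) : open U ->
  CooC U (fun v => ext_torus (prod_torus v) 0 j).
Proof.
move=> oU; apply: (@CooC_near _ _ _ _ (fun v => [:: prod_torus v 0 0; prod_torus v 0 1; 1]`_j)).
- exact: oU.
- by move=> v _; rewrite [RHS]mxE.
by elim/ord3_ind: j => /=; [exact: CooC_prod_torus|exact: CooC_prod_torus|exact: CooC_cst].
Qed.

Lemma Coo_rsubmx (U : set 'rV[R]_(2 + 2 + 6)) : open U ->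
  class_Coo U (fun v : 'rV[R]_(2 + 2 + 6) => rsubmx v).
Proof.
move=> oU; apply/class_CooP => // j.
apply: (@Coo_near _ _ _ (fun v : 'rV[R]_(2 + 2 + 6) => v 0 (rshift (2 + 2) j))) => //.
  by move=> v _; rewrite mxE.
exact: Coo_coord.
Qed.

Lemma CooC_pvec_rsubmx s i (U : set 'rV[R]_(2 + 2 + 6)) : open U ->
  CooC U (fun v => pvec s (rsubmx v) 0 i) /\ CooC U (fun v => qvec s (rsubmx v) 0 i).
Proof.
move=> oU; split.
  exact: (@CooC_comp _ _ U (fun z => pvec s z 0 i) (fun v => rsubmx v) oU
    (CooC_pvec _ _ openT) (Coo_rsubmx oU)).
exact: (@CooC_comp _ _ U (fun z => qvec s z 0 i) (fun v => rsubmx v) oU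
  (CooC_qvec _ _ openT) (Coo_rsubmx oU)).
Qed.

(** The torus is not open in C^2, but the action formula makes sense for all [t] with nonzero
    coordinates, an open set, and there it is rational in [t] and in the chart coordinates. *)
Lemma flag_action_smooth :
  smooth_on (M := prod_space (complex_space R 2) M) (@torus R 2 `*` setT) (fun z => theta z.1 z.2).
Proof.
move=> [t0 L0] [/= t0T _].
pose U : set ('rV[C]_2 * M) := [set z : 'rV[C]_2 * M | forall j, z.1 0 j != 0].
exists U, (fun z => theta z.1 z.2); split=> //.
- have oc j : open [set z : 'rV[C]_2 * M | z.1 0 j != 0].
    have nc : continuous (fun z : 'rV[C]_2 * M => normsq (z.1 0 j)).
      by move=> z; apply: cts_normsq; apply: cts_coord; exact: (cts_fst (@cts_id _ z)).
    rewrite (_ : mkset _ = (fun z : 'rV[C]_2 * M => normsq (z.1 0 j)) @^-1` [set r | 0 < r]).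
      by apply: open_comp => [x _|]; [exact: nc|exact: open_gt].
    by apply/seteqP; split=> x; rewrite /= normsq_gt0.
  rewrite (_ : U = [set z : 'rV[C]_2 * M | z.1 0 0 != 0] `&` [set z : 'rV[C]_2 * M | z.1 0 1 != 0]).
    by apply: openI; exact: oc.
  apply/seteqP; split=> z; first by move=> Uz; split; exact: Uz.
  by move=> [z0 z1] [[|[|//]] jj]; [move: z0|move: z1]; congr (~~ (z.1 _ _ == 0)); exact/val_inj.
- by move=> j /=; exact: torus_neq0.
split=> [[t L] /= tn|_ _ [_ -> [c2 [s _ <-] <-]] [s' _ <-]]; first exact: T2_action_cts.
have D (t : 'rV[C]_2) (z : 'rV[R]_6) : (forall j, t 0 j != 0) ->
    chart_dom (flag_chart R s') (theta t (flag_param s z)) <->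
    pvec s z 0 (s' 0) != 0 /\ qvec s z 0 (s' 2) != 0.
  move=> tn; have e0 := ext_torus_neq0 tn.
  rewrite (flag_chart_dom s' (T2_action_pair tn (flag_param_pair s _))).
  rewrite [(\row_j _) _ _]mxE [X in _ /\ X]/is_true [(\row_j (qvec _ _ _ _ / _)) _ _]mxE.
  by rewrite !mulf_eq0 ?invr_eq0 !(negbTE (e0 _)) !orbF.
set S := _ @` _.
have SE : S = [set v | (forall j, prod_torus v 0 j != 0) /\ pvec s (rsubmx v) 0 (s' 0) != 0 /\
    qvec s (rsubmx v) 0 (s' 2) != 0].
  have cK (t : 'rV[C]_2) (z : 'rV[R]_6) :
      prod_torus (row_mx (row_mx (map_mx (@cRe R) t) (map_mx (@cIm R) t)) z) = t.
    by apply/rowP => j; rewrite mxE row_mxKl row_mxKl row_mxKr !mxE mkCK.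
  apply/seteqP; split=> v.
    move=> [[t L] [[Ut [_ [z _ zL]]] dom] <-]; rewrite /= in Ut zL *; subst L.
    have dom' : chart_dom (flag_chart R s') (theta t (flag_param s z)) by exact: dom.
    rewrite [X in row_mx _ X](flag_chart_param s z) cK row_mxKr; split=> //.
    exact: (D t z Ut).1 dom'.
  move=> [tn dom]; exists (prod_torus v, flag_param s (rsubmx v)).
    split; last exact/D.
    by split=> //; split=> //; exists (rsubmx v).
  rewrite /= [X in row_mx _ X](flag_chart_param s (rsubmx v)) -[RHS]hsubmxK; congr row_mx.
  rewrite -[RHS]hsubmxK; congr row_mx; apply/rowP => j; rewrite !mxE //.
have oS : open S.
  rewrite SE (_ : mkset _ = [set v | prod_torus v 0 0 != 0] `&` [set v | prod_torus v 0 1 != 0] `&`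
      ([set v | pvec s (rsubmx v) 0 (s' 0) != 0] `&` [set v | qvec s (rsubmx v) 0 (s' 2) != 0])).
    apply: openI; apply: openI; apply: open_neq0C; try exact: (CooC_prod_torus _ openT).
      exact: (CooC_pvec_rsubmx _ _ openT).1.
    exact: (CooC_pvec_rsubmx _ _ openT).2.
  apply/seteqP; split=> v; first by move=> [tn [h1 h2]]; do 2!split => //; exact: tn.
  move=> [[t0' t1'] [h1 h2]]; split=> // [[[|[|//]] jj]]; [move: t0'|move: t1'];
    by congr (~~ (prod_torus v _ _ == 0)); exact/val_inj.
have Sn v : S v -> forall j, prod_torus v 0 j != 0 by rewrite SE => -[].
have h1 v : S v -> plucker_pair (theta (prod_torus v) (flag_param s (rsubmx v)))
    (\row_j (pvec s (rsubmx v) 0 j * ext_torus (prod_torus v) 0 j))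
    (\row_j (qvec s (rsubmx v) 0 j / ext_torus (prod_torus v) 0 j)).
  by move=> /Sn tn; exact: (T2_action_pair tn (flag_param_pair s _)).
have h2 i : CooC S (fun v => (\row_j (pvec s (rsubmx v) 0 j * ext_torus (prod_torus v) 0 j) : 'rV[C]_3) 0 i).
  apply: (@CooC_near _ _ _ oS (fun v => pvec s (rsubmx v) 0 i * ext_torus (prod_torus v) 0 i)).
    by move=> v _; rewrite [RHS]mxE.
  apply: CooCM => //; last exact: CooC_ext_torus.
  exact: (CooC_pvec_rsubmx _ _ oS).1.
have h3 i : CooC S (fun v => (\row_j (qvec s (rsubmx v) 0 j / ext_torus (prod_torus v) 0 j) : 'rV[C]_3) 0 i).
  apply: (@CooC_near _ _ _ oS (fun v => qvec s (rsubmx v) 0 i * (ext_torus (prod_torus v) 0 i)^-1)).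
    by move=> v _; rewrite [RHS]mxE.
  apply: CooCM => //.
    exact: (CooC_pvec_rsubmx _ _ oS).2.
  apply: CooCV => //; last exact: CooC_ext_torus.
  by move=> v /Sn tn; exact: ext_torus_neq0.
have h4 v : S v -> chart_dom (flag_chart R s') (theta (prod_torus v) (flag_param s (rsubmx v))).
  by move=> Sv; apply/D; [exact: Sn|move: Sv; rewrite SE => -[_]].
exact: (@smooth_into_flag R _ S (fun v => theta (prod_torus v) (flag_param s (rsubmx v))) _ _ s' oS h1 h2 h3 h4).
Qed.

End SmoothStructure.

Section GlobalProperties.
Variable R : realType.
Local Notation C := (Cplx R).
Local Notation M := (flag_manifold R).
Local Notation mu := (@flag_moment_map R).
Local Notation theta := (@T2_action R).

Lemma flag_effective : effective theta.
Proof.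
move=> t tT tid; have [L /main_stratumP[sp sq]] := @main_admissible R.
have /stabE[_ [cA _]] : stab theta L t by split.
rewrite sp in cA; apply/rowP => j; rewrite [RHS]mxE.
have E (i : 'I_3) : ext_torus t 0 i = 1.
  by rewrite (cA i 2) ?inE // mxE.
case: j => -[|[|//]] jj.
  by have := E 0; rewrite mxE /= => <-; congr (t _ _); exact/val_inj.
by have := E 1; rewrite mxE /= => <-; congr (t _ _); exact/val_inj.
Qed.

Lemma polytope_mu : polytope (range (mu : M -> _)).
Proof.
rewrite range_mu; apply: conv_hull_polytope; rewrite -idx_ofT.
by apply: idx_of_neq0; exact: main_good.
Qed.

(** A smaller rank would leave a nonzero vector orthogonal to all edges. By [const_on_edges] its
    extension to three entries is constant, hence equal to its last entry 0. *)
Lemma aff_dim_mu : aff_dim (range (mu : M -> _)) 2.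
Proof.
have /finset.set0Pn[i0 si0] : idx_of finset.setT finset.setT != finset.set0.
  by apply: idx_of_neq0; exact: main_good.
rewrite range_mu -idx_ofT; have := hull_aff_dim (vtx R) si0.
have := rank_kernel_edge (vtx R) (idx_of finset.setT finset.setT) i0.
set K := kermx _; have [->|rK] := posnP (\rank K); first by rewrite addn0 => ->.
pose x : 'rV[R]_2 := delta_mx 0 (Ordinal rK) *m row_base K.
have x0 : x != 0.
  have /row_freeP[B KB] : row_free (row_base K) by exact: row_base_free.
  apply/eqP => /(congr1 (fun A => A *m B)); rewrite mul0mx -mulmxA KB mulmx1.
  by move=> /matrixP/(_ 0 (Ordinal rK)); rewrite !mxE !eqxx => /eqP; rewrite oner_eq0.
have : [set x : 'rV[R]_2 | forall i, i \in idx_of finset.setT finset.setT ->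
    x *m (vtx R i - vtx R i0)^T = 0] x.
  by rewrite edge_mx_kernel; exists (delta_mx 0 (Ordinal rK)).
move=> /(const_on_edges x main_good si0)[cT _]; case/eqP: x0.
have E (j : 'I_3) : ext_vec x j = 0 by rewrite (cT j 2) ?inE.
apply/rowP => -[[|[|//]] jj]; rewrite [RHS]mxE.
  by have := E 0; rewrite /ext_vec /= => <-; congr (x _ _); exact/val_inj.
by have := E 1; rewrite /ext_vec /= => <-; congr (x _ _); exact/val_inj.
Qed.

End GlobalProperties.

(** * The torus as a manifold *)

Section TorusManifold.
Variables (R : realType) (n : nat).

Definition torus_set : set 'rV[R]_(n + n) :=
  [set v | forall j, v 0 (lshift n j) ^+ 2 + v 0 (rshift n j) ^+ 2 = 1].

Definition torus_space : topologicalType := torus_set.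

Definition pole (e : bool) : R := if e then 1 else -1.

Lemma pole_sq e : pole e ^+ 2 = 1.
Proof. by case: e; rewrite /pole ?sqrrN expr1n. Qed.

(** In each circle factor, stereographic projection from the point with first coordinate opposite to
    [pole (e j)]. *)
Definition stereo_dom (e : {ffun 'I_n -> bool}) : set torus_space :=
  [set v : torus_space | forall j, 1 + pole (e j) * set_val v 0 (lshift n j) != 0].

Definition stereo_map (e : {ffun 'I_n -> bool}) (v : torus_space) : 'rV[R]_n :=
  \row_j (set_val v 0 (rshift n j) / (1 + pole (e j) * set_val v 0 (lshift n j))).

Definition stereo_row (e : {ffun 'I_n -> bool}) (u : 'rV[R]_n) : 'rV[R]_(n + n) :=
  row_mx (\row_j (pole (e j) * (1 - u 0 j ^+ 2) / (1 + u 0 j ^+ 2)))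
         (\row_j (2 * u 0 j / (1 + u 0 j ^+ 2))).

Lemma stereo_rowE e u j :
  stereo_row e u 0 (lshift n j) = pole (e j) * (1 - u 0 j ^+ 2) / (1 + u 0 j ^+ 2) /\
  stereo_row e u 0 (rshift n j) = 2 * u 0 j / (1 + u 0 j ^+ 2).
Proof. by rewrite row_mxEl row_mxEr !mxE. Qed.

Lemma sqr1_neq0 (x : R) : 1 + x ^+ 2 != 0.
Proof. by rewrite gt_eqF // ltr_pwDl // sqr_ge0. Qed.

Lemma stereo_row_torus e u : torus_set (stereo_row e u).
Proof.
move=> j; have [-> ->] := stereo_rowE e u j; have p2 := pole_sq (e j).
have n0 := sqr1_neq0 (u 0 j); move: (u 0 j) (pole _) p2 n0 => x p p2 n0.
transitivity ((p ^+ 2 * (1 - x ^+ 2) ^+ 2 + 4 * x ^+ 2) / (1 + x ^+ 2) ^+ 2); first by field.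
by rewrite p2; field.
Qed.

Definition stereo_inv e u : torus_space := exist _ (stereo_row e u) (mem_set (stereo_row_torus e u)).

Definition stereo_chart e : chart R n torus_space := Chart (stereo_dom e) (stereo_map e) (stereo_inv e).

Definition torus_mfd : charted_space R := ChartedSpace (cs_space := torus_space) (range stereo_chart).

Lemma stereo_inv_dom e u : stereo_dom e (stereo_inv e u).
Proof.
move=> j; rewrite set_valE /= (stereo_rowE e u j).1.
have n0 := sqr1_neq0 (u 0 j); have p2 := pole_sq (e j).
rewrite (_ : _ + _ = 2 / (1 + u 0 j ^+ 2)); first by rewrite mulf_neq0 ?invr_eq0 // pnatr_eq0.
move: (u 0 j) (pole _) p2 n0 => x p p2 n0.
transitivity ((1 + x ^+ 2 + p ^+ 2 * (1 - x ^+ 2)) / (1 + x ^+ 2)); first by field.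
by rewrite p2; field.
Qed.

Lemma stereo_invK e : cancel (stereo_inv e) (stereo_map e).
Proof.
move=> u; apply/rowP => j; have d := stereo_inv_dom e u j.
rewrite mxE; move: d; rewrite set_valE /= (stereo_rowE e u j).1 (stereo_rowE e u j).2.
have n0 := sqr1_neq0 (u 0 j); have p2 := pole_sq (e j).
move: (u 0 j) (pole _) p2 n0 => x p p2 n0 d.
have E : 1 + p * (p * (1 - x ^+ 2) / (1 + x ^+ 2)) = 2 / (1 + x ^+ 2).
  transitivity ((1 + x ^+ 2 + p ^+ 2 * (1 - x ^+ 2)) / (1 + x ^+ 2)); first by field.
  by rewrite p2; field.
by rewrite E; field.
Qed.

Lemma stereo_mapK e v : stereo_dom e v -> stereo_inv e (stereo_map e v) = v.
Proof.
move=> dv; apply: set_val_inj; apply/rowP => l; rewrite set_valE /=.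
have tv : torus_set (set_val v) := set_valP v.
suff H j : stereo_row e (stereo_map e v) 0 (lshift n j) = set_val v 0 (lshift n j) /\
    stereo_row e (stereo_map e v) 0 (rshift n j) = set_val v 0 (rshift n j).
  by rewrite -[l]splitK; case: (fintype.split l) => j /=; have [] := H j.
have [-> ->] := stereo_rowE e (stereo_map e v) j; rewrite !mxE.
have := tv j; have := dv j; have := pole_sq (e j).
move: (set_val v 0 _) (set_val v 0 _) (pole _) => y x p p2 d xy.
have E : 1 + (y / (1 + p * x)) ^+ 2 = 2 / (1 + p * x).
  transitivity ((1 + 2 * (p * x) + p ^+ 2 * x ^+ 2 + y ^+ 2) / (1 + p * x) ^+ 2); first by field.
  rewrite p2 mul1r (_ : _ + y ^+ 2 = 1 + 2 * (p * x) + (x ^+ 2 + y ^+ 2)); last by ring.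
  by rewrite xy; field.
rewrite E; have y2 : y ^+ 2 = 1 - x ^+ 2 by rewrite -xy; ring.
split; last by field; rewrite d.
have -> : p * (1 - (y / (1 + p * x)) ^+ 2) / (2 / (1 + p * x)) =
    p * ((1 + p * x) ^+ 2 - y ^+ 2) / (2 * (1 + p * x)) by field; rewrite d.
rewrite y2 (_ : (1 + p * x) ^+ 2 - (1 - x ^+ 2) = 2 * (p * x) + (p ^+ 2 + 1) * x ^+ 2); last by ring.
rewrite p2 (_ : p * _ = 2 * x * (p ^+ 2 + p * x)); last by ring.
by rewrite p2; field; rewrite d.
Qed.

Lemma torus_coord_continuous l : continuous (fun v : torus_space => set_val v 0 l).
Proof. by move=> v; exact: (@cts_coord _ _ _ _ _ 0 l v (@continuous_set_val _ torus_set v)). Qed.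

Lemma stereo_den_continuous e j :
  continuous (fun v : torus_space => 1 + pole (e j) * set_val v 0 (lshift n j)).
Proof.
move=> v.
exact: (ctsD (@cts_cst R _ 1 v) (ctsM (@cts_cst R _ (pole (e j)) v) (@torus_coord_continuous _ v))).
Qed.

Lemma stereo_dom_open e : open (stereo_dom e).
Proof.
rewrite openE => v dv.
suff H : forall j, nbhs v [set w : torus_space | 1 + pole (e j) * set_val w 0 (lshift n j) != 0].
  by have := @filter_forall _ _ _ _ (nbhs_filter v) H; apply: filterS => w.
move=> j.
have o0 : open [set x : R | x != 0].
  rewrite (_ : mkset _ = ~` [set 0]); first exact: closed_openC (@closed_eq _ 0).
  by apply/seteqP; split=> x /= /eqP.
have nb : nbhs (1 + pole (e j) * set_val v 0 (lshift n j)) [set x : R | x != 0].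
  by apply: open_nbhs_nbhs; split=> //; exact: dv.
exact: (@stereo_den_continuous e j v _ nb).
Qed.

Lemma stereo_cod e : chart_cod (stereo_chart e) = setT.
Proof.
apply/seteqP; split=> // u _; exists (stereo_inv e u); first exact: stereo_inv_dom.
exact: stereo_invK.
Qed.

Lemma Coo_stereo_row e (U : set 'rV[R]_n) l : open U -> Coo U (fun u => stereo_row e u 0 l).
Proof.
move=> oU; rewrite -[l]splitK; case: (fintype.split l) => j /=.
  apply: (@Coo_near _ _ _ (fun u => pole (e j) * (1 - u 0 j * u 0 j) * (1 + u 0 j * u 0 j)^-1)) => //.
    by move=> u _; rewrite (stereo_rowE e u j).1 !expr2.
  apply: CooM => //.
    apply: CooM => //; first exact: Coo_cst.
    apply: CooB => //; first exact: Coo_cst.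
    by apply: CooM => //; exact: Coo_coord.
  apply: CooV => // [u _|]; first by rewrite -expr2 sqr1_neq0.
  by apply: CooD => //; [exact: Coo_cst|apply: CooM => //; exact: Coo_coord].
apply: (@Coo_near _ _ _ (fun u => 2 * u 0 j * (1 + u 0 j * u 0 j)^-1)) => //.
  by move=> u _; rewrite (stereo_rowE e u j).2 !expr2.
apply: CooM => //; first by apply: CooM => //; [exact: Coo_cst|exact: Coo_coord].
apply: CooV => // [u _|]; first by rewrite -expr2 sqr1_neq0.
by apply: CooD => //; [exact: Coo_cst|apply: CooM => //; exact: Coo_coord].
Qed.

Lemma stereo_inv_continuous e : continuous (stereo_inv e).
Proof.
move=> u; apply: cts_set_type; apply: continuous_row => l.
exact: (Coo_continuous (Coo_stereo_row e l openT) (I : setT u)).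
Qed.

Lemma stereo_map_cts e v : stereo_dom e v -> {for v, continuous (stereo_map e)}.
Proof.
move=> dv; apply: continuous_row => j.
have := ctsM (@torus_coord_continuous (rshift n j) v)
  (@ctsV R _ (fun v : torus_space => 1 + pole (e j) * set_val v 0 (lshift n j)) v (dv j)
    (@stereo_den_continuous e j v)).
by congr (continuous_at v _); apply/funext => w; rewrite [RHS]mxE.
Qed.

Lemma stereo_is_chart e : is_chart (stereo_chart e).
Proof.
split.
- by split; [exact: stereo_dom_open|rewrite stereo_cod; exact: openT].
- by move=> v /set_mem; exact: stereo_mapK.
- exact: stereo_map_cts.
- by move=> u _; exact: stereo_inv_continuous.
Qed.

Lemma Coo_stereo_map (m : nat) (U : set 'rV[R]_m) (f : 'rV[R]_m -> torus_space) e : open U ->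
  (forall l, Coo U (fun x => set_val (f x) 0 l)) -> (forall x, U x -> stereo_dom e (f x)) ->
  class_Coo U (fun x => stereo_map e (f x)).
Proof.
move=> oU Cf dom; apply/class_CooP => // j.
apply: (@Coo_near _ _ _ (fun x => set_val (f x) 0 (rshift n j) *
    (1 + pole (e j) * set_val (f x) 0 (lshift n j))^-1)) => //.
  by move=> x _; rewrite [RHS]mxE.
apply: CooM => //; apply: CooV => // [x Ux|]; first exact: dom.
by apply: CooD => //; [exact: Coo_cst|apply: CooM => //; exact: Coo_cst].
Qed.

Lemma stereo_compatible e e' : compatible (stereo_chart e) (stereo_chart e').
Proof.
suff H e1 e2 : class_Coo (stereo_map e1 @` (stereo_dom e1 `&` stereo_dom e2)) (stereo_map e2 \o stereo_inv e1).
  by split; [exact: H|rewrite setIC; exact: H].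
apply: Coo_stereo_map.
- rewrite setIC; exact: (open_chart_image (stereo_is_chart e1) (@stereo_dom_open e2)).
- move=> l; apply: Coo_stereo_row; rewrite setIC.
  exact: (open_chart_image (stereo_is_chart e1) (@stereo_dom_open e2)).
- by move=> _ [v [d1 d2] <-]; rewrite stereo_mapK.
Qed.

Lemma torus_set_compact : compact torus_set.
Proof.
have cb := @rV_compact R (n + n) (fun=> `[(-1), 1]%classic) (fun=> @segment_compact R (-1) 1).
apply: (subclosed_compact _ cb).
  rewrite (_ : torus_set = \bigcap_(j in [set: 'I_n])
      [set v : 'rV[R]_(n + n) | v 0 (lshift n j) ^+ 2 + v 0 (rshift n j) ^+ 2 = 1]).
    apply: closed_bigI => j _.
    apply: (@closed_comp _ _ (fun v : 'rV[R]_(n + n) => v 0 (lshift n j) ^+ 2 + v 0 (rshift n j) ^+ 2)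
      [set x : R | x = 1]); last exact: closed_eq.
    move=> v _; have c l := @coord_continuous R 1 (n + n) 0 l v.
    exact: (ctsD (ctsM (c _) (c _)) (ctsM (c _) (c _))).
  by apply/seteqP; split=> v; [move=> tv j _; exact: tv|move=> tv j; exact: tv].
move=> v tv; rewrite /= => l; rewrite in_itv /= -ler_norml -(@ler_pXn2r _ 2) ?nnegrE //.
rewrite real_normK ?num_real // expr1n -[l]splitK; case: (fintype.split l) => j /=;
  rewrite -(tv j) ?lerDl ?lerDr sqr_ge0 //.
Qed.

Lemma torus_mfd_smooth : smooth_manifold torus_mfd.
Proof.
have cT : compact [set: torus_space] by exact: compact_set_type torus_set_compact.
split.
- exact: (injective_hausdorff (@continuous_set_val _ torus_set) (@set_val_inj _ torus_set) (@hausdorff_rV R _)).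
- exact: (embed_second_countable cT (@continuous_set_val _ torus_set) (@set_val_inj _ torus_set)
    (stereo_inv [ffun=> true] 0)).
split.
- by move=> _ [e _ <-]; exact: stereo_is_chart.
- apply/seteqP; split=> // v _.
  (* The sign of the first coordinate selects the pole for which the denominator is at least 1. *)
  exists (stereo_chart [ffun j => 0 <= set_val v 0 (lshift n j)]); first by eexists.
  move=> j; rewrite ffunE /pole; case: ifPn => x0.
    by rewrite gt_eqF // mul1r ltr_pwDl.
  by rewrite gt_eqF // mulN1r ltr_pwDl // oppr_ge0 ltW // ltNge.
- by move=> _ _ [e _ <-] [e' _ <-]; exact: stereo_compatible.
Qed.

End TorusManifold.

(** * Coordinates on the leaves *)

Section ReparametrizedCharts.
Variable R : realType.
Local Notation M := (flag_manifold R).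
Variables (s : 'S_3) (f g : 'rV[R]_6 -> 'rV[R]_6) (O : set 'rV[R]_6).
Hypotheses (fK : cancel f g) (gK : cancel g f) (fS : class_Coo setT f) (gS : class_Coo setT g).
Hypothesis oO : open O.

(** A standard chart followed by a diffeomorphism of R^6 and cut down to [O]. For the leaves, [f]
    undoes a shear and reorders coordinates, and [O] keeps the nonvanishing ones away from 0, so
    that the others being 0 describes the leaf. *)
Definition repar_chart : chart R 6 M :=
  Chart (chart_dom (flag_chart R s) `&` [set L | O (f (chart_map (flag_chart R s) L))])
        (fun L => f (chart_map (flag_chart R s) L)) (fun v => flag_param s (g v)).

Lemma class_Coo_comp (n m l : nat) (U : set 'rV[R]_n) (V : set 'rV[R]_m)
    (F : 'rV[R]_m -> 'rV[R]_l) (G : 'rV[R]_n -> 'rV[R]_m) : open U -> open V ->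
  (forall x, U x -> V (G x)) -> class_Coo V F -> class_Coo U G -> class_Coo U (fun x => F (G x)).
Proof.
move=> oU oV UV CF CG; apply/class_CooP => // j.
by apply: (@Coo_comp _ _ _ _ _ (fun y => F y 0 j) G oU oV UV _ CG); move/class_CooP: CF; apply.
Qed.

Lemma class_Coo_cts (n m : nat) (U : set 'rV[R]_n) (F : 'rV[R]_n -> 'rV[R]_m) x :
  class_Coo U F -> U x -> {for x, continuous F}.
Proof. by move=> CF; exact: (CF 0%N). Qed.

Lemma class_Coo_sub (n m : nat) (U V : set 'rV[R]_n) (F : 'rV[R]_n -> 'rV[R]_m) :
  open U -> open V -> V `<=` U -> class_Coo U F -> class_Coo V F.
Proof.
move=> oU oV VU /(class_CooP F oU) CF; apply/(class_CooP F oV) => j.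
exact: Coo_sub VU (CF j).
Qed.

Lemma repar_dom_open : open (chart_dom repar_chart).
Proof.
have [[oD _] _ mc _] := flag_is_chart R s.
rewrite openE => L [DL OL]; apply: filterI; first exact: open_nbhs_nbhs.
have fc := class_Coo_cts fS (I : setT (chart_map (flag_chart R s) L)).
by apply: (cts_comp (mc L DL) fc); exact: open_nbhs_nbhs.
Qed.

Lemma repar_map_param z : chart_map repar_chart (flag_param s z) = f z.
Proof. exact: (congr1 f (flag_chart_param s z)). Qed.

Lemma repar_domP L : chart_dom repar_chart L <-> exists2 v, O v & L = flag_param s (g v).
Proof.
split=> [[[z _ <-] Oz]|[v Ov ->]].
  exists (f z); last by rewrite fK.
  by rewrite -(repar_map_param z).
split; first by exists (g v).
by have := repar_map_param (g v); rewrite gK => E; rewrite /mkset -[X in O X]/(chart_map repar_chart _) E.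
Qed.

Lemma repar_is_chart : is_chart repar_chart.
Proof.
have [_ _ mc _] := flag_is_chart R s; split.
- split; first exact: repar_dom_open.
  rewrite (_ : chart_cod _ = O) //; apply/seteqP; split=> v.
    by move=> [L /repar_domP[w Ow ->] <-]; rewrite repar_map_param gK.
  move=> Ov; exists (flag_param s (g v)); last by rewrite repar_map_param gK.
  by apply/repar_domP; exists v.
- move=> L /set_mem /repar_domP[v _ ->]; rewrite repar_map_param gK //.
- move=> L [DL _]; exact: (cts_comp (mc L DL) (class_Coo_cts fS (I : setT _))).
- move=> v _; apply: (cts_comp (class_Coo_cts gS (I : setT v))).
  exact: flag_param_continuous.
Qed.

Lemma repar_smooth_chart : smooth_chart (M := M) repar_chart.
Proof.
split=> [|_ [s' _ <-]]; first exact: repar_is_chart.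
have C12 : class_Coo (chart_map (flag_chart R s) @` (chart_dom (flag_chart R s) `&` chart_dom (flag_chart R s' : chart R 6 M)))
    (transition (flag_chart R s) (flag_chart R s')) := (flag_compatible R s s').1.
have C21 : class_Coo (chart_map (flag_chart R s') @` (chart_dom (flag_chart R s) `&` chart_dom (flag_chart R s' : chart R 6 M)))
    (transition (flag_chart R s') (flag_chart R s)) := (flag_compatible R s s').2.
have [[oD _] _ _ _] := flag_is_chart R s; have [[oD' _] _ _ _] := flag_is_chart R s'.
have oU1 : open (chart_map (flag_chart R s) @` (chart_dom (flag_chart R s) `&` chart_dom (flag_chart R s' : chart R 6 M))).
  by rewrite setIC; exact: (open_chart_image (flag_is_chart R s) oD').
have oU2 : open (chart_map (flag_chart R s') @` (chart_dom (flag_chart R s) `&` chart_dom (flag_chart R s' : chart R 6 M))).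
  exact: (open_chart_image (flag_is_chart R s') oD).
have oV1 : open (chart_map repar_chart @` (chart_dom repar_chart `&` chart_dom (flag_chart R s' : chart R 6 M))).
  by rewrite setIC; exact: (open_chart_image repar_is_chart oD').
have oV2 : open (chart_map (flag_chart R s') @` (chart_dom repar_chart `&` chart_dom (flag_chart R s' : chart R 6 M))).
  exact: (open_chart_image (flag_is_chart R s') repar_dom_open).
have gS1 := class_Coo_sub openT oV1 (fun _ _ => I) gS.
have V21 : (chart_map (flag_chart R s') @` (chart_dom repar_chart `&` chart_dom (flag_chart R s' : chart R 6 M))) `<=`
    (chart_map (flag_chart R s') @` (chart_dom (flag_chart R s) `&` chart_dom (flag_chart R s' : chart R 6 M))).
  by move=> _ [L [[DL _] D'L] <-]; exists L.
have gV : forall v, (chart_map repar_chart @` (chart_dom repar_chart `&` chart_dom (flag_chart R s' : chart R 6 M))) v ->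
    (chart_map (flag_chart R s) @` (chart_dom (flag_chart R s) `&` chart_dom (flag_chart R s' : chart R 6 M))) (g v).
  by move=> _ [L [[DL OL] D'L] <-]; exists L; [split; [exact: DL|exact: D'L]|exact: (esym (fK _))].
have C21' := class_Coo_sub oU2 oV2 V21 C21.
split; first exact: (@class_Coo_comp _ _ _ _ _ (transition (flag_chart R s) (flag_chart R s')) g oV1 oU1 gV C12 gS1).
exact: (@class_Coo_comp _ _ _ _ setT f (transition (flag_chart R s') (flag_chart R s)) oV2 openT (fun _ _ => I) fS C21').
Qed.

End ReparametrizedCharts.

Section StarSets.

(** A submanifold chart must have its vanishing coordinates last, so the nonvanishing ones are moved
    to the front. *)
Lemma sort_perm (S : {set 'I_3}) : exists t : 'S_3, forall m, (t m \in S) = (m < #|S|)%N.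
Proof.
have cS : #|S| = (((0%R : 'I_3) \in S) + ((1%R : 'I_3) \in S) + ((2%R : 'I_3) \in S))%N.
  by rewrite -sum1_card big_mkcond (sum_ord3 (fun i => if i \in S then 1%N else 0%N)) /=;
    case: ((0%R : 'I_3) \in S); case: ((1%R : 'I_3) \in S); case: ((2%R : 'I_3) \in S).
have P (i k j : 'I_3) : i != k -> i != j -> k != j ->
    (i \in S) = (0 < #|S|)%N -> (k \in S) = (1 < #|S|)%N -> (j \in S) = (2 < #|S|)%N ->
    exists t : 'S_3, forall m, (t m \in S) = (m < #|S|)%N.
  move=> ik ij kj h0 h1 h2; have [t [t0 t1 t2]] := perm3_ex ik ij kj.
  by exists t; apply: ord3_ind; rewrite ?t0 ?t1 ?t2.
case S0: ((0%R : 'I_3) \in S) cS; case S1: ((1%R : 'I_3) \in S); case S2: ((2%R : 'I_3) \in S) => /= cS.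
- by apply: (P 0 1 2); rewrite // ?S0 ?S1 ?S2 cS.
- by apply: (P 0 1 2); rewrite // ?S0 ?S1 ?S2 cS.
- by apply: (P 0 2 1); rewrite // ?S0 ?S1 ?S2 cS.
- by apply: (P 0 1 2); rewrite // ?S0 ?S1 ?S2 cS.
- by apply: (P 1 2 0); rewrite // ?S0 ?S1 ?S2 cS.
- by apply: (P 1 0 2); rewrite // ?S0 ?S1 ?S2 cS.
- by apply: (P 2 0 1); rewrite // ?S0 ?S1 ?S2 cS.
- by apply: (P 0 1 2); rewrite // ?S0 ?S1 ?S2 cS.
Qed.

Lemma ccoord_tail (R : realType) (v : 'rV[R]_6) n :
  (forall j : 'I_6, (n.*2 <= j)%N -> v 0 j = 0) <-> (forall m : 'I_3, (n <= m)%N -> ccoord v m = 0).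
Proof.
split=> H m nm.
  have m6 (b : bool) : (b + m.*2 < 6)%N by case: m {nm} => -[|[|[|//]]] ?; case: b.
  apply: cplxP; rewrite /ccoord /= H // inordK; first by rewrite leq_double.
  - exact: (m6 false).
  - by rewrite (leq_trans _ (leqnSn _)) // leq_double.
  - exact: (m6 true).
rewrite -[v]ccoordK mxE.
have mh : (m./2 < 3)%N by rewrite ltn_half_double.
have -> : ccoord v (inord m./2) = 0.
  by apply: H; rewrite inordK // geq_half_double.
by case: ifP.
Qed.

End StarSets.

(** The case of the main stratum. In chart coordinates a, b, d the products p_i q_i are a d - b, -a
    d and b. Given a, d and all c_i nonzero, proportionality to c is the single equation b = -(c_2 /
    c_1) a d, and the other nonvanishing conditions follow from it. *)
Lemma slope_matches (K : fieldType) (a b d : K) (c : 'I_3 -> K) :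
  c 0 = - c 1 - c 2 -> c 0 != 0 -> c 1 != 0 -> c 2 != 0 ->
  [/\ (a != 0) = true, (b != 0) = true, (a * d - b != 0) = true & (d != 0) = true] /\
    (forall i j : 'I_3, [:: a * d - b; - (a * d); b]`_i * c j = [:: a * d - b; - (a * d); b]`_j * c i) <->
  [/\ (a != 0) = true, (b - - (c 2 / c 1) * a * d != 0) = false & (d != 0) = true].
Proof.
move=> cs c0 c1 c2; split=> [[[h0 h1 h2 h3] m]|[h0 h1 h3]].
  split=> //; apply/negbTE; rewrite negbK subr_eq0; apply/eqP/(mulIf c1).
  by have := m 1 2 => /= E; rewrite -E; field.
have b0 : b = - (c 2 / c 1) * a * d by apply/eqP; rewrite -subr_eq0 -[_ == 0]negbK h1.
have l0 : - (a * d / c 1) != 0 by rewrite oppr_eq0 !mulf_neq0 ?invr_eq0 ?h0 ?h3.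
have E (i : 'I_3) : [:: a * d - b; - (a * d); b]`_i = - (a * d / c 1) * c i.
  by elim/ord3_ind: i; rewrite /= ?b0 ?cs; field.
have := E 0; have := E 2; rewrite /= => E2 E0.
split; last by move=> i j; rewrite !E; ring.
by split=> //; [rewrite E2 mulf_neq0|rewrite E0 mulf_neq0].
Qed.

Section Leaves.
Variable R : realType.
Local Notation C := (Cplx R).
Local Notation M := (flag_manifold R).
Local Notation mu := (@flag_moment_map R).
Local Notation theta := (@T2_action R).
Local Notation atlas := (@flag_atlas R).
Local Notation stratum := (@stratum R M atlas).
Local Notation admissible := (@admissible R M atlas).

(** Such a chart contains the whole stratum. Taking both distinguished indices in the intersection,
    if there is one, leaves only the position of the third index to discuss. *)
Lemma leaf_perm_ex A B : good A B -> exists p : 'S_3, [/\ p 0 \in A, p 2 \in B &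
  A :&: B != finset.set0 -> p 0 \in A :&: B /\ p 2 \in A :&: B].
Proof.
move=> gAB; suff [a [b [aA bB ab ABE]]] : exists a b : 'I_3, [/\ a \in A, b \in B, a != b &
    A :&: B != finset.set0 -> a \in A :&: B /\ b \in A :&: B].
  have [k [ka kb]] := third_ex a b; rewrite eq_sym in ka.
  by have [t [t0 _ t2]] := perm3_ex ka ab kb; exists t; rewrite t0 t2.
have [D0|/finset.set0Pn[a aD]] := eqVneq (A :&: B) finset.set0.
  have /and3P[/finset.set0Pn[a aA] _ _] := gAB; have [b bB ba] := good_other gAB aA.
  by exists a, b; rewrite eq_sym; split.
have [b [bA bB ba]] := good_two gAB aD; exists a, b; rewrite eq_sym.
by move: (aD); rewrite finset.in_setI => /andP[aA aB]; split=> //; rewrite !inE aA aB bA bB.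
Qed.

Variables (s : idx) (c : par_space R s) (p : 'S_3).
Hypothesis sA : admissible s.
Local Notation A := (firsts s).
Local Notation B := (lasts s).
Local Notation D := (firsts s :&: lasts s).
Local Notation k := (set_val c : CP R 1).
Hypotheses (pA : p 0 \in A) (pB : p 2 \in B) (pD : D != finset.set0 -> p 0 \in D /\ p 2 \in D).
Implicit Types (z : 'I_3 -> C) (L : M).

(** The coordinates that are nonzero on the leaf once the shear is undone. The middle one survives
    only if the supports share exactly [p 0] and [p 2]: for disjoint supports it vanishes, and on
    the main stratum the shear removes it. *)
Definition star : {set 'I_3} :=
  [set l : 'I_3 | [:: p 1 \in A; (D != finset.set0) && (p 1 \notin D); p 1 \in B]`_l]%SET.

(** On the main stratum the leaf of c is given by z_1 = [slope] z_0 z_2; on the other strata no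
    shear is applied. *)
Definition slope : C := if p 1 \in D then - (CPvec k 0 (p 2) / CPvec k 0 (p 1)) else 0.

Definition shear z (l : 'I_3) : C := [:: z 0; z 1 + slope * z 0 * z 2; z 2]`_l.
Definition unshear z (l : 'I_3) : C := [:: z 0; z 1 - slope * z 0 * z 2; z 2]`_l.

Lemma shearK z : unshear (shear z) =1 z.
Proof. by apply: ord3_ind; rewrite /unshear /shear //=; ring. Qed.

Lemma unshearK z : shear (unshear z) =1 z.
Proof. by apply: ord3_ind; rewrite /unshear /shear //=; ring. Qed.

Lemma leaf_gs : good A B /\ s = idx_of A B.
Proof. exact: admissible_good sA. Qed.

Lemma leaf_fits : fits A B k.
Proof. by apply: par_fits => //; exact: par_spaceP. Qed.

Lemma param_stratum (v : 'rV[R]_6) : stratum s (flag_param p v) <->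
  [/\ (ccoord v 0 != 0) = (p 1 \in A), (ccoord v 1 != 0) = (p 2 \in A),
      (ccoord v 0 * ccoord v 2 - ccoord v 1 != 0) = (p 0 \in B) & (ccoord v 2 != 0) = (p 1 \in B)].
Proof.
have [gs sE] := leaf_gs; rewrite {1}sE stratum_idx_of //.
have [-> ->] := supp_pair (flag_param_pair p v); split.
  move=> [/setP eA /setP eB].
  have := eA (p 1); have := eA (p 2); have := eB (p 0); have := eB (p 1).
  by rewrite !inE !pqvecE oppr_eq0.
move=> [h1 h2 h3 h4]; split; apply/setP; apply: (@perm3_ind p); rewrite inE !pqvecE ?oner_eq0 ?oppr_eq0 //=.
Qed.

(** Three cases. For disjoint supports every class matches, and b and a d vanish. For two common
    indices the class is unique on the stratum, and a d = 0. For three, [slope_matches] applies. *)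
Lemma param_leaf (v : 'rV[R]_6) : leaf (D := par_data R) (s := s) c (flag_param p v) <->
  forall l, (unshear (ccoord v) l != 0) = (l \in star).
Proof.
have [gs sE] := leaf_gs; have f := leaf_fits; rewrite leafP.
have S0 : (0 \in star) = (p 1 \in A) by rewrite inE.
have S1 : (1 \in star) = (D != finset.set0) && (p 1 \notin D) by rewrite inE.
have S2 : (2 \in star) = (p 1 \in B) by rewrite inE.
set a := ccoord v 0; set b := ccoord v 1; set d := ccoord v 2.
have U0 : unshear (ccoord v) 0 = a by [].
have U1 : unshear (ccoord v) 1 = b - slope * a * d by [].
have U2 : unshear (ccoord v) 2 = d by [].
have -> : (forall l, (unshear (ccoord v) l != 0) = (l \in star)) <->
    [/\ (a != 0) = (p 1 \in A), (b - slope * a * d != 0) = (D != finset.set0) && (p 1 \notin D) &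
        (d != 0) = (p 1 \in B)].
  split=> [H|[h0 h1 h2]]; last by apply: ord3_ind; rewrite ?U0 ?U1 ?U2 ?S0 ?S1 ?S2.
  by have := H 0; have := H 1; have := H 2; rewrite U0 U1 U2 S0 S1 S2.
rewrite (param_stratum v) -/a -/b -/d.
have adz : p 1 \notin D -> (a != 0) = (p 1 \in A) -> (d != 0) = (p 1 \in B) -> a * d = 0.
  rewrite finset.in_setI => nD ha hd; apply/eqP; rewrite mulf_eq0 -[_ || _]negbK negb_or ha hd.
  exact: nD.
have [D0|D0] := eqVneq D finset.set0.
  have p1D : p 1 \notin D by rewrite D0 inE.
  have p2A : p 2 \in A = false.
    by apply/negP => p2A; move/setP/(_ (p 2)): D0; rewrite !inE p2A pB.
  have p0B : p 0 \in B = false.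
    by apply/negP => p0B; move/setP/(_ (p 0)): D0; rewrite !inE p0B pA.
  rewrite /slope (negbTE p1D) !mul0r subr0 p2A p0B; split=> [[[h0 h1 h2 h3] _]|[h0 h1 h3]] //.
  have b0 : b = 0 by apply/eqP/negPn; rewrite h1.
  have st : stratum s (flag_param p v).
    apply/param_stratum; rewrite -/a -/b -/d p2A p0B; split=> //.
    by rewrite b0 subr0 adz // eqxx.
  split; first by split=> //; rewrite b0 subr0 adz // eqxx.
  by apply: disjoint_matches; have [<- <-] := stratum_supp st.
have [p0D p2D] := pD D0; move: (p0D) (p2D); rewrite !finset.in_setI => /andP[_ p0B] /andP[p2A _].
have [p1D|p1D] := boolP (p 1 \in D); last first.
  have pe : ~~ ((p 1 \in A) && (p 1 \in B)) by rewrite -finset.in_setI.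
  rewrite /slope (negbTE p1D) !mul0r subr0 p2A p0B pe /=; split=> [[[h0 h1 h2 h3] _]|[h0 h1 h3]] //.
  have st : stratum s (flag_param p v).
    apply/param_stratum; rewrite -/a -/b -/d p2A p0B; split=> //.
    by rewrite adz // sub0r oppr_eq0.
  split; first by split=> //; rewrite adz // sub0r oppr_eq0.
  rewrite (_ : k = flag_class (flag_param p v)); first exact: flag_classP.
  apply: (@fits_uniq _ A B) => //; first by exists (p 1).
  exact: stratum_fits st (flag_classP _).
have cn l : CPvec k 0 (p l) != 0.
  rewrite (f D0); have : p l = p 0 \/ p l = p 1 \/ p l = p 2 by elim/ord3_ind: l; tauto.
  by case=> [->|[->|->]].
move: (p1D); rewrite finset.in_setI => /andP[p1A p1B].
rewrite /slope p1D p2A p0B p1A p1B /=.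
have cs : CPvec k 0 (p 0) = - CPvec k 0 (p 1) - CPvec k 0 (p 2).
  have := sum_CPvec k; rewrite (sum_perm3 p) => e.
  by apply/eqP; rewrite -subr_eq0 -[X in _ == X]e; apply/eqP; ring.
have mP : CP_matches (flag_param p v) k <->
    forall l l' : 'I_3, [:: a * d - b; - (a * d); b]`_l * CPvec k 0 (p l') =
      [:: a * d - b; - (a * d); b]`_l' * CPvec k 0 (p l).
  have pq l : pvec p v 0 (p l) * qvec p v 0 (p l) = [:: a * d - b; - (a * d); b]`_l.
    by elim/ord3_ind: l; rewrite !pqvecE ?mul1r ?mulr1 ?mulrN.
  apply: (iff_trans (flag_matchesP (CPvec k) (flag_param_pair p v))).
  split=> [m l l'|m i j]; first by rewrite -!pq.
  by rewrite -(permKV p i) -(permKV p j) !pq.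
apply: (iff_trans (and_iff_compat_l _ mP)).
exact: (@slope_matches _ a b d (fun l => CPvec k 0 (p l)) cs (cn 0) (cn 1) (cn 2)).
Qed.

Definition straighten (t : 'S_3) (v : 'rV[R]_6) : 'rV[R]_6 :=
  rcoord (fun m => unshear (ccoord v) (t m)).
Definition unstraighten (t : 'S_3) (v : 'rV[R]_6) : 'rV[R]_6 :=
  rcoord (shear (fun l => ccoord v ((t^-1)%g l))).

Lemma unshear_ext z z' : z =1 z' -> unshear z =1 unshear z'.
Proof. by move=> E l; rewrite /unshear !E. Qed.

Lemma shear_ext z z' : z =1 z' -> shear z =1 shear z'.
Proof. by move=> E l; rewrite /shear !E. Qed.

Lemma straightenK t : cancel (straighten t) (unstraighten t).
Proof.
move=> v; apply: ccoord_inj => l; rewrite rcoordK -[RHS]unshearK.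
by apply: shear_ext => m; rewrite rcoordK permKV.
Qed.

Lemma unstraightenK t : cancel (unstraighten t) (straighten t).
Proof.
move=> v; apply: ccoord_inj => m; rewrite rcoordK.
rewrite (unshear_ext (rcoordK (shear (fun l => ccoord v ((t^-1)%g l))))) shearK.
by rewrite permK.
Qed.

Lemma CooC_ccoord l (U : set 'rV[R]_6) : CooC U (fun v => ccoord v l).
Proof. by apply: CooC_mk; exact: Coo_coord. Qed.

Lemma CooC_unshear n (U : set 'rV[R]_n) (F : 'rV[R]_n -> 'I_3 -> C) l : open U ->
  (forall m, CooC U (fun x => F x m)) -> CooC U (fun x => unshear (F x) l).
Proof.
move=> oU CF; elim/ord3_ind: l; rewrite /unshear /=; [exact: CF| |exact: CF].
by apply: CooCB => //; apply: CooCM => //; apply: CooCM => //; exact: CooC_cst.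
Qed.

Lemma CooC_shear n (U : set 'rV[R]_n) (F : 'rV[R]_n -> 'I_3 -> C) l : open U ->
  (forall m, CooC U (fun x => F x m)) -> CooC U (fun x => shear (F x) l).
Proof.
move=> oU CF; elim/ord3_ind: l; rewrite /shear /=; [exact: CF| |exact: CF].
by apply: CooCD => //; apply: CooCM => //; apply: CooCM => //; exact: CooC_cst.
Qed.

Lemma straighten_smooth t : class_Coo setT (straighten t).
Proof.
apply: Coo_rcoord => [|m]; first exact: openT.
by apply: CooC_unshear => [|l]; [exact: openT|exact: CooC_ccoord].
Qed.

Lemma unstraighten_smooth t : class_Coo setT (unstraighten t).
Proof.
apply: Coo_rcoord => [|m]; first exact: openT.
by apply: CooC_shear => [|l]; [exact: openT|exact: CooC_ccoord].
Qed.

Lemma leaf_dom L : leaf (D := par_data R) (s := s) c L -> exists v, L = flag_param p v.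
Proof.
move=> /leafP[/stratum_supp[AE BE] _].
have [v _ vL] : chart_dom (flag_chart R p) L.
  by rewrite flag_domE; split; [move: pA|move: pB]; rewrite ?AE ?BE inE.
by exists v.
Qed.

Lemma leaf_submanifold : smooth_submanifold (M := M) (leaf (D := par_data R) (s := s) c).
Proof.
have [t tS] := sort_perm star.
(* After sorting, the nonvanishing coordinates are the first [#|star|] ones. *)
pose O := [set v : 'rV[R]_6 | forall m : 'I_3, (m < #|star|)%N -> ccoord v m != 0].
have oO : open O.
  rewrite openE => v Ov.
  suff H (m : 'I_3) : nbhs v [set w : 'rV[R]_6 | (m < #|star|)%N -> ccoord w m != 0].
    by have := @filter_forall _ _ _ _ (nbhs_filter v) H; apply: filterS => w.
  have [mS|mS] := boolP (m < #|star|)%N; last first.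
    by apply: (filterS _ (@filterT _ (nbhs v) _)) => w _.
  have oc : open [set w : 'rV[R]_6 | ccoord w m != 0] by apply: open_neq0C; exact: CooC_ccoord.
  by apply: filterS (open_nbhs_nbhs (conj oc (Ov m mS))) => w cw _.
have e6 : (#|star|.*2 <= 6)%N by rewrite (leq_double _ 3) (leq_trans (max_card _)) // card_ord.
exists #|star|.*2 => // L lL; have [v LE] := leaf_dom lL.
have fK := straightenK t; have gK := unstraightenK t.
exists (repar_chart p (straighten t) (unstraighten t) O); split.
- by apply: repar_smooth_chart => //; [exact: straighten_smooth|exact: unstraighten_smooth].
- apply: (proj2 (repar_domP p O fK gK L)); exists (straighten t v); last by rewrite fK.
  move=> m mS; rewrite rcoordK; rewrite LE in lL.
  by move/param_leaf: lL => ->; rewrite tS.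
move=> y /(proj1 (repar_domP p O fK gK y))[w Ow ->]; rewrite repar_map_param gK.
rewrite (param_leaf _) (ccoord_tail w #|star|).
have E m : ccoord w m = unshear (ccoord (unstraighten t w)) (t m).
  by rewrite -{1}[w]gK rcoordK.
split=> [H m nm|H l]; first by apply/eqP/negPn; rewrite E H tS -leqNgt.
rewrite -(permKV t l) -E tS; have [mS|mS] := ltnP; first by rewrite Ow.
by rewrite H ?eqxx.
Qed.

End Leaves.

(** * Moduli as functions of the moment *)

Section Radius.
Variables (R : realType) (A B : {set 'I_3}) (d : 'I_3 -> R).
Hypothesis d_ge0 : forall m, 0 <= d m.
Hypothesis d_supp : A :&: B != finset.set0 -> forall m, (0 < d m) = (m \in A :&: B).
Implicit Types (x : 'rV[R]_3) (m : 'I_3).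

(* On the open cell of [A], [B] this is [|x_m|] outside [A :&: B]. *)
Definition bent x m : R := if m \in A :&: B then x 0 m else side R A B m * x 0 m.

(** The root r of the overview as a function on R^3. Replacing |x_m| by the linear [bent] outside
    [A :&: B] gives an equation whose solution is smooth off the cell too, as local extendability
    demands. *)
Definition radius x : R := xget 0 [set r | 0 <= r /\ radial_sum (bent x) d r = 2].

(** An open neighbourhood in R^3 of the cell, whatever the dimension of the cell. For an index
    outside both supports [bent] is identically 0, so nothing is required there. *)
Definition cell_nbhd : set 'rV[R]_3 := [set x |
  (A :&: B != finset.set0 -> \sum_m `|bent x m| < 2) /\
  forall m, m \notin A :&: B -> m \in A :|: B -> 0 < bent x m].

Lemma Coo_bent (U : set 'rV[R]_3) m : open U -> Coo U (fun x => bent x m).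
Proof.
move=> oU; rewrite /bent; case: (m \in A :&: B); first exact: Coo_coord.
by apply: CooM => //; [exact: Coo_cst|exact: Coo_coord].
Qed.

Lemma cts_bent m x : {for x, continuous (fun y => bent y m)}.
Proof. exact: (Coo_continuous (Coo_bent m openT) (I : setT x)). Qed.

Lemma cts_near_lt (T : topologicalType) (f : T -> R) (x : T) (a : R) :
  {for x, continuous f} -> f x < a -> \forall y \near x, f y < a.
Proof.
move=> fc fa; apply: (fc [set z | z < a]).
by apply: open_nbhs_nbhs; split=> //; exact: open_lt.
Qed.

Lemma cts_near_gt (T : topologicalType) (f : T -> R) (x : T) (a : R) :
  {for x, continuous f} -> a < f x -> \forall y \near x, a < f y.
Proof.
move=> fc fa; apply: (fc [set z | a < z]).
by apply: open_nbhs_nbhs; split=> //; exact: open_gt.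
Qed.

Lemma cts_bent_sum x : {for x, continuous (fun y => \sum_m `|bent y m|)}.
Proof. by apply: cts_sum => m _; apply: cts_norm; exact: cts_bent. Qed.

Lemma open_cell_nbhd : open cell_nbhd.
Proof.
rewrite openE => x [x2 xp]; apply: filterI.
  have [D0|D0] := boolP (A :&: B != finset.set0); last first.
    by apply: (filterS _ (@filterT _ (nbhs x) _)) => w _.
  exact: filterS (cts_near_lt (@cts_bent_sum x) (x2 D0)) => w wx _.
suff H m : nbhs x [set w | m \notin A :&: B -> m \in A :|: B -> 0 < bent w m].
  by have := @filter_forall _ _ _ _ (nbhs_filter x) H; apply: filterS => w.
have [mD|mD] := boolP (m \in A :&: B).
  by apply: (filterS _ (@filterT _ (nbhs x) _)) => w _.
have [mU|mU] := boolP (m \in A :|: B); last first.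
  by apply: (filterS _ (@filterT _ (nbhs x) _)) => w _.
by apply: filterS (cts_near_gt (@cts_bent m x) (xp m mD mU)) => w wx _ _.
Qed.

Lemma d_ex : A :&: B != finset.set0 -> exists m, 0 < d m.
Proof. by move=> D0; have /finset.set0Pn[m mD] := D0; exists m; rewrite d_supp. Qed.

Lemma radiusP x : A :&: B != finset.set0 -> \sum_m `|bent x m| < 2 ->
  0 < radius x /\ radial_sum (bent x) d (radius x) = 2.
Proof.
move=> D0 x2; have [r r0 rE] := radial_ex d_ge0 (d_ex D0) (ltW x2).
have [r0' rE'] : [set r | 0 <= r /\ radial_sum (bent x) d r = 2] (radius x).
  by apply: (@xgetPex _ 0 [set r | 0 <= r /\ radial_sum (bent x) d r = 2]); exists r.
split=> //; rewrite lt_neqAle r0' andbT; apply/eqP => r0''.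
by move: x2; rewrite -(radial_sum0 (bent x) d) r0'' rE' ltxx.
Qed.

Lemma radius_uniq x r : A :&: B != finset.set0 -> \sum_m `|bent x m| < 2 ->
  0 <= r -> radial_sum (bent x) d r = 2 -> r = radius x.
Proof.
move=> D0 x2 r0 rE; have [rp rE'] := radiusP D0 x2.
exact: (radial_sum_inj d_ge0 (d_ex D0) r0 (ltW rp) (etrans rE (esym rE'))).
Qed.

Lemma cts_radial_sum x r : {for x, continuous (fun y => radial_sum (bent y) d r)}.
Proof.
apply: cts_sum => m _; apply: cts_sqrt; apply: ctsD; last exact: cts_cst.
exact: (ctsM (@cts_bent m x) (@cts_bent m x)).
Qed.

(** The radial sum increases with r, so it is above 2 at r + e and, if r - e > 0, below 2 at r - e.
    Both inequalities persist near [x] and trap the root. *)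
Lemma radius_continuous x : A :&: B != finset.set0 -> \sum_m `|bent x m| < 2 ->
  {for x, continuous radius}.
Proof.
move=> D0 x2; have [rp rE] := radiusP D0 x2; have dx := d_ex D0.
have near2 := cts_near_lt (@cts_bent_sum x) x2.
move=> P /nbhs_ballP[e /= e0 eP].
have up : \forall y \near x, 2 < radial_sum (bent y) d (radius x + e).
  apply: cts_near_gt; first exact: cts_radial_sum.
  by rewrite -rE radial_sum_lt ?ltrDl // ltW.
have low : \forall y \near x, radius x - e < radius y.
  have [re|re] := leP (radius x - e) 0.
    apply: filterS near2 => y y2; apply: (le_lt_trans re).
    by have [] := radiusP D0 y2.
  have : \forall y \near x, radial_sum (bent y) d (radius x - e) < 2.
    apply: cts_near_lt; first exact: cts_radial_sum.
    by rewrite -rE radial_sum_lt ?ltrBlDr ?ltrDl // ltW.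
  apply: filterS2 near2 => y y2 ys; have [yp yE] := radiusP D0 y2.
  rewrite ltNge; apply/negP; rewrite le_eqVlt => /orP[/eqP yr|yr].
    by move: ys; rewrite -yr yE ltxx.
  by move: ys; rewrite -yE => /(lt_trans (radial_sum_lt (bent y) d_ge0 dx (ltW yp) yr)); rewrite ltxx.
apply: filterS3 near2 up low => y y2 yu yl; apply: eP; rewrite /ball /=; have [yp yE] := radiusP D0 y2.
rewrite ltr_distlC yl /= ltNge; apply/negP; rewrite le_eqVlt => /orP[/eqP yr|yr].
  by move: yu; rewrite yr yE ltxx.
have re0 : 0 <= radius x + e by rewrite addr_ge0 // ltW.
by move: yu; rewrite -yE => /(lt_trans (radial_sum_lt (bent y) d_ge0 dx re0 yr)); rewrite ltxx.
Qed.

Lemma bent_ge0 x m : cell_nbhd x -> m \notin A :&: B -> 0 <= bent x m.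
Proof.
move=> [_ xp] mD; have [mU|mU] := boolP (m \in A :|: B); first by rewrite ltW ?xp.
rewrite /bent (negbTE mD) /side; move: mU; rewrite finset.in_setU negb_or => /andP[/negbTE-> /negbTE->].
by rewrite subrr mul0r.
Qed.

(** Outside [A :&: B] the numbers [d m] vanish and the roots reduce to the linear [bent x m]. Moved
    to the right-hand side, these leave an equation with positive [d] only, to which
    [Coo_implicit_sqrt] applies. *)
Lemma radius_smooth : A :&: B != finset.set0 -> Coo cell_nbhd radius.
Proof.
move=> D0; have o := open_cell_nbhd.
have inD (i : 'I_#|A :&: B|) : enum_val i \in A :&: B := enum_valP i.
apply: (@Coo_implicit_sqrt R 3 cell_nbhd #|A :&: B| (fun i x => x 0 (enum_val i))
  (fun x => 2 - \sum_(m | m \notin A :&: B) side R A B m * x 0 m) (fun i => d (enum_val i)) radius o).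
- move=> i; exists (delta_mx (enum_val i) 0) => x; rewrite mxE (bigD1 (enum_val i)) //= mxE !eqxx mulr1.
  by rewrite big1 ?addr0 // => j /negbTE ji; rewrite mxE ji mulr0.
- exists 2, (- \col_m (if m \notin A :&: B then side R A B m else 0)) => x.
  rewrite mulmxN [in RHS]mxE mxE; congr (_ - _).
  rewrite big_mkcond; apply: eq_bigr => m _; rewrite mxE; case: ifP => _; last by rewrite mulr0.
  by rewrite mulrC.
- by move=> i; rewrite d_supp.
- by rewrite card_gt0.
- by move=> x [x2 _]; have [] := radiusP D0 (x2 D0).
- by move=> x [x2 _]; exact: radius_continuous (x2 D0).
move=> x xV; have [x2 _] := xV; have [rp rE] := radiusP D0 (x2 D0).
rewrite -{1}rE /radial_sum (bigID (fun m => m \in A :&: B)) /=.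
rewrite -(big_enum_val (fun m => Num.sqrt (x 0 m ^+ 2 + 4 * radius x * d m))) /= -addrA.
rewrite (_ : (\sum_(m | _) _) - _ = 0).
  by rewrite addr0; apply: eq_bigr => m mD; rewrite /bent mD.
apply/eqP; rewrite subr_eq0; apply/eqP; apply: eq_bigr => m mD.
have dm : d m = 0 by apply/eqP; rewrite eq_le d_ge0 andbT leNgt d_supp // mD.
rewrite dm mulr0 addr0 sqrtr_sqr ger0_norm; first by rewrite /bent (negbTE mD).
exact: bent_ge0.
Qed.

(** The sum u_m + w_m of the two weights. Outside [A :&: B] one of them vanishes and no root is
    taken. *)
Definition root_sum x m : R :=
  if m \in A :&: B then Num.sqrt (x 0 m ^+ 2 + 4 * radius x * d m) else bent x m.
Definition p_weight x m : R := (root_sum x m + x 0 m) / 2.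
Definition q_weight x m : R := (root_sum x m - x 0 m) / 2.

Lemma diag_neq0 m : m \in A :&: B -> A :&: B != finset.set0.
Proof. by move=> mD; apply/finset.set0Pn; exists m. Qed.

Lemma root_gt x m : cell_nbhd x -> m \in A :&: B -> `|x 0 m| < root_sum x m.
Proof.
move=> [x2 _] mD; have D0 := diag_neq0 mD; have [rp _] := radiusP D0 (x2 D0).
rewrite /root_sum mD -sqrtr_sqr ltr_sqrt.
  by rewrite ltrDl !mulr_gt0 ?d_supp.
by rewrite ltr_wpDl ?sqr_ge0 // !mulr_gt0 ?d_supp.
Qed.

Lemma p_weight_gt0 x m : cell_nbhd x -> m \in A -> 0 < p_weight x m.
Proof.
move=> xV mA; rewrite divr_gt0 //; have [mD|mD] := boolP (m \in A :&: B).
  by have := root_gt xV mD; rewrite ltr_norml => /andP[h _]; rewrite -ltrBlDr sub0r ltrNl.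
have mB : m \in B = false by apply/negbTE; move: mD; rewrite finset.in_setI mA.
have : 0 < bent x m by apply: xV.2 => //; rewrite finset.in_setU mA.
rewrite /root_sum /bent (negbTE mD) /side mA mB subr0 mul1r => h; exact: addr_gt0.
Qed.

Lemma q_weight_gt0 x m : cell_nbhd x -> m \in B -> 0 < q_weight x m.
Proof.
move=> xV mB; rewrite divr_gt0 //; have [mD|mD] := boolP (m \in A :&: B).
  by have := root_gt xV mD; rewrite ltr_norml subr_gt0 => /andP[_ h].
have mA : m \in A = false by apply/negbTE; move: mD; rewrite finset.in_setI mB andbT.
have : 0 < bent x m by apply: xV.2 => //; rewrite finset.in_setU mB orbT.
rewrite /root_sum /bent (negbTE mD) /side mA mB sub0r mulN1r => h; exact: addr_gt0.
Qed.

Lemma Coo_root_sum m : Coo cell_nbhd (fun x => root_sum x m).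
Proof.
have o := open_cell_nbhd; have [mD|mD] := boolP (m \in A :&: B); last first.
  by apply: Coo_near (Coo_bent m o) => // x _; rewrite /root_sum (negbTE mD).
have D0 := diag_neq0 mD.
have pos x : cell_nbhd x -> 0 < x 0 m * x 0 m + 4 * radius x * d m.
  move=> [x2 _]; have [rp _] := radiusP D0 (x2 D0).
  by rewrite ltr_wpDl -?expr2 ?sqr_ge0 // !mulr_gt0 ?d_supp.
apply: (@Coo_near _ _ _ (fun x => Num.sqrt (x 0 m * x 0 m + 4 * radius x * d m))) => //.
  by move=> x _; rewrite /root_sum mD expr2.
apply: Coo_sqrt => //; apply: CooD => //; first by apply: CooM => //; exact: Coo_coord.
apply: CooM => //; last exact: Coo_cst.
by apply: CooM => //; [exact: Coo_cst|exact: radius_smooth].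
Qed.

Lemma Coo_p_weight m : Coo cell_nbhd (fun x => p_weight x m).
Proof.
have o := open_cell_nbhd; apply: CooM => //; last exact: Coo_cst.
by apply: CooD => //; [exact: Coo_root_sum|exact: Coo_coord].
Qed.

Lemma Coo_q_weight m : Coo cell_nbhd (fun x => q_weight x m).
Proof.
have o := open_cell_nbhd; apply: CooM => //; last exact: Coo_cst.
by apply: CooB => //; [exact: Coo_root_sum|exact: Coo_coord].
Qed.

Lemma bent_cell (y : 'rV[R]_2) m : open_cell A B (plane_x y) ->
  `|bent (\row_j plane_x y j) m| = `|plane_x y m|.
Proof.
move=> [_ _ y0 _]; rewrite /bent mxE; case: ifP => // /negbT mD; rewrite /side.
move: mD; rewrite finset.in_setI; have := y0 m.
case: (m \in A); case: (m \in B) => //= h _.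
- by rewrite subr0 mul1r.
- by rewrite sub0r mulN1r normrN.
- by rewrite h // mulr0.
Qed.

Lemma cell_nbhdP (y : 'rV[R]_2) : open_cell A B (plane_x y) -> cell_nbhd (\row_j plane_x y j).
Proof.
move=> yc; have [yA yB _ y2] := yc; split=> [D0|m mD mU].
  by rewrite (eq_bigr _ (fun m _ => bent_cell m yc)); move: y2; rewrite (negbTE D0).
rewrite /bent (negbTE mD) mxE /side; move: mD mU; rewrite finset.in_setI finset.in_setU.
case mA: (m \in A) => /=.
  by move=> mB _; rewrite (negbTE mB) subr0 mul1r yA.
by move=> _ mB; rewrite mB sub0r mulN1r oppr_gt0 yB ?mA.
Qed.

End Radius.

(** * Phases on the leaves *)

Section BundleCharts.
Variable R : realType.
Local Notation C := (Cplx R).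
Local Notation M := (flag_manifold R).
Local Notation mu := (@flag_moment_map R).
Local Notation atlas := (@flag_atlas R).
Local Notation stratum := (@stratum R M atlas).
Local Notation admissible := (@admissible R M atlas).
Local Notation sigma := (@sigma_polytope R 2 M mu atlas).

Lemma open_preim_on (X Y : topologicalType) (U : set X) (f : X -> Y) (W : set Y) : open U -> open W ->
  (forall x, U x -> {for x, continuous f}) -> open (U `&` f @^-1` W).
Proof.
move=> oU oW fc; rewrite openE => x [Ux Wx]; apply: filterI.
  exact: open_nbhs_nbhs.
by apply: (fc x Ux W); exact: open_nbhs_nbhs.
Qed.

Definition real_mk (a : R) : C := mkC a 0.

Lemma normsq_real (a : R) : normsq (real_mk a) = a ^+ 2.
Proof. by rewrite /normsq /= expr0n /= addr0. Qed.

Lemma real_mk_eq0 (a : R) : (real_mk a == 0) = (a == 0).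
Proof. by rewrite -normsq_eq0 normsq_real sqrf_eq0. Qed.

Lemma real_mkM (a b : R) : real_mk a * real_mk b = real_mk (a * b).
Proof. by apply: cplxP; rewrite ?cReM ?cImM /=; ring. Qed.

(** The value 1 at 0 makes every phase a unit complex number, so that [phases] always lands in the
    torus. *)
Definition phase (z : C) : C := if z == 0 then 1 else real_mk (Num.sqrt (normsq z))^-1 * z.

Lemma normsq_phase z : normsq (phase z) = 1.
Proof.
rewrite /phase; have [_|z0] := eqVneq z 0; first exact: normsq1.
have n0 : 0 < normsq z by rewrite normsq_gt0.
by rewrite normsqM normsq_real exprVn sqr_sqrtr ?ltW // mulVf // gt_eqF.
Qed.

Lemma phaseK z : z != 0 -> real_mk (Num.sqrt (normsq z)) * phase z = z.
Proof.
move=> z0; rewrite /phase (negbTE z0) mulrA real_mkM divff ?mul1r //.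
by rewrite gt_eqF // sqrtr_gt0 normsq_gt0.
Qed.

Lemma phase_scale (a : R) z : 0 < a -> normsq z = 1 -> phase (real_mk a * z) = z.
Proof.
move=> a0 nz; have a0' : a != 0 by rewrite gt_eqF.
have z0 : z != 0 by rewrite -normsq_gt0 nz.
rewrite /phase mulf_eq0 real_mk_eq0 (negbTE z0) (negbTE a0') /= normsqM nz mulr1 normsq_real.
by rewrite sqrtr_sqr ger0_norm ?ltW // mulrA real_mkM mulVf // mul1r.
Qed.

Lemma CooC_phase n (U : set 'rV[R]_n) (F : 'rV[R]_n -> C) : open U ->
  (forall x, U x -> F x != 0) -> CooC U F -> CooC U (fun x => phase (F x)).
Proof.
move=> oU F0 CF; have n0 x : U x -> 0 < normsq (F x) by move=> Ux; rewrite normsq_gt0 F0.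
apply: (@CooC_near _ _ _ oU (fun x => real_mk (Num.sqrt (normsq (F x)))^-1 * F x)).
  by move=> x Ux; rewrite /phase (negbTE (F0 x Ux)).
apply: CooCM => //; apply: CooC_mk; last exact: Coo_cst.
apply: CooV => // [x Ux|]; first by rewrite gt_eqF // sqrtr_gt0 n0.
apply: Coo_sqrt => //; exact: Coo_normsq.
Qed.

Variables (s : idx) (c : par_space R s) (p : 'S_3).
Hypothesis sA : admissible s.
Local Notation A := (firsts s).
Local Notation B := (lasts s).
Local Notation D := (firsts s :&: lasts s).
Local Notation k := (set_val c : CP R 1).
Hypotheses (pA : p 0 \in A) (pB : p 2 \in B) (pD : D != finset.set0 -> p 0 \in D /\ p 2 \in D).
Local Notation St := (star s p).
Local Notation shr := (shear c p).
Local Notation ushr := (unshear c p).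
Local Notation Lf := (leaf (D := par_data R) (s := s) c).
Implicit Types (z : 'I_3 -> C) (L : M) (x : 'rV[R]_3) (y : 'rV[R]_2) (l : 'I_3).

Definition star_elt : 'I_#|St| -> 'I_3 := locked (fun m => enum_val m).

Lemma star_elt_inj : injective star_elt.
Proof. by rewrite /star_elt -lock; exact: enum_val_inj. Qed.

Lemma star_elt_in m : star_elt m \in St.
Proof. by rewrite /star_elt -lock; exact: enum_valP. Qed.

Lemma star_elt_ex l : l \in St -> exists m, star_elt m = l.
Proof.
by move=> lS; exists (enum_rank_in lS l); rewrite /star_elt -lock enum_rankK_in.
Qed.

(* The [l]-th phase, or 0 when the coordinate [l] vanishes on the leaf. *)
Definition comp (w : 'rV[R]_(#|St| + #|St|)) l : C :=
  \sum_(m < #|St|) if star_elt m == l then mkC (w 0 (lshift _ m)) (w 0 (rshift _ m)) else 0.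

Lemma comp_elt w m : comp w (star_elt m) = mkC (w 0 (lshift _ m)) (w 0 (rshift _ m)).
Proof.
rewrite /comp (bigD1 m) //= eqxx big1 ?addr0 // => m' mm'.
by rewrite (inj_eq star_elt_inj) (negbTE mm').
Qed.

Lemma comp_off w l : l \notin St -> comp w l = 0.
Proof.
move=> lS; apply: big1 => m _; case: eqP => // ml.
by move: lS; rewrite -ml star_elt_in.
Qed.

Lemma normsq_comp w l : torus_set w -> l \in St -> normsq (comp w l) = 1.
Proof. by move=> wT /star_elt_ex[m <-]; rewrite comp_elt /normsq /= wT. Qed.

Definition phase_row z : 'rV[R]_(#|St| + #|St|) :=
  row_mx (\row_m cRe (phase (z (star_elt m)))) (\row_m cIm (phase (z (star_elt m)))).

Lemma phase_rowE z m : phase_row z 0 (lshift _ m) = cRe (phase (z (star_elt m))) /\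
  phase_row z 0 (rshift _ m) = cIm (phase (z (star_elt m))).
Proof. by rewrite /phase_row row_mxEl row_mxEr !mxE. Qed.

Lemma phase_row_torus z : torus_set (phase_row z).
Proof. by move=> m; have [-> ->] := phase_rowE z m; exact: normsq_phase. Qed.

Definition phases z : torus_space R #|St| := exist _ (phase_row z) (mem_set (phase_row_torus z)).

Lemma comp_phases z l : l \in St -> comp (phase_row z) l = phase (z l).
Proof.
by move=> /star_elt_ex[m <-]; rewrite comp_elt; have [-> ->] := phase_rowE z m; rewrite mkCK.
Qed.

Local Notation wp x m := (p_weight A B (height (CPvec k)) x m).
Local Notation wq x m := (q_weight A B (height (CPvec k)) x m).
Local Notation nb := (@cell_nbhd R A B).

(** The squared moduli of the chart coordinates as quotients of weights: two come from [p],
    normalized at [p 0], and the third from [q], normalized at [p 2]. *)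
Definition modulus_sq x l : R :=
  [:: wp x (p 1) / wp x (p 0); wp x (p 2) / wp x (p 0); wq x (p 1) / wq x (p 2)]`_l.

Lemma height_supp : D != finset.set0 -> forall m, (0 < height (CPvec k) m) = (m \in D).
Proof. by move=> D0 m; rewrite /height normsq_gt0 (leaf_fits c sA D0). Qed.

Let d0 := fun m => height_ge0 (CPvec k) m.

Lemma star0 : (0 \in St) = (p 1 \in A). Proof. by rewrite inE. Qed.
Lemma star1 : (1 \in St) = (D != finset.set0) && (p 1 \notin D). Proof. by rewrite inE. Qed.
Lemma star2 : (2 \in St) = (p 1 \in B). Proof. by rewrite inE. Qed.

Lemma star1_A : 1 \in St -> p 2 \in A.
Proof. by rewrite star1 => /andP[D0 _]; have [_] := pD D0; rewrite finset.in_setI => /andP[]. Qed.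

Lemma modulus_sq_gt0 x l : nb x -> l \in St -> 0 < modulus_sq x l.
Proof.
move=> xV; have pp m (mA : m \in A) := p_weight_gt0 d0 height_supp xV mA.
have qp m (mB : m \in B) := q_weight_gt0 d0 height_supp xV mB.
elim/ord3_ind: l; rewrite /modulus_sq.
- by rewrite star0 => kA; rewrite divr_gt0 ?pp.
- by move=> /star1_A kA; rewrite divr_gt0 ?pp.
- by rewrite star2 => kB; rewrite divr_gt0 ?qp.
Qed.

Lemma Coo_modulus_sq l : Coo nb (fun x => modulus_sq x l).
Proof.
have o := @open_cell_nbhd R A B.
have cp m := Coo_p_weight d0 height_supp m; have cq m := Coo_q_weight d0 height_supp m.
have pn x : nb x -> wp x (p 0) != 0.
  by move=> xV; rewrite gt_eqF // (p_weight_gt0 d0 height_supp xV pA).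
have qn x : nb x -> wq x (p 2) != 0.
  by move=> xV; rewrite gt_eqF // (q_weight_gt0 d0 height_supp xV pB).
elim/ord3_ind: l; rewrite /modulus_sq /=.
- exact: (CooM o (cp _) (CooV o pn (cp _))).
- exact: (CooM o (cp _) (CooV o pn (cp _))).
- exact: (CooM o (cq _) (CooV o qn (cq _))).
Qed.

Definition to_plane y : 'rV[R]_3 := \row_j plane_x y j.

Lemma to_plane_smooth (U : set 'rV[R]_2) : open U -> class_Coo U to_plane.
Proof.
move=> oU; apply/class_CooP => // j.
have E y : to_plane y 0 j = plane_x y j by rewrite mxE.
have one : Coo U (fun=> 1) := @Coo_cst _ _ U 1; have two : Coo U (fun=> 2) := @Coo_cst _ _ U 2.
have c0 : Coo U (fun y => y 0 0) by exact: Coo_coord.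
have c1 : Coo U (fun y => y 0 1) by exact: Coo_coord.
apply: (@Coo_near _ _ _ (fun y => plane_x y j)) => //.
elim/ord3_ind: j {E}.
- exact: (CooB oU c0 one).
- exact: (CooB oU c1 one).
- exact: (CooB oU (CooB oU two c0) c1).
Qed.

Definition base_nbhd : set 'rV[R]_2 := [set y | nb (to_plane y)].

Lemma open_base_nbhd : open base_nbhd.
Proof.
rewrite (_ : base_nbhd = setT `&` (to_plane @^-1` nb)); last by rewrite setTI.
apply: open_preim_on; [exact: openT|exact: open_cell_nbhd|] => y _.
by have := to_plane_smooth openT; move/(_ 0%N); apply.
Qed.

(* Normal form of the points of the leaf over [y] with phases [w]. *)
Definition bundle_coord y (w : 'rV[R]_(#|St| + #|St|)) l : C :=
  real_mk (Num.sqrt (modulus_sq (to_plane y) l)) * comp w l.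
Definition bundle_row y w : 'rV[R]_6 := rcoord (shr (bundle_coord y w)).

Lemma ushr_bundle y w l : ushr (ccoord (bundle_row y w)) l = bundle_coord y w l.
Proof. by rewrite /bundle_row (unshear_ext c p (rcoordK (shr (bundle_coord y w)))) shearK. Qed.

Lemma normsq_bundle y w l : base_nbhd y -> torus_set w ->
  normsq (bundle_coord y w l) = if l \in St then modulus_sq (to_plane y) l else 0.
Proof.
move=> yV wT; rewrite normsqM normsq_real; case: ifP => lS.
  by rewrite normsq_comp // mulr1 sqr_sqrtr // ltW ?modulus_sq_gt0.
by rewrite comp_off ?lS // normsq0 mulr0.
Qed.

Lemma bundle_leaf y w : base_nbhd y -> torus_set w -> Lf (flag_param p (bundle_row y w)).
Proof.
move=> yV wT; apply/(param_leaf c sA pA pB pD) => l; rewrite ushr_bundle -normsq_gt0 normsq_bundle //.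
by case: ifP => // lS; rewrite ?ltxx // modulus_sq_gt0.
Qed.

Lemma leaf_cell L : Lf L -> open_cell A B (plane_x (mu L)).
Proof. by move=> /leafP[sL _]; exact: stratum_cell. Qed.

Lemma leaf_base L : Lf L -> base_nbhd (mu L).
Proof. by move=> /leaf_cell; exact: cell_nbhdP. Qed.

(** The difference of the two weights is x_m, and by uniqueness of the root their sum is [root_sum];
    so the moment and the class of the leaf determine both. *)
Lemma leaf_weights v m : Lf (flag_param p v) ->
  weight (pvec p v) m = wp (to_plane (mu (flag_param p v))) m /\
  weight (qvec p v) m = wq (to_plane (mu (flag_param p v))) m.
Proof.
move=> lL; set L := flag_param p v in lL *.
have pr : plucker_pair L (pvec p v) (qvec p v) := flag_param_pair p v.
have cl := leaf_cell lL; have [_ nb0] := leaf_base lL; have [x2 _] := leaf_base lL.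
have [sL mL] := (leafP c L).1 lL; have [SA SB] := stratum_supp sL; have [Sp Sq] := supp_pair pr.
have [r [r0 rE uw us]] := weights_radial pr (CPvec_neq0 k) ((flag_matchesP _ pr).1 mL).
have xE j : plane_x (mu L) j = moment_x L j := congr1 (@^~ j) (plane_moment L).
have tE j : to_plane (mu L) 0 j = moment_x L j by rewrite mxE xE.
have bE j : `|bent A B (to_plane (mu L)) j| = `|moment_x L j| by rewrite bent_cell // xE.
have sum_root : weight (pvec p v) m + weight (qvec p v) m =
    root_sum A B (height (CPvec k)) (to_plane (mu L)) m.
  rewrite /root_sum; have [mD|mD] := boolP (m \in D); last first.
    have pq0 : weight (pvec p v) m * weight (qvec p v) m = 0.
      move: mD; rewrite SA SB Sp Sq finset.in_setI !inE negb_and !negbK => /orP[] /eqP e.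
        by have /eqP := weight_eq0 m (pvec_neq0 p v); rewrite e eqxx => /eqP/eqP ->; rewrite mul0r.
      by have /eqP := weight_eq0 m (qvec_neq0 p v); rewrite e eqxx => /eqP/eqP ->; rewrite mulr0.
    have := bE m; rewrite ger0_norm; last exact: bent_ge0 (leaf_base lL) mD.
    move=> ->; rewrite us -mulrA -uw pq0 mulr0 addr0 sqrtr_sqr //.
  rewrite us tE (_ : radius A B (height (CPvec k)) (to_plane (mu L)) = r) //.
  have D0 := diag_neq0 mD.
  apply/esym/(radius_uniq d0 height_supp D0 (x2 D0) r0).
  rewrite -rE; apply: eq_bigr => j _.
  by rewrite -[bent _ _ _ _ ^+ 2]real_normK ?num_real // bE real_normK ?num_real.
have diff_x : weight (pvec p v) m - weight (qvec p v) m = to_plane (mu L) 0 m.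
  by rewrite tE (moment_xE m pr).
by rewrite /p_weight /q_weight -sum_root -diff_x; split; field.
Qed.

Lemma weight_ratio (q : 'rV[C]_3) i j : q != 0 -> weight q i / weight q j = normsq (q 0 i) / normsq (q 0 j).
Proof.
move=> q0; rewrite /weight; have := sum_normsq_gt0 q0; set S := \sum_i _ => S0.
by rewrite invfM invrK mulrACA mulVf ?mulr1 // gt_eqF.
Qed.

Lemma leaf_modulus v l : Lf (flag_param p v) -> l \in St ->
  normsq (ushr (ccoord v) l) = modulus_sq (to_plane (mu (flag_param p v))) l.
Proof.
move=> lL; have W m := leaf_weights m lL; have Wp m := (W m).1; have Wq m := (W m).2.
elim/ord3_ind: l => lS; rewrite /modulus_sq -?Wp -?Wq /=.
- by rewrite weight_ratio ?pvec_neq0 // !pqvecE normsq1 divr1.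
(* The middle coordinate occurs only where the slope is 0, so there the shear changes nothing. *)
- rewrite weight_ratio ?pvec_neq0 // !pqvecE normsq1 divr1.
  move: lS; rewrite star1 => /andP[_ p1D]; rewrite /unshear /slope (negbTE p1D) /=.
  by rewrite !mul0r subr0.
- by rewrite weight_ratio ?qvec_neq0 // !pqvecE normsq1 divr1 normsqN.
Qed.

Lemma weight_normsq (q q' : 'rV[C]_3) m : (forall i, normsq (q 0 i) = normsq (q' 0 i)) ->
  weight q m = weight q' m.
Proof. by move=> E; rewrite /weight E (eq_bigr _ (fun i _ => E i)). Qed.

Lemma moment_normsq L L' (q r q' r' : 'rV[C]_3) : plucker_pair L q r -> plucker_pair L' q' r' ->
  (forall m, normsq (q 0 m) = normsq (q' 0 m)) -> (forall m, normsq (r 0 m) = normsq (r' 0 m)) ->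
  mu L = mu L'.
Proof.
move=> pL pL' hq hr; apply: plane_x_inj => m; rewrite !plane_moment.
by rewrite (moment_xE m pL) (moment_xE m pL') (weight_normsq m hq) (weight_normsq m hr).
Qed.

(* On the leaf the product of the three coordinates vanishes, so that the moduli of
   the Plucker coordinates depend on those of the coordinates only. *)
Lemma moment_moduli v v' : Lf (flag_param p v) -> Lf (flag_param p v') ->
  (forall l, normsq (ushr (ccoord v) l) = normsq (ushr (ccoord v') l)) ->
  mu (flag_param p v) = mu (flag_param p v').
Proof.
move=> /(param_leaf c sA pA pB pD) lv /(param_leaf c sA pA pB pD) lv' E.
have H u : (forall l, (ushr (ccoord u) l != 0) = (l \in St)) ->
    [/\ normsq (ccoord u 0) = normsq (ushr (ccoord u) 0),
     normsq (ccoord u 1) = normsq (ushr (ccoord u) 1) +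
       normsq (slope c p) * normsq (ushr (ccoord u) 0) * normsq (ushr (ccoord u) 2),
     normsq (ccoord u 0 * ccoord u 2 - ccoord u 1) = normsq (ushr (ccoord u) 1) +
       (if 1 \in St then 0 else normsq (1 - slope c p)) * normsq (ushr (ccoord u) 0) * normsq (ushr (ccoord u) 2) &
     normsq (ccoord u 2) = normsq (ushr (ccoord u) 2)].
  move=> lu; have e1 : ccoord u 1 = ushr (ccoord u) 1 + slope c p * ushr (ccoord u) 0 * ushr (ccoord u) 2.
    by rewrite /unshear /=; ring.
  have e0 : ccoord u 0 = ushr (ccoord u) 0 by [].
  have e2 : ccoord u 2 = ushr (ccoord u) 2 by [].
  rewrite e0 e1 e2; have l1 := lu 1.
  move: {e0 e1 e2} (lu 0) (lu 1) (lu 2); move: (ushr _ 0) (ushr _ 1) (ushr _ 2) => a b d a0 b0 dd.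
  have [S1|S1] := boolP (1 \in St).
    have p1D : p 1 \notin D by move: S1; rewrite star1 => /andP[].
    have s0 : slope c p = 0 by rewrite /slope (negbTE p1D).
    have ad : a * d = 0.
      apply/eqP; rewrite mulf_eq0 -[_ || _]negbK negb_or a0 dd star0 star2.
      by rewrite -finset.in_setI.
    by rewrite s0 ad normsq0 !mul0r !addr0 sub0r normsqN.
  have b1 : b = 0 by apply/eqP/negPn; rewrite b0 (negbTE S1).
  rewrite b1 !add0r normsq0 !add0r -!normsqM; split=> //.
  by congr normsq; ring.
have [h0 h1 h3 h2] := H v lv; have [h0' h1' h3' h2'] := H v' lv'.
apply: (moment_normsq (flag_param_pair p v) (flag_param_pair p v')); apply: (@perm3_ind p); rewrite !pqvecE ?normsqN //.
- by rewrite h0 h0' E.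
- by rewrite h1 h1' !E.
- by rewrite h3 h3' !E.
- by rewrite h2 h2' E.
Qed.

Lemma leaf_onto y : open_cell A B (plane_x y) -> exists2 L, Lf L & mu L = y.
Proof.
move=> yc; have [L [LE m]] := orbit_of_ex k (cell_hexagon yc).
exists L => //; apply/leafP; split=> //.
by apply: cell_stratum m (leaf_fits c sA) => //; rewrite LE.
Qed.

(** Instead of being computed, the moment is compared with that of some flag of the leaf over [y]:
    by [leaf_modulus] the coordinates have the same moduli, and these determine the moment on the
    leaf. *)
Lemma mu_bundle y w : open_cell A B (plane_x y) -> torus_set w ->
  mu (flag_param p (bundle_row y w)) = y.
Proof.
move=> yc wT; have yV : base_nbhd y := cell_nbhdP yc.
have [L lL LE] := leaf_onto yc; have [v vE] := leaf_dom pA pB lL; rewrite vE in lL LE.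
rewrite -[RHS]LE; apply: (moment_moduli (bundle_leaf yV wT) lL) => l; rewrite ushr_bundle normsq_bundle //; case: ifP => lS.
  by rewrite leaf_modulus // LE.
apply/esym/eqP; rewrite normsq_eq0; apply/negPn.
by rewrite ((param_leaf c sA pA pB pD v).1 lL) lS.
Qed.

Lemma bundle_phases v : Lf (flag_param p v) ->
  bundle_row (mu (flag_param p v)) (phase_row (ushr (ccoord v))) = v.
Proof.
move=> lL; rewrite -[RHS]ccoordK; apply: ccoord_inj => l; rewrite !rcoordK.
rewrite -[RHS](unshearK c p); apply: shear_ext => m; rewrite /bundle_coord.
have nz := (param_leaf c sA pA pB pD v).1 lL m.
have [mS|mS] := boolP (m \in St).
  by rewrite comp_phases // -leaf_modulus // phaseK // nz.
by rewrite comp_off // mulr0; apply/esym/eqP/negPn; rewrite nz.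
Qed.

Lemma phases_bundle y w : base_nbhd y -> torus_set w ->
  phase_row (ushr (ccoord (bundle_row y w))) = w.
Proof.
move=> yV wT; have E m : phase (ushr (ccoord (bundle_row y w)) (star_elt m)) = comp w (star_elt m).
  rewrite ushr_bundle phase_scale //; last by rewrite normsq_comp ?star_elt_in.
  by rewrite sqrtr_gt0 modulus_sq_gt0 ?star_elt_in.
apply/rowP => l; rewrite -[l]splitK; case: (fintype.split l) => m /=.
  by rewrite (phase_rowE _ m).1 E comp_elt.
by rewrite (phase_rowE _ m).2 E comp_elt.
Qed.

End BundleCharts.

Section Bundles.
Variable R : realType.
Local Notation C := (Cplx R).
Local Notation M := (flag_manifold R).
Local Notation mu := (@flag_moment_map R).
Local Notation atlas := (@flag_atlas R).
Local Notation stratum := (@stratum R M atlas).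
Local Notation admissible := (@admissible R M atlas).
Local Notation sigma := (@sigma_polytope R 2 M mu atlas).
Variables (s : idx) (c : par_space R s) (p : 'S_3).
Hypothesis sA : admissible s.
Local Notation A := (firsts s).
Local Notation B := (lasts s).
Local Notation D := (firsts s :&: lasts s).
Hypotheses (pA : p 0 \in A) (pB : p 2 \in B) (pD : D != finset.set0 -> p 0 \in D /\ p 2 \in D).
Local Notation St := (star s p).
Local Notation shr := (shear c p).
Local Notation ushr := (unshear c p).
Local Notation Lf := (leaf (D := par_data R) (s := s) c).
Local Notation K := (torus_mfd R #|St|).
Local Notation chp := (flag_chart R p : chart R 6 M).

Definition star_nbhd : set 'rV[R]_6 := [set v | forall l : 'I_3, l \in St -> ushr (ccoord v) l != 0].

Lemma CooC_ushr l (U : set 'rV[R]_6) : open U -> CooC U (fun v => ushr (ccoord v) l).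
Proof. by move=> oU; apply: CooC_unshear => // m; exact: CooC_ccoord. Qed.

Lemma open_star_nbhd : open star_nbhd.
Proof.
rewrite openE => v Ov.
suff H (l : 'I_3) : nbhs v [set w : 'rV[R]_6 | l \in St -> ushr (ccoord w) l != 0].
  by have := @filter_forall _ _ _ _ (nbhs_filter v) H; apply: filterS => w.
have [lS|lS] := boolP (l \in St); last first.
  by apply: (filterS _ (@filterT _ (nbhs v) _)) => w _.
have oc : open [set w : 'rV[R]_6 | ushr (ccoord w) l != 0].
  by apply: open_neq0C; apply: CooC_ushr; exact: openT.
by apply: filterS (open_nbhs_nbhs (conj oc (Ov l lS))) => w cw _.
Qed.

Definition phase_map (v : 'rV[R]_6) : K := phases s p (ushr (ccoord v)).

Lemma Coo_phase_map l : Coo star_nbhd (fun v => set_val (phase_map v) 0 l).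
Proof.
have o := open_star_nbhd.
have Cp m : CooC star_nbhd (fun v => phase (ushr (ccoord v) (star_elt (s := s) (p := p) m))).
  apply: CooC_phase => // [v Ov|]; first by apply: Ov; exact: star_elt_in.
  exact: CooC_ushr.
rewrite -[l]splitK; case: (fintype.split l) => m /=.
  by apply: Coo_near (Cp m).1 => // v _; rewrite (phase_rowE _ m).1.
by apply: Coo_near (Cp m).2 => // v _; rewrite (phase_rowE _ m).2.
Qed.

Lemma phase_map_cts v : star_nbhd v -> {for v, continuous phase_map}.
Proof.
move=> Ov; apply: cts_set_type; apply: continuous_row => l.
exact: (Coo_continuous (Coo_phase_map l) Ov).
Qed.

Definition leaf_phases (L : M) : K := phase_map (chart_map chp L).

Definition leaf_nbhd : set M := chart_dom chp `&` [set L | star_nbhd (chart_map chp L)].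

Lemma open_leaf_nbhd : open leaf_nbhd.
Proof.
have [[oD _] _ mc _] := flag_is_chart R p.
exact: open_preim_on oD open_star_nbhd mc.
Qed.

Lemma leaf_phases_cts L : leaf_nbhd L -> {for L, continuous leaf_phases}.
Proof.
move=> [DL OL]; have [_ _ mc _] := flag_is_chart R p.
exact: (cts_comp (mc L DL) (phase_map_cts OL)).
Qed.

Lemma leaf_phases_smooth : smooth_on_open (M := M) (N := K) leaf_nbhd leaf_phases.
Proof.
split=> [L LU|_ _ [s' _ <-] [e _ <-]]; first exact: leaf_phases_cts.
set N := _ @` _.
have [[oD' _] _ _ _] := flag_is_chart R s'; have [[oD _] _ _ _] := flag_is_chart R p.
pose T12 := chart_map (flag_chart R s') @` (chart_dom (flag_chart R s') `&` chart_dom chp).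
have C12 : class_Coo T12 (transition (flag_chart R s') (flag_chart R p)) := (flag_compatible R s' p).1.
have oT12 : open T12.
  by rewrite /T12 setIC; exact: (open_chart_image (flag_is_chart R s') oD).
have oe := @stereo_dom_open R #|St| e.
have oP : open (leaf_nbhd `&` leaf_phases @^-1` stereo_dom e).
  exact: open_preim_on open_leaf_nbhd oe leaf_phases_cts.
have oN : open N.
  rewrite /N -setIA [chart_dom _ `&` _]setIC setIA.
  exact: (open_chart_image (flag_is_chart R s') oP).
have NT : N `<=` T12.
  by move=> _ [L [[[DL _] D'L] _] <-]; exists L.
have CN := class_Coo_sub oT12 oN NT C12.
have NL v : N v -> leaf_nbhd (flag_param s' v) /\ stereo_dom e (leaf_phases (flag_param s' v)).
  move=> [L [[LU [z _ zL]] Le] <-]; rewrite -zL in LU Le *.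
  by rewrite [chart_map _ _](flag_chart_param s' z).
have NO v : N v -> star_nbhd (transition (flag_chart R s') (flag_chart R p) v).
  by move=> /NL[[_ OL] _].
have cf l : Coo N (fun v => set_val (leaf_phases (flag_param s' v)) 0 l).
  exact: (@Coo_comp R 6 6 N star_nbhd (fun v => set_val (phase_map v) 0 l)
    (transition (flag_chart R s') (flag_chart R p)) oN open_star_nbhd NO (Coo_phase_map l) CN).
have de v : N v -> stereo_dom e (leaf_phases (flag_param s' v)) by move=> /NL[].
exact: (@Coo_stereo_map R #|St| 6 N (fun v => leaf_phases (flag_param s' v)) e oN cf de).
Qed.

Lemma leaf_in_nbhd : Lf `<=` leaf_nbhd.
Proof.
move=> L lL; have [v LE] := leaf_dom pA pB lL; split; first by exists v.
move=> l lS; rewrite LE [chart_map _ _](flag_chart_param p v).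
by rewrite LE in lL; rewrite ((param_leaf c sA pA pB pD v).1 lL).
Qed.

Local Notation n := #|St|.

Definition row_nbhd : set 'rV[R]_(2 + (n + n)) := [set v | base_nbhd s (lsubmx v)].

Lemma submx_smooth m m' (U : set 'rV[R]_(m + m')) : open U ->
  class_Coo U (fun v : 'rV[R]_(m + m') => lsubmx v) /\ class_Coo U (fun v : 'rV[R]_(m + m') => rsubmx v).
Proof.
move=> oU; split; apply/class_CooP => // j.
  apply: (@Coo_near _ _ _ (fun v : 'rV[R]_(m + m') => v 0 (lshift m' j))) => //.
    by move=> v _; rewrite mxE.
  exact: Coo_coord.
apply: (@Coo_near _ _ _ (fun v : 'rV[R]_(m + m') => v 0 (rshift m j))) => //.
  by move=> v _; rewrite mxE.
exact: Coo_coord.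
Qed.

Lemma open_row_nbhd : open row_nbhd.
Proof.
rewrite (_ : row_nbhd = setT `&` ((fun v : 'rV[R]_(2 + (n + n)) => lsubmx v) @^-1` base_nbhd s)); last by rewrite setTI.
apply: open_preim_on; [exact: openT|exact: open_base_nbhd|] => v _.
exact: (class_Coo_cts (submx_smooth openT).1 (I : setT v)).
Qed.

Definition bundle_of (v : 'rV[R]_(2 + (n + n))) : 'rV[R]_6 := bundle_row c (lsubmx v) (rsubmx v).

Lemma bundle_of_smooth : class_Coo row_nbhd bundle_of.
Proof.
have o := open_row_nbhd; apply: Coo_rcoord => // m; apply: CooC_shear => // l.
have [lS|lS] := boolP (l \in St); last first.
  apply: (@CooC_near _ _ _ o (fun=> 0)); last exact: CooC_cst.
  by move=> v _; rewrite /bundle_coord comp_off // mulr0.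
have oc := @open_cell_nbhd R A B; have ob := @open_base_nbhd R s.
have Cm : Coo row_nbhd (fun v => modulus_sq c p (to_plane (lsubmx v)) l).
  have Cp : class_Coo row_nbhd (fun v : 'rV[R]_(2 + (n + n)) => to_plane (lsubmx v)).
    exact: (@class_Coo_comp R _ _ _ row_nbhd setT (@to_plane R) (fun v => lsubmx v) o openT (fun _ _ => I) (to_plane_smooth openT) (submx_smooth o).1).
  exact: (@Coo_comp R _ _ row_nbhd (cell_nbhd A B) (fun x => modulus_sq c p x l) _ o oc
    (fun v (h : row_nbhd v) => h) (Coo_modulus_sq c sA pA pB l) Cp).
apply: CooCM => //.
  apply: CooC_mk; last exact: Coo_cst.
  by apply: Coo_sqrt => // v nv; exact: (modulus_sq_gt0 c sA pA pB pD nv lS).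
have [m' <-] := star_elt_ex lS.
apply: (@CooC_near _ _ _ o (fun v => mkC (v 0 (rshift 2 (lshift n m'))) (v 0 (rshift 2 (rshift n m'))))).
  by move=> v _; rewrite comp_elt !mxE.
by apply: CooC_mk; exact: Coo_coord.
Qed.

Definition bundle_param (z : prod_space (euclidean R 2) K) : M :=
  flag_param p (bundle_row c z.1 (set_val z.2)).

Definition pair_row (z : prod_space (euclidean R 2) K) : 'rV[R]_(2 + (n + n)) :=
  row_mx (z.1 : 'rV[R]_2) (set_val z.2).

Lemma pair_row_cts : continuous pair_row.
Proof.
move=> z; apply: continuous_row => l; rewrite -[l]splitK; case: (fintype.split l) => j /=.
  have E : (fun y => pair_row y 0 (lshift (n + n) j)) = (fun y => y.1 0 j).
    by apply/funext => y; rewrite /pair_row row_mxEl.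
  by rewrite E; apply: cts_coord; exact: (cts_fst (@cts_id _ z)).
have E : (fun y => pair_row y 0 (rshift 2 j)) = (fun y => set_val y.2 0 j).
  by apply/funext => y; rewrite /pair_row row_mxEr.
rewrite E; exact: (cts_comp (cts_snd (@cts_id _ z)) (@torus_coord_continuous R n j _)).
Qed.

Lemma bundle_pair z : bundle_of (pair_row z) = bundle_row c z.1 (set_val z.2).
Proof. by rewrite /bundle_of /pair_row row_mxKl row_mxKr. Qed.

Definition param_nbhd : set (prod_space (euclidean R 2) K) := [set z | base_nbhd s z.1].

Lemma open_param_nbhd : open param_nbhd.
Proof.
rewrite (_ : param_nbhd = setT `&` ((fun z : prod_space (euclidean R 2) K => z.1 : 'rV[R]_2) @^-1` base_nbhd s)); last by rewrite setTI.
apply: open_preim_on; [exact: openT|exact: open_base_nbhd|] => z _.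
exact: (cts_fst (@cts_id _ z)).
Qed.

Lemma bundle_param_cts z : param_nbhd z -> {for z, continuous bundle_param}.
Proof.
move=> Vz; have nz : row_nbhd (pair_row z) by rewrite /row_nbhd /mkset /pair_row row_mxKl.
have c1 := cts_comp (@pair_row_cts z) (class_Coo_cts bundle_of_smooth nz).
have -> : bundle_param = (fun y => flag_param p (bundle_of (pair_row y))).
  by apply/funext => y; rewrite bundle_pair.
exact: (cts_comp c1 (@flag_param_continuous R p _)).
Qed.

Lemma bundle_param_smooth : smooth_on_open (M := prod_space (euclidean R 2) K) (N := M) param_nbhd bundle_param.
Proof.
split=> [z|_ _ [_ -> [_ [e _ <-] <-]] [s' _ <-]]; first exact: bundle_param_cts.
set ch := prod_chart _ _; set N := _ @` _.
pose inv (v : 'rV[R]_(2 + n)) : prod_space (euclidean R 2) K := (lsubmx v, stereo_inv e (rsubmx v)).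
have inv_cts : continuous inv.
  move=> v; apply: cts_pair; first exact: (class_Coo_cts (submx_smooth openT).1 (I : setT v)).
  apply: (cts_comp (class_Coo_cts (submx_smooth openT).2 (I : setT v))).
  exact: stereo_inv_continuous.
have [[oD' _] _ _ _] := flag_is_chart R s'.
have oP : open (param_nbhd `&` bundle_param @^-1` chart_dom (flag_chart R s' : chart R 6 M)).
  exact: open_preim_on open_param_nbhd oD' bundle_param_cts.
have NE : N = setT `&` inv @^-1` (param_nbhd `&` bundle_param @^-1` chart_dom (flag_chart R s' : chart R 6 M)).
  rewrite setTI; apply/seteqP; split=> v.
    move=> [[y t] [[Vz [_ te]] D'z] <-].
    have E : inv (chart_map ch (y, t)) = (y, t).
      rewrite /inv /ch /= row_mxKl row_mxKr; congr (_, _); exact: (stereo_mapK te).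
    by rewrite /preimage /mkset E.
  move=> [Vz D'z]; exists (inv v).
    by split=> //; split=> //; split=> //; exact: stereo_inv_dom.
  rewrite /ch /= (stereo_invK e) -[RHS]hsubmxK //.
have oN : open N by rewrite NE; exact: open_preim_on openT oP (fun v _ => inv_cts v).
have NV v : N v -> base_nbhd s (lsubmx v) by rewrite NE => -[_ []].
pose G (v : 'rV[R]_(2 + n)) := bundle_of (row_mx (lsubmx v) (stereo_row e (rsubmx v))).
pose G' (v : 'rV[R]_(2 + n)) : 'rV[R]_(2 + (n + n)) := row_mx (lsubmx v) (stereo_row e (rsubmx v)).
have NG' v : N v -> row_nbhd (G' v) by move=> /NV Vv; rewrite /row_nbhd /mkset row_mxKl.
have CG' : class_Coo N G'.
  apply/class_CooP => // l; rewrite -[l]splitK; case: (fintype.split l) => j /=.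
    apply: (@Coo_near _ _ _ (fun v : 'rV[R]_(2 + n) => lsubmx v 0 j)) => //.
      by move=> v _; rewrite row_mxEl.
    exact: ((class_CooP _ oN).1 (submx_smooth oN).1 j).
  apply: (@Coo_near _ _ _ (fun v : 'rV[R]_(2 + n) => stereo_row e (rsubmx v) 0 j)) => //.
    by move=> v _; rewrite row_mxEr.
  exact: (@Coo_comp R _ _ N setT (fun u => stereo_row e u 0 j) _ oN openT (fun _ _ => I)
    (Coo_stereo_row e j openT) (submx_smooth oN).2).
have CG : class_Coo N G := @class_Coo_comp R _ _ _ N row_nbhd bundle_of G' oN open_row_nbhd NG' bundle_of_smooth CG'.
have GE v : bundle_param (inv v) = flag_param p (G v).
  by rewrite /bundle_param -bundle_pair.
have h1 v : N v -> plucker_pair (bundle_param (inv v)) (pvec p (G v)) (qvec p (G v)).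
  by move=> _; rewrite GE; exact: flag_param_pair.
have h2 i : CooC N (fun v => pvec p (G v) 0 i).
  exact: (@CooC_comp _ _ _ N (fun z => pvec p z 0 i) G oN (CooC_pvec _ _ openT) CG).
have h3 i : CooC N (fun v => qvec p (G v) 0 i).
  exact: (@CooC_comp _ _ _ N (fun z => qvec p z 0 i) G oN (CooC_qvec _ _ openT) CG).
have h4 v : N v -> chart_dom (flag_chart R s') (bundle_param (inv v)) by rewrite NE => -[_ []].
exact: (@smooth_into_flag R _ N (fun v => bundle_param (inv v)) _ _ s' oN h1 h2 h3 h4).
Qed.

(** The bundle is globally a product with a torus: [base_nbhd s] contains the whole open polytope,
    so one neighbourhood serves all base points. Phases, and in the other direction moduli times
    phases, are the two inverse maps, both smooth on open neighbourhoods. *)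
Lemma leaf_bundle : smooth_fiber_bundle (M := M) Lf (relint (sigma s)) mu.
Proof.
have sm := @flag_moment_smooth R.
split.
  move=> L _; have [U [g [oU UL e g_sm]]] := sm L I.
  by exists U, g; split=> // y; rewrite in_setI => /andP[yU _]; apply: e; rewrite in_setI yU in_setT.
split.
  apply/seteqP; split=> [_ [L lL <-]|y]; first by apply: mu_relint; have [] := (leafP c L).1 lL.
  by move=> /(relint_sigma _ sA) /(leaf_onto c sA)[L lL <-]; exists L.
exists K; split=> [|b bB]; first exact: torus_mfd_smooth.
have bc : open_cell A B (plane_x b) by apply/(relint_sigma _ sA).
exists (base_nbhd s); split; [exact: open_base_nbhd|exact: cell_nbhdP|].
exists leaf_phases, bundle_param => EV BK; split.
- move=> L [lL _]; exists leaf_nbhd, leaf_phases; split=> //; first exact: open_leaf_nbhd.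
    exact: leaf_in_nbhd.
  exact: leaf_phases_smooth.
- move=> z [[Vz _] _]; exists param_nbhd, bundle_param; split=> //; first exact: open_param_nbhd.
  exact: bundle_param_smooth.
- move=> _ [z [[Vz Bz] _] <-].
  have wT : torus_set (set_val z.2) := set_valP z.2.
  split; first exact: (bundle_leaf c sA pA pB pD Vz wT).
  rewrite /preimage /mkset /bundle_param (mu_bundle c sA pA pB pD _ wT) //.
  by apply/(relint_sigma _ sA).
- move=> L /set_mem[lL _]; have [v LE] := leaf_dom pA pB lL; rewrite LE in lL *.
  rewrite /bundle_param /leaf_phases /phase_map [chart_map _ _](flag_chart_param p v).
  by rewrite [set_val _]/(phase_row s p _) (bundle_phases sA pA pB pD lL).
move=> [y w] /set_mem[[Vy By] _]; have wT : torus_set (set_val w) := set_valP w.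
have yc : open_cell A B (plane_x y) by apply/(relint_sigma _ sA).
rewrite /bundle_param; congr (_, _); first exact: (mu_bundle c sA pA pB pD yc wT).
apply: set_val_inj; rewrite /leaf_phases /phase_map [chart_map _ _](flag_chart_param p _).
exact: (phases_bundle c sA pA pB pD Vy wT).
Qed.

End Bundles.

(** * Leaves are submanifolds, fibered over open polytopes *)

Section LeafStructure.
Variable R : realType.
Local Notation M := (flag_manifold R).
Local Notation mu := (@flag_moment_map R).
Local Notation theta := (@T2_action R).

(** The maps between spaces of parameters are continuous because they go to one-point spaces:
    boundary strata are never the main one. *)
Lemma flag_axiom5 : axiom5 (par_data R).
Proof.
move=> s sA; have [gs _] := admissible_good sA.
have [p [pA pB pD]] := leaf_perm_ex gs; split.
- move=> c; split; first exact: (leaf_submanifold c sA pA pB pD).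
  exact: (leaf_bundle c sA pA pB pD).
- by move=> t; exact: par_bdry_face.
- by move=> c; exact: leaf_bdry.
move=> t ts; have [tA _ _ _ _] := ts; have tn := par_bdry_proper sA ts.
have H : continuous (fun x : par_space R s => par_mk t (set_val x)).
  move=> c; have -> : (fun x : par_space R s => par_mk t (set_val x)) = (fun=> par_mk t (set_val c)).
    by apply/funext => x; exact: par_subsingleton.
  exact: cts_const.
exact: H.
Qed.

End LeafStructure.

Theorem proposition15p2 (R : realType) :
  [/\ nk_manifold 3 (@T2_action R) (@flag_moment_map R),
      homeomorphic (orbit_space (@T2_action R)) (join R (circle R) (CP R 1)) &
      homeomorphic (join R (circle R) (CP R 1)) (sphere R 4)].
Proof.
split; [split=> //|exact: orbits_join|exact: join_sphere_homeo].
- split=> //; [exact: flag_smooth_manifold|exact: compact_flag|exact: flag_orientable].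
- split; [exact: T2_torus_action|exact: flag_action_smooth|exact: flag_effective|].
  exact: stab_connected.
- split; [exact: flag_moment_smooth| |exact: polytope_mu|exact: aff_dim_mu|].
    by move=> t L tT; exact: mu_action.
  by move=> U oU; exact: flag_moment_open.
exists (flag_atlas R), (par_data R); split.
- exact: flag_axiom1.
- exact: flag_axiom2.
- exact: flag_axiom3.
split; [exact: flag_axiom4|exact: flag_axiom5|exact: flag_axiom6].
Qed.
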